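(* Let $p>3$ be prime. Then the function $$\eta(p^2z)\,\mathcal{R}_p(z)$$ is a weakly holomorphic modular form of weight $1$ on the group $\Gamma_0(p^2)\cap\Gamma_1(p)$.
   Context: Notation: $z$ lies in the upper half plane, $q=\exp(2\pi i z)$, $q^r:=\exp(2\pi i r z)$ for rational $r$, $\zeta_p=\exp(2\pi i/p)$, $(a;q)_\infty=\prod_{k\ge 0}(1-aq^k)$, $(a;q)_n=(a;q)_\infty/(aq^n;q)_\infty$, $(a_1,\dots,a_j;q)_n=\prod_i (a_i;q)_n$, and $\eta(z)=q^{1/24}\prod_{n\ge1}(1-q^n)$. The rank of a partition is its largest part minus its number of parts; $N(m,n)$ is the number of partitions of $n$ with rank $m$ (the empty partition has rank $0$), and $$R(w,q)=\sum_{n\ge0}\sum_m N(m,n)w^mq^n=1+\sum_{n\ge1}\frac{q^{n^2}}{(wq,w^{-1}q;q)_n}.$$ $\chi_{12}(n)=1$ if $n\equiv\pm1\pmod{12}$, $-1$ if $n\equiv\pm5\pmod{12}$, and $0$ otherwise. For $p>3$ prime and $1\le a\le\frac12(p-1)$, $$\Phi_{p,a}(q):=\begin{cases}\displaystyle\sum_{n=0}^\infty\frac{q^{pn^2}}{(q^a;q^p)_{n+1}(q^{p-a};q^p)_n} & \text{if } 0<6a<p,\\ \displaystyle -1+\sum_{n=0}^\infty\frac{q^{pn^2}}{(q^a;q^p)_{n+1}(q^{p-a};q^p)_n} & \text{if } p<6a<3p,\end{cases}$$ and $$\mathcal{R}_p(z):=q^{-\frac1{24}}R(\zeta_p,q)-\chi_{12}(p)\sum_{a=1}^{\frac12(p-1)}(-1)^a\left(\zeta_p^{3a+\frac12(p+1)}+\zeta_p^{-3a-\frac12(p+1)}-\zeta_p^{3a+\frac12(p-1)}-\zeta_p^{-3a-\frac12(p-1)}\right)q^{\frac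 a2(p-3a)-\frac{p^2}{24}}\,\Phi_{p,a}(q^p).$$ A weakly holomorphic modular form is holomorphic on the upper half plane, transforms as a modular form, and is allowed poles at the cusps. *)

(* Defs.v *)
From mathcomp Require Import all_boot all_order all_algebra.
From mathcomp Require Import complex.
From mathcomp Require Import all_classical all_reals all_analysis.

Set Implicit Arguments.
Unset Strict Implicit.
Unset Printing Implicit Defensive.

Import Order.TTheory GRing.Theory Num.Theory.
Import numFieldNormedType.Exports.

Local Open Scope classical_set_scope.
Local Open Scope ring_scope.
Local Open Scope complex_scope.

Definition is_partition (n : nat) (l : seq nat) : bool :=
  [&& sorted geq l, all (leq 1) l & sumn l == n].

Definition rank (l : seq nat) : int := (head 0%N l)%:Z - (size l)%:Z.

(* A partition of n has at most n parts, each at most n, so all the partitions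
   of n occur in the finite type of sequences of length at most n over
   {0, ..., n}. *)
Definition num_rank (m : int) (n : nat) : nat :=
  #|[set l : n.-bseq 'I_n.+1 |
      is_partition n (map val l) & rank (map val l) == m]%SET|.

(* The complex numbers, presented as an abstract [numClosedFieldType] so that
   they inherit their topology and normed module structure over themselves
   from [numFieldNormedType]. *)
Definition Cplx (R : realType) : numClosedFieldType := R[i].

Section Functions.
Variable R : realType.
Local Notation C := (Cplx R).
Implicit Types (z w q a : C) (r : rat) (n p : nat).

Definition cexp z : C :=
  (expR (complex.Re z) * cos (complex.Im z)) +i*
  (expR (complex.Re z) * sin (complex.Im z)).

Definition two_pi_i : C := 0 +i* (2 * pi).

(* q^r, where q = exp(2 pi i z) *)
Definition qpow z r : C := cexp (two_pi_i * ratr r * z).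

Definition qexp z : C := cexp (two_pi_i * z).

Definition zeta p : C := cexp (two_pi_i / p%:R).

Definition qpoch_inf a q : C := \big[*%R/1]_(0 <= k <oo) (1 - a * q ^+ k).

Definition qpoch a q n : C := qpoch_inf a q / qpoch_inf (a * q ^+ n) q.

Definition eta z : C :=
  qpow z (1 / 24) * \big[*%R/1]_(1 <= k <oo) (1 - qexp z ^+ k).

(* The rank of a partition of n lies between -n and n, so that the inner sum,
   with m = j - n, runs over all the ranks that occur. *)
Definition rank_gf w q : C :=
  \big[+%R/0]_(0 <= n <oo)
    ((\sum_(0 <= j < (2 * n).+1)
        (num_rank (j%:Z - n%:Z) n)%:R * w ^ (j%:Z - n%:Z)) * q ^+ n).

Definition chi12 n : int :=
  if (n %% 12)%N \in [:: 1; 11]%N then 1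
  else if (n %% 12)%N \in [:: 5; 7]%N then -1
  else 0.

(* When p > 3 is prime and 1 <= a <= (p - 1)/2, either 0 < 6a < p or
   p < 6a < 3p. *)
Definition Phi p (a : nat) q : C :=
  let S := \big[+%R/0]_(0 <= n <oo)
    (q ^+ (p * n ^ 2) /
      (qpoch (q ^+ a) (q ^+ p) n.+1 * qpoch (q ^+ (p - a)) (q ^+ p) n)) in
  if (6 * a < p)%N then S else -1 + S.

Definition calR p z : C :=
  qpow z (- (1 / 24)) * rank_gf (zeta p) (qexp z)
  - (chi12 p)%:~R *
    \sum_(1 <= a < ((p - 1) %/ 2).+1)
      (-1) ^+ a *
      (zeta p ^+ (3 * a + (p + 1) %/ 2) + zeta p ^- (3 * a + (p + 1) %/ 2)
       - zeta p ^+ (3 * a + (p - 1) %/ 2) - zeta p ^- (3 * a + (p - 1) %/ 2)) *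
      qpow z (a%:R / 2 * (p%:R - 3 * a%:R) - p%:R ^+ 2 / 24) *
      Phi p a (qexp z ^+ p).

Definition upper_half : set C := [set z | 0 < complex.Im z].

Definition SL2Z : set 'M[int]_2 := [set g | \det g = 1].

Definition Gamma0 (N : nat) : set 'M[int]_2 :=
  [set g | SL2Z g /\ (g 1%R 0%R = 0 %[mod N])%Z].

Definition Gamma1 (N : nat) : set 'M[int]_2 :=
  [set g | [/\ SL2Z g, (g 1%R 0%R = 0 %[mod N])%Z,
               (g 0%R 0%R = 1 %[mod N])%Z & (g 1%R 1%R = 1 %[mod N])%Z]].

Definition autom_factor (g : 'M[int]_2) z : C :=
  (g 1 0)%:~R * z + (g 1 1)%:~R.

Definition moebius (g : 'M[int]_2) z : C :=
  ((g 0 0)%:~R * z + (g 0 1)%:~R) / autom_factor g z.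

Definition slash (k : int) (f : C -> C) (g : 'M[int]_2) z : C :=
  autom_factor g z ^ (- k) * f (moebius g z).

(* Differentiability is with respect to the field C, i.e. complex. *)
Definition holomorphic_on (D : set C) (f : C -> C) : Prop :=
  forall z, D z -> derivable f z 1.

(* f is given on the upper half plane by a Laurent series in q^(1/h) with
   finitely many terms of negative exponent. *)
Definition meromorphic_at_infty (f : C -> C) : Prop :=
  exists (h : nat) (n0 : int) (c : nat -> C), (0 < h)%N /\
    forall z, upper_half z ->
      (\sum_(0 <= k < n) c k * qpow z ((k%:Z + n0)%:~R / h%:R))
        @[n --> \oo] --> f z.

Record weakly_holomorphic_modular_form
    (k : int) (G : set 'M[int]_2) (f : C -> C) : Prop := {
  whmf_holomorphic : holomorphic_on upper_half f;
  whmf_modular : forall g z, G g -> upper_half z ->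
    f (moebius g z) = autom_factor g z ^ k * f z;
  (* Every cusp is of the form g(oo) with g in SL2(Z). *)
  whmf_cusps : forall g, SL2Z g -> meromorphic_at_infty (slash k f g)
}.

End Functions.

(* Main.v *)
Require Import Defs.
From mathcomp Require Import all_boot all_order all_algebra.
From mathcomp Require Import complex.
From mathcomp Require Import all_classical all_reals all_analysis.
From mathcomp Require Import ring lra zify.

(** Write e(x) = exp(2 pi i x), q = e(z), and let E(x; q) be the sum over n of
    q^(n^2) / ((x; q)_(n+1) (q/x; q)_n), the universal mock theta function.
    Both pieces of the form are values of E: enumerating partitions by their
    largest part and applying a Rogers-Fine identity gives R(w, q) = (1 - w)
    E(w; q) for |w| = 1 ([rank_gf_Ku]), and Phi_(p,a)(q^p) is E(q^(pa);
    q^(p^2)), minus 1 when 6a > p ([PhiE]). So the modular object is the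
    function of an elliptic variable u obtained from E(e(u); q), and the form
    is read off at a torsion point.

    Two facts about E drive the proof. Telescoping gives E(xq) + q x^3 E(x) = 1
    - q x^2 ([Eu_shift]); thus E is quasi-periodic of index -3/2 in u up to two
    explicit theta terms. And N(u) = e(u/2) E(e(u); q) (q; q)_oo has simple
    poles exactly at the lattice points l z + m, with residue - e((l + m)/2 + 3
    l^2 z/2) / (2 pi i) ([pol_mockN]; at u = 0 this is Cauchy's identity
    [Ku1]). These residues are permuted by SL_2(Z) with weight 1 and index -3/2
    ([isres_moebius]), although N itself is not modular.

    For the period pz the theta terms of N(1/p + u)/eta(z) are, up to sign,
    those of the combination of the functions E(e(pu + paz); q^(p^2))
    subtracted in calR_p, and after adding the value at -u the two systems
    cancel ([defect_sym], [combH_shift]). Let H(u) be the resulting function,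
    times eta(p^2 z): it is quasi-periodic for 1 and pz, and at u = 0 it is, up
    to a nonzero constant, the function of the theorem ([mform_combGN]). For g
    in Gamma_0(p^2) and Gamma_1(p) the poles of H coming from the second kind
    of terms have the same residues as those of its transform under g
    ([twist_appellN_pol]), and the remaining ones lie above u = 1/p and u =
    -1/p, because g fixes the torsion point 1/p. Multiplied by theta(u - 1/p)
    theta(u + 1/p), the difference of H and its transform becomes an entire
    function whose quasi-periodicity factors force it to decay, so that it is
    bounded and then zero ([negative_index_zero]). At u = 0 this is the
    transformation law of weight 1 ([weight_one], [mform_modular]).

    At a cusp, the form is holomorphic and periodic of period p^2, being
    invariant under the conjugates of translation by p^2 ([at_cusp_period]),
    and it grows at most like exp(B y) as y grows, since |f(z)| <= A exp(B (y +
    1/y)) in the whole half plane ([mform_mgrow], [at_cusp_growth]). Hence it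
    is a Laurent series in q^(1/p^2) with finitely many negative exponents
    ([periodic_laurent]).

    The complex analysis used is Cauchy's expansion of holomorphic functions in
    power series ([cauchy_taylor]), proved with averages over roots of unity in
    place of contour integrals, and its consequences: series of holomorphic
    functions ([sdiff_series]), removable singularities ([removable_taylor],
    [removable_extension]) and Liouville's theorem ([liouville]). *)

Set Implicit Arguments.
Unset Strict Implicit.
Unset Printing Implicit Defensive.

Import Order.TTheory GRing.Theory Num.Theory.
Import numFieldNormedType.Exports.
Local Open Scope classical_set_scope.
Local Open Scope ring_scope.

(** * The modulus of a complex number *)

Section Modulus.
Variable R : realType.
Local Notation C := (Cplx R).

(** The modulus with values in the real numbers, so that estimates take place
    in a totally ordered field. *)
Definition cm (z : C) : R := ComplexField.Normc.normc z.

Lemma cmM (x y : C) : cm (x * y) = cm x * cm y.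
Proof. exact: ComplexField.Normc.normcM. Qed.
Lemma cmD (x y : C) : cm (x + y) <= cm x + cm y.
Proof. exact: le_normcD. Qed.
Lemma cmN (x : C) : cm (- x) = cm x.
Proof. exact: normcN. Qed.
Lemma cm0 : cm 0 = 0.
Proof. exact: ComplexField.Normc.normc0. Qed.
Lemma cm1 : cm 1 = 1.
Proof. exact: ComplexField.Normc.normc1. Qed.
Lemma cmV (x : C) : cm x^-1 = (cm x)^-1.
Proof. exact: ComplexField.Normc.normcV. Qed.
Lemma cm_ge0 (x : C) : 0 <= cm x.
Proof. by case: x => a b; exact: sqrtr_ge0. Qed.
Lemma cm_eq0 (x : C) : (cm x == 0) = (x == 0).
Proof.
apply/eqP/eqP => [|->]; last exact: cm0.
exact: ComplexField.Normc.eq0_normc.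
Qed.
Lemma cm_gt0 (x : C) : (0 < cm x) = (x != 0).
Proof. by rewrite lt_def cm_ge0 andbT cm_eq0. Qed.
Lemma cmX (x : C) n : cm (x ^+ n) = cm x ^+ n.
Proof. by elim: n => [|n IH]; rewrite ?expr0 ?cm1 // !exprS cmM IH. Qed.
Lemma cmBC (x y : C) : cm (x - y) = cm (y - x).
Proof. by rewrite -cmN opprB. Qed.
Lemma cmB (x y : C) : cm (x - y) <= cm x + cm y.
Proof. by rewrite -(cmN y); exact: cmD. Qed.
Lemma cmB_ge (x y : C) : cm x - cm y <= cm (x - y).
Proof. by have := cmD (x - y) y; rewrite subrK; lra. Qed.
Lemma cm_tri (z x y : C) : cm (x - y) <= cm (x - z) + cm (z - y).
Proof. by have := cmD (x - z) (z - y); rewrite addrA subrK. Qed.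
Lemma cm_sum (I : Type) (r : seq I) (P : pred I) (F : I -> C) :
  cm (\sum_(i <- r | P i) F i) <= \sum_(i <- r | P i) cm (F i).
Proof.
elim/big_rec2: _ => [|i y x _ h]; first by rewrite cm0.
by apply: (le_trans (cmD _ _)); rewrite lerD2l.
Qed.
Lemma cm_prod (I : Type) (r : seq I) (P : pred I) (F : I -> C) :
  cm (\prod_(i <- r | P i) F i) = \prod_(i <- r | P i) cm (F i).
Proof. by elim/big_rec2: _ => [|i y x _ h]; rewrite ?cm1 // cmM h. Qed.

Lemma cmE (z : C) : cm z ^+ 2 = complex.Re z ^+ 2 + complex.Im z ^+ 2.
Proof.
by case: z => a b /=; rewrite /cm /= sqr_sqrtr // addr_ge0 ?sqr_ge0.
Qed.
Lemma Re_le (z : C) : `|complex.Re z| <= cm z.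
Proof.
rewrite -(@ler_pXn2r _ 2) ?nnegrE ?cm_ge0 // cmE real_normK ?num_real //.
by rewrite lerDl sqr_ge0.
Qed.
Lemma Im_le (z : C) : `|complex.Im z| <= cm z.
Proof.
rewrite -(@ler_pXn2r _ 2) ?nnegrE ?cm_ge0 // cmE real_normK ?num_real //.
by rewrite lerDr sqr_ge0.
Qed.
Lemma cm_real (x : R) : cm (x%:C)%C = `|x|.
Proof. by rewrite /cm /= expr0n /= addr0 sqrtr_sqr. Qed.
Lemma cm_imag (x : R) : cm (0 +i* x)%C = `|x|.
Proof. by rewrite /cm /= expr0n /= add0r sqrtr_sqr. Qed.
Lemma cm_le_ReIm (z : C) : cm z <= `|complex.Re z| + `|complex.Im z|.
Proof.
have -> : z = ((complex.Re z)%:C)%C + (0 +i* (complex.Im z))%C :> C.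
  by case: z => a b; apply/eqP; rewrite eq_complex /= addr0 add0r !eqxx.
apply: (le_trans (cmD _ _)); rewrite cm_real cm_imag /=.
by rewrite addr0 add0r.
Qed.
Lemma realC_nat n : ((n%:R : R)%:C)%C = n%:R :> C.
Proof. by rewrite (rmorph_nat (real_complex R)). Qed.
Lemma realC_int (m : int) : ((m%:~R : R)%:C)%C = m%:~R :> C.
Proof. by rewrite (rmorph_int (real_complex R)). Qed.
Lemma realCM (x y : R) : ((x * y)%:C)%C = (x%:C)%C * (y%:C)%C :> C.
Proof. exact: (rmorphM (real_complex R)). Qed.
Lemma realCD (x y : R) : ((x + y)%:C)%C = (x%:C)%C + (y%:C)%C :> C.
Proof. exact: (rmorphD (real_complex R)). Qed.
Lemma realCN (x : R) : ((- x)%:C)%C = - (x%:C)%C :> C.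
Proof. exact: (rmorphN (real_complex R)). Qed.
Lemma realCV (x : R) : (x^-1%:C)%C = (x%:C)%C^-1 :> C.
Proof. exact: (fmorphV (real_complex R)). Qed.
Lemma cm_nat n : cm (n%:R : C) = n%:R.
Proof.
by rewrite -[n%:R : C](rmorph_nat (real_complex R)) cm_real ger0_norm.
Qed.
Lemma ReD (x y : C) : complex.Re (x + y) = complex.Re x + complex.Re y.
Proof. by case: x y => a b []. Qed.
Lemma ImD (x y : C) : complex.Im (x + y) = complex.Im x + complex.Im y.
Proof. by case: x y => a b []. Qed.
Lemma ReN (x : C) : complex.Re (- x) = - complex.Re x.
Proof. by case: x. Qed.
Lemma ImN (x : C) : complex.Im (- x) = - complex.Im x.
Proof. by case: x. Qed.
Lemma cReM (x y : C) : complex.Re (x * y) =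
  complex.Re x * complex.Re y - complex.Im x * complex.Im y.
Proof. by case: x y => a b []. Qed.
Lemma cImM (x y : C) : complex.Im (x * y) =
  complex.Re x * complex.Im y + complex.Im x * complex.Re y.
Proof. by case: x y => a b []. Qed.
Lemma ceq (x y : C) : complex.Re x = complex.Re y ->
  complex.Im x = complex.Im y -> x = y.
Proof. by case: x y => a b [c d] /= -> ->. Qed.

End Modulus.

Arguments cm {R} z : simpl never.

(** * Limits and geometrically dominated series *)

Section Convergence.
Variable R : realType.
Local Notation C := (Cplx R).
Implicit Types (u v : nat -> C) (l m : C).

Definition ccvg u l :=
  forall e : R, 0 < e -> exists N, forall n, (N <= n)%N -> cm (u n - l) < e.

Lemma ccvg_cvg u l : ccvg u l -> u @ \oo --> l.
Proof.
move=> h; apply/cvgrPdist_lt => e e0.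
have [eI eR] : complex.Im e = 0 /\ 0 < complex.Re e.
  by move: e0; rewrite ltcE /= => /andP[/eqP -> ->].
have [N hN] := h _ eR.
exists N => // n /= Nn; rewrite distrC.
have -> : `|u n - l| = ((cm (u n - l))%:C)%C by [].
by rewrite ltcE /= eI eqxx /=; exact: hN.
Qed.

Lemma ccvg_lim u l : ccvg u l -> lim (u @ \oo) = l.
Proof. by move=> /ccvg_cvg/cvg_lim; apply. Qed.

Lemma ccvg_cst l : ccvg (fun=> l) l.
Proof. by move=> e e0; exists 0%N => n _; rewrite subrr cm0. Qed.

Lemma ccvg_uniq u l m : ccvg u l -> ccvg u m -> l = m.
Proof.
move=> hl hm; apply/eqP; rewrite -subr_eq0 -cm_eq0 eq_le cm_ge0 andbT.
apply/ler_addgt0Pl => e e0; rewrite addr0.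
have e20 : 0 < e / 2 by lra.
have [N1 h1] := hl _ e20; have [N2 h2] := hm _ e20.
have := h1 _ (leq_maxl N1 N2); have := h2 _ (leq_maxr N1 N2).
by have := cm_tri (u (maxn N1 N2)) l m; rewrite (cmBC l (u _)); lra.
Qed.

Lemma ccvg_near u v l N : (forall n, (N <= n)%N -> u n = v n) ->
  ccvg u l -> ccvg v l.
Proof.
move=> uv h e e0; have [M hM] := h _ e0.
exists (maxn N M) => n; rewrite geq_max => /andP[Nn Mn].
by rewrite -uv // hM.
Qed.

Lemma ccvg_ext u v l : u =1 v -> ccvg u l -> ccvg v l.
Proof. by move=> uv; apply: (@ccvg_near _ _ _ 0) => n _. Qed.

Lemma ccvg_shift u l k : ccvg u l -> ccvg (fun n => u (n + k)%N) l.
Proof.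
move=> h e e0; have [M hM] := h _ e0; exists M => n Mn; apply: hM.
by rewrite (leq_trans Mn) // leq_addr.
Qed.

Lemma ccvg_unshift u l k : ccvg (fun n => u (n + k)%N) l -> ccvg u l.
Proof.
move=> h e e0; have [M hM] := h _ e0; exists (M + k)%N => n Mn.
have kn : (k <= n)%N by lia.
by rewrite -(subnK kn); apply: hM; lia.
Qed.

Lemma ccvgD u v l m : ccvg u l -> ccvg v m -> ccvg (fun n => u n + v n) (l + m).
Proof.
move=> hl hm e e0; have e20 : 0 < e / 2 by lra.
have [N1 h1] := hl _ e20; have [N2 h2] := hm _ e20.
exists (maxn N1 N2) => n; rewrite geq_max => /andP[n1 n2].
have -> : u n + v n - (l + m) = (u n - l) + (v n - m) by ring.
have := cmD (u n - l) (v n - m); have := h1 _ n1; have := h2 _ n2; lra.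
Qed.

Lemma ccvgZ (c : C) u l : ccvg u l -> ccvg (fun n => c * u n) (c * l).
Proof.
move=> hl e e0; have c0 : 0 < 1 + cm c by have := cm_ge0 c; lra.
have [N h] := hl _ (divr_gt0 e0 c0).
exists N => n Nn; rewrite -mulrBr cmM.
have := h _ Nn; rewrite ltr_pdivlMr // => h2.
by have := cm_ge0 (u n - l); have := cm_ge0 c; nra.
Qed.

Lemma ccvgN u l : ccvg u l -> ccvg (fun n => - u n) (- l).
Proof. by move=> h e /h [N hN]; exists N => n /hN; rewrite -opprD cmN. Qed.

Lemma ccvgB u v l m : ccvg u l -> ccvg v m -> ccvg (fun n => u n - v n) (l - m).
Proof. by move=> hu hv; apply: ccvgD => //; exact: ccvgN. Qed.

Lemma ccvg_le u l B : ccvg u l -> (forall n, cm (u n) <= B) -> cm l <= B.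
Proof.
move=> h uB; apply/ler_addgt0Pl => e e0.
have [N hN] := h _ e0; have := hN _ (leqnn N); have := uB N.
have := cmB_ge l (u N); rewrite (cmBC l); lra.
Qed.

Lemma ccvg_ge u l B : ccvg u l -> (forall n, B <= cm (u n)) -> B <= cm l.
Proof.
move=> h uB; apply/ler_addgt0Pl => e e0.
have [N hN] := h _ e0; have := hN _ (leqnn N); have := uB N.
have := cmB_ge (u N) l; lra.
Qed.

Definition csum u l := ccvg (fun n => \sum_(k < n) u k) l.

Definition geo u (D r : R) := forall n, cm (u n) <= D * r ^+ n.

Lemma geo_D u D r : geo u D r -> 0 <= D.
Proof. by move=> /(_ 0%N); rewrite expr0 mulr1; have := cm_ge0 (u 0%N); lra. Qed.

Lemma geo_sum_le (r : R) n : 0 <= r -> r < 1 -> \sum_(k < n) r ^+ k <= (1 - r)^-1.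
Proof.
move=> r0 r1; rewrite -[leRHS]mul1r ler_pdivlMr; last by lra.
have := subrX1 r n; have := exprn_ge0 n r0.
by set s := \sum_(k < n) _; set t := r ^+ n => t0 e; nra.
Qed.

Lemma geo_tail u D r (m n : nat) : geo u D r -> 0 <= r -> r < 1 -> (m <= n)%N ->
  cm (\sum_(k < n) u k - \sum_(k < m) u k) <= D * r ^+ m / (1 - r).
Proof.
move=> g r0 r1 mn; have D0 := geo_D g.
have -> : \sum_(k < n) u k - \sum_(k < m) u k = \sum_(k < n - m) u (m + k)%N.
  move: (n - m)%N (subnKC mn) => d <-.
  by rewrite big_split_ord /= [LHS]addrC addKr.
apply: (le_trans (cm_sum _ _ _)).
apply: (@le_trans _ _ (\sum_(k < n - m) (D * r ^+ m) * r ^+ k)).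
  by apply: ler_sum => k _; apply: (le_trans (g _)); rewrite exprD mulrA.
by rewrite -mulr_sumr ler_wpM2l ?geo_sum_le // mulr_ge0 // exprn_ge0.
Qed.

Lemma expr_small (D r e : R) : 0 <= r -> r < 1 -> 0 <= D -> 0 < e ->
  exists N, forall n, (N <= n)%N -> D * r ^+ n < e.
Proof.
move=> r0 r1 D0 e0.
have : (fun n => D * r ^+ n) @ \oo --> D * 0.
  apply: cvgM; first exact: cvg_cst.
  by apply: cvg_expr; rewrite ger0_norm.
rewrite mulr0 => /cvgrPdist_lt /(_ _ e0) [N _ hN].
exists N => n /hN /=; rewrite sub0r normrN ger0_norm //.
by rewrite mulr_ge0 // exprn_ge0.
Qed.

Lemma ccvg_ReIm u (a b : R) : (fun n => complex.Re (u n)) @ \oo --> a ->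
  (fun n => complex.Im (u n)) @ \oo --> b -> ccvg u (a +i* b)%C.
Proof.
move=> /cvgrPdist_lt ha /cvgrPdist_lt hb e e0; have e20 : 0 < e / 2 by lra.
have [N1 _ h1] := ha _ e20; have [N2 _ h2] := hb _ e20.
exists (maxn N1 N2) => n; rewrite geq_max => /andP[/h1 /= n1 /h2 /= n2].
have := cm_le_ReIm (u n - (a +i* b)%C); rewrite ReD ImD ReN ImN /=.
by rewrite distrC (distrC _ b); lra.
Qed.

(** A series bounded termwise by a geometric one converges because its real and
    imaginary parts converge absolutely. *)
Lemma geo_cvg u D r : geo u D r -> 0 <= r -> r < 1 -> exists l, csum u l.
Proof.
move=> g r0 r1; have D0 := geo_D g.
have key (f : C -> R) : (forall z, `|f z| <= cm z) ->
  (forall x y, f (x + y) = f x + f y) ->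
    cvgn (fun n => f (\sum_(k < n) u k)).
  move=> fle fD; have f0 : f 0 = 0.
    by have := fle 0; rewrite cm0 normr_le0 => /eqP.
  have fS n : f (\sum_(k < n) u k) = \sum_(0 <= k < n) f (u k).
    rewrite -(big_mkord xpredT u); elim: n => [|n IH]; first by rewrite !big_nil.
    by rewrite !big_nat_recr //= fD IH.
  have -> : (fun n => f (\sum_(k < n) u k)) = series (fun n => f (u n)).
    by apply/funext => n; rewrite fS.
  apply: normed_cvg; apply: (@series_le_cvg _ _ (geometric D r)).
  - by move=> n; exact: normr_ge0.
  - by move=> n; rewrite /= mulr_ge0 // exprn_ge0.
  - by move=> n; apply: (le_trans (fle _)); exact: g.
  - by apply: is_cvg_geometric_series; rewrite ger0_norm.
have h1 := key _ (@Re_le R) (@ReD R); have h2 := key _ (@Im_le R) (@ImD R).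
by exists (lim ((fun n => complex.Re (\sum_(k < n) u k)) @ \oo) +i*
           lim ((fun n => complex.Im (\sum_(k < n) u k)) @ \oo))%C; apply: ccvg_ReIm.
Qed.

Lemma csum_tail u l D r n : csum u l -> geo u D r -> 0 <= r -> r < 1 ->
  cm (l - \sum_(k < n) u k) <= D * r ^+ n / (1 - r).
Proof.
move=> h g r0 r1; have h2 := @ccvg_shift _ _ n h.
apply: (@ccvg_le (fun j => \sum_(k < j + n) u k - \sum_(k < n) u k)).
  by apply: ccvgB => //; exact: ccvg_cst.
by move=> j; apply: geo_tail => //; rewrite leq_addl.
Qed.

Lemma csum_le u l D r : csum u l -> geo u D r -> 0 <= r -> r < 1 ->
  cm l <= D / (1 - r).
Proof.
by move=> h g r0 r1; have := @csum_tail _ _ _ _ 0 h g r0 r1;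
  rewrite big_ord0 subr0 expr0 mulr1.
Qed.

Lemma csum_cvg u l : csum u l -> \big[+%R/0]_(0 <= n <oo) u n = l.
Proof.
move=> h; apply: ccvg_lim; apply: ccvg_ext h => n; by rewrite big_mkord.
Qed.

Lemma csumD u v l m : csum u l -> csum v m -> csum (fun n => u n + v n) (l + m).
Proof.
move=> hu hv; apply: (@ccvg_ext (fun n => \sum_(k < n) u k + \sum_(k < n) v k)).
  by move=> n; rewrite big_split.
exact: ccvgD.
Qed.

Lemma csumZ c u l : csum u l -> csum (fun n => c * u n) (c * l).
Proof.
move=> hu; apply: (@ccvg_ext (fun n => c * \sum_(k < n) u k)); last exact: ccvgZ.
by move=> n; rewrite mulr_sumr.
Qed.

Lemma csum_ext u v l : u =1 v -> csum u l -> csum v l.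
Proof. by move=> uv; apply: ccvg_ext => n; apply: eq_bigr. Qed.

Lemma csum_tele u l : ccvg u l -> csum (fun n => u n.+1 - u n) (l - u 0%N).
Proof.
move=> h; apply: (@ccvg_ext (fun n => u n - u 0%N)).
  by move=> n; rewrite -(big_mkord xpredT (fun k => u k.+1 - u k)) telescope_sumr.
by apply: ccvgB => //; exact: ccvg_cst.
Qed.

Lemma geo_ccvg0 u D r : geo u D r -> 0 <= r -> r < 1 -> ccvg u 0.
Proof.
move=> g r0 r1 e e0; have [N hN] := expr_small r0 r1 (geo_D g) e0.
by exists N => n /hN h; rewrite subr0; apply: le_lt_trans h; exact: g.
Qed.

Lemma csum_S u l : csum u l -> csum (fun n => u n.+1) (l - u 0%N).
Proof.
move=> h; apply: (@ccvg_ext (fun n => \sum_(k < n + 1) u k - u 0%N)).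
  by move=> n; rewrite addn1 big_ord_recl addrC addKr.
by apply: ccvgB; [exact: (@ccvg_shift (fun n => \sum_(k < n) u k))|exact: ccvg_cst].
Qed.

End Convergence.

(** * Strict complex differentiability *)

Section StrictDerivative.
Variable R : realType.
Local Notation C := (Cplx R).
Implicit Types (h g : C -> C) (z w a b : C).

(** Differentiability with two moving points. A holomorphic function has this
    property, and unlike the one-point version it controls the increments of a
    function along a subdivided path, which is what replaces integration in
    [circle_mean]. *)
Definition sderiv h z a := forall e : R, 0 < e -> exists2 d : R, 0 < d &
  forall x y, cm (x - z) < d -> cm (y - z) < d ->
    cm (h y - h x - a * (y - x)) <= e * cm (y - x).

Definition sdiff h z := exists a, sderiv h z a.

Lemma sdiff_derivable h z : sdiff h z -> derivable h z 1.
Proof.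
move=> [a ha]; rewrite /derivable.
apply/cvg_ex; exists a; apply/cvgrPdist_le => /= e e0.
have [eI eR] : complex.Im e = 0 /\ 0 < complex.Re e.
  by move: e0; rewrite ltcE /= => /andP[/eqP -> ->].
have [d d0 hd] := ha _ eR.
exists (d%:C)%C; first by rewrite /= ltcR.
move=> t /=; rewrite sub0r normrN => td t0.
have td' : cm t < d by move: td; rewrite -ltcR.
have -> : t *: (1 : C) = t by rewrite /GRing.scale /= mulr1.
have := hd z (t + z).
rewrite subrr cm0 addrK => /(_ d0 td').
have -> : `|a - t^-1 *: (h (t + z) - h z)| =
  ((cm (a - t^-1 * (h (t + z) - h z)))%:C)%C by [].
move=> H.
have -> : e = ((complex.Re e)%:C)%C by apply: ceq => //=.
rewrite lecR.
have -> : a - t^-1 * (h (t + z) - h z) = - t^-1 * (h (t + z) - h z - a * t).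
  by field.
by rewrite cmM cmN cmV mulrC ler_pdivrMr // cm_gt0.
Qed.

Lemma sderiv_lip h z a : sderiv h z a -> exists2 d : R, 0 < d &
  forall x y, cm (x - z) < d -> cm (y - z) < d ->
    cm (h y - h x) <= (cm a + 1) * cm (y - x).
Proof.
move=> ha; have [d d0 hd] := ha 1 ltr01; exists d => // x y xd yd.
have := hd _ _ xd yd; have := cmB_ge (h y - h x) (a * (y - x)); rewrite cmM; lra.
Qed.

Lemma sdiff_cont h z (e : R) : sdiff h z -> 0 < e -> exists2 d : R, 0 < d &
  forall x, cm (x - z) < d -> cm (h x - h z) < e.
Proof.
move=> [a ha] e0; have [d d0 hd] := sderiv_lip ha.
have a0 : 0 < cm a + 1 by have := cm_ge0 a; lra.
exists (Num.min d (e / (cm a + 1))) => [|x].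
  by rewrite lt_min d0 divr_gt0.
rewrite lt_min => /andP[xd]; rewrite ltr_pdivlMr // => xe.
have := hd z x; rewrite subrr cm0 => /(_ d0 xd); lra.
Qed.

Lemma sdiff_bounded h z : sdiff h z -> exists2 d : R, 0 < d &
  exists2 B : R, 0 < B & forall x, cm (x - z) < d -> cm (h x) <= B.
Proof.
move=> hz; have [d d0 hd] := sdiff_cont hz ltr01; exists d => //.
exists (1 + cm (h z)) => [|x /hd]; first by have := cm_ge0 (h z); lra.
have := cmD (h x - h z) (h z); rewrite subrK; lra.
Qed.

Lemma sdiff_near h g z (d : R) : 0 < d ->
  (forall x, cm (x - z) < d -> h x = g x) -> sdiff h z -> sdiff g z.
Proof.
move=> d0 hg [a ha]; exists a => e /ha [d' d'0 hd'].
exists (Num.min d d') => [|x y]; first by rewrite lt_min d0.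
rewrite !lt_min => /andP[x1 x2] /andP[y1 y2].
by rewrite -!hg //; exact: hd'.
Qed.

Lemma sdiff_ext h g z : h =1 g -> sdiff h z -> sdiff g z.
Proof. by move=> hg; apply: (@sdiff_near _ _ _ 1) => // x _. Qed.

Lemma sdiff_cst c z : sdiff (fun=> c) z.
Proof.
exists 0 => e e0; exists 1 => // x y _ _.
by rewrite subrr mul0r subrr cm0 mulr_ge0 ?cm_ge0 // ltW.
Qed.

Lemma sdiff_id z : sdiff id z.
Proof.
exists 1 => e e0; exists 1 => // x y _ _.
by rewrite mul1r subrr cm0 mulr_ge0 ?cm_ge0 // ltW.
Qed.

Lemma sdiffD h g z : sdiff h z -> sdiff g z -> sdiff (fun x => h x + g x) z.
Proof.
move=> [a ha] [b hb]; exists (a + b) => e e0; have e20 : 0 < e / 2 by lra.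
have [d d0 hd] := ha _ e20; have [d' d'0 hd'] := hb _ e20.
exists (Num.min d d') => [|x y]; first by rewrite lt_min d0.
rewrite !lt_min => /andP[x1 x2] /andP[y1 y2].
have -> : h y + g y - (h x + g x) - (a + b) * (y - x) =
  (h y - h x - a * (y - x)) + (g y - g x - b * (y - x)) by ring.
apply: (le_trans (cmD _ _)); have := hd _ _ x1 y1; have := hd' _ _ x2 y2; clear; lra.
Qed.

Lemma sdiffM h g z : sdiff h z -> sdiff g z -> sdiff (fun x => h x * g x) z.
Proof.
move=> hz gz; have [[a ha] [b hb]] := (hz, gz).
exists (a * g z + b * h z) => e e0.
have [d1 d10 [B1 B10 h1]] := sdiff_bounded gz.
have A0 : 0 < 1 + cm a + B1 + cm (h z) + cm b.
  by have := cm_ge0 a; have := cm_ge0 (h z); have := cm_ge0 b; lra.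
set A := 1 + cm a + B1 + cm (h z) + cm b in A0.
have eA : 0 < e / (4 * A) by rewrite divr_gt0 // mulr_gt0.
have [d2 d20 h2] := ha _ eA; have [d3 d30 h3] := hb _ eA.
have eA2 : 0 < Num.min 1 (e / (4 * A)) by rewrite lt_min ltr01.
have [d4 d40 h4] := sdiff_cont hz eA2; have [d5 d50 h5] := sdiff_cont gz eA.
exists (Num.min (Num.min d1 d2) (Num.min d3 (Num.min d4 d5))) => [|x y].
  by rewrite !lt_min d10 d20 d30 d40 d50.
rewrite !lt_min => /andP[/andP[x1 x2] /andP[x3 /andP[x4 x5]]].
move=> /andP[/andP[y1 y2] /andP[y3 /andP[y4 y5]]].
have -> : h y * g y - h x * g x - (a * g z + b * h z) * (y - x) =
  (h y - h x - a * (y - x)) * g y + a * (y - x) * (g y - g z) +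
  h x * (g y - g x - b * (y - x)) + b * (y - x) * (h x - h z) by ring.
apply: (@le_trans _ _ ((e / (4 * A)) * cm (y - x) * B1 +
  cm a * cm (y - x) * (e / (4 * A)) +
   (cm (h z) + 1) * (e / (4 * A) * cm (y - x)) + cm b * cm (y - x) * (e / (4 * A)))).
  apply: (le_trans (cmD _ _)); apply: lerD.
    apply: (le_trans (cmD _ _)); apply: lerD.
      apply: (le_trans (cmD _ _)); apply: lerD.
  - by rewrite cmM; apply: ler_pM; rewrite ?cm_ge0 //; [exact: h2|exact: h1].
  - by rewrite !cmM; apply: ler_wpM2l; rewrite ?mulr_ge0 ?cm_ge0 // ltW // h5.
  - rewrite cmM; apply: ler_pM; rewrite ?cm_ge0 //; last exact: h3.
    have := h4 _ x4; rewrite lt_min => /andP[+ _].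
    by have := cmD (h x - h z) (h z); rewrite subrK; clear; lra.
  - rewrite !cmM; apply: ler_wpM2l; rewrite ?mulr_ge0 ?cm_ge0 //.
    by have := h4 _ x4; rewrite lt_min => /andP[_ /ltW].
have E : e / (4 * A) * A = e / 4 by field; rewrite gt_eqF.
have := cm_ge0 (y - x); set t := cm (y - x) => t0.
set k := e / (4 * A) in E *.
have -> : k * t * B1 + cm a * t * k + (cm (h z) + 1) * (k * t) + cm b * t * k =
  (k * A) * t by rewrite /A; ring.
by move: e0 t0; rewrite E; clear; nra.
Qed.

Lemma sdiffV h z : h z != 0 -> sdiff h z -> sdiff (fun x => (h x)^-1) z.
Proof.
move=> hz0 hz; have [a ha] := hz.
have c0 : 0 < cm (h z) by rewrite cm_gt0.
set c := cm (h z) in c0.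
exists (- a / (h z) ^+ 2) => e e0.
have a0 := cm_ge0 a.
have k0 : 0 < e * c ^+ 2 / 8 by rewrite divr_gt0 // mulr_gt0 // exprn_gt0.
have [d1 d10 h1] := ha _ k0.
have m0 : 0 < Num.min (c / 2) (e * c ^+ 3 / (16 * (cm a + 1))).
  by rewrite lt_min !divr_gt0 ?mulr_gt0 ?exprn_gt0 //; lra.
have [d2 d20 h2] := sdiff_cont hz m0.
exists (Num.min d1 d2) => [|x y]; first by rewrite lt_min d10.
rewrite !lt_min => /andP[x1 /h2 +] /andP[y1 /h2 +].
rewrite !lt_min => /andP[X1 X2] /andP[Y1 Y2].
have hx : c / 2 < cm (h x) by have := cmB_ge (h z) (h x); rewrite cmBC -/c; lra.
have hy : c / 2 < cm (h y) by have := cmB_ge (h z) (h y); rewrite cmBC -/c; lra.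
have hx0 : h x != 0 by rewrite -cm_gt0; move: hx c0; clear; lra.
have hy0 : h y != 0 by rewrite -cm_gt0; move: hy c0; clear; lra.
have -> : (h y)^-1 - (h x)^-1 - (- a / (h z) ^+ 2) * (y - x) =
  - ((h y - h x - a * (y - x)) * ((h y)^-1 * (h x)^-1)) +
  a * (y - x) * ((h y - h z) * ((h y)^-1 * (h z) ^- 1 * (h z) ^-1) +
    (h x - h z) * ((h y)^-1 * (h x)^-1 * (h z)^-1)).
  by field; rewrite hz0 hx0 hy0.
have c20 : 0 < c / 2 by rewrite divr_gt0.
have iy : cm (h y)^-1 <= 2 / c.
  by rewrite cmV -(invf_div c) lef_pV2 ?posrE ?cm_gt0 // ltW.
have ix : cm (h x)^-1 <= 2 / c.
  by rewrite cmV -(invf_div c) lef_pV2 ?posrE ?cm_gt0 // ltW.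
have iz : cm (h z)^-1 = c^-1 by rewrite cmV.
have ic0 : 0 < c^-1 by rewrite invr_gt0.
apply: (@le_trans _ _ (e * c ^+ 2 / 8 * cm (y - x) * ((2 / c) * (2 / c)) +
  cm a * cm (y - x) * (e * c ^+ 3 / (16 * (cm a + 1)) * (2 / c * c^-1 * c^-1) +
  e * c ^+ 3 / (16 * (cm a + 1)) * (2 / c * (2 / c) * c^-1)))).
  apply: (le_trans (cmD _ _)); apply: lerD.
    rewrite cmN !cmM; apply: ler_pM; rewrite ?mulr_ge0 ?cm_ge0 //; first exact: h1.
    by apply: ler_pM; rewrite ?cm_ge0.
  rewrite !cmM; apply: ler_wpM2l; first by rewrite mulr_ge0 ?cm_ge0.
  apply: (le_trans (cmD _ _)); apply: lerD; rewrite !cmM ?cmX iz.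
    apply: ler_pM; rewrite ?mulr_ge0 ?cm_ge0 ?(ltW ic0) //; first exact: ltW.
    by rewrite !ler_pM2r.
  apply: ler_pM; rewrite ?mulr_ge0 ?cm_ge0 ?(ltW ic0) //; first exact: ltW.
  apply: ler_wpM2r; first exact: ltW.
  by apply: ler_pM; rewrite ?cm_ge0.
set t := cm (y - x); have t0 : 0 <= t := cm_ge0 _.
have -> : e * c ^+ 2 / 8 * t * ((2 / c) * (2 / c)) = e * t / 2.
  by field; rewrite gt_eqF.
set A := cm a in a0 *.
have -> : A * t * (e * c ^+ 3 / (16 * (A + 1)) * (2 / c * c^-1 * c^-1) +
  e * c ^+ 3 / (16 * (A + 1)) * (2 / c * (2 / c) * c^-1)) =
    e * t * (A / (A + 1)) * (6 / 16).
  by field; rewrite !gt_eqF //; move: a0; clear; lra.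
have A1 : 0 < A + 1 by move: a0; clear; lra.
have : A / (A + 1) <= 1 by rewrite ler_pdivrMr // mul1r lerDl.
have : 0 <= e * t by rewrite mulr_ge0 // ltW.
by move: (A / (A + 1)) (e * t) => w v; clear; nra.
Qed.

Lemma sdiff_comp h g z : sdiff g z -> sdiff h (g z) -> sdiff (fun x => h (g x)) z.
Proof.
move=> gz [a ha]; have [b hb] := gz; exists (a * b) => e e0.
have b0 := cm_ge0 b; have a0 := cm_ge0 a.
have k0 : 0 < e / (2 * (cm b + 1)) by rewrite divr_gt0 // mulr_gt0 //; lra.
have m0 : 0 < e / (2 * (cm a + 1)) by rewrite divr_gt0 // mulr_gt0 //; lra.
have [d1 d10 h1] := ha _ k0; have [d2 d20 h2] := hb _ m0.
have [d3 d30 h3] := sderiv_lip hb; have [d4 d40 h4] := sdiff_cont gz d10.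
exists (Num.min (Num.min d2 d3) d4) => [|x y].
  by rewrite !lt_min d20 d30 d40.
rewrite !lt_min => /andP[/andP[x2 x3] /h4 x4] /andP[/andP[y2 y3] /h4 y4].
have -> : h (g y) - h (g x) - a * b * (y - x) =
  (h (g y) - h (g x) - a * (g y - g x)) + a * (g y - g x - b * (y - x)) by ring.
apply: (le_trans (cmD _ _)); rewrite cmM.
have H1 := h1 _ _ x4 y4; have H2 := h2 _ _ x2 y2; have H3 := h3 _ _ x3 y3.
have t0 : 0 <= cm (y - x) := cm_ge0 _.
have : e / (2 * (cm b + 1)) * cm (g y - g x) <= e / 2 * cm (y - x).
  apply: (le_trans (ler_wpM2l (ltW k0) H3)); rewrite le_eqVlt; apply/orP; left.
  by apply/eqP; field; rewrite gt_eqF //; move: b0; clear; lra.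
have : cm a * cm (g y - g x - b * (y - x)) <= e / 2 * cm (y - x).
  apply: (le_trans (ler_wpM2l a0 H2)).
  have -> : cm a * (e / (2 * (cm a + 1)) * cm (y - x)) =
    (e / 2 * cm (y - x)) * (cm a / (cm a + 1)).
    by field; rewrite gt_eqF //; move: a0; clear; lra.
  rewrite ler_piMr ?mulr_ge0 ?divr_ge0 ?(ltW e0) //.
  by rewrite ler_pdivrMr; move: a0; clear; lra.
move: H1; clear; lra.
Qed.

Lemma sdiffN h z : sdiff h z -> sdiff (fun x => - h x) z.
Proof.
by move=> hz; apply: (@sdiff_ext (fun x => -1 * h x)) => [x|];
  [rewrite mulN1r|apply: sdiffM => //; exact: sdiff_cst].
Qed.

Lemma sdiffB h g z : sdiff h z -> sdiff g z -> sdiff (fun x => h x - g x) z.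
Proof. by move=> hz gz; apply: sdiffD => //; exact: sdiffN. Qed.

Lemma sdiff_div h g z : g z != 0 -> sdiff h z -> sdiff g z ->
  sdiff (fun x => h x / g x) z.
Proof. by move=> g0 hz gz; apply: sdiffM => //; exact: sdiffV. Qed.

Lemma sdiffX h n z : sdiff h z -> sdiff (fun x => h x ^+ n) z.
Proof.
move=> hz; elim: n => [|n IH].
  by apply: (@sdiff_ext (fun=> 1)) => //; exact: sdiff_cst.
by apply: (@sdiff_ext (fun x => h x * h x ^+ n)) => [x|]; [rewrite exprS|exact: sdiffM].
Qed.

Lemma sdiff_sum (I : Type) (r : seq I) (P : pred I) (F : I -> C -> C) z :
  (forall i, P i -> sdiff (F i) z) -> sdiff (fun x => \sum_(i <- r | P i) F i x) z.
Proof.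
move=> hF; elim: r => [|i r IH].
  by apply: (@sdiff_ext (fun=> 0)) => [x|]; [rewrite big_nil|exact: sdiff_cst].
have [Pi|Pi] := boolP (P i).
  by apply: (@sdiff_ext (fun x => F i x + \sum_(i <- r | P i) F i x)) => [x|];
    [rewrite big_cons Pi|exact: sdiffD (hF _ Pi) IH].
by apply: sdiff_ext IH => x; rewrite big_cons (negbTE Pi).
Qed.

Lemma sdiff_prod (I : Type) (r : seq I) (P : pred I) (F : I -> C -> C) z :
  (forall i, P i -> sdiff (F i) z) -> sdiff (fun x => \prod_(i <- r | P i) F i x) z.
Proof.
move=> hF; elim: r => [|i r IH].
  by apply: (@sdiff_ext (fun=> 1)) => [x|]; [rewrite big_nil|exact: sdiff_cst].
have [Pi|Pi] := boolP (P i).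
  by apply: (@sdiff_ext (fun x => F i x * \prod_(i <- r | P i) F i x)) => [x|];
    [rewrite big_cons Pi|exact: sdiffM (hF _ Pi) IH].
by apply: sdiff_ext IH => x; rewrite big_cons (negbTE Pi).
Qed.

Lemma sdiff_affine a b z : sdiff (fun x => a * x + b) z.
Proof.
by apply: sdiffD; [apply: sdiffM; [exact: sdiff_cst|exact: sdiff_id]|exact: sdiff_cst].
Qed.

Lemma sdiff_compl h a b z : sdiff h (a * z + b) -> sdiff (fun x => h (a * x + b)) z.
Proof. by move=> hz; apply: (@sdiff_comp h) => //; exact: sdiff_affine. Qed.

End StrictDerivative.

(** * The exponential function *)

Section Exponential.
Variable R : realType.
Local Notation C := (Cplx R).
Implicit Types (z w : C).

Local Notation cexp := (@cexp R).
Local Notation qexp := (@qexp R).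

Lemma cexpD z w : cexp (z + w) = cexp z * cexp w.
Proof.
rewrite /Defs.cexp ReD ImD expRD cosD sinD.
by apply: ceq; rewrite ?cReM ?cImM /=; ring.
Qed.

Lemma cm_cexp z : cm (cexp z) = expR (complex.Re z).
Proof.
apply/eqP; rewrite -(@eqrXn2 _ 2) ?cm_ge0 ?expR_ge0 // cmE /=.
by rewrite !exprMn -mulrDr cos2Dsin2 mulr1.
Qed.

Lemma cexp0 : cexp 0 = 1.
Proof. by apply: ceq; rewrite /= expR0 ?cos0 ?sin0 ?mulr1 ?mulr0. Qed.

Lemma cexp_neq0 z : cexp z != 0.
Proof. by rewrite -cm_gt0 cm_cexp expR_gt0. Qed.

Lemma cexpN z : cexp (- z) = (cexp z)^-1.
Proof.
apply: (mulIf (cexp_neq0 z)); rewrite mulVf ?cexp_neq0 //.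
by rewrite -cexpD addNr cexp0.
Qed.

Lemma cexpMn n z : cexp (n%:R * z) = cexp z ^+ n.
Proof.
elim: n => [|n IH]; first by rewrite mul0r cexp0 expr0.
by rewrite -natr1 mulrDl mul1r cexpD IH exprSr.
Qed.

Lemma is_derive_eps (f : R -> R) (x df e : R) : is_derive x (1 : R) f df -> 0 < e ->
  exists2 d : R, 0 < d & forall t, `|t| < d -> `|f (t + x) - f x - df * t| <= e * `|t|.
Proof.
move=> [der val] e0.
have : (fun h : R => h^-1 *: (f (h *: (1 : R) + x) - f x)) @ 0^' --> df.
  by rewrite -val; exact: der.
move=> /cvgrPdist_le /(_ _ e0) [d /= d0 hd].
exists d => // t td; have [->|t0] := eqVneq t 0.
  by rewrite add0r mulr0 !subrr normr0 mulr0.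
have := hd t; rewrite /= sub0r normrN => /(_ td t0).
have -> : t *: (1 : R) = t by rewrite /GRing.scale /= mulr1.
have -> : f (t + x) - f x - df * t = - t * (df - t^-1 *: (f (t + x) - f x)).
  by rewrite /GRing.scale /=; field.
by rewrite normrM normrN mulrC => h; rewrite ler_wpM2r.
Qed.

(** The derivative at 0 comes from those of the real functions exp, sin and cos
    at 0; the functional equation carries it to every other point. *)
Lemma cexp_near0 (e : R) : 0 < e -> exists2 d : R, 0 < d &
  forall z, cm z < d -> cm (cexp z - 1 - z) <= e * cm z.
Proof.
wlog e1 : e / e <= 1.
  move=> H e0; have m0 : 0 < Num.min e 1 by rewrite lt_min e0 ltr01.
  have [|d d0 hd] := H (Num.min e 1) _ m0; first by rewrite ge_min lexx orbT.
  exists d => // z /hd h; apply: (le_trans h).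
  by rewrite ler_wpM2r ?cm_ge0 // ge_min lexx.
move=> e0; have e80 : 0 < e / 16 by lra.
have [d1 d10 h1] := is_derive_eps (is_derive_expR 0) e80.
have [d2 d20 h2] := is_derive_eps (is_derive_sin (0 : R)) e80.
have [d3 d30 h3] := is_derive_eps (is_derive_cos (0 : R)) e80.
exists (Num.min (Num.min (Num.min d1 1) d2) (Num.min d3 (e / 16))) => [|z].
  by rewrite !lt_min d10 d20 d30 ltr01.
rewrite !lt_min => /andP[/andP[/andP[z1 z11] z2] /andP[z3 ze]].
have r := Re_le z; have i := Im_le z.
have := h1 _ (le_lt_trans r z1); rewrite addr0 expR0 mul1r.
have := h2 _ (le_lt_trans i z2); rewrite addr0 sin0 cos0 mul1r subr0.
have := h3 _ (le_lt_trans i z3); rewrite addr0 sin0 cos0 oppr0 mul0r subr0.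
have := cm_le_ReIm (cexp z - 1 - z).
rewrite !(ReD, ImD, ReN, ImN) /= subr0; move: r i.
set a := complex.Re z; set b := complex.Im z; set t := cm z in ze z11 *.
have t0 : 0 <= t := cm_ge0 z.
move=> r i H Hc Hs He.
have ea : `|expR a - 1 - a| <= e / 16 * t by apply: (le_trans He);
  rewrite ler_wpM2l // ltW.
have ec : `|cos b - 1| <= e / 16 * t by apply: (le_trans Hc); rewrite ler_wpM2l // ltW.
have es : `|sin b - b| <= e / 16 * t by apply: (le_trans Hs); rewrite ler_wpM2l // ltW.
have ea3 : expR a <= 3.
  have : expR a - 1 - a <= e / 16 * t by apply: le_trans (ler_norm _) ea.
  have : a <= t by apply: le_trans (ler_norm _) r.
  by move: e1 t0 z11; clear; nra.
have ea0 := expR_gt0 a.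
apply: (le_trans H).
have -> : expR a * cos b - 1 - a = (expR a - 1 - a) + expR a * (cos b - 1) by ring.
have -> : expR a * sin b - b = expR a * (sin b - b) + ((expR a - 1 - a) + a) * b by ring.
have A1 : `|expR a - 1 - a + expR a * (cos b - 1)| <= e / 16 * t + 3 * (e / 16 * t).
  apply: (le_trans (ler_normD _ _)); rewrite lerD // normrM gtr0_norm //.
  by apply: ler_pM => //; exact: ltW.
have A2 : `|expR a * (sin b - b) + (expR a - 1 - a + a) * b| <=
    3 * (e / 16 * t) + (2 * t) * (e / 16).
  apply: (le_trans (ler_normD _ _)); rewrite !normrM gtr0_norm //; apply: lerD.
    by apply: ler_pM => //; exact: ltW.
  apply: ler_pM => //; last by apply: (le_trans i); exact: ltW.
  apply: (le_trans (ler_normD _ _)); apply: (le_trans (lerD ea r)).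
  by move: e1 t0; clear; nra.
apply: (le_trans (lerD A1 A2)); move: t0 e0; clear; nra.
Qed.

(** By the functional equation the increment between x and y is cexp x times
    the increment from 0 to y - x, and cexp x is close to cexp z. *)
Lemma sderiv_cexp z : sderiv cexp z (cexp z).
Proof.
have key w (e : R) : 0 < e -> exists2 d : R, 0 < d & forall x y, cm (x - w) < d ->
  cm (y - w) < d ->
    cm (cexp y - cexp x - cexp x * (y - x)) <= e * cm (cexp x) * cm (y - x).
  move=> e0; have [d d0 hd] := cexp_near0 e0.
  exists (d / 2) => [|x y xd yd]; first by lra.
  have -> : cexp y - cexp x - cexp x * (y - x) = cexp x * (cexp (y - x) - 1 - (y - x)).
    rewrite cexpD cexpN; field; exact: cexp_neq0.
  rewrite cmM; have -> : e * cm (cexp x) * cm (y - x) =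
    cm (cexp x) * (e * cm (y - x)) by ring.
  rewrite ler_wpM2l ?cm_ge0 // hd //; have := cm_tri w y x; rewrite (cmBC w); lra.
move=> e e0.
have [d1 d10 h1] := key z 1 ltr01.
pose A := cm (cexp z) + 1; have A0 : 0 < A by have := cm_ge0 (cexp z); rewrite /A; lra.
have k0 : 0 < e / (4 * A) by rewrite divr_gt0 // mulr_gt0.
have [d2 d20 h2] := key z _ k0.
exists (Num.min (Num.min d1 d2) (Num.min 1 (e / 2) / (2 * A))) => [|x y].
  by rewrite !lt_min d10 d20 divr_gt0 ?mulr_gt0 // lt_min ltr01 divr_gt0.
rewrite !lt_min => /andP[/andP[x1 x2] x3] /andP[/andP[y1 y2] y3].
have xz : cm (cexp x - cexp z) <= 2 * A * cm (x - z).
  have := h1 z x; rewrite subrr cm0 => /(_ d10 x1).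
  have := cmB_ge (cexp x - cexp z) (cexp z * (x - z)); rewrite cmM /A.
  by have := cm_ge0 (x - z); nra.
have xz2 : 2 * A * cm (x - z) < Num.min 1 (e / 2).
  by rewrite mulrC -ltr_pdivlMr // mulr_gt0.
move: xz2; rewrite lt_min => /andP[xz2 xz3].
have xA : cm (cexp x) <= 2 * A.
  by have := cmD (cexp x - cexp z) (cexp z); rewrite subrK /A;
    have := cm_ge0 (cexp z); lra.
have -> : cexp y - cexp x - cexp z * (y - x) =
  (cexp y - cexp x - cexp x * (y - x)) + (cexp x - cexp z) * (y - x) by ring.
apply: (le_trans (cmD _ _)); rewrite cmM.
have B1 : cm (cexp y - cexp x - cexp x * (y - x)) <= e / 2 * cm (y - x).
  apply: (le_trans (h2 _ _ x2 y2)); rewrite ler_wpM2r ?cm_ge0 //.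
  apply: (le_trans (ler_wpM2l (ltW k0) xA)).
  by rewrite le_eqVlt; apply/orP; left; apply/eqP; field; rewrite gt_eqF.
by have := cm_ge0 (y - x); nra.
Qed.

Lemma sdiff_cexp z : sdiff cexp z.
Proof. by exists (cexp z); exact: sderiv_cexp. Qed.

Lemma qexpD z w : qexp (z + w) = qexp z * qexp w.
Proof. by rewrite /Defs.qexp mulrDr cexpD. Qed.
Lemma qexp0 : qexp 0 = 1.
Proof. by rewrite /Defs.qexp mulr0 cexp0. Qed.
Lemma qexp_neq0 z : qexp z != 0.
Proof. exact: cexp_neq0. Qed.
Lemma qexpN z : qexp (- z) = (qexp z)^-1.
Proof. by rewrite /Defs.qexp mulrN cexpN. Qed.
Lemma qexpB z w : qexp (z - w) = qexp z / qexp w.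
Proof. by rewrite qexpD qexpN. Qed.
Lemma qexpMn n z : qexp (n%:R * z) = qexp z ^+ n.
Proof. by rewrite /Defs.qexp mulrCA cexpMn. Qed.
Lemma cm_qexp z : cm (qexp z) = expR (- (2 * pi * complex.Im z)).
Proof. by rewrite cm_cexp; congr expR; case: z => a b /=; ring. Qed.
Lemma sdiff_qexp z : sdiff qexp z.
Proof.
apply: (@sdiff_comp _ cexp); last exact: sdiff_cexp.
by apply: sdiffM; [exact: sdiff_cst|exact: sdiff_id].
Qed.
Lemma qexp1 : qexp 1 = 1.
Proof.
rewrite /Defs.qexp mulr1; apply: ceq => /=; rewrite expR0 mul1r mulr_natl.
  exact: cos2pi.
by rewrite sin2pi.
Qed.
Lemma qexp_half : qexp (1 / 2) = -1.
Proof.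
have -> : qexp (1 / 2) = cexp (0 +i* pi)%C.
  congr Defs.cexp; rewrite /two_pi_i.
  have -> : (0 +i* (2 * pi))%C = (0 +i* pi)%C + (0 +i* pi)%C :> C.
    by apply: ceq; rewrite ?ReD ?ImD /=; ring.
  by field.
by apply: ceq; rewrite /= expR0 mul1r ?cospi ?sinpi ?oppr0.
Qed.
Lemma qexp_nat n : qexp n%:R = 1.
Proof. by rewrite -[n%:R]mulr1 qexpMn qexp1 expr1n. Qed.
Lemma qexp_int (m : int) : qexp m%:~R = 1.
Proof. by case: m => n; rewrite ?NegzE ?mulrNz ?qexpN -?pmulrn qexp_nat ?invr1. Qed.
Lemma qexpDint z (m : int) : qexp (z + m%:~R) = qexp z.
Proof. by rewrite qexpD qexp_int mulr1. Qed.
Lemma qexp_ImI z : complex.Im z = 0 -> qexp z =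
  (cos (2 * pi * complex.Re z) +i* sin (2 * pi * complex.Re z))%C.
Proof.
by case: z => a b /= ->;
  rewrite /Defs.qexp /Defs.cexp /= !(mul0r, mulr0, subr0, add0r) oppr0 expR0 !mul1r.
Qed.

(** The modulus forces z to be real, and after removing the integer part 1 -
    cos(2 pi t) = 2 sin(pi t)^2 is nonzero for 0 < t < 1. *)
Lemma qexp_eq1 z : qexp z = 1 -> exists m : int, z = m%:~R.
Proof.
move=> h; have p0 := pi_gt0 R.
have z0 : complex.Im z = 0.
  have /expR_inj/eqP : expR (- (2 * pi * complex.Im z)) =
    expR 0 by rewrite -cm_qexp h cm1 expR0.
  rewrite oppr_eq0.
  by rewrite !mulf_eq0 (gt_eqF p0) pnatr_eq0 /= => /eqP.
pose m := Num.floor (complex.Re z); exists m.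
have mC : m%:~R = ((m%:~R : R)%:C)%C :> C by rewrite rmorph_int.
pose t : R := complex.Re z - m%:~R.
have /andP[m1 m2] := floor_itv (complex.Re z).
have t0 : 0 <= t by rewrite subr_ge0.
have t1 : t < 1 by rewrite /t; move: m2; rewrite intrD; lra.
have zE : z = m%:~R + (t%:C)%C.
  by apply: ceq; rewrite ?ReD ?ImD mC /= ?addr0 // /t /m; ring.
suff -> : z = m%:~R + 0 by rewrite addr0.
have [t00|tn0] := eqVneq t 0; first by rewrite zE t00.
have : qexp (t%:C)%C = 1 by move: h; rewrite zE addrC qexpDint.
rewrite qexp_ImI //= => /(congr1 (@complex.Re R)) /=.
have -> : 2 * pi * t = (pi * t) *+ 2 by rewrite mulr2n; ring.
rewrite cos_mulr2n; have := cos2Dsin2 (pi * t).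
have : 0 < sin (pi * t).
  apply: sin_gt0_pi; rewrite mulr_gt0 //=; last by rewrite lt_def tn0.
  by rewrite gtr_pMr.
rewrite mulr2n => s0 e1 e2; exfalso.
have : sin (pi * t) ^+ 2 = 0 by lra.
by move/eqP; rewrite expf_eq0 /= (gt_eqF s0).
Qed.

Lemma qexp_surj w : w != 0 -> exists z, qexp z = w.
Proof.
move=> w0; have c0 : 0 < cm w by rewrite cm_gt0.
pose v := complex.Re w / cm w.
have v1 : -1 <= v <= 1.
  have := Re_le w; rewrite ler_norml => /andP[h1 h2].
  by rewrite /v ler_pdivrMr // ler_pdivlMr // mulN1r h1 mul1r.
have p0 := pi_gt0 R.
have key (s : R) : cos s = v -> sin s = complex.Im w / cm w -> exists z, qexp z = w.
  move=> hc hs.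
  exists ((ln (cm w) +i* s)%C / two_pi_i R).
  rewrite /Defs.qexp mulrC divfK; last first.
    rewrite -cm_gt0 cm_imag normr_gt0 mulf_neq0 ?(gt_eqF p0) //.
  by apply: ceq; rewrite /= lnK ?posrE // ?hc ?hs /v mulrC divfK // gt_eqF.
have sn : Num.sqrt (1 - v ^+ 2) = `|complex.Im w / cm w|.
  have -> : 1 - v ^+ 2 = (complex.Im w / cm w) ^+ 2.
    have : complex.Im w ^+ 2 = cm w ^+ 2 - complex.Re w ^+ 2 by rewrite cmE; ring.
    by rewrite /v !expr_div_n => ->; field; rewrite gt_eqF.
  by rewrite sqrtr_sqr.
have [i0|i0] := leP 0 (complex.Im w).
  apply: (key (acos v)); first by rewrite acosK // in_itv.
  by rewrite sin_acos // sn ger0_norm // divr_ge0 // ltW.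
apply: (key (- acos v)); first by rewrite cosN acosK // in_itv.
by rewrite sinN sin_acos // sn ltr0_norm ?opprK // pmulr_llt0 // invr_gt0.
Qed.

End Exponential.

(** * Power series expansion of a holomorphic function *)

Section Cauchy.
Variable R : realType.
Local Notation C := (Cplx R).
Implicit Types (z w : C) (h : C -> C).

Local Notation qexp := (@qexp R).

(** Compactness of a square, in the form of a Lebesgue number for a local
    property that is inherited by smaller radii. *)
Lemma square_uniform (L : R) (Q : R -> C -> Prop) :
  (forall d d' w, d' <= d -> Q d w -> Q d' w) ->
  (forall z, exists2 d : R, 0 < d & forall w, cm (w - z) < d -> Q d w) ->
  exists2 d : R, 0 < d & forall w, cm w <= L -> Q d w.
Proof.
move=> Qd loc.
pose K := (`[- L, L] `*` `[- L, L])%classic : set (R * R).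
have cK : compact K by apply: compact_setX; exact: segment_compact.
have /compact_near_coveringP nc := cK.
have := nc _ (0 : R)^'+ (fun d xy => Q d (xy.1 +i* xy.2)%C) _.
case.
  move=> [x y] _; have [d d0 hd] := loc (x +i* y)%C.
  exists ([set xy : R * R | cm ((xy.1 +i* xy.2)%C - (x +i* y)%C : C) < d],
    [set d' | 0 < d' <= d]); last first.
    by move=> [[x' y'] d'] /= [h1 /andP[_ h2]]; apply: Qd h2 _; exact: hd.
  split => /=.
    apply/nbhs_ballP; exists (d / 2) => [|[x' y'] /= [h1 h2]]; first by rewrite /=; lra.
    apply: (le_lt_trans (cm_le_ReIm _)); rewrite /= distrC (distrC y').
    by move: h1 h2; rewrite /ball /=; lra.
  exists d => //= d' /=; rewrite sub0r normrN => hd' d'0.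
  by rewrite d'0 ltW // (le_lt_trans (ler_norm _)).
move=> d /= d0 hd; exists (d / 2); first by lra.
move=> w wL; have := hd (d / 2); rewrite /= sub0r normrN gtr0_norm; last by lra.
have d2 : d / 2 < d by lra.
have d3 : 0 < d / 2 by lra.
case: w wL => a b wL => /(_ d2 d3) H; apply: (H (a, b)); split => /=.
  have := le_trans (Re_le (a +i* b)%C) wL; rewrite /= ler_norml => h.
  by rewrite in_itv.
have := le_trans (Im_le (a +i* b)%C) wL; rewrite /= ler_norml => h.
by rewrite in_itv.
Qed.

Lemma sderiv_close h z a w b (d e : R) :
  (forall x y, cm (x - z) < d -> cm (y - z) < d ->
     cm (h y - h x - a * (y - x)) <= e * cm (y - x)) ->
  cm (w - z) < d -> sderiv h w b -> cm (b - a) <= e.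
Proof.
move=> H wd hb; apply/ler_addgt0Pl => e1 e10.
have [d1 d10 h1] := hb _ e10.
pose t : R := Num.min (d - cm (w - z)) d1 / 2.
have m0 : 0 < Num.min (d - cm (w - z)) d1 by rewrite lt_min subr_gt0 wd.
have t0 : 0 < t by rewrite divr_gt0.
have [t1 t2] : t < d - cm (w - z) /\ t < d1.
  have : t < Num.min (d - cm (w - z)) d1 by rewrite /t; lra.
  by rewrite lt_min => /andP.
pose y : C := w + (t%:C)%C.
have yw : y - w = (t%:C)%C by rewrite /y addrC addKr.
have cy : cm (y - w) = t by rewrite yw cm_real gtr0_norm.
have := h1 w y; rewrite subrr cm0 cy => /(_ d10 t2) A.
have yz : cm (y - z) < d by have := cm_tri w y z; rewrite cy; lra.
have := H _ _ wd yz; rewrite cy => B.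
rewrite -(ler_pM2r t0);
  have -> : cm (b - a) * t = cm ((b - a) * (y - w)) by rewrite cmM cy.
have -> : (b - a) * (y - w) = (h y - h w - a * (y - w)) - (h y - h w - b *
  (y - w)) by ring.
have := cmB (h y - h w - a * (y - w)) (h y - h w - b * (y - w)); lra.
Qed.

(** Strict differentiability at each point of a disc is uniform on the disc:
    near z the derivatives all lie within e of the one at z by [sderiv_close],
    and the disc is compact. *)
Lemma unif_strict h (L : R) : (forall z, cm z <= L -> sdiff h z) ->
  exists h' : C -> C, forall e : R, 0 < e -> exists2 d : R, 0 < d &
    forall x y, cm x <= L -> cm y <= L -> cm (y - x) < d ->
      cm (h y - h x - h' x * (y - x)) <= e * cm (y - x).
Proof.
move=> hh.
have [h' h'P] : exists h' : C -> C, forall z, cm z <= L -> sderiv h z (h' z).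
  have : forall z, exists a, cm z <= L -> sderiv h z a.
    move=> z; have [zL|zL] := boolP (cm z <= L); last by exists 0.
    by have [a ha] := hh _ zL; exists a.
  by move=> H; exists (fun z => projT1 (cid (H z))) => z; exact: projT2 (cid (H z)).
exists h' => e e0.
pose Q (d : R) x := cm x <= L -> forall y, cm y <= L -> cm (y - x) < d ->
      cm (h y - h x - h' x * (y - x)) <= e * cm (y - x).
have [] := @square_uniform L Q.
- by move=> d d' w dd' H wL y yL yd; apply: H => //; exact: lt_le_trans dd'.
- move=> z; have [zL|zL] := boolP (cm z <= L); last first.
    rewrite -ltNge in zL; exists (cm z - L); first by rewrite subr_gt0.
    move=> w wz wL; have := cmB_ge z w; rewrite cmBC; lra.
  have e20 : 0 < e / 2 by lra.
  have [d d0 hd] := h'P _ zL _ e20.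
  exists (d / 2) => [|w wz wL y yL yd]; first by lra.
  have wd : cm (w - z) < d by lra.
  have yd' : cm (y - z) < d by have := cm_tri w y z; lra.
  have A := sderiv_close hd wd (h'P _ wL).
  have B := hd _ _ wd yd'.
  have -> : h y - h w - h' w * (y - w) = (h y - h w - h' z *
    (y - w)) - (h' w - h' z) * (y - w) by ring.
  apply: (le_trans (cmB _ _)); rewrite cmM; have := cm_ge0 (y - w); nra.
by move=> d d0 H; exists d => // x y xL yL xy; exact: H.
Qed.

Definition om N : C := qexp (1 / N%:R).

Lemma cm_om N : cm (om N) = 1.
Proof.
rewrite /om cm_qexp.
have -> : (1 / N%:R : C) = ((1 / N%:R : R)%:C)%C.
  by rewrite realCM realCV realC_nat.
by rewrite /= mulr0 oppr0 expR0.
Qed.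

Lemma om_neq0 N : om N != 0.
Proof. exact: qexp_neq0. Qed.

Lemma omX N k : om N ^+ k = qexp (k%:R / N%:R).
Proof. by rewrite /om -qexpMn mulrA mulr1. Qed.

Lemma omN N : (0 < N)%N -> om N ^+ N = 1.
Proof. by move=> N0; rewrite omX divff ?qexp1 // pnatr_eq0 -lt0n. Qed.

Lemma omX_neq1 N k : (0 < k < N)%N -> om N ^+ k != 1.
Proof.
move=> /andP[k0 kN]; apply/eqP; rewrite omX => /qexp_eq1[m].
have N0 : (N%:R : C) != 0 by rewrite pnatr_eq0; lia.
move=> /(canRL (mulfVK N0)) H.
have : (k : int) = m * N.
  by apply/eqP; rewrite -(eqr_int C) intrM -H.
move=> /(congr1 absz); rewrite abszM /=; move: `|m|%N => a E; case: a E => [|a] E; nia.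
Qed.

Lemma sum_omX N k : (0 < k < N)%N -> \sum_(j < N) (om N ^+ k) ^+ j = 0.
Proof.
move=> kN; have h := subrX1 (om N ^+ k) N.
have w1 : om N ^+ k - 1 != 0 by rewrite subr_eq0 omX_neq1.
have N0 : (0 < N)%N by lia.
apply: (mulfI w1); rewrite -h mulr0 -exprM mulnC exprM omN //.
by rewrite expr1n subrr.
Qed.

Lemma om_near1 (d : R) : 0 < d -> exists N0, forall N, (N0 <= N)%N -> cm (om N - 1) < d.
Proof.
move=> d0; have [e e0 he] := sdiff_cont (sdiff_qexp (0 : C)) d0.
have [N0 hN] := expr_small (ler0n _ 0) ltr01 ler01 e0.
exists (Num.trunc (e^-1)).+1 => N NN.
rewrite -qexp0; apply: he; rewrite subr0.
have N0' : (0 < N)%N by lia.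
have -> : (1 / N%:R : C) = ((1 / N%:R : R)%:C)%C by rewrite realCM realCV realC_nat.
rewrite cm_real mul1r ger0_norm ?invr_ge0 //.
rewrite invf_plt ?posrE ?ltr0n //.
apply: (lt_le_trans (truncnS_gt _)); by rewrite ler_nat.
Qed.

Section Circle.
Variables (h : C -> C) (L : R) (t0 : C).
Hypothesis L0 : 0 < L.
Hypothesis hh : forall z, cm z <= L -> sdiff h z.
Hypothesis t0L : cm t0 < L.

Definition circ_rad : C := (L%:C)%C.
Definition circ_pt N j : C := circ_rad * om N ^+ j.
(** The Cauchy kernel y / (y - t0) at the point y of the circle. *)
Definition circ_ker N j : C := (1 - t0 / circ_pt N j)^-1.

Lemma circ_rad_neq0 : circ_rad != 0.
Proof. by rewrite -cm_gt0 cm_real gtr0_norm. Qed.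

Lemma circ_pt_neq0 N j : circ_pt N j != 0.
Proof. by rewrite /circ_pt mulf_neq0 ?circ_rad_neq0 // expf_neq0 // om_neq0. Qed.

Lemma circ_cm_pt N j : cm (circ_pt N j) = L.
Proof. by rewrite /circ_pt cmM cmX cm_om expr1n mulr1 cm_real gtr0_norm. Qed.

Lemma circ_s1 : 0 < 1 - cm t0 / L.
Proof. by rewrite subr_gt0 ltr_pdivrMr // mul1r. Qed.

Lemma circ_ker_den N j : 1 - cm t0 / L <= cm (1 - t0 / circ_pt N j).
Proof.
by have := cmB_ge 1 (t0 / circ_pt N j); rewrite cm1 cmM cmV circ_cm_pt.
Qed.

Lemma circ_den_gt0 N j : 0 < cm (1 - t0 / circ_pt N j).
Proof. exact: lt_le_trans circ_s1 (circ_ker_den N j). Qed.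

Lemma circ_ker_le N j : cm (circ_ker N j) <= (1 - cm t0 / L)^-1.
Proof.
by rewrite /circ_ker cmV lef_pV2 ?posrE ?circ_den_gt0 ?circ_s1 // circ_ker_den.
Qed.

Lemma circ_den_neq0 N j : 1 - t0 / circ_pt N j != 0.
Proof. by rewrite -cm_gt0 circ_den_gt0. Qed.

Lemma circ_ker_mul N j : circ_ker N j * (circ_pt N j - t0) = circ_pt N j.
Proof.
have -> : circ_pt N j - t0 = (1 - t0 / circ_pt N j) * circ_pt N j.
  by rewrite mulrBl mul1r divfK // circ_pt_neq0.
by rewrite /circ_ker mulKf // circ_den_neq0.
Qed.

(** Cauchy's integral formula in discrete form. Contract the circle linearly to
    t0 in n steps. One step changes the average of h times the kernel by 1/n
    times the average of h'(W) y, because the kernel times y - t0 is y; and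
    that average is, up to a factor, a Riemann sum of h' around the closed
    polygon j -> W i j, whose increments of h telescope to zero. *)
Lemma circle_mean (e : R) : 0 < e -> exists N0, forall N, (N0 <= N)%N ->
  cm (N%:R^-1 * \sum_(j < N) (h (circ_pt N j) - h t0) * circ_ker N j) <= e.
Proof.
move=> e0; have L0' := L0; have t0L' := t0L; pose kap := (1 - cm t0 / L)^-1.
have k0 : 0 < kap by rewrite invr_gt0 circ_s1.
pose e1 := e / (L * (1 + 2 * kap)).
have e10 : 0 < e1 by rewrite divr_gt0 // mulr_gt0 //; lra.
have [h' h'P] := unif_strict hh; have [d d0 hd] := h'P _ e10.
have [N0 hN0] := @om_near1 (d / L) (divr_gt0 d0 L0).
exists (maxn 2 N0) => N; rewrite geq_max => /andP[N2 NN].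
have {}hN0 := hN0 _ NN.
have Npos : (0 < N)%N by exact: ltnW.
have Np : 0 < N%:R :> R by rewrite ltr0n.
have Nc : (N%:R : C) != 0 by rewrite pnatr_eq0 -lt0n.
have Ncm : cm (N%:R^-1 : C) = N%:R^-1 by rewrite cmV cm_nat.
pose n := (Num.trunc (2 * L / d)).+1.
have np : 0 < n%:R :> R by rewrite ltr0n.
have nc : (n%:R : C) != 0 by rewrite pnatr_eq0.
have nd : 2 * L / n%:R < d.
  by rewrite ltr_pdivrMr // [d * _]mulrC -ltr_pdivrMr // truncnS_gt.
(* The points of the contracted circle: W 0 is t0 and W n is the circle. *)
pose W i j : C := t0 + i%:R / n%:R * (circ_pt N j - t0).
have WL i j : (i <= n)%N -> cm (W i j) <= L.
  move=> i_n; pose s : R := i%:R / n%:R.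
  have s0 : 0 <= s by rewrite divr_ge0.
  have s1' : s <= 1 by rewrite ler_pdivrMr // mul1r ler_nat.
  have sE : (i%:R / n%:R : C) = (s%:C)%C by rewrite realCM realCV !realC_nat.
  have -> : W i j = (1 - s)%:C%C * t0 + (s%:C)%C * circ_pt N j.
    by rewrite /W sE realCD realCN; ring.
  apply: (le_trans (cmD _ _));
    rewrite (cmM _ t0) (cmM _ (circ_pt N j)) circ_cm_pt !cm_real !ger0_norm //; last lra.
  have : 0 <= (1 - s) * (L - cm t0) by rewrite mulr_ge0 // subr_ge0 // ltW.
  lra.
have ptt0 j : cm (circ_pt N j - t0) <= 2 * L.
  by have := cmB (circ_pt N j) t0; rewrite circ_cm_pt; lra.
(* The term of order 1/n in the change of D below. *)
pose S i : C := N%:R^-1 * \sum_(j < N) h' (W i j) * circ_pt N j.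
have SE i : (i < n)%N -> cm (S i) <= e1 * L.
  move=> i_n; have [i0|i0] := posnP i.
    have -> : S i = 0.
      rewrite /S (eq_bigr (fun j : 'I_N => (h' t0 * circ_rad) * (om N ^+ 1) ^+ j));
        last first.
        by move=> j _; rewrite i0 /W mul0r mul0r addr0 /circ_pt expr1 mulrA.
      by rewrite -mulr_sumr sum_omX ?mulr0.
    by rewrite cm0 mulr_ge0 // ltW.
  have ip : 0 < (i%:R / n%:R : R) by rewrite divr_gt0 // ltr0n.
  have w1 : 0 < cm (om N - 1).
    by rewrite cm_gt0 subr_eq0 -(expr1 (om N)) omX_neq1.
  have WS j : W i j.+1 - W i j = i%:R / n%:R * (om N - 1) * circ_pt N j.
    by rewrite /W /circ_pt exprS; ring.
  have cmW j : cm (W i j.+1 - W i j) = i%:R / n%:R * cm (om N - 1) * L.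
    by rewrite WS (cmM _ (circ_pt N j)) circ_cm_pt !cmM cmV !cm_nat.
  have tele : \sum_(j < N) (h (W i j.+1) - h (W i j)) = 0.
    rewrite -(big_mkord xpredT (fun j => h (W i j.+1) - h (W i j))) telescope_sumr //.
    have -> : W i N = W i 0%N by rewrite /W /circ_pt (omN Npos) expr0.
    exact: subrr.
  have : cm (\sum_(j < N) (h (W i j.+1) - h (W i j) - h' (W i j) * (W i j.+1 - W i j))) <=
     N%:R * (e1 * (i%:R / n%:R * cm (om N - 1) * L)).
    apply: (le_trans (cm_sum _ _ _)).
    rewrite -[leRHS]/(N%:R * (e1 * (i%:R / n%:R * cm (om N - 1) *
      L))) mulr_natl -[X in _ *+ X]card_ord -sumr_const.
    apply: ler_sum => j _; rewrite -(cmW j); apply: hd; rewrite ?WL ?(ltnW i_n) //.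
    rewrite cmW; move: hN0; rewrite ltr_pdivlMr // => hN0.
    apply: le_lt_trans hN0; rewrite -mulrA ler_piMl ?mulr_ge0 ?cm_ge0 ?(ltW L0) //.
    by rewrite ler_pdivrMr // mul1r ler_nat ltnW.
  rewrite sumrB tele sub0r cmN.
  have -> : \sum_(j < N) h' (W i j) * (W i j.+1 - W i j) =
    N%:R * (i%:R / n%:R * (om N - 1)) * S i.
    rewrite /S [RHS]mulrA [X in X * \sum__ _]mulrAC divff // mul1r mulr_sumr.
    by apply: eq_bigr => j _; rewrite WS; ring.
  rewrite !cmM cmV !cm_nat => H.
  rewrite -(ler_pM2l (_ : 0 < N%:R * (i%:R / n%:R * cm (om N - 1)))); last first.
    exact: mulr_gt0 Np (mulr_gt0 ip w1).
  by apply: (le_trans H); rewrite le_eqVlt; apply/orP; left; apply/eqP; ring.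
pose D i : C := N%:R^-1 * \sum_(j < N) h (W i j) * circ_ker N j.
have Dstep i : (i < n)%N -> cm (D i.+1 - D i) <= n%:R^-1 * (e1 * L * (1 + 2 * kap)).
  move=> i_n.
  have WS j : W i.+1 j - W i j = n%:R^-1 * (circ_pt N j - t0).
    by rewrite /W -natr1; field.
  have -> : D i.+1 - D i = n%:R^-1 * S i + N%:R^-1 * \sum_(j < N)
      (h (W i.+1 j) - h (W i j) - h' (W i j) * (W i.+1 j - W i j)) * circ_ker N j.
    rewrite /D /S mulrCA -!mulrBr -mulrDr mulr_sumr; congr (_ * _).
    rewrite -sumrB -big_split /=; apply: eq_bigr => j _.
    rewrite -[X in n%:R^-1 * (_ * X)](circ_ker_mul N j) WS; ring.
  apply: (le_trans (cmD _ _)).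
  rewrite cmM cmV cm_nat mulrDr mulrDr mulr1; apply: lerD.
    by rewrite ler_wpM2l ?invr_ge0 // SE.
  rewrite cmM Ncm mulrC ler_pdivrMr //.
  apply: (le_trans (cm_sum _ _ _)).
  have -> : n%:R^-1 * (e1 * L * (2 * kap)) * N%:R =
    \sum_(j < N) n%:R^-1 * (e1 * L * (2 * kap)).
    by rewrite sumr_const card_ord mulr_natr.
  apply: ler_sum => j _; rewrite cmM.
  have -> : n%:R^-1 * (e1 * L * (2 * kap)) = (e1 * (n%:R^-1 * (2 * L))) * kap by ring.
  have cW : cm (W i.+1 j - W i j) <= n%:R^-1 * (2 * L).
    by rewrite WS (cmM _ (circ_pt N j - t0)) cmV cm_nat ler_wpM2l ?invr_ge0.
  apply: ler_pM; rewrite ?cm_ge0 //; last exact: circ_ker_le.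
  apply: (le_trans (hd _ _ _ _ _)); rewrite ?WL ?(ltnW i_n) //.
    by apply: (le_lt_trans cW); rewrite mulrC.
  by rewrite ler_wpM2l // ltW.
have -> : N%:R^-1 * \sum_(j < N) (h (circ_pt N j) - h t0) * circ_ker N j = D n - D 0%N.
  rewrite /D -mulrBr -sumrB; congr (_ * _); apply: eq_bigr => j _.
  have -> : W n j = circ_pt N j by rewrite /W divff // mul1r addrC subrK.
  have -> : W 0%N j = t0 by rewrite /W mul0r mul0r addr0.
  exact: mulrBl.
rewrite -(telescope_sumr D (leq0n n)) big_mkord.
apply: (le_trans (cm_sum _ _ _)).
apply: (@le_trans _ _ (\sum_(i < n) n%:R^-1 * (e1 * L * (1 + 2 * kap)))).
  by apply: ler_sum => i _; exact: Dstep.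
rewrite sumr_const card_ord -[X in X <= _]mulr_natr /e1 le_eqVlt; apply/orP; left;
  apply/eqP.
field; rewrite !gt_eqF //; lra.
Qed.

End Circle.

(** An ultrafilter finer than the filter at infinity plays the part of a
    diagonal subsequence: all the sequences u k converge along it. *)
Lemma bounded_cluster (u : nat -> nat -> C) (B : nat -> R) :
  (forall k N, cm (u k N) <= B k) ->
  exists c : nat -> C, forall (K : nat) (e : R) N0, 0 < e ->
    exists2 N, (N0 <= N)%N & forall k, (k < K)%N -> cm (u k N - c k) <= e.
Proof.
move=> uB; have [U [UU Uoo]] := ultraFilterLemma (F := \oo) _.
have PU : ProperFilter U by exact: ultra_proper.
have key (f : nat -> R) (b : R) : (forall N, `|f N| <= b) -> exists l : R, f @ U --> l.
  move=> fb; have := @segment_compact R (- b) b; rewrite compact_ultra => /(_ (f @ U)).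
  have UF : UltraFilter (f @ U).
    split; first exact: fmap_proper_filter.
    move=> G PG sG; apply/seteqP; split => [A GA|A]; last exact: sG.
    have [//|nA] := in_ultra_setVsetC (f @^-1` A) UU.
    have GnA : G (~` A) by apply: sG.
    by have [x []] := filter_ex (filterI GA GnA).
  case=> //; last by move=> l [_ hl]; exists l; exact: hl.
  apply: (@filterS _ U _ setT) => [N _ /=|]; last exact: filterT.
  by rewrite in_itv /= -ler_norml; exact: fb.
have : forall k, exists c : C, forall e : R, 0 < e -> U [set N | cm (u k N - c) <= e].
  move=> k.
  have [a ha] := key (fun N => complex.Re (u k N)) (B k) (fun N =>
    le_trans (Re_le _) (uB k N)).
  have [b hb] := key (fun N => complex.Im (u k N)) (B k) (fun N =>
    le_trans (Im_le _) (uB k N)).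
  exists (a +i* b)%C => e e0; have e20 : 0 < e / 2 by lra.
  have /cvgrPdist_lt /(_ _ e20) h1 := ha; have /cvgrPdist_lt /(_ _ e20) h2 := hb.
  apply: filterS2 h1 h2 => N /= h1 h2.
  have := cm_le_ReIm (u k N - (a +i* b)%C); rewrite ReD ImD ReN ImN /=.
  by rewrite distrC (distrC _ b); lra.
move=> H; exists (fun k => projT1 (cid (H k))) => K e N0 e0.
have HU : U [set N | (N0 <= N)%N /\ forall k, (k < K)%N ->
  cm (u k N - projT1 (cid (H k))) <= e].
  elim: K => [|K IH].
    have : U [set N | (N0 <= N)%N] by apply: Uoo; exists N0.
    by apply: filterS => N /=.
  apply: filterS2 IH (projT2 (cid (H K)) _ e0) => N /= [h1 h2] h3.
  split=> // k; rewrite ltnS leq_eqVlt => /orP[/eqP -> //|]; exact: h2.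
by have [N [h1 h2]] := filter_ex HU; exists N.
Qed.

(** The coefficients are cluster values of the discrete Fourier coefficients of
    h on the circle of radius L. For N points, the polynomial of degree less
    than N with these coefficients differs from h(t) by exactly the quantity
    that [circle_mean] shows to be small, and the bound M / L^k on the
    coefficients controls the tails uniformly in N. *)
Theorem cauchy_taylor h (L M : R) : 0 < L ->
  (forall z, cm z <= L -> sdiff h z) -> (forall z, cm z <= L -> cm (h z) <= M) ->
  exists c : nat -> C, (forall k, cm (c k) * L ^+ k <= M) /\
    forall t, cm t < L -> csum (fun k => c k * t ^+ k) (h t).
Proof.
move=> L0 hh hM.
have M0 : 0 <= M by apply: le_trans (cm_ge0 _) (hM 0 _); rewrite cm0 ltW.
pose u k N : C := N%:R^-1 * \sum_(j < N) h (circ_pt L N j) / (circ_pt L N j) ^+ k.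
have ptN0 N j : circ_pt L N j != 0 by exact: circ_pt_neq0.
have uB k N : cm (u k N) <= M / L ^+ k.
  have Lk : 0 < L ^+ k by rewrite exprn_gt0.
  have [->|N0] := posnP N; first by rewrite /u big_ord0 mulr0 cm0 divr_ge0 // ltW.
  rewrite /u cmM cmV cm_nat mulrC ler_pdivrMr ?ltr0n //.
  apply: (le_trans (cm_sum _ _ _)).
  have -> : M / L ^+ k * N%:R = \sum_(j < N) M / L ^+ k.
    by rewrite sumr_const card_ord mulr_natr.
  apply: ler_sum => j _; rewrite cmM cmV cmX circ_cm_pt // ler_pM2r ?invr_gt0 //.
  by rewrite hM // circ_cm_pt.
have [c hc] := bounded_cluster uB.
have cB k : cm (c k) <= M / L ^+ k.
  apply/ler_addgt0Pl => e e0; have [N _ hN] := hc k.+1 e 0%N e0.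
  have := hN _ (ltnSn k); have := uB k N; have := cmB_ge (c k) (u k N).
  by rewrite cmBC; lra.
exists c; split => [k|t tL]; first by rewrite -ler_pdivlMr ?exprn_gt0.
pose s := cm t / L.
have s0 : 0 <= s by rewrite divr_ge0 ?cm_ge0 // ltW.
have s1 : s < 1 by rewrite ltr_pdivrMr // mul1r.
have term_le (v : C) k : cm v <= M / L ^+ k -> cm (v * t ^+ k) <= M * s ^+ k.
  move=> hv; rewrite cmM cmX /s expr_div_n mulrCA mulrC.
  by rewrite ler_wpM2l ?exprn_ge0 ?cm_ge0.

(* The geometric sum of the ratios t / y is the Cauchy kernel up to the factor
   1 - (t / y)^N, which does not depend on the point y of the circle. *)
have interp N : (0 < N)%N -> \sum_(k < N) u k N * t ^+ k - h t =
    (1 - t ^+ N / (circ_pt L N 0) ^+ N) *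
     (N%:R^-1 * \sum_(j < N) (h (circ_pt L N j) - h t) * circ_ker L t N j).
  move=> N0; have Nc : (N%:R : C) != 0 by rewrite pnatr_eq0 -lt0n.
  have kerE j : (1 - t ^+ N / (circ_pt L N 0) ^+ N) * circ_ker L t N j =
      \sum_(k < N) (t / circ_pt L N j) ^+ k.
    have den := circ_den_neq0 L0 tL N j.
    apply: (mulIf den); rewrite /circ_ker mulfVK //.
    have := subrX1 (t / circ_pt L N j) N.
    rewrite expr_div_n.
    have -> : circ_pt L N j ^+ N = circ_pt L N 0 ^+ N.
      by rewrite /circ_pt !exprMn -!exprM mulnC exprM omN // mul0n !expr1n expr0.
    by move=> e; rewrite -opprB e -mulNr opprB mulrC.
  (* Orthogonality of the characters of Z/N leaves the term k = 0 alone. *)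
  have avg : N%:R^-1 * \sum_(j < N) \sum_(k < N) (t / circ_pt L N j) ^+ k = 1.
    rewrite exchange_big /=.
    have -> : \sum_(k < N) \sum_(j < N) (t / circ_pt L N j) ^+ k =
       \sum_(k < N) (if val k == 0%N then N%:R else 0).
      apply: eq_bigr => k _; case: eqP => [->|/eqP k0].
        by under eq_bigr do rewrite expr0; rewrite sumr_const card_ord.
      have -> : \sum_(j < N) (t / circ_pt L N j) ^+ k =
         \sum_(j < N) (t / (L%:C)%C) ^+ k * (om N ^+ (N - k)) ^+ j.
        apply: eq_bigr => j _; rewrite /circ_pt /circ_rad invfM mulrA [in LHS]exprMn;
          congr (_ * _).
        have w0 := expf_neq0 k (om_neq0 N).
        have -> : om N ^+ (N - k) = (om N ^+ k)^-1.
          apply: (mulIf w0); rewrite mulVf // -exprD subnK ?omN //.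
          by rewrite ltnW.
        by rewrite !exprVn -!exprM mulnC.
      by rewrite -mulr_sumr sum_omX ?mulr0 // subn_gt0 ltn_ord /= ltn_subrL lt0n k0 N0.
    case: N N0 Nc {kerE} => // N _ Nc.
    rewrite big_ord_recl /= big1 ?addr0 ?mulVf // => i _.
  rewrite mulrCA mulr_sumr.
  under [in RHS]eq_bigr do rewrite mulrCA kerE mulrBl.
  rewrite sumrB mulrBr -[in X in _ = _ - X]mulr_sumr [in X in _ = _ - X]mulrCA avg mulr1.
  congr (_ - _); rewrite mulr_sumr.
  under [in RHS]eq_bigr do rewrite mulr_sumr mulr_sumr.
  rewrite exchange_big /=; apply: eq_bigr => k _.
  rewrite /u -mulrA mulr_suml mulr_sumr; apply: eq_bigr => j _.
  by rewrite expr_div_n; ring.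
move=> e e0.
have d0 : 0 < 1 - s by lra.
have e40 : 0 < e / 4 by lra.
have e80 : 0 < e / 8 by lra.
have [K1 hK1] := expr_small s0 s1 M0 (mulr_gt0 e40 d0).
have [N1 hN1] := circle_mean L0 hh tL e80.
exists K1 => K KK.
pose A := 1 + \sum_(k < K) cm t ^+ k.
have A0 : 0 < A.
  have : 0 <= \sum_(k < K) cm t ^+ k by apply: sumr_ge0 => k _; rewrite exprn_ge0 ?cm_ge0.
  by rewrite /A; lra.
have [N NN hN] := hc K (e / 4 / A) (maxn (maxn N1 K) 1) (divr_gt0 e40 A0).
move: NN; rewrite !geq_max => /andP[/andP[NN1 NK] N0].
have E1 : cm (\sum_(k < N) u k N * t ^+ k - h t) <= e / 4.
  rewrite interp // cmM.
  have := hN1 _ NN1; set w := _ * \sum_(j < N) _.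
  have : cm (1 - t ^+ N / circ_pt L N 0 ^+ N) <= 2.
    apply: (le_trans (cmB _ _)); rewrite cm1 cmM cmV !cmX circ_cm_pt // -expr_div_n.
    by have : s ^+ N <= 1; [rewrite exprn_ile1 // ltW|rewrite /s; lra].
  have := cm_ge0 w; have := cm_ge0 (1 - t ^+ N / circ_pt L N 0 ^+ N); clear; nra.
have E2 : cm (\sum_(k < N) u k N * t ^+ k - \sum_(k < K) u k N * t ^+ k) <=
  M * s ^+ K / (1 - s).
  apply: (@geo_tail _ (fun k => u k N * t ^+ k)) => // k; exact: term_le.
have E3 : cm (\sum_(k < K) u k N * t ^+ k - \sum_(k < K) c k * t ^+ k) <= e / 4.
  rewrite -sumrB; apply: (le_trans (cm_sum _ _ _)).
  apply: (@le_trans _ _ (\sum_(k < K) e / 4 / A * cm t ^+ k)).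
    apply: ler_sum => k _; rewrite -mulrBl cmM cmX ler_wpM2r ?exprn_ge0 ?cm_ge0 //.
    exact: hN.
  rewrite -mulr_sumr -mulrA ler_piMr ?(ltW e40) // mulrC ler_pdivrMr // mul1r /A; lra.
have E4 : M * s ^+ K / (1 - s) < e / 4 by rewrite ltr_pdivrMr //; exact: hK1.
move: E1 E2 E3; set X := \sum_(k < N) _; set Y := \sum_(k < K) u k N * _;
  set Z := \sum_(k < K) c k * _.
move=> E1 E2 E3.
have -> : Z - h t = (X - h t) - ((X - Y) + (Y - Z)) by ring.
apply: (le_lt_trans (cmB _ _)); have := cmD (X - Y) (Y - Z); lra.
Qed.

End Cauchy.

(** * Series of holomorphic functions and removable singularities *)

Section Consequences.
Variable R : realType.
Local Notation C := (Cplx R).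
Implicit Types (z w P : C) (h : C -> C).

Lemma cauchy_taylor_at h P (L M : R) : 0 < L ->
  (forall z, cm (z - P) <= L -> sdiff h z) ->
  (forall z, cm (z - P) <= L -> cm (h z) <= M) ->
  exists c : nat -> C, (forall k, cm (c k) * L ^+ k <= M) /\
    forall z, cm (z - P) < L -> csum (fun k => c k * (z - P) ^+ k) (h z).
Proof.
move=> L0 hh hM.
have [||c [cM cS]] := @cauchy_taylor R (fun t => h (t + P)) L M L0.
- move=> z zL; apply: (@sdiff_comp _ h (fun t => t + P)).
    by apply: sdiffD; [exact: sdiff_id|exact: sdiff_cst].
  by apply: hh; rewrite addrK.
- by move=> z zL; apply: hM; rewrite addrK.
by exists c; split=> // z zL; have := cS _ zL; rewrite subrK.
Qed.

Lemma cm_subX (x y : C) (rho : R) k : cm x <= rho -> cm y <= rho ->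
  cm (y ^+ k.+1 - x ^+ k.+1) <= k.+1%:R * rho ^+ k * cm (y - x).
Proof.
move=> xr yr; have r0 := le_trans (cm_ge0 _) xr.
rewrite subrXX cmM mulrC ler_wpM2r ?cm_ge0 //.
apply: (le_trans (cm_sum _ _ _)).
rewrite mulr_natl -[X in _ *+ X]card_ord -sumr_const.
apply: ler_sum => i _; rewrite cmM !cmX.
have -> : rho ^+ k = rho ^+ (k.+1 - i.+1) * rho ^+ i.
  by rewrite -exprD subSS subnK // -ltnS.
have i0 := ltn_ord i.
by apply: ler_pM; rewrite ?exprn_ge0 ?cm_ge0 // lerXn2r // nnegrE ?cm_ge0.
Qed.

(** The bound depends on h through M and L only. This uniformity is what makes
    termwise differentiation of series, the removal of singularities and
    Liouville's theorem work. *)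
Lemma strict_estimate h P (L M : R) : 0 < L ->
  (forall z, cm (z - P) <= L -> sdiff h z) ->
  (forall z, cm (z - P) <= L -> cm (h z) <= M) ->
  exists2 a : C, cm a * L <= M & forall (rho : R) x y, rho <= L / 4 ->
    cm (x - P) <= rho -> cm (y - P) <= rho ->
    cm (h y - h x - a * (y - x)) <= 8 * M * rho / L ^+ 2 * cm (y - x).
Proof.
move=> L0 hh hM; have [c [cM cS]] := cauchy_taylor_at L0 hh hM.
exists (c 1%N) => [|rho x y rL xr yr]; first by have := cM 1%N; rewrite expr1.
have r0 := le_trans (cm_ge0 _) xr.
have M0 : 0 <= M by apply: le_trans (cm_ge0 _) (hM P _); rewrite subrr cm0 ltW.
have xL : cm (x - P) < L by lra.
have yL : cm (y - P) < L by lra.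
have S0 : csum (fun k => c k * (y - P) ^+ k - c k * (x - P) ^+ k) (h y - h x).
  apply: csumD; first exact: cS.
  apply: (@csum_ext _ (fun k => -1 * (c k * (x - P) ^+ k))); first by move=> k;
    rewrite mulN1r.
  have -> : - h x = -1 * h x by rewrite mulN1r.
  by apply: csumZ; exact: cS.
have := csum_S (csum_S S0); rewrite !expr0 !expr1 subrr subr0 -mulrBr.
have -> : y - P - (x - P) = y - x by ring.
move=> S2; have -> : 8 * M * rho / L ^+ 2 * cm (y - x) =
   (4 * M * rho / L ^+ 2 * cm (y - x)) / (1 - 1 / 2).
  by field; rewrite gt_eqF.
apply: (csum_le S2); try lra.
move=> k; rewrite -mulrBr cmM.
have ck : cm (c k.+2) <= M / L ^+ k.+2 by rewrite ler_pdivlMr ?exprn_gt0.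
have := cm_subX k.+1 xr yr.
have -> : y - P - (x - P) = y - x by ring.
move=> H; apply: (le_trans (ler_pM (cm_ge0 _) (cm_ge0 _) ck H)).
have -> : M / L ^+ k.+2 * (k.+2%:R * rho ^+ k.+1 * cm (y - x)) =
  (M * rho / L ^+ 2 * cm (y - x)) * (k.+2%:R * (rho / L) ^+ k).
  by rewrite !exprS expr_div_n; field; rewrite expf_neq0 gt_eqF.
have -> : 4 * M * rho / L ^+ 2 * cm (y - x) * (1 / 2) ^+ k =
  (M * rho / L ^+ 2 * cm (y - x)) * (4 * (1 / 2) ^+ k) by ring.
rewrite ler_wpM2l ?mulr_ge0 ?invr_ge0 ?exprn_ge0 ?cm_ge0 ?(ltW L0) //.
have rl : rho / L <= 1 / 4 by rewrite ler_pdivrMr //; lra.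
have rl0 : 0 <= rho / L by rewrite divr_ge0 // ltW.
apply: (@le_trans _ _ (2 ^+ k.+2 * (1 / 4) ^+ k)).
  apply: ler_pM => //; rewrite ?exprn_ge0 //.
    by rewrite -natrX ler_nat ltnW // ltn_expl.
  by rewrite lerXn2r // nnegrE.
have -> : 1 / 2 = 2 * (1 / 4) :> R by field.
by rewrite (exprMn k 2) !exprS le_eqVlt; apply/orP; left; apply/eqP; ring.
Qed.

(** Weierstrass's theorem: [strict_estimate] bounds the second-order remainder
    of the n-th term by a multiple of D r^n, so that the remainders can be
    summed. *)
Theorem sdiff_series (g : nat -> C -> C) h P (L D r : R) : 0 < L -> 0 <= r -> r < 1 ->
  (forall n z, cm (z - P) <= L -> sdiff (g n) z) ->
  (forall z, cm (z - P) <= L -> geo (fun n => g n z) D r) ->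
  (forall z, cm (z - P) <= L -> csum (fun n => g n z) (h z)) ->
  sdiff h P.
Proof.
move=> L0 r0 r1 gs gb hS.
have D0 : 0 <= D by apply: (geo_D (gb P _)); rewrite subrr cm0 ltW.
have [a aP] : exists a : nat -> C, forall n, cm (a n) * L <= D * r ^+ n /\
    forall (rho : R) x y, rho <= L / 4 ->
    cm (x - P) <= rho -> cm (y - P) <= rho ->
    cm (g n y - g n x - a n * (y - x)) <= 8 * (D * r ^+ n) * rho / L ^+ 2 * cm (y - x).
  have : forall n, exists a : C, cm a * L <= D * r ^+ n /\
    forall (rho : R) x y, rho <= L / 4 ->
    cm (x - P) <= rho -> cm (y - P) <= rho ->
    cm (g n y - g n x - a * (y - x)) <= 8 * (D * r ^+ n) * rho / L ^+ 2 * cm (y - x).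
    move=> n; have [|a a1 a2] := @strict_estimate (g n) P L (D * r ^+ n) L0 (gs n).
      by move=> z zL; exact: gb.
    by exists a.
  by move=> H; exists (fun n => projT1 (cid (H n))) => n; exact: projT2 (cid (H n)).
have ga : geo a (D / L) r.
  by move=> n; rewrite mulrAC ler_pdivlMr //; have [] := aP n.
have [b hb] := geo_cvg ga r0 r1.
exists b => e e0.
pose K := 8 * D / (L ^+ 2 * (1 - r)).
have K0 : 0 <= K by rewrite divr_ge0 ?mulr_ge0 ?exprn_ge0 ?(ltW L0) //; lra.
have K1 : 0 < K + 1 by lra.
exists (Num.min (L / 4) (e / (K + 1))) => [|x y].
  by rewrite lt_min !divr_gt0.
set rho := Num.min _ _ => xr yr.
have rL : rho <= L / 4 by rewrite ge_min lexx.
have re : rho <= e / (K + 1) by rewrite ge_min lexx orbT.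
have rho0 : 0 <= rho by apply: le_trans (cm_ge0 _) (ltW xr).
have xL : cm (x - P) <= L by have := le_trans (ltW xr) rL; lra.
have yL : cm (y - P) <= L by have := le_trans (ltW yr) rL; lra.
have S : csum (fun n => g n y - g n x - a n * (y - x)) (h y - h x - b * (y - x)).
  have -> : h y - h x - b * (y - x) = h y + (-1 * h x) + (- (y - x)) * b by ring.
  apply: (@csum_ext _ (fun n => g n y + (-1 * g n x) + (- (y - x)) * a n)).
    by move=> n; ring.
  by apply: csumD; [apply: csumD; [exact: hS|apply: csumZ; exact: hS]|exact: csumZ].
have G : geo (fun n => g n y - g n x - a n * (y - x)) (8 * D * rho / L ^+ 2 *
  cm (y - x)) r.
  move=> n; have [_ /(_ rho x y rL (ltW xr) (ltW yr)) H] := aP n.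
  apply: (le_trans H); rewrite le_eqVlt; apply/orP; left; apply/eqP; ring.
apply: (le_trans (csum_le S G r0 r1)).
have -> : 8 * D * rho / L ^+ 2 * cm (y - x) / (1 - r) = K * rho * cm (y - x).
  by rewrite /K; field; rewrite !gt_eqF //; lra.
rewrite ler_wpM2r ?cm_ge0 //.
have := ler_wpM2l K0 re.
have : K * (e / (K + 1)) <= e by rewrite mulrA ler_pdivrMr //; nra.
lra.
Qed.

(** Strict differentiability at 0, with derivative 0, of a function k = z^2 h.
    If |y - x| > |x| / 8 the size |k| <= M |z|^2 suffices; otherwise x and y
    lie in a disc of radius |x| / 2 around x avoiding 0, where
    [strict_estimate] bounds the increment of h by a multiple of M |y - x| /
    |x|. *)
Lemma removable_sdiff h (L M : R) : 0 < L ->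
  (forall z, 0 < cm z <= L -> sdiff h z) ->
  (forall z, 0 < cm z <= L -> cm (h z) <= M) ->
  forall k : C -> C, k 0 = 0 -> (forall z, z != 0 -> k z = z ^+ 2 * h z) -> sdiff k 0.
Proof.
move=> L0 hh hM k k0 kE.
have M0 : 0 <= M.
  apply: le_trans (cm_ge0 _) (hM (L%:C)%C _); rewrite cm_real gtr0_norm //.
  by rewrite L0 lexx.
exists 0 => e e0.
exists (Num.min (L / 4) (e / (20 * (M + 1)))) => [|x y].
  by rewrite lt_min !divr_gt0 // mulr_gt0 //; lra.
rewrite !subr0 !lt_min => /andP[xL xe] /andP[yL ye]; rewrite mul0r subr0.
have M1 : 0 < 20 * (M + 1) by rewrite mulr_gt0 //; move: M0; clear; lra.
move: xe ye; rewrite !ltr_pdivlMr // => xe ye.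
have x0 := cm_ge0 x; have y0 := cm_ge0 y; have t0 := cm_ge0 (y - x).
have kM z : cm z < L / 4 -> cm (k z) <= M * cm z ^+ 2.
  have [->|z0] := eqVneq z 0; first by rewrite k0 cm0 expr0n mulr0.
  move=> zL; rewrite (kE _ z0) cmM cmX mulrC ler_wpM2r ?exprn_ge0 ?cm_ge0 //.
  by apply: hM; rewrite cm_gt0 z0 /=; lra.
have [far|near] := ltP (cm x / 8) (cm (y - x)).
  apply: (le_trans (cmB _ _)); have := kM _ xL; have := kM _ yL.
  have : cm y <= cm x + cm (y - x) by have := cmD x (y - x); rewrite addrC subrK.
  have h1 : cm x <= 8 * cm (y - x) by move: far; clear; lra.
  move=> h2 h3 h4; have h5 : cm y <= 9 * cm (y - x) by move: h1 h2; clear; lra.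
  have a1 : cm x ^+ 2 <= cm x * (8 * cm (y - x)) by rewrite expr2 ler_wpM2l.
  have a2 : cm y ^+ 2 <= cm y * (9 * cm (y - x)) by rewrite expr2 ler_wpM2l.
  have b1 : M * cm x ^+ 2 <= M * (cm x * (8 * cm (y - x))) by rewrite ler_wpM2l.
  have b2 : M * cm y ^+ 2 <= M * (cm y * (9 * cm (y - x))) by rewrite ler_wpM2l.
  have : (M * cm x * 8 + M * cm y * 9) * cm (y - x) <= e * cm (y - x).
    by rewrite ler_wpM2r //; move: M0 x0 y0 xe ye; clear; nra.
  by move: h3 h4 b1 b2; clear; lra.
have [x00|xn0] := eqVneq x 0.
  have : cm (y - x) <= 0 by move: near; rewrite x00 cm0 mul0r.
  rewrite le_eqVlt ltNge t0 orbF cm_eq0 subr_eq0 => /eqP ->.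
  by rewrite !subrr cm0 mulr0.
have xp : 0 < cm x by rewrite cm_gt0.
have yn0 : y != 0.
  by rewrite -cm_gt0; have := cmB_ge x y; rewrite cmBC; move: near xp; clear; lra.
have x2 : 0 < cm x / 2 by rewrite divr_gt0.
have bnd z : cm (z - x) <= cm x / 2 -> 0 < cm z <= L.
  move=> zx; have := cmB_ge x z; have := cmD (z - x) x; rewrite subrK (cmBC x).
  by move: zx xL xp; clear; lra.
have [a aM aP] := @strict_estimate h x _ M x2 (fun z zx =>
  hh z (bnd z zx)) (fun z zx => hM z (bnd z zx)).
have := aP (cm x / 8) x y; rewrite subrr cm0 => H.
have {}H : cm (h y - h x - a * (y - x)) <= 4 * M / cm x * cm (y - x).
  have -> : 4 * M / cm x = 8 * M * (cm x / 8) / (cm x / 2) ^+ 2 by field; rewrite gt_eqF.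
  by apply: H; move: xp xL near; clear; lra.
have ac : cm a <= 2 * M / cm x by rewrite ler_pdivlMr //; move: aM; clear; lra.
have hyx : cm (h y - h x) <= 6 * M / cm x * cm (y - x).
  have := cmB_ge (h y - h x) (a * (y - x)); rewrite cmM.
  have := ler_wpM2r t0 ac;
    have -> : 6 * M / cm x = 4 * M / cm x + 2 * M / cm x by field; rewrite gt_eqF.
  move: H; clear; lra.
rewrite (kE _ xn0) (kE _ yn0).
have -> : y ^+ 2 * h y - x ^+ 2 * h x = (y - x) * ((y + x) * h y) +
  x ^+ 2 * (h y - h x) by ring.
apply: (le_trans (cmD _ _)); rewrite (cmM (x ^+ 2)) cmX (cmM (y - x)) (cmM (y + x)).
have c1 : cm (y + x) * cm (h y) <= (cm y + cm x) * M.
  by apply: ler_pM; rewrite ?cm_ge0 ?cmD // hM // cm_gt0 yn0 /=; move: yL L0; clear; lra.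
have c2 : cm x ^+ 2 * cm (h y - h x) <= 6 * M * cm x * cm (y - x).
  have := ler_wpM2l (exprn_ge0 2 x0) hyx.
  have -> : cm x ^+ 2 * (6 * M / cm x * cm (y - x)) = 6 * M * cm x * cm (y - x).
    by field; rewrite gt_eqF.
  by [].
have c3 := ler_wpM2l t0 c1.
have : (M * cm x * 7 + M * cm y) * cm (y - x) <= e * cm (y - x).
  by rewrite ler_wpM2r //; move: M0 x0 y0 xe ye; clear; nra.
move: c2 c3; clear; lra.
Qed.

(** Riemann's theorem on removable singularities: z^2 h has a power series by
    [removable_sdiff] and [cauchy_taylor], whose first two coefficients vanish
    because z^2 h is O(z^2), and it can be divided by z^2. *)
Theorem removable_taylor h P (L M : R) : 0 < L ->
  (forall z, 0 < cm (z - P) <= L -> sdiff h z) ->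
  (forall z, 0 < cm (z - P) <= L -> cm (h z) <= M) ->
  exists c : nat -> C, (forall k, cm (c k) * L ^+ k <= M) /\
    forall z, 0 < cm (z - P) < L -> csum (fun k => c k * (z - P) ^+ k) (h z).
Proof.
move=> L0 hh hM.
pose g z := h (z + P); pose k z := z ^+ 2 * g z.
have gs z : 0 < cm z <= L -> sdiff g z.
  move=> zL; apply: (@sdiff_comp _ h (fun t => t + P)).
    by apply: sdiffD; [exact: sdiff_id|exact: sdiff_cst].
  by apply: hh; rewrite addrK.
have gM z : 0 < cm z <= L -> cm (g z) <= M by move=> zL; apply: hM; rewrite addrK.
have k0 : sdiff k 0 by apply: (removable_sdiff L0 gs gM) => //; rewrite /k expr0n mul0r.
have ks z : cm z <= L -> sdiff k z.
  have [->//|z0 zL] := eqVneq z 0.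
  by apply: sdiffM; [apply: sdiffX; exact: sdiff_id|apply: gs; rewrite cm_gt0 z0].
have kM z : cm z <= L -> cm (k z) <= M * cm z ^+ 2.
  have [->|z0 zL] := eqVneq z 0; first by rewrite /k expr0n mul0r cm0 expr0n mulr0.
  by rewrite cmM cmX mulrC ler_wpM2r ?exprn_ge0 ?cm_ge0 // gM // cm_gt0 z0.
have M0 : 0 <= M.
  by have := kM (L%:C)%C;
    rewrite cm_real gtr0_norm // lexx => /(_ isT)/(le_trans (cm_ge0 _));
      rewrite pmulr_lge0 // exprn_gt0.
have [|c [cM cS]] := @cauchy_taylor R k L (M * L ^+ 2) L0 ks.
  move=> z zL; apply: (le_trans (kM _ zL));
    rewrite ler_wpM2l // lerXn2r // nnegrE ?cm_ge0 //.
  exact: ltW.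

have c0 : c 0%N = 0.
  have := cS 0; rewrite cm0 => /(_ L0) H;
    apply: (ccvg_uniq _ (_ : ccvg (fun=> 0) 0)); last exact: ccvg_cst.
  have : csum (fun k => c k * 0 ^+ k) (c 0%N).
    apply: (@ccvg_near _ (fun=> c 0%N) _ _ 1); last exact: ccvg_cst.
    move=> [//|n] _; rewrite big_ord_recl expr0 mulr1 big1 ?addr0 // => i _.
    by rewrite expr0n mulr0.
  move=> H2; have -> : c 0%N = 0 by rewrite (ccvg_uniq H2 H) /k expr0n mul0r.
  exact: ccvg_cst.
have c1 : c 1%N = 0.
  apply/eqP; rewrite -cm_eq0 eq_le cm_ge0 andbT; apply/ler_addgt0Pl => e e0;
    rewrite addr0.
  pose t : R := Num.min (L / 2) (e * L ^+ 0 / (4 * (M + 1))).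
  have t0 : 0 < t by rewrite lt_min !divr_gt0 ?mulr_gt0 //; lra.
  have tL : t <= L / 2 by rewrite ge_min lexx.
  have te : t * (4 * (M + 1)) <= e.
    rewrite -ler_pdivlMr ?mulr_gt0 //; last lra.
    by apply: (@le_trans _ _ (e * L ^+ 0 / (4 * (M + 1))));
      [rewrite ge_min lexx orbT|rewrite expr0 mulr1].
  pose z : C := (t%:C)%C; have zt : cm z = t by rewrite cm_real gtr0_norm.
  have zL : cm z < L by rewrite zt; lra.
  have := csum_S (csum_S (cS _ zL)); rewrite c0 mul0r subr0 expr1 => S.
  have G : geo (fun n => c n.+2 * z ^+ n.+2) (M * t ^+ 2) (1 / 2).
    move=> n; rewrite cmM cmX zt.
    have cn : cm (c n.+2) <= M * L ^+ 2 / L ^+ n.+2 by rewrite ler_pdivlMr ?exprn_gt0.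
    apply: (le_trans (ler_wpM2r (exprn_ge0 _ (ltW t0)) cn)).
    have -> : M * L ^+ 2 / L ^+ n.+2 * t ^+ n.+2 = M * t ^+ 2 * (t / L) ^+ n.
      by rewrite !exprS expr_div_n; field; rewrite expf_neq0 gt_eqF.
    rewrite ler_wpM2l ?mulr_ge0 ?exprn_ge0 ?(ltW t0) // lerXn2r ?nnegrE ?divr_ge0 ?(ltW t0) ?(ltW L0) //.
    by rewrite ler_pdivrMr //; lra.
  have h20 : 0 <= 1 / 2 :> R by lra.
  have h21 : 1 / 2 < 1 :> R by lra.
  have H := csum_le S G h20 h21.
  have kz := kM _ (ltW zL); rewrite zt in kz.
  have : cm (c 1%N) * t <= 3 * M * t ^+ 2.
    have := cmB_ge (c 1%N * z) (k z); rewrite cmM zt cmBC.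
    have E : M * t ^+ 2 / (1 - 1 / 2) = 2 * M * t ^+ 2 by field.
    by rewrite E in H; lra.
  rewrite expr2 mulrA ler_pM2r // => H2; nra.
exists (fun n => c n.+2); split => [n|z /andP[z0 zL]].
  have := cM n.+2; rewrite -addn2 exprD mulrA ler_pM2r // exprn_gt0 //.
have := csum_S (csum_S (cS _ zL)); rewrite c0 c1 !mul0r !subr0 => S.
have zP : z - P != 0 by rewrite -cm_gt0.
have := csumZ ((z - P) ^- 2) S.
rewrite /k /g subrK mulKf ?expf_neq0 //.
apply: csum_ext => n; rewrite !exprS; field; exact: zP.
Qed.

End Consequences.

(** * Quasi-periodic functions of negative index *)

Section NegativeIndex.
Variable R : realType.
Local Notation C := (Cplx R).
Implicit Types (z w P : C) (h g Y Z : C -> C).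
Local Notation cexp := (@cexp R).

Lemma cm_eq_punctured h g P (d : R) : 0 < d -> sdiff h P -> sdiff g P ->
  (forall z, 0 < cm (z - P) < d -> cm (h z) = cm (g z)) -> cm (h P) = cm (g P).
Proof.
move=> d0 hP gP hg; apply/eqP; rewrite -subr_eq0 -normr_eq0 eq_le normr_ge0 andbT.
apply/ler_addgt0Pl => e e0; rewrite addr0; have e20 : 0 < e / 2 by rewrite divr_gt0.
have [d1 d10 h1] := sdiff_cont hP e20; have [d2 d20 h2] := sdiff_cont gP e20.
pose x : R := Num.min d (Num.min d1 d2) / 2.
have m0 : 0 < Num.min d (Num.min d1 d2) by rewrite !lt_min d0 d10.
have x0 : 0 < x by rewrite divr_gt0.
have xm : x < Num.min d (Num.min d1 d2) by rewrite ltr_pdivrMr // ltr_pMr // ltr1n.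
pose z := P + (x%:C)%C.
have cz : cm (z - P) = x by rewrite /z addrC addKr cm_real gtr0_norm.
move: xm; rewrite !lt_min -cz => /and3P[zd z1 z2].
have := hg z; rewrite zd cz x0 => /(_ isT) E.
have := h1 z z1; have := h2 z z2.
have := cmB_ge (h z) (h P); have := cmB_ge (h P) (h z).
have := cmB_ge (g z) (g P); have := cmB_ge (g P) (g z).
by rewrite (cmBC (h P)) (cmBC (g P)) -E ler_norml; clear; lra.
Qed.

Lemma eq_punctured h g P (d : R) : 0 < d -> sdiff h P -> sdiff g P ->
  (forall z, 0 < cm (z - P) < d -> h z = g z) -> h P = g P.
Proof.
move=> d0 hP gP hg.
have E : cm (h P - g P) = cm (0 : C).
  apply: (@cm_eq_punctured (fun z => h z - g z) (fun=> 0) _ d) => //.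
  - exact: sdiffB.
  - exact: sdiff_cst.
  - by move=> z /hg ->; rewrite subrr.
by apply/eqP; rewrite -subr_eq0 -cm_eq0 E cm0.
Qed.

Lemma removable_sum h P (L M : R) : 0 < L ->
  (forall z, 0 < cm (z - P) <= L -> sdiff h z) ->
  (forall z, 0 < cm (z - P) <= L -> cm (h z) <= M) ->
  exists2 g, sdiff g P & forall z, 0 < cm (z - P) < L -> g z = h z.
Proof.
move=> L0 hh hM; have [c [cM cS]] := removable_taylor L0 hh hM.
have M0 : 0 <= M by have := cM 0%N; rewrite expr0 mulr1; apply: le_trans; exact: cm_ge0.
exists (fun z => if z == P then c 0%N else h z); last first.
  by move=> z /andP[z0 _]; rewrite ifN // -subr_eq0 -cm_gt0.
have L20 : 0 < L / 2 by rewrite divr_gt0.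
have h1 : 0 <= 1 / 2 :> R by lra.
have h2 : 1 / 2 < 1 :> R by lra.
apply: (@sdiff_series _ (fun k z => c k * (z - P) ^+ k) _ P (L / 2) M (1 / 2)) => //.
- move=> k z _; apply: sdiffM; first exact: sdiff_cst.
  by apply: sdiffX; apply: sdiffB; [exact: sdiff_id|exact: sdiff_cst].
- move=> z zL k; rewrite cmM cmX; have Lk : 0 < L ^+ k by rewrite exprn_gt0.
  have ck : cm (c k) <= M / L ^+ k by rewrite ler_pdivlMr.
  apply: (le_trans (ler_pM (cm_ge0 _) (exprn_ge0 k (cm_ge0 _)) ck (lexx _))).
  rewrite -mulrA ler_wpM2l // mulrC ler_pdivrMr // -exprMn.
  rewrite lerXn2r ?nnegrE ?cm_ge0 //; last by rewrite div1r mulrC.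
  by rewrite mulr_ge0 // ltW.
- move=> z zL; case: eqVneq => [->|zP]; last first.
    by apply: cS; rewrite cm_gt0 subr_eq0 zP /=; move: zL L0; clear; lra.
  apply: (@ccvg_near _ (fun=> c 0%N) _ _ 1); last exact: ccvg_cst.
  move=> [//|n] _; rewrite subrr big_ord_recl expr0 mulr1 big1 ?addr0 // => i _.
  by rewrite expr0n mulr0.
Qed.

(** The value that removes the singularity at P is a limit, so the local
    extensions around different points agree with Y and with each other. *)
Lemma removable_extension Y :
  (forall P, exists2 L : R, 0 < L & exists M : R, forall z, 0 < cm (z - P) <= L ->
     sdiff Y z /\ cm (Y z) <= M) ->
  exists2 Z, forall P, sdiff Z P & forall P, exists2 L : R, 0 < L &
    forall z, 0 < cm (z - P) < L -> Z z = Y z.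
Proof.
move=> loc.
have [H HP] : exists H : C -> C -> C, forall P, sdiff (H P) P /\
    exists2 L : R, 0 < L & forall z, 0 < cm (z - P) < L -> H P z = Y z.
  have ex P : exists g, sdiff g P /\ exists2 L : R, 0 < L &
    forall z, 0 < cm (z - P) < L -> g z = Y z.
    have [L L0 [M LM]] := loc P.
    have [z /LM[]//|z /LM[]//|g g1 g2] := @removable_sum Y P L M L0.
    by exists g; split=> //; exists L.
  by exists (fun P => projT1 (cid (ex P))) => P; exact: projT2 (cid (ex P)).
have near P : exists2 L : R, 0 < L & forall z, 0 < cm (z - P) < L -> H z z = Y z.
  have [L L0 [M LM]] := loc P; exists L => // z /andP[z0 zL].
  have [|sz _] := LM z; first by rewrite z0 ltW.
  by have [hs [d d0 hd]] := HP z; exact: (eq_punctured d0).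
exists (fun P => H P P) => // P.
have [hs [d d0 hd]] := HP P; have [L L0 hL] := near P.
apply: (@sdiff_near _ (H P) _ P (Num.min d L)) => //; first by rewrite lt_min d0.
move=> x; rewrite lt_min => /andP[xd xL]; have [->//|xP] := eqVneq x P.
have x0 : 0 < cm (x - P) by rewrite cm_gt0 subr_eq0.
by rewrite hd ?x0 // hL ?x0.
Qed.

(** By [strict_estimate] on the disc of radius L around 0, Z z - Z 0 is at most
    3 M |z| / L, for every large L. *)
Theorem liouville Z (M : R) : (forall z, sdiff Z z) -> (forall z, cm (Z z) <= M) ->
  forall z, Z z = Z 0.
Proof.
move=> Zs ZM z; apply/eqP; rewrite -subr_eq0 -cm_eq0 eq_le cm_ge0 andbT.
have M0 : 0 <= M by apply: le_trans (ZM 0); exact: cm_ge0.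
apply/ler_addgt0Pl => e e0; rewrite addr0.
set t := cm z; have t0 : 0 <= t := cm_ge0 z.
(* Large enough for z to lie in the disc of the estimate and for the bound 3 M
   t / L to be at most e. *)
pose L := 4 * t + 3 * M * t / e + 1.
have k0 : 0 <= 3 * M * t / e by rewrite divr_ge0 ?(ltW e0) // !mulr_ge0.
have L0 : 0 < L by rewrite /L; move: t0 k0; clear; lra.
have tL : t <= L / 4 by rewrite /L; move: t0 k0; clear; lra.
have Le : 3 * M * t <= e * L.
  have -> : e * L = 3 * M * t + e * (4 * t + 1) by rewrite /L; field; rewrite gt_eqF.
  by rewrite lerDl mulr_ge0 ?(ltW e0) // addr_ge0 // mulr_ge0.
have [//|//|a aL H] := @strict_estimate R Z 0 L M L0.
have := H t 0 z tL; rewrite !subr0 cm0 -/t => /(_ t0 (lexx _)) {}H.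
have : cm (Z z - Z 0) <= 8 * M * t / L ^+ 2 * t + cm a * t.
  have := cmB_ge (Z z - Z 0) (a * z); rewrite cmM -/t; move: H; clear; lra.
move=> /le_trans; apply; rewrite -(ler_pM2r L0) mulrDl.
apply: le_trans Le; have -> : 3 * M * t = 2 * M * t + M * t by ring.
apply: lerD; last by rewrite mulrAC ler_wpM2r.
have -> : 8 * M * t / L ^+ 2 * t * L = 2 * M * t * (4 * t / L) by field; rewrite gt_eqF.
by rewrite ler_piMr ?mulr_ge0 // ler_pdivrMr // mul1r; move: tL; clear; lra.
Qed.

Lemma int_period (T : Type) (f : C -> T) w : (forall u, f (u + w) = f u) ->
  forall (m : int) u, f (u + m%:~R * w) = f u.
Proof.
move=> fw m u; have nat n v : f (v + n%:R * w) = f v.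
  elim: n => [|n IH]; first by rewrite mul0r addr0.
  by rewrite -natr1 mulrDl mul1r addrA fw IH.
case: m => n; first by rewrite -pmulrn nat.
by rewrite NegzE mulrNz -pmulrn mulNr -[in RHS](subrK (n.+1%:R * w) u) nat.
Qed.

Lemma lattice_reduce w z : 0 < complex.Im w ->
  exists a b : int, cm (z + a%:~R * 1 + b%:~R * w) <= 1 + cm w.
Proof.
move=> w0; pose tt := complex.Im z / complex.Im w.
pose ss := complex.Re z - tt * complex.Re w.
have zE : z = (ss%:C)%C + (tt%:C)%C * w.
  apply: ceq; rewrite ?ReD ?ImD ?cReM ?cImM /= ?mul0r ?addr0 ?subr0 ?add0r /ss;
    first by ring.
  by rewrite /tt divfK // gt_eqF.
exists (- Num.floor ss), (- Num.floor tt).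
have fl (x : R) : `|x - (Num.floor x)%:~R| <= 1.
  have /andP[h1 h2] := floor_itv x; rewrite ger0_norm ?subr_ge0 //.
  by move: h2; rewrite intrD lerBlDr; clear; lra.
have -> : z + (- Num.floor ss)%:~R * 1 + (- Num.floor tt)%:~R * w =
    ((ss - (Num.floor ss)%:~R)%:C)%C + ((tt - (Num.floor tt)%:~R)%:C)%C * w.
  by rewrite [in LHS]zE !realCD !realCN !realC_int !intrN; ring.
apply: (le_trans (cmD _ _)); rewrite cmM !cm_real; apply: lerD => //.
by rewrite ler_piMl // cm_ge0.
Qed.

(** The product of |Z| with exp(kap (Im z)^2 / Im w), where Z extends Y, has
    the periods 1 and w, hence is bounded by its values near the origin. As the
    Gaussian is at least 1, Z is bounded, so constant, and the factor at w then
    makes the constant zero. *)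
Theorem negative_index_zero Y w (kap : R) : 0 < complex.Im w -> 0 < kap ->
  (forall P, exists2 L : R, 0 < L & exists M : R, forall z, 0 < cm (z - P) <= L ->
     sdiff Y z /\ cm (Y z) <= M) ->
  (forall P, exists2 L : R, 0 < L & forall z, 0 < cm (z - P) <= L ->
     cm (Y (z + 1)) = cm (Y z) /\
     cm (Y (z + w)) = cm (Y z) * expR (- (2 * kap * complex.Im z +
       kap * complex.Im w))) ->
  forall P, exists2 L : R, 0 < L & forall z, 0 < cm (z - P) < L -> Y z = 0.
Proof.
move=> w0 k0 loc per; have [Z Zs ZY] := removable_extension loc.
have shift (v : C) g : (forall P, sdiff g P) ->
    (forall P, exists2 L : R, 0 < L & forall z, 0 < cm (z - P) <= L ->
      cm (Y (z + v)) = cm (Y z) * cm (g z)) ->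
    forall P, cm (Z (P + v)) = cm (Z P) * cm (g P).
  move=> gs gE P; rewrite -cmM.
  have [L1 L10 h1] := ZY P; have [L2 L20 h2] := ZY (P + v); have [L3 L30 h3] := gE P.
  apply: (@cm_eq_punctured (fun z => Z (z + v)) (fun z =>
    Z z * g z) P (Num.min L1 (Num.min L2 L3))).
  - by rewrite !lt_min L10 L20.
  - apply: (@sdiff_ext _ (fun z => Z (1 * z + v))); first by move=> x; rewrite mul1r.
    exact: sdiff_compl.
  - exact: sdiffM.
  move=> z /andP[z0]; rewrite !lt_min => /and3P[z1 z2 z3].
  rewrite (h1 z) ?z0 // (h2 (z + v)); last by rewrite opprD addrACA subrr addr0 z0.
  by rewrite cmM h3 // z0 ltW.
have Z1 P : cm (Z (P + 1)) = cm (Z P).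
  rewrite (shift 1 (fun=> 1)) ?cm1 ?mulr1 // => Q; first exact: sdiff_cst.
  by have [L L0 hL] := per Q; exists L => // z /hL[-> _]; rewrite ?cm1 ?mulr1.
have Zw P : cm (Z (P + w)) = cm (Z P) * expR (- (2 * kap * complex.Im P +
  kap * complex.Im w)).
  have E (v : C) : expR (- (2 * kap * complex.Im v + kap * complex.Im w)) =
      cm (cexp ((0 +i* (2 * kap))%C * v + ((- (kap * complex.Im w))%:C)%C)).
    by rewrite cm_cexp; case: v => v1 v2 /=; congr expR; ring.
  rewrite E; apply: (shift w (fun v => cexp (_ * v + _))) => Q.
    by apply: (@sdiff_compl _ cexp); exact: sdiff_cexp.
  by have [L L0 hL] := per Q; exists L => // z /hL[_ ->]; rewrite E.
pose be := kap / complex.Im w; have be0 : 0 < be by rewrite divr_gt0.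
pose g u := cm (Z u) * expR (be * complex.Im u ^+ 2).
have g1 u : g (u + 1) = g u by rewrite /g Z1 ImD /= addr0.
have gw u : g (u + w) = g u.
  rewrite /g Zw -mulrA -expRD ImD; congr (_ * expR _); rewrite /be; field.
  by rewrite gt_eqF.
have [d d0 hd] : exists2 d : R, 0 < d & forall u, cm u <= 1 + cm w -> 0 < d ->
  cm (Z u) <= d^-1.
  apply: (@square_uniform R _ (fun d u => 0 < d -> cm (Z u) <= d^-1)).
    move=> d d' u dd h d'0; have d0 := lt_le_trans d'0 dd.
    by apply: le_trans (h d0) _; rewrite lef_pV2.
  move=> P; have [e e0 [B B0 hB]] := sdiff_bounded (Zs P).
  have m0 : 0 < Num.min e B^-1 by rewrite lt_min e0 invr_gt0.
  exists (Num.min e B^-1) => // x; rewrite lt_min => /andP[xe _] _.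
  apply: le_trans (hB x xe) _; rewrite -[B]invrK lef_pV2 ?posrE ?invr_gt0 ?invrK //.
  by rewrite ge_min lexx orbT.
have Zb z : cm (Z z) <= d^-1 * expR (be * (1 + cm w) ^+ 2).
  have [a [b hab]] := lattice_reduce z w0.
  apply: (@le_trans _ _ (g z)).
    rewrite /g ler_peMr ?cm_ge0 // -expR0 ler_expR.
    by rewrite mulr_ge0 ?(ltW be0) // sqr_ge0.
  rewrite -(int_period g1 a) -(int_period gw b) /g.
  apply: ler_pM; rewrite ?cm_ge0 ?expR_ge0 ?hd // ler_expR ler_wpM2l ?(ltW be0) //.
  rewrite -real_normK ?num_real // lerXn2r ?nnegrE ?normr_ge0 //.
    by rewrite addr_ge0 ?cm_ge0.
  exact: le_trans (Im_le _) hab.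
have Zc := liouville Zs Zb.
have Z00 : Z 0 = 0.
  have := Zw 0; rewrite (Zc (0 + w)) /= mulr0 add0r => E.
  apply/eqP; rewrite -cm_eq0; apply/eqP.
  have : expR (- (kap * complex.Im w)) < 1.
    by rewrite -[X in _ < X]expR0 ltr_expR oppr_lt0 mulr_gt0.
  move: E; have := cm_ge0 (Z 0); set x := cm (Z 0); set y := expR _ => x0 E y1.
  have : x * (1 - y) = 0 by rewrite mulrBr mulr1 -E subrr.
  by move=> /eqP; rewrite mulf_eq0 subr_eq0 [1 == y]gt_eqF // orbF => /eqP.
move=> P; have [L L0 hL] := ZY P; exists L => // z zL.
by rewrite -hL // Zc.
Qed.

End NegativeIndex.

(** * Infinite products *)

Section Products.
Variable R : realType.
Local Notation C := (Cplx R).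
Implicit Types (a q x : C) (r : R).

Definition qp a q n : C := \prod_(k < n) (1 - a * q ^+ k).

Lemma qp0 a q : qp a q 0 = 1. Proof. by rewrite /qp big_ord0. Qed.
Lemma qpS a q n : qp a q n.+1 = qp a q n * (1 - a * q ^+ n).
Proof. by rewrite /qp big_ord_recr. Qed.
Lemma qpSl a q n : qp a q n.+1 = (1 - a) * qp (a * q) q n.
Proof.
rewrite /qp big_ord_recl expr0 mulr1; congr (_ * _).
by apply: eq_bigr => k _; rewrite -mulrA -exprS.
Qed.
Lemma qp_add a q m n : qp a q (m + n) = qp a q m * qp (a * q ^+ m) q n.
Proof.
rewrite /qp big_split_ord /=; congr (_ * _).
by apply: eq_bigr => k _; rewrite -mulrA -exprD.
Qed.

Lemma prod1B_ge (n : nat) (u : nat -> R) : (forall k, 0 <= u k <= 1) ->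
  1 - \sum_(k < n) u k <= \prod_(k < n) (1 - u k).
Proof.
move=> u01; have pos m : 0 <= \prod_(k < m) (1 - u k) <= 1.
  elim: m => [|m /andP[h0 h1]]; first by rewrite big_ord0 ler01 lexx.
  have /andP[a0 a1] := u01 m; rewrite big_ord_recr /=; apply/andP; split.
    by rewrite mulr_ge0 // subr_ge0.
  by rewrite mulr_ile1 // ?subr_ge0 // lerBlDr lerDl.
elim: n => [|n IH]; first by rewrite !big_ord0 subr0.
rewrite !big_ord_recr /=; have /andP[h0 h1] := pos n; have /andP[a0 a1] := u01 n.
by move: IH; set s := \sum_(k < n) _; set p := \prod_(k < n) _ in h0 h1 *; nra.
Qed.

(** The product (r; r)_n, a lower bound for |(a; q)_n| when |a| and |q| are at
    most r. *)
Definition rp r n : R := \prod_(k < n) (1 - r ^+ k.+1).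

Lemma rp_ge0 r n : 0 <= r -> r < 1 -> 0 < rp r n.
Proof. by move=> r0 r1; apply: prodr_gt0 => k _; rewrite subr_gt0 exprn_ilt1. Qed.

Lemma sum_geoS_le r n : 0 <= r -> r < 1 -> \sum_(k < n) r ^+ k.+1 <= r / (1 - r).
Proof.
move=> r0 r1; under eq_bigr do rewrite exprS.
by rewrite -mulr_sumr ler_wpM2l // geo_sum_le.
Qed.

Lemma expR_prod (n : nat) (u : nat -> R) : (forall k, 0 <= u k) ->
  \prod_(k < n) (1 + u k) <= expR (\sum_(k < n) u k).
Proof.
move=> u0; elim: n => [|n IH]; first by rewrite !big_ord0 expR0.
rewrite !big_ord_recr /= expRD; apply: ler_pM => //; last exact: expR_ge1Dx.
  by apply: prodr_ge0 => k _; rewrite addr_ge0.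
by rewrite addr_ge0.
Qed.

(** Euler's factorization (r^2; r^2)_n = (r; r)_n prod (1 + r^k) shows that
    phi(r) = (r; r)_n exp(2 r / (1 - r)) does not increase when r is replaced
    by r^2, and phi(r^(2^m)) tends to 1. *)
Lemma rp_lower r n : 0 <= r -> r < 1 -> expR (- (2 * (r / (1 - r)))) <= rp r n.
Proof.
pose s (t : R) := t / (1 - t); pose phi t := rp t n * expR (2 * s t).
have step t : 0 <= t -> t < 1 -> phi (t ^+ 2) <= phi t.
  move=> t0 t1; have t2 : t ^+ 2 < 1 by rewrite exprn_ilt1.
  have e : rp (t ^+ 2) n = rp t n * \prod_(k < n) (1 + t ^+ k.+1).
    by rewrite /rp -big_split /=; apply: eq_bigr => k _; rewrite -exprM mulnC exprM; ring.
  have p0 := rp_ge0 n t0 t1.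
  rewrite /phi e -mulrA ler_pM2l //.
  apply: (@le_trans _ _ (expR (s t) * expR (s t))).
    apply: ler_pM.
    - by apply: prodr_ge0 => k _; rewrite addr_ge0 // exprn_ge0.
    - exact: expR_ge0.
    - have U k : 0 <= t ^+ k.+1 by rewrite exprn_ge0.
      by apply: (le_trans (expR_prod n U)); rewrite ler_expR sum_geoS_le.
    - rewrite ler_expR /s.
      have -> : 1 - t ^+ 2 = (1 - t) * (1 + t) by ring.
      have p1 : 0 < 1 + t by lra.
      have p2 : 0 < 1 - t by lra.
      have -> : 2 * (t ^+ 2 / ((1 - t) * (1 + t))) = t / (1 - t) * (2 * t / (1 + t)).
        by field; rewrite !gt_eqF.
      by rewrite ler_piMr ?divr_ge0 ?(ltW p2) // ler_pdivrMr //; lra.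
  by rewrite -expRD ler_expR -mulr2n mulr_natl.
move=> r0 r1; have iter m : phi (r ^+ (2 ^ m)) <= phi r.
  elim: m => [|m IH]; first by rewrite expn0 expr1.
  apply: le_trans IH; rewrite expnSr exprM; apply: step; first exact: exprn_ge0.
  by rewrite exprn_ilt1 // -lt0n expn_gt0.
have one : 1 <= phi r.
  apply/ler_addgt0Pl => e e0.
  have [M hM] := expr_small r0 r1 (ler0n R n) e0.
  have m_big : (M <= 2 ^ M)%N by rewrite ltnW // ltn_expl.
  have := hM _ m_big => {}hM; have := iter M; set t := r ^+ (2 ^ M) in hM *.
  have t0 : 0 <= t by rewrite exprn_ge0.
  have t1 : t < 1 by rewrite exprn_ilt1 // -lt0n expn_gt0.
  have A : 1 - n%:R * t <= rp t n.
    have U k : 0 <= t ^+ k.+1 <= 1 by rewrite exprn_ge0 // exprn_ile1 // ltW.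
    apply: le_trans (prod1B_ge n U).
    rewrite lerD2l lerN2 mulr_natl -[X in _ *+ X]card_ord -sumr_const.
    by apply: ler_sum => k _; rewrite exprS ler_piMr // exprn_ile1 // ltW.
  have B : rp t n <= phi t.
    rewrite /phi ler_peMr ?(ltW (rp_ge0 n t0 t1)) //.
    rewrite -expR0 ler_expR mulr_ge0 // divr_ge0 //; lra.
  by move=> D; lra.
have e0 := expR_gt0 (2 * s r).
by rewrite expRN -[X in X <= _]mul1r ler_pdivrMr.
Qed.

Lemma qp_le a q n : cm q < 1 -> cm (qp a q n) <= expR (cm a / (1 - cm q)).
Proof.
move=> q1; rewrite /qp cm_prod.
apply: (@le_trans _ _ (\prod_(k < n) (1 + cm a * cm q ^+ k))).
  apply: ler_prod => k _; rewrite cm_ge0 /=; apply: (le_trans (cmB _ _)).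
  by rewrite cm1 cmM cmX.
have U k : 0 <= cm a * cm q ^+ k by rewrite mulr_ge0 ?exprn_ge0 ?cm_ge0.
by apply: (le_trans (expR_prod n U));
  rewrite ler_expR -mulr_sumr ler_wpM2l ?cm_ge0 // geo_sum_le // cm_ge0.
Qed.

Lemma qp_ge_rp a q r n : 0 <= r -> r < 1 -> (forall k, cm (a * q ^+ k) <= r ^+ k.+1) ->
  rp r n <= cm (qp a q n).
Proof.
move=> r0 r1 h; rewrite /qp cm_prod; apply: ler_prod => k _.
rewrite subr_ge0 exprn_ile1 ?(ltW r1) //=.
have := cmB_ge 1 (a * q ^+ k); rewrite cm1; have := h k; lra.
Qed.

(** Finitely many factors are merely nonzero; the others are bounded below by
    the product of [rp_lower]. *)
Lemma qp_lower a q : q != 0 -> cm q < 1 -> (forall k, 1 - a * q ^+ k != 0) ->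
  exists2 c : R, 0 < c & forall n, c <= cm (qp a q n).
Proof.
move=> q0 q1 an0; have r0 : 0 < cm q by rewrite cm_gt0.
have [k0 hk0] := expr_small (ltW r0) q1 (cm_ge0 a) r0.
pose m k : R := Num.min 1 (cm (1 - a * q ^+ k)).
have m0 k : 0 < m k by rewrite lt_min ltr01 cm_gt0 an0.
have m1 k : m k <= 1 by rewrite ge_min lexx.
pose c0 := expR (- (2 * (cm q / (1 - cm q)))).
have c01 : c0 <= 1.
  by rewrite -expR0 ler_expR oppr_le0 mulr_ge0 // divr_ge0 ?(ltW r0) //; lra.
have M0 : 0 < \prod_(k < k0) m k by apply: prodr_gt0.
exists (\prod_(k < k0) m k * c0) => [|n]; first by rewrite mulr_gt0 ?expR_gt0.
have small j : (j <= k0)%N -> \prod_(k < k0) m k <= cm (qp a q j).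
  move=> jk; rewrite /qp cm_prod.
  apply: (@le_trans _ _ (\prod_(k < j) m k)).
    rewrite -(subnKC jk) big_split_ord /= ler_piMr //;
      first by apply: prodr_ge0 => k _; exact: ltW.
    by apply: prodr_ile1 => k _; rewrite (ltW (m0 _)) m1.
  by apply: ler_prod => k _; rewrite (ltW (m0 _)) /= ge_min lexx orbT.
have [nk|nk] := leqP n k0.
  by apply: le_trans (small n nk); rewrite ler_piMr // ltW.
rewrite -(subnKC (ltnW nk)) qp_add cmM.
apply: ler_pM; rewrite ?expR_ge0 ?(ltW M0) //; first exact: small.
apply: le_trans (qp_ge_rp _ (ltW r0) q1 _); first by rewrite rp_lower // ltW.
move=> k; rewrite !cmM !cmX exprS ler_wpM2r ?exprn_ge0 ?(ltW r0) //.
by have := hk0 _ (leqnn k0); lra.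
Qed.

Lemma qp_neq0 a q n : (forall k, 1 - a * q ^+ k != 0) -> qp a q n != 0.
Proof. by move=> h; apply/prodf_neq0 => k _. Qed.

Definition qpi a q : C := lim ((qp a q) @ \oo).

(** Through the differences of its partial products an infinite product is a
    geometrically dominated series, to which [sdiff_series] applies. *)
Lemma geo_qpD a q : cm q < 1 ->
  geo (fun n => qp a q n.+1 - qp a q n) (cm a * expR (cm a / (1 - cm q))) (cm q).
Proof.
move=> q1 n; rewrite qpS.
have -> : qp a q n * (1 - a * q ^+ n) - qp a q n = - (a * q ^+ n * qp a q n) by ring.
rewrite cmN !cmM cmX mulrAC ler_wpM2r ?exprn_ge0 ?cm_ge0 //.
by rewrite ler_wpM2l ?cm_ge0 // qp_le.
Qed.

Lemma csum_diff (u : nat -> C) l : csum (fun n => u n.+1 - u n) l -> ccvg u (l + u 0%N).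
Proof.
move=> h; apply: (@ccvg_ext _ (fun n => \sum_(k < n) (u k.+1 - u k) + u 0%N)).
  move=> n; rewrite -(big_mkord xpredT (fun k =>
    u k.+1 - u k)) telescope_sumr // subrK //.
by apply: ccvgD => //; exact: ccvg_cst.
Qed.

Lemma qpi_cvg a q : cm q < 1 -> ccvg (qp a q) (qpi a q).
Proof.
move=> q1; have [l hl] := geo_cvg (geo_qpD a q1) (cm_ge0 q) q1.
by have h := csum_diff hl; rewrite /qpi (ccvg_lim h).
Qed.

Lemma qpi_csum a q : cm q < 1 -> csum (fun n => qp a q n.+1 - qp a q n) (qpi a q - 1).
Proof. by move=> q1; have := csum_tele (qpi_cvg a q1); rewrite qp0. Qed.

Lemma qpoch_infE a q : qpoch_inf a q = qpi a q.
Proof.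
rewrite /qpi; have -> : qp a q = (fun n => \prod_(0 <= k < n) (1 - a * q ^+ k)).
  by apply/funext => n; rewrite /qp big_mkord.
by [].
Qed.

Lemma qpi_shift a q n : cm q < 1 -> qpi a q = qp a q n * qpi (a * q ^+ n) q.
Proof.
move=> q1; apply: ccvg_uniq (qpi_cvg a q1) _.
apply: (@ccvg_unshift _ _ _ n).
apply: (@ccvg_ext _ (fun m => qp a q n * qp (a * q ^+ n) q m)).
  by move=> m; rewrite addnC qp_add.
by apply: ccvgZ; exact: qpi_cvg.
Qed.

Lemma qpi_neq0 a q : q != 0 -> cm q < 1 -> (forall k, 1 - a * q ^+ k != 0) ->
  qpi a q != 0.
Proof.
move=> q0 q1 h; have [c c0 hc] := qp_lower q0 q1 h.
by rewrite -cm_gt0; apply: lt_le_trans c0 _; apply: ccvg_ge hc; exact: qpi_cvg.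
Qed.

Lemma qpochE a q n : q != 0 -> cm q < 1 -> (forall k, 1 - a * q ^+ k != 0) ->
  qpoch a q n = qp a q n.
Proof.
move=> q0 q1 h; rewrite /qpoch !qpoch_infE (qpi_shift a n q1) mulfK //.
by apply: qpi_neq0 => // k; rewrite -mulrA -exprD.
Qed.

Lemma qpi_sdiff (fa fq : C -> C) P (L A r : R) : 0 < L -> 0 <= r -> r < 1 ->
  (forall z, cm (z - P) <= L -> sdiff fa z /\ sdiff fq z) ->
  (forall z, cm (z - P) <= L -> cm (fa z) <= A /\ cm (fq z) <= r) ->
  sdiff (fun z => qpi (fa z) (fq z)) P.
Proof.
move=> L0 r0 r1 sd bd.
have A0 : 0 <= A by have [|h _] := bd P;
  [rewrite subrr cm0 ltW|apply: le_trans (cm_ge0 _) h].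
apply: (@sdiff_ext _ (fun z => (qpi (fa z) (fq z) - 1) + 1)); first by move=> z;
  rewrite subrK.
apply: sdiffD; last exact: sdiff_cst.
apply: (@sdiff_series _ (fun n z => qp (fa z) (fq z) n.+1 - qp (fa z) (fq z) n) _ P L
  (A * expR (A / (1 - r))) r) => //.
- move=> n z zL; have [sa sq] := sd z zL.
  have sp m : sdiff (fun z => qp (fa z) (fq z) m) z.
    apply: sdiff_prod => k _; apply: sdiffB; first exact: sdiff_cst.
    by apply: sdiffM => //; exact: sdiffX.
  by apply: sdiffB.
- move=> z zL n; have [ba bq] := bd z zL.
  have q1 : cm (fq z) < 1 by lra.
  apply: (le_trans (geo_qpD (fa z) q1 n)).
  apply: ler_pM; rewrite ?mulr_ge0 ?exprn_ge0 ?expR_ge0 ?cm_ge0 //.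
    apply: ler_pM; rewrite ?expR_ge0 ?cm_ge0 // ler_expR.
    by apply: ler_pM; rewrite ?cm_ge0 ?invr_ge0 ?lef_pV2 ?posrE //; lra.
  by rewrite lerXn2r // nnegrE ?cm_ge0.
- by move=> z zL; apply: qpi_csum; have [_] := bd z zL; lra.
Qed.

End Products.

(** * The universal mock theta function *)

Section UniversalMock.
Variable R : realType.
Local Notation C := (Cplx R).
Implicit Types (a q x : C) (r : R).

Definition eterm x q n : C := q ^+ (n ^ 2) / (qp x q n.+1 * qp (q / x) q n).
(** The universal mock theta function; it has poles at the powers of q. *)
Definition Eu x q : C := lim ((fun n => \sum_(k < n) eterm x q k) @ \oo).
Definition kterm x q n : C := q ^+ (n ^ 2) / (qp (x * q) q n * qp (q / x) q n).
(** This is (1 - x) E(x; q), which has no pole in the annulus |q| < |x| < 1 /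
    |q|. *)
Definition Ku x q : C := lim ((fun n => \sum_(k < n) kterm x q k) @ \oo).

Definition regular x q := [/\ x != 0, forall k, 1 - x * q ^+ k != 0 &
  forall k, 1 - q / x * q ^+ k != 0].

Lemma regularS x q : q != 0 -> regular x q -> regular (x * q) q.
Proof.
move=> q0 [x0 h1 h2]; split => [|k|k]; first by rewrite mulf_neq0.
  by rewrite -mulrA -exprS.
have -> : q / (x * q) * q ^+ k = x^-1 * q ^+ k by field; rewrite q0 x0.
case: k => [|k]; last by have := h2 k; rewrite exprS mulrA [x^-1 * q]mulrC.
have := h1 0%N; rewrite !expr0 !mulr1 !subr_eq0; apply: contra => /eqP e.
by rewrite -[x]invrK -e invr1.
Qed.

Lemma eterm_geo x q : q != 0 -> cm q < 1 -> regular x q ->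
  exists D, geo (eterm x q) D (cm q).
Proof.
move=> q0 q1 [x0 h1 h2].
have [c1 c10 hc1] := qp_lower q0 q1 h1; have [c2 c20 hc2] := qp_lower q0 q1 h2.
exists ((c1 * c2)^-1) => n; rewrite /eterm cmM cmV cmX mulrC.
apply: ler_pM; rewrite ?invr_ge0 ?exprn_ge0 ?cm_ge0 //.
  have h : c1 * c2 <= cm (qp x q n.+1 * qp (q / x) q n).
    by rewrite cmM; apply: ler_pM => //; exact: ltW.
  by rewrite lef_pV2 ?posrE ?mulr_gt0 // (lt_le_trans _ h) // mulr_gt0.
apply: ler_wiXn2l; rewrite ?cm_ge0 ?(ltW q1) //.
by case: n => // n; rewrite expnS expn1 leq_pmulr.
Qed.

Lemma Eu_csum x q : q != 0 -> cm q < 1 -> regular x q -> csum (eterm x q) (Eu x q).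
Proof.
move=> q0 q1 /(eterm_geo q0 q1) [D g]; have [l hl] := geo_cvg g (cm_ge0 q) q1.
by rewrite /Eu (ccvg_lim hl).
Qed.

Lemma etermS x q n : regular x q -> eterm x q n.+1 =
  eterm x q n * (q ^+ n ^+ 2 * q / ((1 - x * (q * q ^+ n)) * (1 - q * q ^+ n / x))).
Proof.
move=> [x0 h1 h2]; have a0 := qp_neq0 n.+1 h1; have b0 := qp_neq0 n h2.
rewrite /eterm (qpS x q n.+1) (qpS (q / x)) exprS.
have -> : q / x * q ^+ n = q * q ^+ n / x by ring.
have d1 := h1 n.+1; rewrite exprS in d1.
have d2 : 1 - q * q ^+ n / x != 0 by have := h2 n; rewrite mulrAC.
have -> : (n.+1 ^ 2 = n ^ 2 + n * 2 + 1)%N by rewrite !expnS !expn0; lia.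
rewrite !exprD expr1 exprM.
set A := qp _ _ _ in a0 *; set B := qp _ _ _ in b0 *; set Q := q ^+ n in d1 d2 *.
field; rewrite x0 a0 b0 /=.
have -> : x - q * Q = (1 - q * Q / x) * x by field.
by rewrite mulf_neq0 // d1.
Qed.

Lemma eterm_shift x q n : q != 0 -> regular x q ->
  eterm (x * q) q n = eterm x q n * ((q ^+ n - x) / (1 - x * (q * q ^+ n))).
Proof.
move=> q0 rg; have [x0 h1 h2] := rg.
have a0 := qp_neq0 n.+1 h1; have b0 := qp_neq0 n h2.
have d0 := h1 0%N; rewrite expr0 mulr1 in d0.
have d1 := h1 n.+1; rewrite exprS in d1.
have [_ g1 g2] := regularS q0 rg.
have a1 := qp_neq0 n.+1 g1; have b1 := qp_neq0 n g2.
have E1 : (1 - x) * qp (x * q) q n.+1 = qp x q n.+1 * (1 - x * (q * q ^+ n)).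
  by rewrite -qpSl qpS exprS.
have xq : q / (x * q) = x^-1 by field; rewrite q0 x0.
have E2 : (1 - x^-1) * qp (q / x) q n = qp (q / (x * q)) q n * (1 - x^-1 * q ^+ n).
  by rewrite xq -qpS qpSl [x^-1 * q]mulrC.
rewrite /eterm; move: E1 E2 a1 b1 a0 b0.
set A := qp x _ _; set B := qp (q / x) _ _; set A1 := qp (x * q) _ _;
  set B1 := qp (q / (x * q)) _ _.
move=> E1 E2 a1 b1 a0 b0.
have A1E : A1 = A * (1 - x * (q * q ^+ n)) / (1 - x) by rewrite -E1; field.
have n1 : 1 - x^-1 * q ^+ n != 0.
  have : (1 - x^-1) * B != 0.
    rewrite mulf_neq0 //; move: d0; rewrite !subr_eq0; apply: contra => /eqP e.
    by rewrite -[x]invrK -e invr1.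
  by rewrite E2 mulf_eq0 negb_or => /andP[].
have B1E : B1 = (1 - x^-1) * B / (1 - x^-1 * q ^+ n) by rewrite E2 mulfK.
rewrite A1E B1E; set Q := q ^+ n in d1 n1 *; set QQ := q ^+ (n ^ 2).
field; rewrite x0 a0 b0 d1 /=.
have -> : x - Q = (1 - x^-1 * Q) * x by field.
have -> : x - 1 = - (1 - x) by ring.
by rewrite oppr_eq0 d0 mulf_neq0.
Qed.

(** The multiple x (1 - q x^2) (1 - q^n / x) of the n-th term of E(x) has as
    its difference in n the n-th term of E(xq) + q x^3 E(x), so that the series
    telescopes. *)
Theorem Eu_shift x q : q != 0 -> cm q < 1 -> regular x q ->
  Eu (x * q) q + q * x ^+ 3 * Eu x q = 1 - q * x ^+ 2.
Proof.
move=> q0 q1 rg; have [x0 h1 h2] := rg.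
pose c n := x * (1 - q * x ^+ 2) * (1 - q ^+ n / x) * eterm x q n.
have tele n : c n.+1 - c n = eterm (x * q) q n + q * x ^+ 3 * eterm x q n.
  rewrite /c eterm_shift // etermS // (exprS q n).
  have d1 := h1 n.+1; rewrite exprS in d1.
  have d2 : 1 - q * q ^+ n / x != 0 by have := h2 n; rewrite mulrAC.
  set A := eterm x q n; set Q := q ^+ n in d1 d2 *.
  field; rewrite x0 d1 /=.
  have -> : x - q * Q = (1 - q * Q / x) * x by field.
  by rewrite mulf_neq0.
have [D g] := eterm_geo q0 q1 rg.
have c_to0 : ccvg c 0.
  have D0 := geo_D g.
  apply: (@geo_ccvg0 _ _ (cm (x * (1 - q * x ^+ 2)) * (1 + cm x^-1) * D) (cm q));
    rewrite ?cm_ge0 // => n.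
  rewrite /c (cmM _ (eterm x q n)) (cmM (x * _)) -!mulrA.
  rewrite ler_wpM2l ?cm_ge0 //; apply: ler_pM; rewrite ?cm_ge0 //.
  apply: (le_trans (cmB _ _)); rewrite cm1 lerD2l cmM ler_piMl ?cm_ge0 // cmX.
  by rewrite exprn_ile1 ?cm_ge0 // ltW.
have S1 := csum_tele c_to0.
have S2 : csum (fun n => c n.+1 - c n) (Eu (x * q) q + q * x ^+ 3 * Eu x q).
  apply: (@csum_ext _ (fun n => eterm (x * q) q n + q * x ^+ 3 * eterm x q n)).
    by move=> n; rewrite tele.
  apply: csumD; last by apply: csumZ; exact: Eu_csum.
  by apply: Eu_csum => //; exact: regularS.
rewrite (ccvg_uniq S2 S1) sub0r /c /eterm qp0 qpS qp0 !expr0 !mul1r !mulr1.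
have d0 := h1 0%N; rewrite expr0 mulr1 in d0.
by field; rewrite x0 d0.
Qed.

(** The bound is explicit in s, because it serves both for differentiability,
    with s fixed, and for the growth near the real axis, where s tends to 1. *)
Lemma kterm_bound x q (s : R) n : cm q <= s -> s < 1 -> cm (x * q) <= s ->
  cm (q / x) <= s ->
  [/\ qp (x * q) q n != 0, qp (q / x) q n != 0 &
      cm (kterm x q n) <= expR (4 * (s / (1 - s))) * s ^+ n].
Proof.
move=> qs s1 xs xs'; have s0 : 0 <= s by apply: le_trans (cm_ge0 q) qs.
have B a : cm a <= s -> expR (- (2 * (s / (1 - s)))) <= cm (qp a q n).
  move=> as_; apply: le_trans (rp_lower n s0 s1) (qp_ge_rp n s0 s1 _) => k.
  rewrite cmM cmX exprS; apply: ler_pM; rewrite ?cm_ge0 ?exprn_ge0 ?cm_ge0 //.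
  by rewrite lerXn2r // nnegrE ?cm_ge0.
have B1 := B _ xs; have B2 := B _ xs'.
have p1 := lt_le_trans (expR_gt0 _) B1; have p2 := lt_le_trans (expR_gt0 _) B2.
split; rewrite -?cm_gt0 //.
rewrite /kterm cmM cmV cmM cmX mulrC; apply: ler_pM.
- by rewrite invr_ge0 mulr_ge0 ?cm_ge0.
- by rewrite exprn_ge0 ?cm_ge0.
- have -> : expR (4 * (s / (1 - s))) = (expR (- (2 * (s / (1 - s)))) * expR (- (2 *
  (s / (1 - s)))))^-1.
    by rewrite -expRD -expRN; congr expR; ring.
  rewrite lef_pV2 ?posrE ?mulr_gt0 ?expR_gt0 //.
  by apply: ler_pM; rewrite ?expR_ge0.
- apply: (@le_trans _ _ (s ^+ (n ^ 2))); first by rewrite lerXn2r // nnegrE ?cm_ge0.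
  apply: ler_wiXn2l; rewrite ?(ltW s1) //.
  by case: n {B B1 B2 p1 p2} => // n; rewrite expnS expn1 leq_pmulr.
Qed.

Lemma Ku_csum x q (s : R) : cm q <= s -> s < 1 -> cm (x * q) <= s -> cm (q / x) <= s ->
  csum (kterm x q) (Ku x q).
Proof.
move=> qs s1 xs xs'; have s0 : 0 <= s by apply: le_trans (cm_ge0 q) qs.
have g : geo (kterm x q) (expR (4 * (s / (1 - s)))) s.
  by move=> n; have [] := kterm_bound n qs s1 xs xs'.
by have [l hl] := geo_cvg g s0 s1; rewrite /Ku (ccvg_lim hl).
Qed.

Lemma Ku_le x q (s : R) : cm q <= s -> s < 1 -> cm (x * q) <= s -> cm (q / x) <= s ->
  cm (Ku x q) <= expR (4 * (s / (1 - s))) / (1 - s).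
Proof.
move=> qs s1 xs xs'; have s0 : 0 <= s by apply: le_trans (cm_ge0 q) qs.
apply: (csum_le (Ku_csum qs s1 xs xs')) => // n.
by have [] := kterm_bound n qs s1 xs xs'.
Qed.

Lemma Ku_sdiff (fx fq : C -> C) P (L s : R) : 0 < L -> s < 1 ->
  (forall z, cm (z - P) <= L -> [/\ sdiff fx z, sdiff fq z & fx z != 0]) ->
  (forall z, cm (z - P) <= L -> [/\ cm (fq z) <= s, cm (fx z * fq z) <=
    s & cm (fq z / fx z) <= s]) ->
  sdiff (fun z => Ku (fx z) (fq z)) P.
Proof.
move=> L0 s1 sd bd.
have s0 : 0 <= s.
  by have [|h _ _] := bd P; [rewrite subrr cm0 ltW|apply: le_trans (cm_ge0 _) h].
apply: (@sdiff_series _ (fun n z => kterm (fx z) (fq z) n) _ P L (expR (4 *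
  (s / (1 - s)))) s) => //.
- move=> n z zL; have [sx sq x0] := sd z zL; have [b1 b2 b3] := bd z zL.
  have [n1 n2 _] := kterm_bound n b1 s1 b2 b3.
  have sp (a : C -> C) m : sdiff a z -> sdiff (fun z => qp (a z) (fq z) m) z.
    move=> sa; apply: sdiff_prod => k _; apply: sdiffB; first exact: sdiff_cst.
    by apply: sdiffM => //; exact: sdiffX.
  apply: sdiff_div; first by rewrite mulf_neq0.
    exact: sdiffX.
  by apply: sdiffM; apply: sp; [exact: sdiffM|exact: sdiff_div].
- move=> z zL n; have [b1 b2 b3] := bd z zL.
  by have [] := kterm_bound n b1 s1 b2 b3.
- by move=> z zL; have [b1 b2 b3] := bd z zL; exact: (Ku_csum b1 s1 b2 b3).
Qed.

Lemma Eu_Ku x q (s : R) : q != 0 -> cm q <= s -> s < 1 -> cm (x * q) <= s ->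
  cm (q / x) <= s ->
  regular x q -> Eu x q = Ku x q / (1 - x).
Proof.
move=> q0 qs s1 xs xs' rg; have [x0 h1 h2] := rg.
have q1 : cm q < 1 by apply: le_lt_trans s1.
have S := csumZ (1 - x)^-1 (Ku_csum qs s1 xs xs').
rewrite mulrC; apply: (ccvg_uniq (Eu_csum q0 q1 rg)); apply: csum_ext S => n.
rewrite /eterm /kterm qpSl invfM invfM mulrCA; congr (_ * _).
by rewrite invfM mulrA.
Qed.

Lemma regular_annulus x q (s : R) : cm q <= s -> s < 1 -> cm (x * q) <= s ->
  cm (q / x) <= s ->
  x != 0 -> x != 1 -> regular x q.
Proof.
move=> qs s1 xs xs' x0 x1; have s0 : 0 <= s by apply: le_trans (cm_ge0 q) qs.
have key a k : cm a <= s -> 1 - a * q ^+ k != 0.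
  move=> as_; rewrite -cm_gt0; have := cmB_ge 1 (a * q ^+ k); rewrite cm1 cmM cmX.
  have : cm q ^+ k <= 1 by rewrite exprn_ile1 ?cm_ge0 // ltW // (le_lt_trans qs).
  have := exprn_ge0 k (cm_ge0 q); have := cm_ge0 a; nra.
split=> // k; last exact: key.
case: k => [|k]; first by rewrite expr0 mulr1 subr_eq0 eq_sym.
by rewrite exprS mulrA; exact: key.
Qed.

(** Cauchy's identity. The sums g_N over n of q^(Nn + n^2) / ((q)_n
    (q^(N+1))_n) satisfy (1 - q^(N+1)) g_N = g_(N+1) by telescoping and tend to
    1, so that g_0 (q)_N = g_N gives g_0 (q)_oo = 1. *)
Lemma Ku1 q : q != 0 -> cm q < 1 -> Ku 1 q * qpi q q = 1.
Proof.
move=> q0 q1; pose r := cm q; have r0 : 0 < r by rewrite cm_gt0.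
pose A N n : C := q ^+ (N * n + n ^ 2) / (qp q q n * qp (q ^+ N.+1) q n).
have qn0 n : qp q q n != 0.
  apply: qp_neq0 => k; rewrite -exprS -cm_gt0; have := cmB_ge 1 (q ^+ k.+1);
    rewrite cm1 cmX.
  have : r ^+ k.+1 < 1 by rewrite exprn_ilt1 // ltW.
  by rewrite /r; lra.
have d0 k : 1 - q ^+ k.+1 != 0.
  rewrite -cm_gt0; have := cmB_ge 1 (q ^+ k.+1); rewrite cm1 cmX.
  have : r ^+ k.+1 < 1 by rewrite exprn_ilt1 // ltW.
  by rewrite /r; lra.
have dN N k : 1 - q ^+ N.+1 * q ^+ k != 0 by rewrite -exprD addSn.
have qN0 N n : qp (q ^+ N.+1) q n != 0 by apply: qp_neq0 => k; exact: dN.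
pose D := expR (4 * (r / (1 - r))).
have bq N n : expR (- (2 * (r / (1 - r)))) <= cm (qp (q ^+ N.+1) q n).
  apply: le_trans (rp_lower n (ltW r0) q1) (qp_ge_rp n (ltW r0) q1 _) => k.
  rewrite -exprD cmX; apply: ler_wiXn2l; rewrite ?(ltW r0) ?(ltW q1) //.
  by rewrite addSn ltnS leq_addl.
have gA N : geo (A N) D r.
  move=> n; rewrite /A cmM cmV cmM cmX mulrC; apply: ler_pM.
  - by rewrite invr_ge0 mulr_ge0 ?cm_ge0.
  - by rewrite exprn_ge0 ?cm_ge0.
  - have -> : D = (expR (- (2 * (r / (1 - r)))) * expR (- (2 * (r / (1 - r)))))^-1.
      by rewrite -expRD -expRN; congr expR; ring.
    rewrite lef_pV2 ?posrE ?mulr_gt0 ?expR_gt0 ?cm_gt0 //.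
    by apply: ler_pM; rewrite ?expR_ge0 // -[q in qp q q n]expr1.
  - apply: ler_wiXn2l; rewrite ?(ltW r0) ?(ltW q1) //.
    by case: n => // n; rewrite expnS expn1; nia.
have [g gP] : exists g : nat -> C, forall N, csum (A N) (g N).
  have H N : exists l, csum (A N) l by exact: geo_cvg (gA N) (ltW r0) q1.
  by exists (fun N => projT1 (cid (H N))) => N; exact: projT2 (cid (H N)).
have step N : (1 - q ^+ N.+1) * g N = g N.+1.
  pose c n := - (1 - q ^+ N.+1) * (1 - q ^+ n) * A N n.
  have tele n : c n.+1 - c n = (1 - q ^+ N.+1) * A N n + -1 * A N.+1 n.
    have E : (1 - q ^+ N.+1) * qp (q ^+ N.+2) q n =
      qp (q ^+ N.+1) q n * (1 - q ^+ N.+1 * q ^+ n).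
      by rewrite -qpS qpSl [q ^+ N.+1 * q]mulrC -exprS.
    have AN1 : A N.+1 n = A N n * (q ^+ n * (1 - q ^+ N.+1) / (1 - q ^+ N.+1 * q ^+ n)).
      rewrite /A (_ : (N.+1 * n + n ^ 2 = N * n + n ^ 2 + n)%N); last by lia.
      rewrite (exprD _ _ n).
      have -> : qp (q ^+ N.+2) q n = qp (q ^+ N.+1) q n * (1 - q ^+ N.+1 *
        q ^+ n) / (1 - q ^+ N.+1).
        by rewrite -E; field; exact: d0.
      have h1 := qn0 n; have h2 := qN0 N n; have h3 := dN N n; have h4 := d0 N.
      set a := qp _ _ _ in h1 *; set b := qp _ _ _ in h2 *;
        set u := q ^+ N.+1 in h3 h4 *; set v := q ^+ n in h3 *.
      by field; rewrite h1 h2 h3 h4.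
    have ANS : A N n.+1 = A N n * (q ^+ N.+1 * q ^+ n ^+ 2 / ((1 - q * q ^+ n) *
      (1 - q ^+ N.+1 * q ^+ n))).
      rewrite /A !qpS (_ : (N * n.+1 + n.+1 ^ 2 = N * n + n ^ 2 + N.+1 + n * 2)%N);
        last by rewrite !expnS !expn0; lia.
      rewrite (exprD _ _ (n * 2)) (exprD _ _ N.+1) exprM.
      have h1 := qn0 n; have h2 := qN0 N n; have h3 := dN N n; have h4 := d0 n;
        rewrite exprS in h4.
      set a := qp _ _ _ in h1 *; set b := qp _ _ _ in h2 *;
        set u := q ^+ N.+1 in h3 *; set v := q ^+ n in h3 h4 *.
      by field; rewrite h1 h2 h3 h4.
    rewrite /c AN1 ANS (exprS q n).
    have h3 := dN N n; have h4 := d0 n; rewrite exprS in h4.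
    set u := q ^+ N.+1 in h3 *; set v := q ^+ n in h3 h4 *.
    by field; rewrite h3 h4.
  have c0 : ccvg c 0.
    apply: (@geo_ccvg0 _ _ (cm (- (1 - q ^+ N.+1)) * 2 * D) r) => //; last exact: ltW.
    move=> n; rewrite /c (cmM _ (A N n)) (cmM (- _)) -!mulrA ler_wpM2l ?cm_ge0 //.
    apply: ler_pM; rewrite ?cm_ge0 //; last exact: gA.
    apply: (le_trans (cmB _ _)); rewrite cm1 cmX.
    by have : r ^+ n <= 1; [rewrite exprn_ile1 // ltW|rewrite /r; lra].
  have S1 := csum_tele c0.
  have S2 : csum (fun n => c n.+1 - c n) ((1 - q ^+ N.+1) * g N + -1 * g N.+1).
    apply: (@csum_ext _ (fun n => (1 - q ^+ N.+1) * A N n + -1 * A N.+1 n));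
      first by move=> n; rewrite tele.
    by apply: csumD; apply: csumZ; exact: gP.
  have := ccvg_uniq S2 S1; rewrite /c expr0 subrr mulr0 mul0r subrr mulN1r => /eqP.
  by rewrite subr_eq0 => /eqP.
have gN N : g 0%N * qp q q N = g N.
  elim: N => [|N IH]; first by rewrite qp0 mulr1.
  by rewrite qpS mulrA IH -exprS mulrC step.
have g1 : ccvg g 1.
  have [M hM] := geo_cvg (gA 0%N) (ltW r0) q1.
  move=> e e0; have D0 : 0 <= D by exact: expR_ge0.
  have Dr0 : 0 <= D / (1 - r) by rewrite divr_ge0 //; rewrite subr_ge0 ltW.
  have [N0 hN] := expr_small (ltW r0) q1 Dr0 e0.
  exists N0 => N NN; apply: le_lt_trans (hN _ NN).
  have S := csum_S (gP N).
  have A0 : A N 0%N = 1 by rewrite /A !qp0 muln0 exp0n // expr0 mulr1 invr1 mulr1.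
  rewrite A0 in S.
  have G : geo (fun n => A N n.+1) (D * r ^+ N) r.
    move=> n; rewrite /A cmM cmV cmM cmX mulrC -mulrA; apply: ler_pM.
    - by rewrite invr_ge0 mulr_ge0 ?cm_ge0.
    - by rewrite exprn_ge0 ?cm_ge0.
    - have -> : D = (expR (- (2 * (r / (1 - r)))) * expR (- (2 * (r / (1 - r)))))^-1.
        by rewrite -expRD -expRN; congr expR; ring.
      rewrite lef_pV2 ?posrE ?mulr_gt0 ?expR_gt0 ?cm_gt0 //.
      by apply: ler_pM; rewrite ?expR_ge0 // -[q in qp q q n.+1]expr1.
    - rewrite -exprD; apply: ler_wiXn2l; rewrite ?(ltW r0) ?(ltW q1) //.
      by rewrite mulnS expnS expn1; nia.
  apply: (le_trans (csum_le S G (ltW r0) q1)).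
  by rewrite le_eqVlt; apply/orP; left; apply/eqP; ring.
have KE : Ku 1 q = g 0%N.
  have h : csum (kterm 1 q) (Ku 1 q) by apply: (@Ku_csum _ _ r); rewrite ?mul1r ?divr1.
  apply: (ccvg_uniq h); apply: csum_ext (gP 0%N) => n.
  by rewrite /A /kterm mul0n add0n mul1r divr1 expr1.
rewrite KE; apply: (ccvg_uniq (ccvgZ (g 0%N) (qpi_cvg q q1))).
by apply: ccvg_ext g1 => N; rewrite gN.
Qed.

End UniversalMock.

(** * Simple poles *)

Section Poles.
Variable R : realType.
Local Notation C := (Cplx R).
Implicit Types (u z w P a b r : C) (h g : C -> C).
Local Notation cexp := (@cexp R).
Local Notation qexp := (@qexp R).

(** The residue r may be 0, in which case the singularity at P is removable.
    Nothing is said about the value at P. *)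
Definition simple_pole h P r := exists2 L : R, 0 < L & exists M : R, forall z,
  0 < cm (z - P) <= L -> sdiff h z /\ cm (h z - r / (z - P)) <= M.

Definition sdiff_on h P (L : R) := forall z, cm (z - P) <= L -> sdiff h z.

Lemma pol_near h g P r (d : R) : 0 < d ->
  (forall z, 0 < cm (z - P) < d -> h z = g z) -> simple_pole h P r -> simple_pole g P r.
Proof.
move=> d0 hg [L L0 [M hL]]; have m0 : 0 < Num.min L (d / 2) by rewrite lt_min L0; lra.
exists (Num.min L (d / 2)) => //; exists M => z /andP[z0].
rewrite le_min => /andP[zL zd]; have zd' : cm (z - P) < d by lra.
have [|s b] := hL z; first by rewrite z0.
split; last by rewrite -hg // z0.
have e0 : 0 < Num.min (cm (z - P)) (d - cm (z - P)) by rewrite lt_min z0; lra.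
apply: (@sdiff_near _ h g z _ e0) => // x; rewrite lt_min => /andP[x1 x2]; apply: hg.
have := cm_tri z x P; have := cm_tri x z P; rewrite (cmBC z x); lra.
Qed.

Lemma pol_ext h g P r : h =1 g -> simple_pole h P r -> simple_pole g P r.
Proof. by move=> hg; apply: (@pol_near _ _ _ _ 1). Qed.

Lemma sdiff_pol h P (L : R) : 0 < L -> sdiff_on h P L -> simple_pole h P 0.
Proof.
move=> L0 hL; have sP : sdiff h P by apply: hL; rewrite subrr cm0 ltW.
have [d d0 [B B0 hB]] := sdiff_bounded sP.
exists (Num.min L (d / 2)); first by rewrite lt_min L0; lra.
exists B => z /andP[z0]; rewrite le_min => /andP[zL zd]; split; first exact: hL.
by rewrite mul0r subr0; apply: hB; lra.
Qed.

Lemma entire_pol h P : (forall z, sdiff h z) -> simple_pole h P 0.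
Proof. by move=> hs; apply: (@sdiff_pol _ _ 1) => // z _. Qed.

Lemma polD h g P a b : simple_pole h P a -> simple_pole g P b ->
  simple_pole (fun z => h z + g z) P (a + b).
Proof.
move=> [L1 L10 [M1 h1]] [L2 L20 [M2 h2]].
exists (Num.min L1 L2); first by rewrite lt_min L10.
exists (M1 + M2) => z /andP[z0]; rewrite le_min => /andP[zL1 zL2].
have [|s1 b1] := h1 z; first by rewrite z0.
have [|s2 b2] := h2 z; first by rewrite z0.
split; first exact: sdiffD.
have -> : h z + g z - (a + b) / (z - P) = (h z - a / (z - P)) +
  (g z - b / (z - P)) by ring.
by apply: (le_trans (cmD _ _)); exact: lerD.
Qed.

Lemma polM h g P r (L : R) : 0 < L -> sdiff_on g P L -> simple_pole h P r ->
  simple_pole (fun z => h z * g z) P (r * g P).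
Proof.
move=> L0 gs [L1 L10 [M1 h1]].
have sP : sdiff g P by apply: gs; rewrite subrr cm0 ltW.
have [d1 d10 [B B0 hB]] := sdiff_bounded sP.
have [a ga] := sP; have [d2 d20 h2] := sderiv_lip ga.
exists (Num.min (Num.min L L1) (Num.min (d1 / 2) (d2 / 2))).
  by rewrite !lt_min L0 L10; apply/andP; split; lra.
exists (M1 * B + cm r * (cm a + 1)) => z /andP[z0].
rewrite !le_min => /andP[/andP[zL zL1] /andP[zd1 zd2]].
have [|s1 b1] := h1 z; first by rewrite z0.
split; first by apply: sdiffM => //; exact: gs.
have zP : z - P != 0 by rewrite -cm_gt0.
have -> : h z * g z - r * g P / (z - P) = (h z - r / (z - P)) * g z +
  r * ((g z - g P) / (z - P)).
  by field.
apply: (le_trans (cmD _ _)); rewrite (cmM _ (g z)) (cmM r) (cmM (g z - g P)) cmV;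
  apply: lerD.
  by apply: ler_pM; rewrite ?cm_ge0 // hB //; lra.
rewrite ler_wpM2l ?cm_ge0 // ler_pdivrMr //; apply: h2; last lra.
by rewrite subrr cm0.
Qed.

Lemma polZ c h P r : simple_pole h P r -> simple_pole (fun z => c * h z) P (c * r).
Proof.
move=> hp; apply: (@pol_ext (fun z => h z * c)); first by move=> z; rewrite mulrC.
rewrite mulrC; apply: (@polM _ (fun=> c) _ _ 1) => // z _; exact: sdiff_cst.
Qed.

Lemma polB h g P a b : simple_pole h P a -> simple_pole g P b ->
  simple_pole (fun z => h z - g z) P (a - b).
Proof.
move=> ha hb; rewrite -mulN1r; apply: (@pol_ext (fun z => h z + -1 * g z)).
  by move=> z; rewrite mulN1r.
by apply: polD => //; exact: polZ.
Qed.

Lemma pol_comp h P r a b : a != 0 -> simple_pole h (a * P + b) r ->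
  simple_pole (fun z => h (a * z + b)) P (r / a).
Proof.
move=> a0 [L L0 [M hL]]; have ca : 0 < cm a by rewrite cm_gt0.
exists (L / cm a); first by rewrite divr_gt0.
exists M => z /andP[z0 zL].
have E : a * z + b - (a * P + b) = a * (z - P) by ring.
have [|s B] := hL (a * z + b).
  by rewrite E cmM mulr_gt0 //= mulrC -ler_pdivlMr.
split; first exact: sdiff_compl.
have zP : z - P != 0 by rewrite -cm_gt0.
have -> // : r / a / (z - P) = r / (a * z + b - (a * P + b)).
by rewrite E; field; rewrite a0 zP.
Qed.

Lemma pol_sum (I : Type) (s : seq I) (F : I -> C -> C) P :
  (forall i, simple_pole (F i) P 0) -> simple_pole (fun z => \sum_(i <- s) F i z) P 0.
Proof.
move=> hF; elim: s => [|i s IH].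
  apply: (@pol_ext (fun=> 0)); first by move=> z; rewrite big_nil.
  by apply: entire_pol => z; exact: sdiff_cst.
apply: (@pol_ext (fun z => F i z + \sum_(i <- s) F i z)); first by move=> z;
  rewrite big_cons.
by have H := polD (hF i) IH; rewrite addr0 in H.
Qed.

(** The quadratic remainder comes from [strict_estimate], whose linear
    coefficient must be 1 by [cexp_near0]. *)
Lemma cexp_taylor2 : exists2 K : R, 0 < K & forall z, cm z <= 1 / 4 ->
  cm (cexp z - 1 - z) <= K * cm z ^+ 2.
Proof.
have L1 : 0 < 1 :> R := ltr01.
have [z _|z zL|a _ ha] := @strict_estimate R cexp 0 1 (expR 1) L1.
- exact: sdiff_cexp.
- rewrite cm_cexp ler_expR.
  by have := Re_le z; rewrite ler_norml => /andP[_]; move: zL; rewrite subr0; lra.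
pose K := 8 * expR 1 + 1 : R.
have K0 : 0 < K by have := expR_gt0 (1 : R); rewrite /K; lra.
have est z : cm z <= 1 / 4 -> cm (cexp z - 1 - a * z) <= K * cm z ^+ 2.
  move=> z4; have := ha (cm z) 0 z;
    rewrite !subr0 cm0 cexp0 => /(_ z4 (cm_ge0 z) (lexx _)).
  rewrite expr1n divr1 => h; apply: (le_trans h);
    rewrite expr2 mulrA ler_wpM2r ?cm_ge0 //.
  by rewrite ler_wpM2r ?cm_ge0 // /K; lra.
suff a1 : a = 1 by exists K => // z /est; rewrite a1 mul1r.
apply/eqP; rewrite -subr_eq0 -cm_eq0 eq_le cm_ge0 andbT.
apply/ler_addgt0Pl => e e0; rewrite addr0; have e20 : 0 < e / 2 by lra.
have [d d0 hd] := cexp_near0 e20.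
pose t : R := Num.min (Num.min (1 / 4) (d / 2)) (e / (2 * K)).
have t0 : 0 < t by rewrite !lt_min !divr_gt0 // mulr_gt0.
have [t1 t2 t3] : [/\ t <= 1 / 4, t <= d / 2 & t <= e / (2 * K)].
  by split; rewrite /t !ge_min lexx ?orbT.
have t3' : t * (2 * K) <= e by rewrite -ler_pdivlMr // mulr_gt0.
have ct : cm ((t%:C)%C : C) = t by rewrite cm_real gtr0_norm.
have := est ((t%:C)%C : C); rewrite ct => /(_ t1) E1.
have := hd ((t%:C)%C : C); rewrite ct => H;
  have {H}E2 : cm (cexp (t%:C)%C - 1 - (t%:C)%C) <= e / 2 * t by apply: H; lra.
rewrite -(ler_pM2r t0) -{1}ct -cmM.
have -> : (a - 1) * (t%:C)%C = (cexp (t%:C)%C - 1 - (t%:C)%C) - (cexp (t%:C)%C - 1 - a * (t%:C)%C) by ring.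
by apply: (le_trans (cmB _ _)); nra.
Qed.

Definition tpi : C := two_pi_i R.
Lemma tpi_neq0 : tpi != 0.
Proof. by rewrite -cm_gt0 /tpi cm_imag normr_gt0 mulf_neq0 // gt_eqF // pi_gt0. Qed.

(** The residue of 1 / (1 - e(z)) at the integers. *)
Definition rho : C := - tpi^-1.

Lemma pol_inv_qexp0 : simple_pole (fun z => (1 - qexp z)^-1) 0 rho.
Proof.
have [K K0 hK] := cexp_taylor2; have p0 := tpi_neq0.
have c0 : 0 < cm tpi by rewrite cm_gt0.
pose L := Num.min (1 / 4) (1 / (2 * K)) / cm tpi.
have m0 : 0 < Num.min (1 / 4) (1 / (2 * K)) by rewrite lt_min !divr_gt0 // mulr_gt0.
exists L; first by rewrite divr_gt0.
exists (2 * K) => z; rewrite subr0 ler_pdivlMr // mulrC => /andP[z0].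
rewrite le_min => /andP[z1 z2].
pose y := tpi * z; have cy : cm y = cm z * cm tpi by rewrite cmM mulrC.
have y0 : 0 < cm y by rewrite cy mulr_gt0.
have yn0 : y != 0 by rewrite -cm_gt0.
have zn0 : z != 0 by rewrite -cm_gt0; move: z0; rewrite cm_gt0.
have y4 : cm y <= 1 / 4 by rewrite cy mulrC.
have y2 : cm y * (2 * K) <= 1 by rewrite -ler_pdivlMr ?mulr_gt0 // cy mulrC.
have E := hK y y4.
have qE : qexp z = cexp y by [].
have big : cm y / 2 <= cm (1 - qexp z).
  rewrite qE; have := cmB_ge y (- (cexp y - 1 - y)); rewrite cmN.
  have -> : y - - (cexp y - 1 - y) = - (1 - cexp y) by ring.
  rewrite cmN; nra.
have d0 : 1 - qexp z != 0 by rewrite -cm_gt0; lra.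
split.
  apply: (@sdiffV _ (fun z => 1 - qexp z)) => //.
  by apply: sdiffB; [exact: sdiff_cst|exact: sdiff_qexp].
have -> : (1 - qexp z)^-1 - rho / z = - (cexp y - 1 - y) / (y * (1 - qexp z)) .
  by rewrite qE in d0 *; rewrite /rho /y in d0 *; field; rewrite p0 zn0 d0.
rewrite cmM cmN cmV cmM ler_pdivrMr ?mulr_gt0 ?cm_gt0 //.
apply: (le_trans E).
have : 0 <= K * cm y * (2 * cm (1 - qexp z) - cm y).
  by rewrite !mulr_ge0 ?cm_ge0 // ?(ltW K0) //; lra.
by lra.
Qed.

Definition inlat (t u : C) := exists l m : int, u = l%:~R * t + m%:~R.

(** Two lattice points at distance less than min(1, Im t) coincide. *)
Lemma lattice_discrete t P : 0 < complex.Im t -> exists2 L : R, 0 < L &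
  forall z, 0 < cm (z - P) <= L -> ~ inlat t z.
Proof.
move=> t0; pose d := Num.min 1 (complex.Im t).
have d0 : 0 < d by rewrite lt_min ltr01.
have sep z w : inlat t z -> inlat t w -> cm (z - w) < d -> z = w.
  move=> [l [m ->]] [l' [m' ->]].
  have -> : l%:~R * t + m%:~R - (l'%:~R * t + m'%:~R) =
    (l - l')%:~R * t + (m - m')%:~R :> C.
    by rewrite !intrB; ring.
  rewrite -!realC_int lt_min => /andP[h1 h2].
  have ll : l - l' = 0.
    have := le_lt_trans (Im_le _) h2;
      rewrite ImD cImM /= mul0r addr0 addr0 normrM (gtr0_norm t0).
    rewrite -[X in _ < X]mul1r ltr_pM2r // -intr_norm ltrz1 -lezD1 => H.
    by apply/eqP; rewrite -normr_eq0 eq_le normr_ge0 andbT -(lerD2r 1).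
  have mm : m - m' = 0.
    move: h1; rewrite ll /= mul0r add0r cm_real -intr_norm ltrz1 -lezD1 => H.
    by apply/eqP; rewrite -normr_eq0 eq_le normr_ge0 andbT -(lerD2r 1).
  by rewrite -(subr0_eq ll) -(subr0_eq mm).
have [[z [zl z0 zd]]|no] := pselect (exists z, [/\ inlat t z, 0 < cm (z - P) &
  cm (z - P) < d / 2]).
  exists (Num.min (d / 3) (cm (z - P) / 2)); first by rewrite lt_min divr_gt0 //=; lra.
  move=> w /andP[w0]; rewrite le_min => /andP[w1 w2] wl.
  have e : z = w by apply: sep => //; have := cm_tri P z w; rewrite (cmBC P w); lra.
  by move: w2 z0; rewrite e; lra.
exists (d / 3); first by lra.
by move=> z /andP[z0 zd] zl; apply: no; exists z; split => //; lra.
Qed.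

End Poles.

(** * Residues of the universal mock theta function *)

Section NFunction.
Variable R : realType.
Local Notation C := (Cplx R).
Implicit Types (u z w P a b r t : C) (h g : C -> C).
Local Notation cexp := (@cexp R).
Local Notation qexp := (@qexp R).

(** The Euler product is included because by [Ku1] it cancels the value of (1 -
    x) E(x; q) at x = 1, which leaves an exponential as residue. *)
Definition mockN t u : C := qexp (u / 2) * Eu (qexp u) (qexp t) * qpi (qexp t) (qexp t).

Section FixTau.
Variable t : C.
Hypothesis t0 : 0 < complex.Im t.

Let q := qexp t.

Lemma nome_neq0 : q != 0. Proof. exact: qexp_neq0. Qed.
Lemma nome_lt1 : cm q < 1.
Proof.
by rewrite /q cm_qexp -expR0 ltr_expR oppr_lt0 !mulr_gt0 // pi_gt0.
Qed.

Lemma qexpDn z k : qexp z * q ^+ k = qexp (z + k%:R * t).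
Proof. by rewrite qexpD qexpMn. Qed.

Lemma notlat_regular u : ~ inlat t u -> regular (qexp u) q.
Proof.
move=> nl; split; first exact: qexp_neq0.
  move=> k; rewrite qexpDn subr_eq0; apply/eqP => /esym /qexp_eq1 [m e]; apply: nl.
  by exists (- k%:Z), m; rewrite -e mulrNz -pmulrn; ring.
move=> k; rewrite -qexpB qexpDn subr_eq0; apply/eqP => /esym /qexp_eq1 [m e]; apply: nl.
exists (k.+1%:Z), (- m); rewrite mulrNz -e -pmulrn -natr1; ring.
Qed.

Lemma inlatD u (l m : int) : inlat t u -> inlat t (u + l%:~R * t + m%:~R).
Proof. by move=> [l' [m' ->]]; exists (l' + l), (m' + m); rewrite !intrD; ring. Qed.

Lemma notlatS u : ~ inlat t u -> ~ inlat t (u + t).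
Proof.
by move=> h h2; apply: h; have := inlatD (-1) 0 h2; rewrite mulrN1z mulN1r addrK addr0.
Qed.

Lemma notlatN u : ~ inlat t u -> ~ inlat t (- u).
Proof.
by move=> h [l [m e]]; apply: h; exists (- l), (- m); rewrite -[u]opprK e !intrN; ring.
Qed.

Lemma mockN_tau u : ~ inlat t u -> mockN t (u + t) =
  - qexp (3 * u + 3 * t / 2) * mockN t u +
  qpi q q * (qexp (u / 2 + t / 2) * (1 - qexp (2 * u + t))).
Proof.
move=> nl; have E := Eu_shift nome_neq0 nome_lt1 (notlat_regular nl).
have {}E : Eu (qexp u * q) q = 1 - q * qexp u ^+ 2 - q * qexp u ^+ 3 * Eu (qexp u) q.
  by rewrite -E addrK.
rewrite /mockN [qexp (u + t)]qexpD -/q E.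
have -> : (u + t) / 2 = u / 2 + t / 2 by ring.
have -> : qexp (2 * u + t) = q * qexp u ^+ 2 by rewrite qexpD (qexpMn 2) mulrC.
have -> : qexp (3 * u + 3 * t / 2) = qexp (t / 2) * q * qexp u ^+ 3.
  have -> : 3 * u + 3 * t / 2 = t / 2 + t + 3%:R * u by field.
  by rewrite !qexpD qexpMn.
rewrite qexpD; ring.
Qed.

(** In the strip |Im u| < Im t the point x = e(u) lies in the annulus where (1
    - x) E(x; q) is regular. *)
Lemma strip_bounds P : `|complex.Im P| < complex.Im t ->
  exists2 L : R, 0 < L & exists2 s : R, s < 1 &
  forall z, cm (z - P) <= L -> [/\ cm q <= s, cm (qexp z * q) <=
    s & cm (q / qexp z) <= s].
Proof.
move=> Pt; have p0 := pi_gt0 R.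
pose d := (complex.Im t - `|complex.Im P|) / 2.
have d0 : 0 < d by rewrite /d; lra.
exists d => //; exists (expR (- (2 * pi * d))).
  by rewrite -expR0 ltr_expR oppr_lt0; apply: mulr_gt0 => //; exact: mulr_gt0.
move=> z zP; have := le_trans (Im_le _) zP; rewrite ImD ImN ler_norml => /andP[h1 h2].
have := lexx `|complex.Im P|; rewrite {1}ler_norml => /andP[h3 h4].
have pp : 0 < 2 * pi :> R by rewrite mulr_gt0.
rewrite -qexpD -qexpB !cm_qexp !ler_expR ImD ImD ImN !lerN2 !ler_pM2l //.
by have := normr_ge0 (complex.Im P); rewrite /d in h1 h2 *; split; lra.
Qed.

Definition Kf u : C := qexp (u / 2) * Ku (qexp u) q * qpi q q.

Lemma sdiff_half z : sdiff (fun z => qexp (z / 2)) z.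
Proof.
by apply: (@sdiff_comp _ qexp (fun z => z / 2)); [apply: sdiffM;
  [exact: sdiff_id|exact: sdiff_cst]|exact: sdiff_qexp].
Qed.

Lemma Kf_sdiff P : `|complex.Im P| < complex.Im t -> sdiff Kf P.
Proof.
move=> Pt; have [L L0 [s s1 bd]] := strip_bounds Pt.
apply: sdiffM; last exact: sdiff_cst.
apply: sdiffM; first exact: sdiff_half.
apply: (@Ku_sdiff _ qexp (fun=> q) P L s) => // z zL.
by split; [exact: sdiff_qexp|exact: sdiff_cst|exact: qexp_neq0].
Qed.

Lemma mockN_Kf u : `|complex.Im u| < complex.Im t -> qexp u != 1 ->
  mockN t u = Kf u * (1 - qexp u)^-1.
Proof.
move=> ut x1; have [L L0 [s s1 bd]] := strip_bounds ut.
have [|b1 b2 b3] := bd u; first by rewrite subrr cm0 ltW.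
rewrite /mockN /Kf -/q (Eu_Ku nome_neq0 b1 s1 b2 b3); first by rewrite !mulrA; ring.
exact: regular_annulus b1 s1 b2 b3 (qexp_neq0 _) x1.
Qed.

Lemma strip_near P : `|complex.Im P| < complex.Im t ->
  exists2 L : R, 0 < L & forall z, cm (z - P) <= L -> `|complex.Im z| < complex.Im t.
Proof.
move=> Pt; exists ((complex.Im t - `|complex.Im P|) / 2); first by lra.
move=> z zP; have := le_trans (Im_le _) zP; rewrite ImD ImN => h.
have := ler_normD (complex.Im z - complex.Im P) (complex.Im P); rewrite subrK; lra.
Qed.

Lemma Kf_int (m : int) : Kf m%:~R = qexp (m%:~R / 2).
Proof. by rewrite /Kf qexp_int -mulrA Ku1 ?mulr1 ?nome_neq0 ?nome_lt1. Qed.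

Lemma pol_inv_qexp (m : int) : simple_pole (fun z =>
  (1 - qexp z)^-1) (m%:~R : C) (@rho R).
Proof.
have H : simple_pole (fun z => (1 - qexp z)^-1) (1 * (m%:~R : C) + (- m)%:~R) (@rho R).
  by rewrite mul1r -intrD subrr; exact: pol_inv_qexp0.
have := pol_comp (oner_neq0 _) H; rewrite divr1; apply: pol_ext => z.
by rewrite mul1r qexpDint.
Qed.

Definition res_mockN (s : C) (l m : int) : C :=
  @rho R * qexp ((l + m)%:~R / 2 + 3 * l%:~R ^+ 2 * s / 2).

(** The relation is total in P, so that regular points, with residue 0, and
    lattice points can be moved by the same lemmas. *)
Definition isres (s P r : C) := (exists l m : int, P = l%:~R * s + m%:~R /\ r =
  res_mockN s l m) \/
  (~ inlat s P /\ r = 0).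

Lemma pol_mockN_strip P r : `|complex.Im P| < complex.Im t -> isres t P r ->
  simple_pole (mockN t) P r.
Proof.
move=> Pt Pr; have [L L0 hL] := strip_near Pt.
have Ks : sdiff_on Kf P L by move=> z zL; exact/Kf_sdiff/hL.
have [L' L'0 hL'] := lattice_discrete P t0.
have nearE z : 0 < cm (z - P) < Num.min L L' -> (1 - qexp z)^-1 * Kf z = mockN t z.
  rewrite lt_min => /andP[z0 /andP[zL zL']]; rewrite mulrC -mockN_Kf //;
    first by apply: hL; exact: ltW.
  apply/eqP => /qexp_eq1 [m e]; apply: (hL' z); first by rewrite z0 ltW.
  by exists 0, m; rewrite mul0r add0r.
have m0 : 0 < Num.min L L' by rewrite lt_min L0.
apply: (pol_near m0 nearE).
case: Pr => [[l [m [PE ->]]]|[nl ->]].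
  have l0 : l = 0.
    move: Pt; rewrite PE -!realC_int ImD cImM /= mul0r addr0 addr0 normrM (gtr0_norm t0).
    rewrite -[X in _ < X]mul1r ltr_pM2r // -intr_norm ltrz1 -lezD1 => H.
    by apply/eqP; rewrite -normr_eq0 eq_le normr_ge0 andbT -(lerD2r 1).
  have Pm : P = m%:~R by rewrite PE l0 mul0r add0r.
  have -> : res_mockN t l m = @rho R * Kf P.
    by rewrite /res_mockN l0 Pm Kf_int add0r expr0n /= mulr0 mul0r mul0r addr0.
  by apply: polM L0 Ks _; rewrite Pm; exact: pol_inv_qexp.
rewrite -(mul0r (Kf P)); apply: polM L0 Ks _.
have x1 : 1 - qexp P != 0.
  rewrite subr_eq0; apply/eqP => /esym /qexp_eq1 [m e]; apply: nl.
  by exists 0, m; rewrite mul0r add0r.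
apply: (sdiff_pol L'0) => z zL'; apply: (@sdiffV _ (fun z => 1 - qexp z)); last first.
  by apply: sdiffB; [exact: sdiff_cst|exact: sdiff_qexp].
have [->//|zP] := eqVneq z P.
rewrite subr_eq0; apply/eqP => /esym /qexp_eq1 [m e]; apply: (hL' z).
  by rewrite cm_gt0 subr_eq0 zP.
by exists 0, m; rewrite mul0r add0r.
Qed.

(** The residues satisfy the homogeneous form of [mockN_tau], the inhomogeneous
    term being entire. *)
Lemma isresS P r : isres t P r -> isres t (P + t) (- qexp (3 * P + 3 * t / 2) * r).
Proof.
case=> [[l [m [-> ->]]]|[nl ->]]; last first.
  by right; rewrite mulr0; split=> //; exact: notlatS.
left; exists (l + 1), m; rewrite intrD; split; first by ring.
rewrite /res_mockN mulrCA; congr (_ * _).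
have -> : - qexp (3 * (l%:~R * t + m%:~R) + 3 * t / 2) =
  qexp (1 / 2) * qexp (3 * (l%:~R * t + m%:~R) + 3 * t / 2) by rewrite qexp_half mulN1r.
rewrite -!qexpD !intrD.
have -> : ((l%:~R + 1 + m%:~R) / 2 + 3 * (l%:~R + 1) ^+ 2 * t / 2 : C) =
  (1 / 2 + (3 * (l%:~R * t + m%:~R) + 3 * t / 2) + ((l%:~R + m%:~R) / 2 +
    3 * l%:~R ^+ 2 * t / 2)) +
   (- 3 * m)%:~R by rewrite intrM; field.
by rewrite qexpDint.
Qed.

Lemma isres_uniq P r r' : isres t P r -> isres t P r' -> r = r'.
Proof.
case=> [[l [m [e ->]]]|[nl ->]] [[l' [m' [e' ->]]]|[nl' ->]] //; last 2 first.
- by case: nl'; exists l, m.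
- by case: nl; exists l', m'.
have : (l%:~R * t + m%:~R : C) = l'%:~R * t + m'%:~R by rewrite -e -e'.
have ll : l = l'.
  have : complex.Im (l%:~R * t + m%:~R : C) =
    complex.Im (l'%:~R * t + m'%:~R : C) by rewrite -e -e'.
  rewrite -!realC_int !ImD !cImM /= !mul0r !addr0.
  by move=> /(mulIf (lt0r_neq0 t0))/eqP; rewrite eqr_int => /eqP.
by rewrite ll => /addrI/eqP; rewrite eqr_int => /eqP ->.
Qed.

Lemma isres_ex P : exists r, isres t P r.
Proof.
have [[l [m e]]|nl] := pselect (inlat t P); last by exists 0; right.
by exists (res_mockN t l m); left; exists l, m.
Qed.

Lemma sdiff_lin (a b : C) z : sdiff (fun z => qexp (a * z + b)) z.
Proof. by apply: (@sdiff_compl _ qexp); exact: sdiff_qexp. Qed.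

Lemma pol_mockN_up P r : isres t P r -> simple_pole (mockN t) P r ->
  forall r', isres t (P + t) r' -> simple_pole (mockN t) (P + t) r'.
Proof.
move=> Pr hp r' /(isres_uniq (isresS Pr)) <-.
have [L L0 hL] := lattice_discrete P t0.
pose g v := mockN t v * (- qexp (3 * v + 3 * t / 2)) + qpi q q * (qexp (v / 2 +
  t / 2) * (1 - qexp (2 * v + t))).
have gp : simple_pole g P (- qexp (3 * P + 3 * t / 2) * r).
  rewrite mulrC -[r * _]addr0; apply: polD.
    by apply: (polM ltr01) => // z _; apply: sdiffN; exact: sdiff_lin.
  apply: entire_pol => z; apply: sdiffM; first exact: sdiff_cst.
  apply: sdiffM; last by apply: sdiffB; [exact: sdiff_cst|exact: sdiff_lin].
  by apply: (@sdiff_ext _ (fun v => qexp (2^-1 * v + t / 2))); [move=> v;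
    rewrite mulrC|exact: sdiff_lin].
have : simple_pole g (1 * (P + t) + (- t)) (- qexp (3 * P +
  3 * t / 2) * r) by rewrite mul1r addrK.
move=> /(pol_comp (oner_neq0 _)); rewrite divr1; apply: (pol_near L0).
move=> z zL; rewrite mul1r /g mulrC -mockN_tau ?subrK //.
apply: hL; have -> : z - t - P = z - (P + t) by ring.
by move: zL => /andP[-> /ltW ->].
Qed.

Lemma pol_mockN_down P r : isres t (P + t) r -> simple_pole (mockN t) (P + t) r ->
  forall r', isres t P r' -> simple_pole (mockN t) P r'.
Proof.
move=> Pr hp r' Pr'; have rE := isres_uniq Pr (isresS Pr').
have [L L0 hL] := lattice_discrete P t0.
have : simple_pole (mockN t) (1 * P + t) r by rewrite mul1r.
move=> /(pol_comp (oner_neq0 _)); rewrite divr1 => hp2.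
pose g v := (mockN t (1 * v + t) - qpi q q * (qexp (v / 2 +
  t / 2) * (1 - qexp (2 * v + t)))) * (- qexp (-3 * v + - (3 * t / 2))).
have gp : simple_pole g P ((r - 0) * (- qexp (-3 * P + - (3 * t / 2)))).
  apply: (polM ltr01) => [z _|]; first by apply: sdiffN; exact: sdiff_lin.
  apply: polB => //.
  apply: entire_pol => z; apply: sdiffM; first exact: sdiff_cst.
  apply: sdiffM; last by apply: sdiffB; [exact: sdiff_cst|exact: sdiff_lin].
  by apply: (@sdiff_ext _ (fun v => qexp (2^-1 * v + t / 2))); [move=> v;
    rewrite mulrC|exact: sdiff_lin].
have canc v : qexp (3 * v + 3 * t / 2) * qexp (-3 * v + - (3 * t / 2)) = 1.
  by rewrite -qexpD -qexp0; congr Defs.qexp; ring.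
have -> : r' = (r - 0) * (- qexp (-3 * P + - (3 * t / 2))).
  rewrite rE subr0; move: (canc P); set A := qexp (3 * P + _);
    set B := qexp (-3 * P + _) => AB.
  by rewrite mulrN mulrAC !mulNr opprK AB mul1r.
apply: (pol_near L0) gp => z /andP[z0 zL].
rewrite /g mul1r mockN_tau; last by apply: hL; rewrite z0 ltW.
rewrite addrK; move: (canc z); set A := qexp (3 * z + _);
  set B := qexp (-3 * z + _) => AB.
by rewrite mulrN mulrAC !mulNr opprK AB mul1r.
Qed.

(** In the strip around the real axis the poles are those of 1 / (1 - x). The
    functional equation carries the statement upwards and downwards by one
    period at a time. *)
Theorem pol_mockN P r : isres t P r -> simple_pole (mockN t) P r.
Proof.
have key (n : nat) P' r' : `|complex.Im P'| < n.+1%:R * complex.Im t ->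
  isres t P' r' -> simple_pole (mockN t) P' r'.
  elim: n P' r' => [|n IH] P' r' Pn; first by apply: pol_mockN_strip;
    rewrite -[X in _ < X]mul1r.
  move=> Pr'; have [small|big] := ltP `|complex.Im P'| (complex.Im t);
    first exact: pol_mockN_strip.
  move: Pn; rewrite -natr1 mulrDl mul1r => Pn.
  have [p0|p0] := leP 0 (complex.Im P').
    rewrite ger0_norm // in big Pn.
    have [r2 Pr2] := isres_ex (P' - t).
    rewrite -(subrK t P'); apply: (pol_mockN_up Pr2); last by rewrite subrK.
    by apply: IH Pr2; rewrite ImD ImN ger0_norm //; lra.
  rewrite ltr0_norm // in big Pn.
  have [r2 Pr2] := isres_ex (P' + t).
  apply: (pol_mockN_down Pr2) => //; apply: IH Pr2; rewrite ImD ler0_norm //; lra.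
move=> Pr; apply: (key (Num.trunc (`|complex.Im P| / complex.Im t))) => //.
by rewrite -ltr_pdivrMr // truncnS_gt.
Qed.

Lemma mockN_sdiff u : `|complex.Im u| < complex.Im t -> ~ inlat t u -> sdiff (mockN t) u.
Proof.
move=> ut nl; have [L L0 hL] := strip_near ut.
have [L' L'0 hL'] := lattice_discrete u t0.
have m0 : 0 < Num.min L L' by rewrite lt_min L0.
have x1 z : ~ inlat t z -> qexp z != 1.
  by move=> nz; apply/eqP => /qexp_eq1 [m e]; apply: nz; exists 0, m; rewrite mul0r add0r.
apply: (@sdiff_near _ (fun z => Kf z * (1 - qexp z)^-1) _ u (Num.min L L')) => //.
  move=> z; rewrite lt_min => /andP[zL zL']; rewrite mockN_Kf //; first exact/hL/ltW.
  have [->|zu] := eqVneq z u; first exact: x1.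
  by apply/x1/hL'; rewrite cm_gt0 subr_eq0 zu ltW.
apply: sdiffM; first exact: Kf_sdiff.
apply: (@sdiffV _ (fun z => 1 - qexp z)); first by rewrite subr_eq0 eq_sym; exact: x1.
by apply: sdiffB; [exact: sdiff_cst|exact: sdiff_qexp].
Qed.

End FixTau.

End NFunction.

(** * Residues under modular substitutions *)

Section Residues.
Variable R : realType.
Local Notation C := (Cplx R).
Implicit Types (u z w P r t : C) (h g : C -> C) (a b c d l m k : int).
Local Notation cexp := (@cexp R).
Local Notation qexp := (@qexp R).

Definition oddz (x : int) : bool := odd `|x|%N.
Lemma oddzD x y : oddz (x + y) = oddz x (+) oddz y. Proof. rewrite /oddz; lia. Qed.
Lemma oddzN x : oddz (- x) = oddz x. Proof. by rewrite /oddz abszN. Qed.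
Lemma oddzM x y : oddz (x * y) = oddz x && oddz y. Proof. by rewrite /oddz abszM oddM. Qed.
Lemma oddz_even x : ~~ oddz x -> exists k, x = k * 2.
Proof. move=> h; exists (x %/ 2)%Z; rewrite /oddz in h; lia. Qed.
Lemma oddz_odd x : oddz x -> exists k, x = k * 2 + 1.
Proof. move=> h; exists (x %/ 2)%Z; rewrite /oddz in h; lia. Qed.
Definition oddzE := (oddzD, oddzN, oddzM).

Lemma qexp_even (x : int) z : ~~ oddz x -> qexp (z + x%:~R / 2) = qexp z.
Proof. by move=> /oddz_even [k ->]; rewrite intrM mulfK // qexpDint. Qed.
Lemma qexp_odd (x : int) z : oddz x -> qexp (z + x%:~R / 2) = - qexp z.
Proof.
move=> /oddz_odd [k ->];
  rewrite intrD intrM mulrDl mulfK // addrCA addrC qexpDint addrC qexpD.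
by rewrite qexp_half mulN1r.
Qed.

Section Moebius.
Variables (a b c d : int).
Hypothesis dt : a * d - b * c = 1.
Variable t : C.
Hypothesis t0 : 0 < complex.Im t.
Let J : C := c%:~R * t + d%:~R.
Let t1 : C := (a%:~R * t + b%:~R) / J.

Lemma aut_neq0 : J != 0.
Proof.
have ht := t0; apply/eqP => J0.
have c0 : c = 0.
  have : complex.Im J = 0 by rewrite J0.
  rewrite /J -!realC_int ImD cImM /= mul0r addr0 addr0 => /eqP.
  by rewrite mulf_eq0 (gt_eqF ht) orbF intr_eq0 => /eqP.
move: J0; rewrite /J c0 mul0r add0r => /eqP; rewrite intr_eq0 => /eqP d0.
by move: dt; rewrite c0 d0 !mulr0.
Qed.

Lemma Im_moebius : complex.Im t1 = complex.Im t / cm J ^+ 2.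
Proof.
have J0 := aut_neq0.
pose K : C := c%:~R * ((complex.Re t) +i* (- complex.Im t))%C + d%:~R.
have E : J * K = ((cm J ^+ 2)%:C)%C.
  apply: ceq; rewrite /J /K -!realC_int;
    rewrite ?cReM ?cImM ?ReD ?ImD ?cReM ?cImM /=; last by ring.
  by rewrite cmE ReD ImD cReM cImM /=; ring.
have J2 : (cm J ^+ 2) != 0 by rewrite expf_neq0 // cm_eq0.
have -> : t1 = ((a%:~R * t + b%:~R) * K) * (((cm J ^+ 2)^-1)%:C)%C.
  rewrite realCV -E /t1; field.
  have : J * K != 0 by rewrite E; rewrite -cm_gt0 cm_real normr_gt0.
  by rewrite mulf_eq0 negb_or => /andP[-> ->].
rewrite cImM /= mulr0 add0r; congr (_ / _).
rewrite /K -!realC_int cImM !ReD !ImD !cReM !cImM /=.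
have D : (a%:~R * d%:~R - b%:~R * c%:~R : R) = 1 by rewrite -!intrM -intrB dt.
transitivity ((a%:~R * d%:~R - b%:~R * c%:~R) * complex.Im t); last by rewrite D mul1r.
by ring.
Qed.

Lemma moebius_up : 0 < complex.Im t1.
Proof. by rewrite Im_moebius divr_gt0 // exprn_gt0 // cm_gt0; exact: aut_neq0. Qed.

Lemma inlat_moebius P : inlat t1 (P / J) <-> inlat t P.
Proof.
have J0 := aut_neq0; have D : (a%:~R * d%:~R - b%:~R * c%:~R : C) =
  1 by rewrite -!intrM -intrB dt.
split=> [[l [m e]]|[l [m ->]]].
  exists (l * a + m * c), (l * b + m * d).
  rewrite -[P](divfK J0) e /t1 !intrD !intrM; move: J0; rewrite /J => J0; by field.
exists (d * l - c * m), (a * m - b * l); rewrite !intrB !intrM /t1.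
apply/eqP; rewrite -(inj_eq (mulIf J0)) divfK //; apply/eqP.
transitivity ((a%:~R * d%:~R - b%:~R * c%:~R) * (l%:~R * t + m%:~R));
  first by rewrite D mul1r.
by move: J0; rewrite /J => J0; field.
Qed.

(** The lattice point l t + m becomes (d l - c m) t1 + (a m - b l) after
    division by c t + d. The exponents differ by a half-integer whose numerator
    is even, since a d - b c is odd. *)
Lemma isres_moebius P r : isres t P r -> isres t1 (P / J) (qexp (- (3 * c%:~R *
  P ^+ 2 / (2 * J))) * r).
Proof.
have J0 := aut_neq0; have D : (a%:~R * d%:~R - b%:~R * c%:~R : C) =
  1 by rewrite -!intrM -intrB dt.
case=> [[l [m [PE ->]]]|[nl ->]]; last first.
  by right; rewrite mulr0; split=> //; rewrite inlat_moebius.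
left; exists (d * l - c * m), (a * m - b * l); split.
  rewrite !intrB !intrM /t1; apply/eqP; rewrite -(inj_eq (mulIf J0)) divfK //; apply/eqP.
  transitivity ((a%:~R * d%:~R - b%:~R * c%:~R) * P); first by rewrite D mul1r.
  by move: J0; rewrite PE /J => J0; field.
rewrite /res_mockN mulrCA -qexpD; congr (_ * _).
set l' := d * l - c * m; set m' := a * m - b * l.
(* The quadratic form l^2 t is transformed by completing P = l t + m; the
   error is an integer. *)
have key : c%:~R * P ^+ 2 / J + l'%:~R ^+ 2 * t1 = l%:~R ^+ 2 * t + (l * m - l' * m')%:~R.
  have : c%:~R * P ^+ 2 / J + l'%:~R ^+ 2 * t1 - (l%:~R ^+ 2 * t +
    (l * m - l' * m')%:~R) =
    ((a%:~R * d%:~R - b%:~R * c%:~R) - 1) * (d%:~R * l%:~R - c%:~R * m%:~R) * P / J.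
    rewrite /l' /m' PE /t1; rewrite !(intrB, intrM); move: J0; rewrite /J => J0;
      field; exact: J0.
  by rewrite D subrr !mul0r => /subr0_eq.
have -> : (l' + m')%:~R / 2 + 3 * l'%:~R ^+ 2 * t1 / 2 =
  - (3 * c%:~R * P ^+ 2 / (2 * J)) +
    ((l + m)%:~R / 2 + 3 * l%:~R ^+ 2 * t / 2) + (l' + m' - l - m +
      3 * (l * m - l' * m'))%:~R / 2.
  have E : 3 * l'%:~R ^+ 2 * t1 / 2 = 3 / 2 * (l%:~R ^+ 2 * t +
    (l * m - l' * m')%:~R) - 3 * c%:~R * P ^+ 2 / (2 * J).
    by rewrite -key; field.
  by rewrite E !(intrD, intrB, intrN, intrM); field.
rewrite qexp_even // /l' /m'; have : oddz (a * d - b * c) by rewrite dt.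
rewrite !oddzE; case: (oddz a); case: (oddz b); case: (oddz c); case: (oddz d);
  case: (oddz l); case: (oddz m) => //.
Qed.

End Moebius.

Lemma isres_shift t P r (L M : int) : isres t P r ->
  isres t (P + L%:~R * t + M%:~R) (qexp ((L + M)%:~R / 2 + 3 * L%:~R ^+ 2 * t / 2 +
    3 * L%:~R * P) * r).
Proof.
case=> [[l [m [-> ->]]]|[nl ->]]; last first.
  right; rewrite mulr0; split=> // h; apply: nl.
  have := inlatD (- L) (- M) h; rewrite !intrN.
  by have -> : P + L%:~R * t + M%:~R + - L%:~R * t + - M%:~R = P by ring.
left; exists (l + L), (m + M); rewrite !intrD; split; first by ring.
rewrite /res_mockN mulrCA; congr (_ * _); rewrite -qexpD.
rewrite -[LHS](qexpDint _ (- (3 * L * m))); congr Defs.qexp.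
by rewrite !(intrD, intrN, intrM); field.
Qed.

End Residues.

(** * The theta function and the quasi-periods of the mock theta function *)

Section MockJacobi.
Variable R : realType.
Local Notation C := (Cplx R).
Implicit Types (u z w P r t : C) (h g : C -> C).
Local Notation cexp := (@cexp R).
Local Notation qexp := (@qexp R).

(** Jacobi's theta function divided by (q; q)_oo; its zeros are the lattice
    points, and its role is to cancel poles. *)
Definition theta t u : C := qexp (- (u / 2)) * qpi (qexp u) (qexp t) *
  qpi (qexp t / qexp u) (qexp t).

Section Theta.
Variable t : C.
Hypothesis t0 : 0 < complex.Im t.
Let q := qexp t.

Lemma theta1 u : theta t (u + 1) = - theta t u.
Proof.
rewrite /theta qexpD qexp1 mulr1.
have -> : - ((u + 1) / 2) = - (u / 2) - 1 / 2 by ring.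
by rewrite qexpB qexp_half invrN invr1 mulrN1 !mulNr.
Qed.

Lemma theta_tau u : theta t (u + t) = - qexp (- u - t / 2) * theta t u.
Proof.
have q1 := nome_lt1 t0; have q0 := nome_neq0 t; have x0 := qexp_neq0 u.
rewrite /theta qexpD -/q.
have -> : - ((u + t) / 2) = - (u / 2) + - (t / 2) by ring.
have -> : qexp (- u - t / 2) = (qexp u)^-1 * qexp (- (t / 2)) by rewrite -qexpN -qexpD.
rewrite qexpD.
have -> : q / (qexp u * q) = (qexp u)^-1 by field; rewrite x0 q0.
rewrite (qpi_shift (qexp u)^-1 1 q1) (qpi_shift (qexp u) 1 q1) !qpS !qp0 !expr0 !expr1 !mul1r !mulr1.
rewrite [(qexp u)^-1 * q]mulrC.
by field.
Qed.

Lemma theta_taun u n : theta t (u + n%:R * t) =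
  (-1) ^+ n * qexp (- (n%:R * u) - n%:R ^+ 2 * t / 2) * theta t u.
Proof.
elim: n => [|n IH]; first by rewrite !mul0r addr0 expr0n /= !mul0r !subr0 oppr0 qexp0 !mul1r.
have -> : u + n.+1%:R * t = u + n%:R * t + t by rewrite -natr1; ring.
rewrite theta_tau IH (exprS (-1) n).
have -> : - (n.+1%:R * u) - n.+1%:R ^+ 2 * t / 2 =
  (- (u + n%:R * t) - t / 2) + (- (n%:R * u) - n%:R ^+ 2 * t / 2).
  by rewrite -natr1; field.
by rewrite (qexpD (- (u + n%:R * t) - t / 2)); ring.
Qed.

Lemma theta_zero u : inlat t u -> theta t u = 0.
Proof.
move=> [l [m ->]].
have z0 : theta t 0 = 0.
  by rewrite /theta qexp0 (qpi_shift 1 1 (nome_lt1 t0)) qpS qp0 expr0 mulr1 subrr mulr0 mul0r mulr0 mul0r.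
have A n : theta t (n%:R * t) = 0 by rewrite -[_ * t]add0r theta_taun z0 mulr0.
have B v k : theta t (v + k%:R) = 0 <-> theta t v = 0.
  elim: k => [|k IH]; first by rewrite addr0.
  rewrite -natr1 addrA theta1; split=> [/eqP|/IH ->]; last by rewrite oppr0.
  by rewrite oppr_eq0 => /eqP /IH.
have A' (n : int) : theta t (n%:~R * t) = 0.
  case: n => n; first exact: A.
  have := theta_taun ((Negz n)%:~R * t) n.+1.
  rewrite NegzE mulrNz mulNr -pmulrn addNr z0 => /esym/eqP.
  by rewrite mulf_eq0 mulf_eq0 signr_eq0 (negPf (qexp_neq0 _)) => /eqP.
case: m => k; first by apply/B; exact: A'.
by apply: (proj1 (B _ k.+1)); rewrite NegzE mulrNz -pmulrn subrK.
Qed.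

Lemma theta_neq0 u : ~ inlat t u -> theta t u != 0.
Proof.
move=> /notlat_regular [x0 h1 h2].
by rewrite !mulf_neq0 ?qexp_neq0 // qpi_neq0 ?nome_neq0 ?nome_lt1.
Qed.

Lemma theta_sdiff u : sdiff (theta t) u.
Proof.
have q0 := nome_neq0 t; have q1 := nome_lt1 t0.
have se : forall z, sdiff (fun z => (qexp z)^-1) z.
  by move=> z; apply: sdiffV; [exact: qexp_neq0|exact: sdiff_qexp].
have Q (f : C -> C) : (forall z, sdiff f z) -> sdiff (fun z => qpi (f z) q) u.
  move=> fs; have [d d0 [B B0 hB]] := sdiff_bounded (fs u).
  apply: (@qpi_sdiff _ f (fun=> q) u (d / 2) B (cm q)); rewrite ?cm_ge0 //; first by lra.
    by move=> z _; split; [exact: fs|exact: sdiff_cst].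
  by move=> z zd; split=> //; apply: hB; lra.
rewrite /theta; apply: sdiffM; last by apply: Q => z; apply: sdiffM;
  [exact: sdiff_cst|exact: se].
apply: sdiffM; last by apply: Q => z; exact: sdiff_qexp.
apply: (@sdiff_ext _ (fun z => qexp ((- 2^-1) * z + 0))); last exact: sdiff_lin.
by move=> z; congr Defs.qexp; ring.
Qed.

End Theta.

(** The power q^(-1/24) makes the inhomogeneous terms of [mock_tau] the theta
    terms of index 1 and 5, and turns the translates by n periods into the
    terms of index 6 n + 1 and 6 n + 5. *)
Definition mock t u : C := qexp (u / 2 - t / 24) * Eu (qexp u) (qexp t).
Definition etaf t : C := qexp (t / 24) * qpi (qexp t) (qexp t).
Definition theta_term t (n : int) u : C := qexp (- (n%:~R ^+ 2 * t / 24) - n%:~R * u / 2).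

Lemma mockN_mock t u : mockN t u = etaf t * mock t u.
Proof.
rewrite /mockN /etaf /mock; have -> : u / 2 = t / 24 + (u / 2 - t / 24) by ring.
rewrite qexpD; have -> : t / 24 + (u / 2 - t / 24) - t / 24 = u / 2 - t / 24 by ring.
by ring.
Qed.

Lemma etaf_neq0 t : 0 < complex.Im t -> etaf t != 0.
Proof.
move=> t0; have q0 := nome_neq0 t; have q1 := nome_lt1 t0.
rewrite mulf_neq0 ?qexp_neq0 // qpi_neq0 // => k.
rewrite -exprS -cm_gt0; have := cmB_ge 1 (qexp t ^+ k.+1); rewrite cm1 cmX.
have : cm (qexp t) ^+ k.+1 < 1 by rewrite exprn_ilt1 ?cm_ge0.
by lra.
Qed.

Lemma mock1 t u : mock t (u + 1) = - mock t u.
Proof.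
rewrite /mock qexpD qexp1 mulr1;
  have -> : (u + 1) / 2 - t / 24 = (u / 2 - t / 24) + 1 / 2 by ring.
by rewrite qexpD qexp_half mulrN1 mulNr.
Qed.

Lemma mock_nat t u n : mock t (u + n%:R) = (-1) ^+ n * mock t u.
Proof.
elim: n => [|n IH]; first by rewrite addr0 mul1r.
by rewrite -natr1 addrA mock1 IH exprS; ring.
Qed.

Lemma mock_tau t u : 0 < complex.Im t -> ~ inlat t u ->
  - qexp (- (3 * t / 2 + 3 * u)) * mock t (u + t) =
    mock t u + theta_term t 1 u - theta_term t 5 u.
Proof.
move=> t0 nl; have E := Eu_shift (nome_neq0 t) (nome_lt1 t0) (notlat_regular nl).
have {}E : Eu (qexp u * qexp t) (qexp t) =
  1 - qexp t * qexp u ^+ 2 - qexp t * qexp u ^+ 3 * Eu (qexp u) (qexp t).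
  by rewrite -E addrK.
rewrite /mock [qexp (u + t)]qexpD E /theta_term.
set e := Eu _ _.
have -> : qexp t * qexp u ^+ 2 = qexp (t + 2 * u) by rewrite qexpD (qexpMn 2).
have -> : qexp t * qexp u ^+ 3 = qexp (t + 3 * u) by rewrite qexpD (qexpMn 3).
set A := qexp (- (3 * t / 2 + 3 * u)); set B := qexp ((u + t) / 2 - t / 24).
have -> : qexp (u / 2 - t / 24) = A * B * qexp (t + 3 * u).
  by rewrite -!qexpD; congr Defs.qexp; field.
have -> : qexp (- ((1%:~R : C) ^+ 2 * t / 24) - (1%:~R : C) * u / 2) =
  A * B * qexp (t + 2 * u).
  by rewrite -!qexpD; congr Defs.qexp; field.
have -> : qexp (- ((5%:~R : C) ^+ 2 * t / 24) - (5%:~R : C) * u / 2) = A * B.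
  by rewrite -!qexpD; congr Defs.qexp; rewrite (_ : (5%:~R : C) = 5) //; field.
ring.
Qed.

Lemma inlat_nat t u (n : nat) : ~ inlat t u -> ~ inlat t (u + n%:R * t).
Proof.
move=> nl h; apply: nl; have := inlatD (- n%:Z) 0 h.
by rewrite mulrNz -pmulrn addr0 mulNr addrK.
Qed.

Lemma theta_term_shiftn t u (n : nat) (k : int) :
  qexp (- (3 * n%:R ^+ 2 * t / 2 + 3 * n%:R * u)) * theta_term t k (u + n%:R * t) =
    theta_term t (k + 6 * n%:Z) u.
Proof.
rewrite /theta_term -qexpD; congr Defs.qexp;
  rewrite intrD intrM -[n%:Z%:~R]pmulrn (_ : (6%:~R : C) = 6) //.
by field.
Qed.

(** The equation [mock_tau] is applied n times, the inhomogeneous terms adding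
    up. *)
Lemma mock_taun t u n : 0 < complex.Im t -> ~ inlat t u ->
  (-1) ^+ n * qexp (- (3 * n%:R ^+ 2 * t / 2 + 3 * n%:R * u)) * mock t (u + n%:R * t) =
  mock t u + \sum_(k < n) (-1) ^+ k * (theta_term t (6 * k%:Z +
    1) u - theta_term t (6 * k%:Z + 5) u).
Proof.
move=> t0 nl; elim: n => [|n IH].
  have -> : - (3 * (0 : C) ^+ 2 * t / 2 + 3 * 0 * u) = 0 by ring.
  by rewrite big_ord0 addr0 expr0 mul1r !mul0r addr0 qexp0 mul1r.
rewrite big_ord_recr /= addrA -IH -(natr1 n).
have -> : u + (n%:R + 1) * t = u + n%:R * t + t by ring.
have -> : - (3 * (n%:R + 1) ^+ 2 * t / 2 + 3 * (n%:R + 1) * u) =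
  - (3 * n%:R ^+ 2 * t / 2 + 3 * n%:R * u) + - (3 * t / 2 + 3 * (u + n%:R * t)) by field.
rewrite qexpD exprS.
have E := mock_tau t0 (inlat_nat (n := n) nl).
have E' : qexp (- (3 * t / 2 + 3 * (u + n%:R * t))) * mock t (u + n%:R * t + t) =
  - (mock t (u + n%:R * t) + theta_term t 1 (u + n%:R * t) - theta_term t 5 (u +
    n%:R * t)) by rewrite -E mulNr opprK.
have F c : (-1) ^+ n * qexp (- (3 * n%:R ^+ 2 * t / 2 +
  3 * n%:R * u)) * (theta_term t c (u + n%:R * t)) =
    (-1) ^+ n * theta_term t (6 * n%:Z + c) u by rewrite -mulrA theta_term_shiftn addrC.
rewrite mulrBr -(F 1) -(F 5) {IH F E}.
set A := (-1) ^+ n; set B := qexp (- (3 * n%:R ^+ 2 * t / 2 + _)).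
transitivity (A * B * - (qexp (- (3 * t / 2 + 3 * (u + n%:R * t))) * mock t (u +
  n%:R * t + t))); first by ring.
by rewrite E'; ring.
Qed.

End MockJacobi.

(** * A combination of mock theta functions with true quasi-periods *)

Section Combination.
Variable R : realType.
Local Notation C := (Cplx R).
Implicit Types (u z w P r t : C) (h g : C -> C) (a p : nat).
Local Notation cexp := (@cexp R).
Local Notation qexp := (@qexp R).

Definition halfp p := ((p - 1) %/ 2)%N.
(** For an integer j this is (-1)^j (zeta^(3j) - zeta^(-3j)). Negative j occur
    when sums over residue classes are folded in [defect_sym]. *)
Definition combc p (j : int) : C := qexp (j%:~R / 2) * (qexp (3 *
  j%:~R / p%:R) - qexp (- (3 * j%:~R / p%:R))).
Definition appell p t a u : C := qexp (- (3 * a%:R ^+ 2 * t / 2 + 3 * a%:R * u)) *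
  mock (p%:R ^+ 2 * t) (p%:R * u + p%:R * a%:R * t) -
  (if (6 * a < p)%N then 0 else theta_term t (6 * a%:Z - p%:Z) u).
Definition combG p t u : C := mock t (1 / p%:R + u) -
  (chi12 p)%:~R * \sum_(1 <= a < (halfp p).+1) combc p a%:Z * appell p t a u.
(** Adding the value at -u removes the defect of [combG_shift]. At u = 0 this
    only doubles the function. *)
Definition combH p t u : C := combG p t u + combG p t (- u).
Definition shift_factor p t u : C := qexp (- (3 * p%:R ^+ 2 * t / 2 + 3 * p%:R * u)).

(** The failure of [combG] to be quasi-periodic, as a linear function of the
    sequence X of theta terms. *)
Definition defect p (X : int -> C) : C :=
  \sum_(k < p) (-1) ^+ k * (qexp (- ((6 * k%:Z +
    1)%:~R / (2 * p%:R))) * X (6 * k%:Z + 1) -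
                            qexp (- ((6 * k%:Z + 5)%:~R / (2 * p%:R))) * X (6 *
                              k%:Z + 5)) -
  (chi12 p)%:~R * \sum_(1 <= a < (halfp p).+1) combc p a%:Z * (X (p%:Z + 6 * a%:Z) +
     (if (6 * a < p)%N then - X (5 * p%:Z + 6 * a%:Z) else X (6 * a%:Z - p%:Z))).

(** The interval of length 2h + 1 starting at -m is a complete residue system
    modulo 2h + 1; it is folded onto 1, ..., h by the sign. *)
Lemma sum_fold (F : int -> C) (h m : nat) : (m <= h)%N -> F 0 = 0 ->
  \sum_(k < (2 * h).+1) F (k%:Z - m%:Z) =
  \sum_(1 <= a < h.+1) (F a%:Z + (if (a <= m)%N then F (- a%:Z) else F ((2 *
    h).+1%:Z - a%:Z))).
Proof.
move=> mh F0; elim: m mh => [|m IH] mh.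
  rewrite big_ord_recl /= subrr F0 add0r (eq_bigr (fun k : 'I_(2*h) => F (k.+1)%:Z));
    last by move=> i _; rewrite subr0.
  rewrite -(big_mkord xpredT (fun k => F k.+1%:Z)) big_add1 /=.
  rewrite (@big_cat_nat _ _ _ h) //=; last by lia.
  rewrite [in RHS]big_split /=; congr (_ + _).
  rewrite [in RHS]big_nat_rev /= -{1}[h]add0n big_addn.
  have -> : (2 * h - h = h)%N by lia.
  rewrite !big_mkord; apply: eq_bigr => i _; congr F.
  by have := ltn_ord i; lia.
have {}IH := IH (ltnW mh).
rewrite big_ord_recl /=.
have -> : \sum_(k < 2 * h) F ((bump 0 k)%:Z - m.+1%:Z) = \sum_(k < 2 * h) F (k%:Z - m%:Z).
  by apply: eq_bigr => i _; congr F; rewrite /bump /=; lia.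
have {}IH : \sum_(k < 2 * h) F (k%:Z - m%:Z) = \sum_(1 <= a < h.+1)
    (F a%:Z + (if (a <= m)%N then F (- a%:Z) else F ((2 *
      h).+1%:Z - a%:Z))) - F ((2 * h)%N%:Z - m%:Z).
  by rewrite -IH big_ord_recr /= addrK.
rewrite IH.
rewrite (@big_cat_nat _ _ _ m.+1) //=; last by lia.
rewrite [in RHS](@big_cat_nat _ _ _ m.+1) //=; last by lia.
rewrite [X in _ + X - _](@big_cat_nat _ _ _ m.+2) //= ?big_nat1.
rewrite [X in _ = _ + X](@big_cat_nat _ _ _ m.+2) //= ?big_nat1.
rewrite ltnn leqnn.
have -> : \sum_(1 <= a < m.+1) (F a + (if (a <=
  m.+1)%N then F (- a%:Z) else F ((2 * h).+1%:Z - a%:Z))) =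
   \sum_(1 <= a < m.+1) (F a + (if (a <= m)%N then F (- a%:Z) else F ((2 *
     h).+1%:Z - a%:Z))).
  by rewrite !big_nat; apply: eq_bigr => i /andP[_]; rewrite ltnS => im; rewrite im leqW.
have -> : \sum_(m.+2 <= a < h.+1) (F a + (if (a <=
  m.+1)%N then F (- a%:Z) else F ((2 * h).+1%:Z - a%:Z))) =
   \sum_(m.+2 <= a < h.+1) (F a + (if (a <= m)%N then F (- a%:Z) else F ((2 *
     h).+1%:Z - a%:Z))).
  by rewrite !big_nat; apply: eq_bigr => i /andP[im _];
    rewrite (leqNgt i m.+1) (leqNgt i m) im (ltnW im).
have -> : (0%N%:Z - m.+1%:Z) = - m.+1%:Z by lia.
have -> : (2 * h)%N%:Z - m%:Z = (2 * h).+1%:Z - m.+1%:Z by lia.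
ring.
Qed.

Section FixP.
Variable p : nat.
Hypothesis hp : prime p.
Hypothesis hp3 : (3 < p)%N.

Lemma p_odd : odd p.
Proof. by have [e|] := even_prime hp; first by move: hp3; rewrite e. Qed.

Lemma halfpE : p = (2 * halfp p).+1.
Proof. have := p_odd; rewrite /halfp; lia. Qed.

Lemma p_neq0 : (p%:R : C) != 0.
Proof. by rewrite pnatr_eq0; move: hp3; case: p. Qed.

Lemma p_mod6 : exists m : nat, p = (6 * m + 1)%N \/ p = (6 * m + 5)%N.
Proof.
exists (p %/ 6)%N; have o := p_odd.
have h3 : ~~ (3 %| p)%N.
  apply/negP => d; have := prime_nt_dvdP hp _ d => /(_ isT) e; by move: hp3; rewrite -e.
lia.
Qed.

Lemma chi12_1 m : p = (6 * m + 1)%N -> (chi12 p)%:~R = (-1) ^+ m :> C.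
Proof.
move=> e; rewrite /chi12 -signr_odd e !inE.
case o : (odd m); rewrite expr0z || idtac.
  have -> : ((6 * m + 1) %% 12 = 7)%N by lia.
  by rewrite /= expr1.
have -> : ((6 * m + 1) %% 12 = 1)%N by lia.
by rewrite /= expr0.
Qed.

Lemma chi12_5 m : p = (6 * m + 5)%N -> (chi12 p)%:~R = - (-1) ^+ m :> C.
Proof.
move=> e; rewrite /chi12 -signr_odd e !inE.
case o : (odd m).
  have -> : ((6 * m + 5) %% 12 = 11)%N by lia.
  by rewrite /= expr1 opprK.
have -> : ((6 * m + 5) %% 12 = 5)%N by lia.
by rewrite /= expr0.
Qed.

Lemma sgn_half (j : int) (n : nat) : oddz j = odd n -> qexp (j%:~R / 2) = (-1) ^+ n.
Proof.
rewrite -signr_odd => <-; case: (boolP (oddz j)) => h.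
  by have := @qexp_odd R j 0 h; rewrite add0r qexp0 expr1.
by have := @qexp_even R j 0 h; rewrite add0r qexp0 expr0.
Qed.

(** The first sum of the defect runs over the classes n prime to 6 modulo 6p.
    The symmetry exchanges the classes of 1 and 5 modulo 6 and so reduces it to
    the n = p + 6 j, where it becomes the second sum after folding j and -j.
    The sign chi12(p) comes from the position of p in its class modulo 6. *)
Lemma defect_sym (X : int -> C) : (forall n, X (6 * p%:Z - n) = X n) -> defect p X = 0.
Proof.
move=> sym; have p0 := p_neq0; have o := p_odd.
pose F (j : int) := combc p j * X (p%:Z + 6 * j).
have F0 : F 0 = 0 by rewrite /F /combc mulr0 mul0r oppr0 subrr mulr0 mul0r.
have [m pm] := p_mod6.
have S1 : \sum_(k < p) (-1) ^+ k * (qexp (- ((6 * k%:Z +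
  1)%:~R / (2 * p%:R))) * X (6 * k%:Z + 1) -
      qexp (- ((6 * k%:Z + 5)%:~R / (2 * p%:R))) * X (6 * k%:Z + 5)) =
      (chi12 p)%:~R * \sum_(k < p) F (k%:Z - m%:Z).
  have rv (k : 'I_p) : (rev_ord k : nat)%:Z = p%:Z - 1 - k%:Z.
    by rewrite /=; have := ltn_ord k; lia.
  have sg (k : 'I_p) : (-1) ^+ (rev_ord k) = (-1) ^+ k :> C.
    by rewrite -signr_odd -[RHS]signr_odd; congr (_ ^+ nat_of_bool _); rewrite /=;
      have := ltn_ord k; lia.
  have ex (j : int) : qexp (- ((p%:Z + 6 * j)%:~R / (2 * p%:R))) =
    - qexp (- (3 * j%:~R / p%:R)).
    have -> : - ((p%:Z + 6 * j)%:~R / (2 * p%:R)) = - (1 / 2) + - (3 * j%:~R / p%:R) :> C.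
      by rewrite intrD intrM -[p%:Z%:~R]pmulrn (_ : (6%:~R : C) = 6) //; field;
        exact: p_neq0.
    by rewrite qexpD [qexp (- (1 / 2))]qexpN qexp_half invrN invr1 mulN1r.
  have ex' (j : int) : qexp (- ((6 * p%:Z - (p%:Z + 6 * j))%:~R / (2 * p%:R))) =
    - qexp (3 * j%:~R / p%:R).
    have -> : - ((6 * p%:Z - (p%:Z + 6 * j))%:~R / (2 * p%:R)) =
      (3 * j%:~R / p%:R + 1 / 2) + (- 3)%:~R :> C.
      by rewrite intrB intrD !intrM -[p%:Z%:~R]pmulrn (_ : (6%:~R : C) =
        6) // (_ : ((- 3)%:~R : C) = - 3) //; field; exact: p_neq0.
    by rewrite qexpDint qexpD qexp_half mulrN1.
  rewrite mulr_sumr; case: pm => pm.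
    rewrite (chi12_1 pm).
    under eq_bigr do rewrite mulrBr.
    rewrite sumrB [X in _ - X](reindex_inj rev_ord_inj) /= -sumrB; apply: eq_bigr => k _.
    have := rv k; have := sg k => /= -> ->.
    have -> : 6 * (p%:Z - 1 - k%:Z) + 5 = 6 * p%:Z - (p%:Z + 6 * (k%:Z - m%:Z)) by lia.
    have -> : 6 * k%:Z + 1 = p%:Z + 6 * (k%:Z - m%:Z) by lia.
    rewrite sym ex ex' /F /combc (@sgn_half _ (k + m)); last by rewrite /oddz; lia.
    rewrite exprD; have : (-1) ^+ m * (-1) ^+ m = 1 :> C by rewrite -expr2 sqrr_sign.
    set s := (-1) ^+ m; set s' := (-1) ^+ k; set x := X _ => ss.
    transitivity ((s * s) * s' * (qexp (3 * (k%:Z - m%:Z)%:~R / p%:R) - qexp (- (3 *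
      (k%:Z - m%:Z)%:~R / p%:R))) * x); last by ring.
    by rewrite ss; ring.
  rewrite (chi12_5 pm).
  under eq_bigr do rewrite mulrBr.
  rewrite sumrB [X in X - _](reindex_inj rev_ord_inj) /= -sumrB; apply: eq_bigr => k _.
  have := rv k; have := sg k => /= -> ->.
  have -> : 6 * (p%:Z - 1 - k%:Z) + 1 = 6 * p%:Z - (p%:Z + 6 * (k%:Z - m%:Z)) by lia.
  have -> : 6 * k%:Z + 5 = p%:Z + 6 * (k%:Z - m%:Z) by lia.
  rewrite sym ex ex' /F /combc (@sgn_half _ (k + m)); last by rewrite /oddz; lia.
  rewrite exprD; have : (-1) ^+ m * (-1) ^+ m = 1 :> C by rewrite -expr2 sqrr_sign.
  set s := (-1) ^+ m; set s' := (-1) ^+ k; set x := X _ => ss.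
  transitivity (- (s * s) * s' * (qexp (3 * (k%:Z - m%:Z)%:~R / p%:R) - qexp (- (3 *
    (k%:Z - m%:Z)%:~R / p%:R))) * x); last by ring.
  by rewrite ss; ring.
rewrite /defect S1 -mulrBr.
have mh : (m <= halfp p)%N by rewrite /halfp; lia.
have -> : \sum_(k < p) F (k%:Z - m%:Z) = \sum_(k < (2 *
  halfp p).+1) F (k%:Z - m%:Z) by rewrite -halfpE.
rewrite (sum_fold mh F0) -sumrB big1 ?mulr0 // => a _.
rewrite -halfpE mulrDr [F a%:Z + _]addrC opprD addrA addrK; apply/eqP;
  rewrite subr_eq0; apply/eqP.
have -> : (a <= m)%N = (6 * a < p)%N by lia.
case: ifP => _.
  have -> : X (5 * p%:Z + 6 * a%:Z) = X (p%:Z + 6 * - a%:Z).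
    by rewrite -sym; congr X; lia.
  have cN : combc p (- a%:Z) = - combc p a%:Z.
    rewrite /combc (@sgn_half _ a); last by rewrite oddzN.
    rewrite (@sgn_half a%:Z a) //.
    have -> : 3 * (- a%:Z)%:~R / p%:R = - (3 *
      (a%:Z)%:~R / p%:R) :> C by rewrite rmorphN; ring.
    by rewrite opprK; ring.
  by rewrite /F cN mulNr (mulrN (combc p a%:Z)).
have -> : X (6 * a%:Z - p%:Z) = X (p%:Z + 6 * (p%:Z - a%:Z)).
  by rewrite -sym; congr X; lia.
rewrite /F /combc (@sgn_half (p%:Z - a%:Z) a.+1); last by move: o; rewrite /oddz; lia.
rewrite (@sgn_half a%:Z a) // exprS.
have -> : 3 * (p%:Z - a%:Z)%:~R / p%:R = - (3 * (a%:Z)%:~R / p%:R) + 3%:~R :> C.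
  by rewrite intrB -[p%:Z%:~R]pmulrn (_ : (3%:~R : C) = 3) //; field; exact: p_neq0.
rewrite qexpDint opprD -(rmorphN intr) qexpDint opprK; ring.
Qed.

Variable t : C.
Hypothesis t0 : 0 < complex.Im t.

Lemma Im_natM (n : nat) z : complex.Im (n%:R * z) = n%:R * complex.Im z.
Proof. by rewrite -realC_nat cImM /= mul0r addr0. Qed.

Lemma Im_intM (n : int) z : complex.Im (n%:~R * z) = n%:~R * complex.Im z.
Proof. by rewrite -realC_int cImM /= mul0r addr0. Qed.

Lemma T_up : 0 < complex.Im (p%:R ^+ 2 * t).
Proof.
rewrite -natrX Im_natM mulr_gt0 // ltr0n expn_gt0.
by move: hp3; case: p.
Qed.

(** A condition excluding the poles of every term of [combG] at u and at -u,
    and stable under the periods. *)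
Definition good u := ~ inlat t (p%:R * u).

Lemma inlat_p u : inlat t u -> inlat t (p%:R * u).
Proof. by move=> [l [m ->]]; exists (p%:Z * l), (p%:Z * m); rewrite !intrM -pmulrn;
  ring. Qed.

Lemma good_a u : good u -> ~ inlat t (1 / p%:R + u).
Proof.
move=> g /inlat_p h; apply: g; have := inlatD 0 (- 1) h.
have -> // : p%:R * (1 / p%:R + u) + (0%:~R) * t + (- 1)%:~R = p%:R * u.
by rewrite (_ : ((- 1)%:~R : C) = - 1) // mul0r addr0; field; exact: p_neq0.
Qed.

Lemma good_b u a : good u -> ~ inlat (p%:R ^+ 2 * t) (p%:R * u + p%:R * a%:R * t).
Proof.
move=> g [l [m e]]; apply: g; exists (p%:Z ^+ 2 * l - p%:Z * a%:Z), m.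
rewrite intrB !intrM -!pmulrn.
have -> : p%:R * u = (p%:R * u + p%:R * a%:R * t) - p%:R * a%:R * t by ring.
by rewrite e; ring.
Qed.

Lemma goodN u : good u -> good (- u).
Proof. by rewrite /good mulrN; exact: notlatN. Qed.

Lemma goodS u : good u -> good (u + p%:R * t).
Proof.
move=> g; rewrite /good mulrDr mulrA -natrM; exact: inlat_nat.
Qed.

Lemma theta_term_shift (n : int) u : shift_factor p t u * theta_term t n (u +
  p%:R * t) = theta_term t (n + 6 * p%:Z) u.
Proof. exact: theta_term_shiftn. Qed.

Lemma theta_term_refl (n : int) u : shift_factor p t u * theta_term t n (- (u +
  p%:R * t)) = theta_term t (6 * p%:Z - n) u.
Proof.
rewrite /shift_factor /theta_term -qexpD; congr Defs.qexp;
  rewrite intrB intrM -[p%:Z%:~R]pmulrn (_ : (6%:~R : C) = 6) //.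
by field.
Qed.

Lemma appell_shift u a : good u -> - shift_factor p t u * appell p t a (u +
  p%:R * t) - appell p t a u =
  theta_term t (p%:Z + 6 * a%:Z) u + (if (6 * a < p)%N then - theta_term t (5 *
    p%:Z + 6 * a%:Z) u else theta_term t (6 * a%:Z - p%:Z) u).
Proof.
move=> g; have nl := good_b (a := a) g; have := mock_tau T_up nl.
rewrite /appell; set T := p%:R ^+ 2 * t; set v := p%:R * u + _ => E.
have -> : p%:R * (u + p%:R * t) + p%:R * a%:R * t = v + T by rewrite /v /T; ring.
set e0 := qexp (- (3 * a%:R ^+ 2 * t / 2 + 3 * a%:R * u)).
have E1 : shift_factor p t u * qexp (- (3 * a%:R ^+ 2 * t / 2 + 3 * a%:R * (u +
  p%:R * t))) = e0 * qexp (- (3 * T / 2 + 3 * v)).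
  by rewrite /shift_factor /e0 -!qexpD; congr Defs.qexp; rewrite /T /v; field.
have E2 (n : int) : e0 * theta_term T n v = theta_term t (n * p%:Z + 6 * a%:Z) u.
  rewrite /e0 /theta_term -qexpD; congr Defs.qexp; rewrite intrD !intrM -!pmulrn.
  by rewrite /T /v; field.
have F : - shift_factor p t u * (qexp (- (3 * a%:R ^+ 2 * t / 2 + 3 * a%:R * (u +
  p%:R * t))) * mock T (v + T)) - e0 * mock T v =
   theta_term t (p%:Z + 6 * a%:Z) u - theta_term t (5 * p%:Z + 6 * a%:Z) u.
  have E21 := E2 1; rewrite mul1r in E21; rewrite -E21 -(E2 5) mulrA mulNr E1 -mulNr.
  transitivity (e0 * (- qexp (- (3 * T / 2 + 3 * v)) * mock T (v +
    T)) - e0 * mock T v); first by ring.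
  by rewrite E; ring.
case: ifP => _; first by rewrite !subr0 F.
have F2 := theta_term_shift (6 * a%:Z - p%:Z) u.
have e5 : 6 * a%:Z - p%:Z + 6 * p%:Z = 5 * p%:Z + 6 * a%:Z by lia.
rewrite e5 in F2.
move: F; set A := qexp _ * _ => F.
transitivity ((- shift_factor p t u * A - e0 * mock T v) +
  shift_factor p t u * theta_term t (6 * a%:Z - p%:Z) (u + p%:R * t) +
    theta_term t (6 * a%:Z - p%:Z) u); first by ring.
by rewrite F F2; ring.
Qed.

Lemma combG_shift u : good u -> - shift_factor p t u * combG p t (u +
  p%:R * t) - combG p t u = defect p (fun n => theta_term t n u).
Proof.
move=> g; have E := mock_taun p t0 (good_a g).
rewrite /combG /defect addrA.
set S1 := \sum_(1 <= a < _) _; set S2 := \sum_(1 <= a < _) combc p a * appell p t a u.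
set S3 := \sum_(1 <= a < _) _ * (_ + _).
have ES : - shift_factor p t u * S1 - S2 = S3.
  rewrite /S1 /S2 /S3 mulr_sumr -sumrB; apply: eq_bigr => a _.
  by rewrite -appell_shift //; ring.
have ER : - shift_factor p t u * mock t (1 / p%:R + u +
  p%:R * t) - mock t (1 / p%:R + u) =
   \sum_(k < p) (-1) ^+ k * (qexp (- ((6 * k%:Z +
     1)%:~R / (2 * p%:R))) * theta_term t (6 * k%:Z + 1) u -
                            qexp (- ((6 * k%:Z + 5)%:~R / (2 * p%:R))) *
                              theta_term t (6 * k%:Z + 5) u).
  have s1 : (-1) ^+ p = -1 :> C by rewrite -signr_odd p_odd // expr1.
  have s2 : qexp (- (3 * p%:R ^+ 2 * t / 2 + 3 * p%:R * (1 / p%:R + u))) =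
    shift_factor p t u.
    have -> : - (3 * p%:R ^+ 2 * t / 2 + 3 * p%:R * (1 / p%:R + u)) =
      - (3 * p%:R ^+ 2 * t / 2 + 3 * p%:R * u) + (- 3)%:~R.
      by rewrite (_ : ((- 3)%:~R : C) = - 3) //; field; exact: p_neq0.
    by rewrite qexpDint.
  move: E; rewrite s1 s2 mulN1r => ->; rewrite addrC addKr; apply: eq_bigr => k _.
  have s3 (n : int) : theta_term t n (1 / p%:R + u) =
    qexp (- (n%:~R / (2 * p%:R))) * theta_term t n u.
    by rewrite /theta_term -qexpD; congr Defs.qexp; field; exact: p_neq0.
  by rewrite !s3.
rewrite -ER -ES; ring.
Qed.

Lemma defectD (X Y : int -> C) : defect p X + defect p Y = defect p (fun n => X n + Y n).
Proof.
rewrite /defect addrACA -opprD -mulrDr -!big_split /=; congr (_ - _ * _).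
  by apply: eq_bigr => k _; ring.
by apply: eq_bigr => a _; case: ifP => _; ring.
Qed.

Lemma defectZ c (X : int -> C) : c * defect p X = defect p (fun n => c * X n).
Proof.
rewrite /defect mulrBr; congr (_ - _).
  by rewrite mulr_sumr; apply: eq_bigr => k _; ring.
rewrite mulrCA mulr_sumr; congr (_ * _).
by apply: eq_bigr => a _; case: ifP => _; ring.
Qed.

(** The defects at u and at -u are built from the sequences X_n and X_(6p - n)
    of theta terms, by [theta_term_refl]; their sum is symmetric, and
    [defect_sym] applies. *)
Theorem combH_shift u : good u -> combH p t (u + p%:R * t) =
  - qexp (3 * p%:R ^+ 2 * t / 2 + 3 * p%:R * u) * combH p t u.
Proof.
move=> g; have E1 := combG_shift g; have E2 := combG_shift (goodN (goodS g)).
have e : - (u + p%:R * t) + p%:R * t = - u by ring.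
rewrite e in E2.
set s' := qexp (3 * _ ^+ 2 * t / 2 + _).
have ss : s' * shift_factor p t u = 1 by rewrite /s' /shift_factor qexpN mulfV // qexp_neq0.
have s2 : shift_factor p t (- (u + p%:R * t)) = s'.
  by rewrite /shift_factor /s'; congr Defs.qexp; field.
rewrite s2 in E2.
have key : (- shift_factor p t u * combG p t (u + p%:R * t) - combG p t u) +
   shift_factor p t u * (- s' * combG p t (- u) - combG p t (- (u + p%:R * t))) = 0.
  rewrite E1 E2 defectZ defectD; apply: defect_sym => n.
  rewrite (theta_term_refl n) (theta_term_refl (6 * p%:Z - n)).
  have -> : 6 * p%:Z - (6 * p%:Z - n) = n by ring.
  by rewrite addrC.
have : - shift_factor p t u * combH p t (u + p%:R * t) = combH p t u.
  apply/eqP; rewrite -subr_eq0; apply/eqP; rewrite /combH -[RHS]key.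
  transitivity (- shift_factor p t u * (combG p t (u + p%:R * t) + combG p t (- (u +
    p%:R * t))) - combG p t u - (s' * shift_factor p t u) * combG p t (- u));
      last by ring.
  by rewrite ss mul1r; ring.
move=> <-; rewrite mulrA mulrNN ss mul1r //.
Qed.

Lemma combG1 u : combG p t (u + 1) = - combG p t u.
Proof.
have B a : appell p t a (u + 1) = - appell p t a u.
  rewrite /appell.
  have -> : p%:R * (u + 1) + p%:R * a%:R * t = p%:R * u + p%:R * a%:R * t + p%:R by ring.
  rewrite mock_nat -signr_odd p_odd // expr1.
  have -> : - (3 * a%:R ^+ 2 * t / 2 + 3 * a%:R * (u + 1)) =
    - (3 * a%:R ^+ 2 * t / 2 + 3 * a%:R * u) + (- 3 * a%:Z)%:~R.
    by rewrite intrM -[a%:Z%:~R]pmulrn (_ : ((- 3)%:~R : C) = - 3) //; ring.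
  rewrite qexpDint mulN1r mulrN -opprD; congr (- (_ + _)).
  case: ifP => _; first by rewrite oppr0.
  rewrite /theta_term.
  have -> : - ((6 * a%:Z - p%:Z)%:~R ^+ 2 * t / 24) - (6 * a%:Z - p%:Z)%:~R * (u +
    1) / 2 =
    - ((6 * a%:Z - p%:Z)%:~R ^+ 2 * t / 24) - (6 * a%:Z - p%:Z)%:~R * u / 2 +
      (p%:Z - 6 * a%:Z)%:~R / 2 :> C.
    by rewrite !intrB; field.
  by rewrite qexp_odd // !oddzE /= /oddz /= p_odd.
rewrite /combG addrA mock1 (eq_bigr (fun a => - (combc p a%:Z * appell p t a u))).
  by rewrite sumrN; ring.
by move=> a _; rewrite B mulrN.
Qed.

Lemma combH1 u : combH p t (u + 1) = - combH p t u.
Proof.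
have e : combG p t (- (u + 1)) = - combG p t (- u).
  have -> : - u = - (u + 1) + 1 by ring.
  by rewrite combG1 opprK.
by rewrite /combH combG1 e -opprD.
Qed.

End FixP.
End Combination.

(** * The weight-one law *)

Section Modularity.
Variable R : realType.
Local Notation C := (Cplx R).
Implicit Types (u z w P r : C) (h g : C -> C) (l m : int).
Local Notation cexp := (@cexp R).
Local Notation qexp := (@qexp R).

Section FixP.
Variable p : nat.
Hypothesis hp : prime p.
Hypothesis hp3 : (3 < p)%N.

Let p0 : (p%:R : C) != 0 := p_neq0 R hp3.

Lemma combH_lattice t u l m : 0 < complex.Im t -> good p t u ->
  combH p t (u + l%:~R * (p%:R * t) + m%:~R) =
  qexp ((l + m)%:~R / 2 + 3 * l%:~R ^+ 2 * p%:R ^+ 2 * t / 2 +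
    3 * l%:~R * p%:R * u) * combH p t u.
Proof.
move=> t0.
have N1 v n : combH p t (v + n%:R) = (-1) ^+ n * combH p t v.
  elim: n => [|n IH]; first by rewrite addr0 mul1r.
  by rewrite -natr1 addrA combH1 // IH exprS; ring.
have Z1 v (k : int) : combH p t (v + k%:~R) = qexp (k%:~R / 2) * combH p t v.
  have E n : combH p t v = (-1) ^+ n * combH p t (v - n%:R) by rewrite -N1 subrK.
  case: k => n; first by rewrite (@sgn_half _ _ n) // -pmulrn N1.
  rewrite NegzE (@sgn_half _ _ n.+1); last by rewrite oddzN.
  by rewrite [in RHS](E n.+1) mulrA -expr2 sqrr_sign mul1r mulrNz -pmulrn.
have gN v n : good p t v -> good p t (v + n%:R * (p%:R * t)).
  move=> gv; elim: n => [|n IH]; first by rewrite mul0r addr0.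
  by rewrite -natr1 mulrDl mul1r addrA; exact: goodS.
have N2 v n : good p t v -> combH p t (v + n%:R * (p%:R * t)) =
    (-1) ^+ n * qexp (3 * n%:R ^+ 2 * p%:R ^+ 2 * t / 2 +
      3 * n%:R * p%:R * v) * combH p t v.
  move=> gv; elim: n => [|n IH].
    have -> : 3 * (0 : C) ^+ 2 * p%:R ^+ 2 * t / 2 + 3 * 0 * p%:R * v = 0 by ring.
    by rewrite mul0r addr0 qexp0 !mul1r.
  rewrite -natr1 mulrDl mul1r addrA combH_shift //; last exact: gN.
  rewrite IH (exprS (-1) n).
  have -> : 3 * (n%:R + 1) ^+ 2 * p%:R ^+ 2 * t / 2 + 3 * (n%:R + 1) * p%:R * v =
    (3 * p%:R ^+ 2 * t / 2 + 3 * p%:R * (v + n%:R * (p%:R * t))) +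
      (3 * n%:R ^+ 2 * p%:R ^+ 2 * t / 2 + 3 * n%:R * p%:R * v).
    by field.
  by rewrite (qexpD (3 * p%:R ^+ 2 * t / 2 + _)); ring.
move=> gu; rewrite Z1.
have Z2 : combH p t (u + l%:~R * (p%:R * t)) =
   qexp (l%:~R / 2 + 3 * l%:~R ^+ 2 * p%:R ^+ 2 * t / 2 +
     3 * l%:~R * p%:R * u) * combH p t u.
  case: l => n; first by rewrite -addrA qexpD (@sgn_half _ _ n) // -pmulrn N2.
  have gu' : good p t (u - n.+1%:R * (p%:R * t)).
    move=> [l' [m' e]]; apply: gu; exists (l' + n.+1%:Z * p%:Z ^+ 2), m'.
    rewrite intrD !intrM -!pmulrn.
    have -> : p%:R * u = p%:R * (u - n.+1%:R * (p%:R * t)) +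
      n.+1%:R * p%:R * p%:R * t by ring.
    by rewrite e; ring.
  have := N2 _ n.+1 gu'; rewrite subrK => ->.
  rewrite NegzE -addrA (qexpD (_ / 2)) (@sgn_half _ _ n.+1); last by rewrite oddzN.
  rewrite mulrNz -pmulrn mulNr.
  set v := u - _; set s := (-1) ^+ _.
  have ss : s * s = 1 by rewrite -expr2 sqrr_sign.
  have EE : qexp (3 * (- n.+1%:R) ^+ 2 * p%:R ^+ 2 * t / 2 + 3 * - n.+1%:R * p%:R * u) *
    qexp (3 * n.+1%:R ^+ 2 * p%:R ^+ 2 * t / 2 + 3 * n.+1%:R * p%:R * v) = 1.
    by rewrite -qexpD -[RHS]qexp0; congr Defs.qexp; rewrite /v; field.
  move: EE; set A := qexp _; set B := qexp _ => AB.
  transitivity ((s * s) * (A * B) * combH p t v); first by rewrite ss AB !mul1r.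
  by ring.
rewrite Z2 mulrA -qexpD; congr (Defs.qexp _ * _).
by rewrite intrD; ring.
Qed.

(** The point 1/p is torsion of exact order p. *)
Lemma torsion_notlat (s : C) : 0 < complex.Im s -> ~ inlat s (1 / p%:R).
Proof.
move=> s0 [l [m e]].
have e2 : (1 : C) = (p%:Z * l)%:~R * s + (p%:Z * m)%:~R.
  by rewrite !intrM -!pmulrn -!mulrA -mulrDr -e; field.
have l0 : p%:Z * l = 0.
  have : complex.Im (1 : C) = complex.Im ((p%:Z * l)%:~R * s +
    (p%:Z * m)%:~R) by rewrite -e2.
  rewrite ImD Im_intM -realC_int /= addr0 => /esym /eqP.
  by rewrite mulf_eq0 (gt_eqF s0) orbF intr_eq0 => /eqP.
move: e2; rewrite l0 mul0r add0r => /esym/eqP;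
  rewrite -[X in _ == X]/(1%:~R) eqr_int => /eqP e3.
have : (p%:Z %| 1)%Z by apply/dvdzP; exists m; rewrite mulrC e3.
move=> h; have : (p %| 1)%N by [].
by rewrite dvdn1 => /eqP e4; move: hp3; rewrite e4.
Qed.

Lemma appell_notlat (s : C) a : 0 < complex.Im s -> (0 < a < p)%N ->
  ~ inlat (p%:R ^+ 2 * s) (p%:R * a%:R * s).
Proof.
move=> s0 /andP[a1 a2] [l [m e]].
have e2 : (p%:Z * a%:Z - p%:Z ^+ 2 * l)%:~R * s = m%:~R :> C.
  have -> : (m%:~R : C) = p%:R * a%:R * s - l%:~R * (p%:R ^+ 2 * s) by rewrite e; ring.
  by rewrite intrB !intrM -!pmulrn; ring.
have l0 : p%:Z * a%:Z - p%:Z ^+ 2 * l = 0.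
  have : complex.Im ((p%:Z * a%:Z - p%:Z ^+ 2 * l)%:~R * s : C) =
    complex.Im (m%:~R : C) by rewrite e2.
  by rewrite Im_intM -[m%:~R in RHS]realC_int /= => /eqP;
    rewrite mulf_eq0 (gt_eqF s0) orbF intr_eq0 => /eqP.
have e3 : a%:Z = p%:Z * l.
  have : p%:Z * (a%:Z - p%:Z * l) = 0 by rewrite -l0; ring.
  move=> /eqP; rewrite mulf_eq0 => /orP[/eqP h|/eqP /subr0_eq //].
  by have := prime_gt0 hp; move: h; case: (p).
have : (p %| a)%N by have : (p%:Z %| a%:Z)%Z by rewrite e3 dvdz_mulr.
by move=> /(dvdn_leq a1); rewrite leqNgt a2.
Qed.

Variables (al be c d k k2 cc : int).
Hypothesis dt : al * d - be * c = 1.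
Hypothesis alE : al = 1 + p%:Z * k.
Hypothesis dE : d = 1 + p%:Z * k2.
Hypothesis cE : c = p%:Z ^+ 2 * cc.
Variable t : C.
Hypothesis t0 : 0 < complex.Im t.

Definition autJ : C := c%:~R * t + d%:~R.
Definition t' : C := (al%:~R * t + be%:~R) / autJ.

Lemma autJ_neq0 : autJ != 0. Proof. exact: (@aut_neq0 _ al be c d). Qed.
Lemma t'_up : 0 < complex.Im t'. Proof. exact: moebius_up. Qed.

Let T := p%:R ^+ 2 * t.
Let T' := p%:R ^+ 2 * t'.

Lemma detC : al%:~R * d%:~R - be%:~R * c%:~R = 1 :> C.
Proof. by rewrite -!intrM -intrB dt. Qed.

Lemma cC : c%:~R = p%:R ^+ 2 * cc%:~R :> C.
Proof. by rewrite cE intrM rmorphXn. Qed.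
Lemma alC : al%:~R = 1 + p%:R * k%:~R :> C.
Proof. by rewrite alE intrD intrM -pmulrn. Qed.
Lemma dC : d%:~R = 1 + p%:R * k2%:~R :> C.
Proof. by rewrite dE intrD intrM -pmulrn. Qed.

Lemma dtT : al * d - (p%:Z ^+ 2 * be) * cc = 1.
Proof. by rewrite -dt cE; ring. Qed.

Lemma JT : cc%:~R * T + d%:~R = autJ.
Proof. by rewrite /autJ /T cE intrM rmorphXn /= -pmulrn; ring. Qed.

Lemma T'E : (al%:~R * T + (p%:Z ^+ 2 * be)%:~R) / (cc%:~R * T + d%:~R) = T'.
Proof. by rewrite JT /T' /t' /T intrM rmorphXn /= -pmulrn; ring. Qed.

(** The term of index a in [combG], cleared of its correction and multiplied by
    eta(p^2 s). *)
Definition appellN a s u : C := qexp (- (3 * a%:R ^+ 2 * s / 2 + 3 * a%:R * u)) *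
  mockN (p%:R ^+ 2 * s) (p%:R * u + p%:R * a%:R * s).

(** The action of weight 1 and index -3/2 of the matrix on functions of u. *)
Definition twist h u := autJ^-1 * qexp (3 * c%:~R * u ^+ 2 / (2 * autJ)) * h (u / autJ).

Lemma sdiff_qexp_comp h z : sdiff h z -> sdiff (fun u => qexp (h u)) z.
Proof. by move=> hs; apply: (@sdiff_comp _ qexp h) => //; exact: sdiff_qexp. Qed.

Lemma sdiffZ a h z : sdiff h z -> sdiff (fun u => a * h u) z.
Proof. by move=> hs; apply: sdiffM => //; exact: sdiff_cst. Qed.

Lemma twist_factor_sdiff z : sdiff (fun u =>
  autJ^-1 * qexp (3 * c%:~R * u ^+ 2 / (2 * autJ))) z.
Proof.
apply: sdiffZ; apply: (@sdiff_ext _ (fun u => qexp ((3 * c%:~R / (2 * autJ)) * u ^+ 2))).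
  by move=> u; congr Defs.qexp; ring.
by apply/sdiff_qexp_comp/sdiffZ/sdiffX; exact: sdiff_id.
Qed.

(** The term of index a is N(p u + p a t) for the modulus p^2 t, on which the
    matrix acts through (al, p^2 be; cc, d). Since al = 1 + p k, the matrix
    sends the argument to its translate by a k p^2 t + p a be, a period, so
    that [isres_shift] and [isres_moebius] identify the residues. The exponents
    differ by half of an even integer. *)
Lemma twist_appellN_pol a P : simple_pole (fun u =>
  twist (appellN a t') u - appellN a t u) P 0.
Proof.
have J0 := autJ_neq0; have pn := p0.
have [r Vr] := isres_ex T (p%:R * P + p%:R * a%:R * t).
have pol1 : simple_pole (appellN a t) P (r / p%:R * qexp (- (3 * a%:R ^+ 2 * t / 2 +
  3 * a%:R * P))).
  have := pol_comp p0 (pol_mockN (T_up hp3 t0) Vr).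
  move=> /(polM ltr01 (g := fun u => qexp (- (3 * a%:R ^+ 2 * t / 2 + 3 * a%:R * u)))) H.
  apply: pol_ext (H _) => [u|z _]; first by rewrite mulrC.
  apply: (@sdiff_ext _ (fun u => qexp (- (3 * a%:R) * u +
    - (3 * a%:R ^+ 2 * t / 2)))); last exact: sdiff_lin.
  by move=> u; congr Defs.qexp; ring.
have Vs := isres_shift (a%:Z * k) (p%:Z * a%:Z * be) Vr.
set s := qexp _ in Vs.
have Vm := isres_moebius dtT (T_up hp3 t0) Vs.
rewrite T'E JT in Vm.
set U := _ + _ + _ in Vm.
pose X : C := al%:~R * t + be%:~R.
have UE : U = p%:R * (P + a%:R * X).
  by rewrite /U /X alC /T !intrM -!pmulrn; ring.
have UJ : U / autJ = p%:R / autJ * P + p%:R * a%:R * t'.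
  by rewrite UE /t' -/X; field.
rewrite UJ in Vm.
have a0 : p%:R / autJ != 0 by rewrite mulf_neq0 ?invr_eq0.
have := pol_comp a0 (pol_mockN (T_up hp3 t'_up) Vm).
pose g u := autJ^-1 * qexp (3 * c%:~R * u ^+ 2 / (2 * autJ)) * qexp (- (3 *
  a%:R ^+ 2 * t' / 2 + 3 * a%:R * (u / autJ))).
move=> /(polM ltr01 (g := g)) H.
have {H}pol2 : simple_pole (twist (appellN a t')) P (qexp (- (3 * cc%:~R *
  U ^+ 2 / (2 * autJ))) * (s * r) / (p%:R / autJ) * g P).
  apply: pol_ext (H _) => [u|z _].
    rewrite /twist /appellN /g; have -> : p%:R * (u / autJ) = p%:R / autJ * u by ring.
    by ring.
  apply: sdiffM; first exact: twist_factor_sdiff.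
  apply: (@sdiff_ext _ (fun u => qexp (- (3 * a%:R / autJ) * u +
    - (3 * a%:R ^+ 2 * t' / 2)))); last exact: sdiff_lin.
  by move=> u; congr Defs.qexp; ring.
suff E : qexp (- (3 * cc%:~R * U ^+ 2 / (2 * autJ))) * (s * r) / (p%:R / autJ) * g P =
   r / p%:R * qexp (- (3 * a%:R ^+ 2 * t / 2 + 3 * a%:R * P)).
  by rewrite -(subrr (r / p%:R * qexp (- (3 * a%:R ^+ 2 * t / 2 +
    3 * a%:R * P)))) -{1}E; exact: polB.
have XJ : c%:~R * X + 1 = al%:~R * autJ.
  transitivity (c%:~R * X + (al%:~R * d%:~R - be%:~R * c%:~R)); first by rewrite detC.
  by rewrite /X /autJ; ring.
(* Completing the square; c X + 1 = al J comes from the determinant. *)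
have key : - (3 * cc%:~R * U ^+ 2 / (2 * autJ)) +
  (3 * c%:~R * P ^+ 2 / (2 * autJ)) - (3 * a%:R ^+ 2 * t' / 2 + 3 * a%:R * (P / autJ)) =
   - (al%:~R * (3 * a%:R ^+ 2 * X + 6 * a%:R * P) / 2).
  transitivity (- ((c%:~R * X + 1) * (3 * a%:R ^+ 2 * X + 6 * a%:R * P) / (2 * autJ))).
    by rewrite UE /t' -/X cC; field.
  by rewrite XJ; field.
have expE : qexp (- (3 * cc%:~R * U ^+ 2 / (2 * autJ))) * s * qexp (3 * c%:~R *
  P ^+ 2 / (2 * autJ)) *
   qexp (- (3 * a%:R ^+ 2 * t' / 2 + 3 * a%:R * (P / autJ))) =
     qexp (- (3 * a%:R ^+ 2 * t / 2 + 3 * a%:R * P)).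
  rewrite /s -!qexpD.
  set N := a%:Z * k + p%:Z * a%:Z * be.
  (* The parity uses that p is odd and that the determinant is odd. *)
  have parity : ~~ oddz (N - 3 * (a%:Z * a%:Z) * al * be).
    have : oddz (al * d - be * c) by rewrite dt.
    have : oddz al = ~~ oddz k.
      by rewrite alE !oddzE /= /oddz /= (p_odd hp hp3).
    rewrite /N !oddzE /= (_ : oddz p%:Z = true); last exact: p_odd hp hp3.
    by case: (oddz al); case: (oddz be); case: (oddz k); case: (oddz d);
      case: (oddz c); case: (oddz a%:Z).
  rewrite -[RHS](qexp_even _ parity); congr Defs.qexp.
  have -> : - (3 * cc%:~R * U ^+ 2 / (2 * autJ)) +
    (N%:~R / 2 + 3 * (a%:Z * k)%:~R ^+ 2 * T / 2 + 3 * (a%:Z * k)%:~R * (p%:R * P +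
      p%:R * a%:R * t)) +
    3 * c%:~R * P ^+ 2 / (2 * autJ) - (3 * a%:R ^+ 2 * t' / 2 + 3 * a%:R * (P / autJ)) =
    - (al%:~R * (3 * a%:R ^+ 2 * X + 6 * a%:R * P) / 2) +
    (N%:~R / 2 + 3 * (a%:Z * k)%:~R ^+ 2 * T / 2 + 3 * (a%:Z * k)%:~R * (p%:R * P +
      p%:R * a%:R * t)).
    by rewrite -key; ring.
  rewrite intrB /N !intrD !intrM -!pmulrn /X /T alC.
  by field.
rewrite -expE /g; field.
by rewrite J0 p0.
Qed.

Definition combGN s u := etaf (p%:R ^+ 2 * s) * combG p s u.
Definition combHN s u := etaf (p%:R ^+ 2 * s) * combH p s u.
(** The entire correction to [appellN], present when 6a > p. *)
Definition corrN a s u := if (6 * a < p)%N then 0 else etaf (p%:R ^+ 2 * s) *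
  theta_term s (6 * a%:Z - p%:Z) u.
Definition eta_ratio s : C := etaf (p%:R ^+ 2 * s) / etaf s.

Lemma combGNE s u : 0 < complex.Im s -> combGN s u =
  eta_ratio s * mockN s (1 / p%:R + u) -
  (chi12 p)%:~R * \sum_(1 <= a < (halfp p).+1) combc R p a%:Z *
    (appellN a s u - corrN a s u).
Proof.
move=> s0; have e0 := etaf_neq0 s0; rewrite /combGN /combG mulrBr; congr (_ - _).
  by rewrite mockN_mock /eta_ratio mulrA divfK.
rewrite mulrCA mulr_sumr; congr (_ * _); apply: eq_bigr => a _.
by rewrite /appellN mockN_mock /corrN /appell; case: ifP => _; ring.
Qed.

Lemma theta_term_sdiff s (n : int) z : sdiff (theta_term s n) z.
Proof.
apply: (@sdiff_ext _ (fun u => qexp ((- (n%:~R / 2)) * u +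
  - (n%:~R ^+ 2 * s / 24)))); last exact: sdiff_lin.
by move=> u; rewrite /theta_term; congr Defs.qexp; ring.
Qed.

Lemma corrN_sdiff a s z : sdiff (corrN a s) z.
Proof.
case E : (6 * a < p)%N.
  by apply: (@sdiff_ext _ (fun=> 0)) => [u|]; [rewrite /corrN E|exact: sdiff_cst].
apply: (@sdiff_ext _ (fun u => etaf (p%:R ^+ 2 * s) * theta_term s (6 *
  a%:Z - p%:Z) u)) => [u|].
  by rewrite /corrN E.
by apply: sdiffZ; exact: theta_term_sdiff.
Qed.

Lemma twist_sdiff h z : sdiff h (z / autJ) -> sdiff (twist h) z.
Proof.
move=> hs; apply: sdiffM; first exact: twist_factor_sdiff.
apply: (@sdiff_ext _ (fun u => h (autJ^-1 * u + 0))); first by move=> u;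
  rewrite addr0 mulrC.
by apply: sdiff_compl; rewrite addr0 mulrC.
Qed.

Lemma isres0 s Q r : isres s Q r -> ~ inlat s Q -> r = 0.
Proof. by move=> [[l [m [e _]]]|[_ ->]] // nl; case: nl; exists l, m. Qed.

(** As d = 1 and c = 0 modulo p, the torsion point 1/p is fixed up to periods. *)
Lemma inlat_torsion P : inlat t' (1 / p%:R + P / autJ) -> inlat t (1 / p%:R + P).
Proof.
have J0 := autJ_neq0; have pn := p0.
have -> : 1 / p%:R + P / autJ = (P + autJ / p%:R) / autJ by field; rewrite pn J0.
move=> /(inlat_moebius dt t0) h.
have := inlatD (- (p%:Z * cc)) (- k2) h.
have -> // : P + autJ / p%:R + (- (p%:Z * cc))%:~R * t + (- k2)%:~R = 1 / p%:R + P.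
by rewrite /autJ dC cC !intrN intrM -!pmulrn; field.
Qed.

Lemma mockN_torsion_pol s P r : 0 < complex.Im s -> isres s (1 / p%:R + P) r ->
  simple_pole (fun u => mockN s (1 / p%:R + u)) P r.
Proof.
move=> s0 hr; have : simple_pole (mockN s) (1 * P +
  1 / p%:R) r by rewrite (mul1r P) (addrC P); exact: pol_mockN.
move=> /(pol_comp (oner_neq0 _)); rewrite divr1; apply: pol_ext => u.
by rewrite (mul1r u) (addrC u).
Qed.

Lemma twist_torsion_pol P : exists2 r, simple_pole (twist (fun u =>
  mockN t' (1 / p%:R + u))) P r &
  ~ inlat t (1 / p%:R + P) -> r = 0.
Proof.
have J0 := autJ_neq0.
have [r hr] := isres_ex t' (1 / p%:R + P / autJ).
have h : simple_pole (fun u => mockN t' (1 / p%:R + u)) (autJ^-1 * P + 0) r.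
  by rewrite addr0 (mulrC autJ^-1 P); exact: mockN_torsion_pol t'_up hr.
have V0 : autJ^-1 != 0 by rewrite invr_eq0.
exists (r / autJ^-1 * (autJ^-1 * qexp (3 * c%:~R * P ^+ 2 / (2 * autJ)))).
  have := polM ltr01 (g := fun u => autJ^-1 * qexp (3 * c%:~R * u ^+ 2 / (2 *
    autJ))) _ (pol_comp V0 h).
  move=> /(_ (fun z _ => twist_factor_sdiff z)); apply: pol_ext => u.
  rewrite /twist addr0 [autJ^-1 * u]mulrC.
  by set f := autJ^-1 * qexp _; rewrite (mulrC f).
move=> nl; rewrite (isres0 hr) ?mul0r //; move=> /inlat_torsion; exact: nl.
Qed.

Lemma pol_opp h P r : simple_pole h (- P) r -> simple_pole (fun u => h (- u)) P (- r).
Proof.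
have -> : - P = -1 * P + 0 by ring.
have n1 : (-1 : C) != 0 by rewrite oppr_eq0 oner_neq0.
move=> /(pol_comp n1); rewrite invrN invr1 mulrN1; apply: pol_ext => u.
by rewrite mulN1r addr0.
Qed.

(** The poles of the terms [appellN] cancel by [twist_appellN_pol], and the
    corrections are entire; what remains are poles of N(1/p + u). *)
Lemma twist_combGN_pol P : exists2 r, simple_pole (fun u =>
  twist (combGN t') u - combGN t u) P r &
  ~ inlat t (1 / p%:R + P) -> r = 0.
Proof.
have [r1 h1 e1] := twist_torsion_pol P.
have [r2 hr2] := isres_ex t (1 / p%:R + P).
have h2 := mockN_torsion_pol t0 hr2.
exists (eta_ratio t' * r1 - eta_ratio t * r2 - (chi12 p)%:~R * 0); last first.
  move=> nl; rewrite (e1 nl) (isres0 hr2 nl).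
  by move: (eta_ratio t') (eta_ratio t) ((chi12 p)%:~R : C) => A B X; ring.
have hs : simple_pole (fun u => \sum_(1 <= a < (halfp p).+1) combc R p a%:Z *
   ((twist (appellN a t') u - appellN a t u) - (twist (corrN a t') u - corrN a t u))) P 0.
  apply: pol_sum => a; rewrite -(mulr0 (combc R p a%:Z)); apply: polZ.
  rewrite -(subr0 0); apply: polB; first exact: twist_appellN_pol.
  apply: entire_pol => z; apply: sdiffB; last exact: corrN_sdiff.
  by apply: twist_sdiff; exact: corrN_sdiff.
have := polB (polB (polZ (eta_ratio t') h1) (polZ (eta_ratio t) h2)) (polZ (chi12 p)%:~R hs).
apply: pol_ext => u; rewrite (combGNE _ t0) [twist (combGN t') u]/twist (combGNE _ t'_up).
set f := autJ^-1 * qexp _.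
have -> : \sum_(1 <= a < (halfp p).+1) combc R p a%:Z *
     (twist (appellN a t') u - appellN a t u - (twist (corrN a t') u - corrN a t u)) =
   f * (\sum_(1 <= a < (halfp p).+1) combc R p a%:Z *
     (appellN a t' (u / autJ) - corrN a t' (u / autJ))) -
   \sum_(1 <= a < (halfp p).+1) combc R p a%:Z * (appellN a t u - corrN a t u).
  rewrite mulr_sumr -sumrB; apply: eq_bigr => a _.
  rewrite /twist -/f.
  move: (appellN a t' _) (appellN a t u) (corrN a t' _) (corrN a t u) (combc R p a%:Z) f => b1 b2 b3 b4 b5 f0.
  ring.
rewrite [twist _ u]/twist -/f.
move: (\sum_(1 <= a < _) _) (\sum_(1 <= a < _) _) (eta_ratio t') (eta_ratio t) (mockN t' _) (mockN t _) f ((chi12 p)%:~R : C) => S1 S2 A B N1 N2 f0 X.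
ring.
Qed.

Lemma twist_combHN u : twist (combHN t') u - combHN t u =
  (twist (combGN t') u - combGN t u) + (twist (combGN t') (- u) - combGN t (- u)).
Proof.
rewrite /twist /combHN /combGN /combH (sqrrN u) (mulNr u autJ^-1).
set f := autJ^-1 * qexp _; set A := combG p t' _; set B := combG p t' _;
  set e := etaf _; set e' := etaf _.
ring.
Qed.

(** The theta factors kill the simple poles at the translates of 1/p and -1/p. *)
Definition twist_gap u := (twist (combHN t') u - combHN t u) *
  (theta t (u - 1 / p%:R) * theta t (u + 1 / p%:R)).

Lemma theta_factor_sdiff z : sdiff (fun u => theta t (u - 1 / p%:R) * theta t (u +
  1 / p%:R)) z.
Proof.
have S (b : C) : sdiff (fun u => theta t (u + b)) z.
  apply: (@sdiff_ext _ (fun u => theta t (1 * u + b))); first by move=> u; rewrite mul1r.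
  by apply: sdiff_compl; exact: theta_sdiff.
by apply: sdiffM; exact: S.
Qed.

Lemma twist_gap_pol P : simple_pole twist_gap P 0.
Proof.
have [r h e] := twist_combGN_pol P; have [r' h' e'] := twist_combGN_pol (- P).
have := polM ltr01 (fun z _ => theta_factor_sdiff z) (polD h (pol_opp h')).
have -> : (r - r') * (theta t (P - 1 / p%:R) * theta t (P + 1 / p%:R)) = 0.
  have A : r * theta t (P + 1 / p%:R) = 0.
    have [l|nl] := pselect (inlat t (1 / p%:R + P)); last by rewrite e ?mul0r.
    by rewrite (theta_zero t0) ?mulr0 // addrC.
  have B : r' * theta t (P - 1 / p%:R) = 0.
    have [l|nl] := pselect (inlat t (1 / p%:R + - P)); last by rewrite e' ?mul0r.
    rewrite (theta_zero t0) ?mulr0 //.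
    by have [l' [m' e2]] := l; exists (- l'), (- m');
      rewrite !intrN -[P - _]opprB e2; ring.
  by transitivity ((r * theta t (P + 1 / p%:R)) * theta t (P - 1 / p%:R) - (r' *
    theta t (P - 1 / p%:R)) * theta t (P + 1 / p%:R)); [ring|rewrite A B !mul0r subrr].
by apply: pol_ext => u; rewrite /twist_gap twist_combHN.
Qed.

Lemma combGN_sdiff (s : C) : 0 < complex.Im s -> sdiff (combGN s) 0.
Proof.
move=> s0.
have gg : (fun u => eta_ratio s * mockN s (1 / p%:R + u) -
  (chi12 p)%:~R * \sum_(1 <= a < (halfp p).+1) combc R p a%:Z *
    (appellN a s u - corrN a s u)) =1 combGN s.
  by move=> v; rewrite combGNE.
apply: (sdiff_ext gg); apply: sdiffB; apply: sdiffZ.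
  apply: (@sdiff_ext _ (fun u => mockN s (1 * u + 1 / p%:R))).
    by move=> v; rewrite (mul1r v) (addrC v).
  apply: sdiff_compl; rewrite mulr0 add0r; apply: (mockN_sdiff s0);
    last exact: torsion_notlat.
  by rewrite mul1r -realC_nat -realCV /= normr0.
apply: (@sdiff_ext _ (fun u => \sum_(1 <= a < (halfp p).+1 | (1 <=
  a < (halfp p).+1)%N) combc R p a%:Z * (appellN a s u - corrN a s u))).
  by move=> v; rewrite -big_nat.
apply: sdiff_sum => a /andP[a1 a2]; apply: sdiffZ; apply: sdiffB; last exact: corrN_sdiff.
have ap : (a < p)%N by have := halfpE hp hp3; move: a2; clear; lia.
apply: sdiffM.
  apply: (@sdiff_ext _ (fun u => qexp (- (3 * a%:R) * u +
    - (3 * a%:R ^+ 2 * s / 2)))); last exact: sdiff_lin.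
  by move=> v; congr Defs.qexp; ring.
apply: sdiff_compl; rewrite mulr0 add0r.
apply: (mockN_sdiff (T_up hp3 s0)); last by apply: appell_notlat; rewrite ?a1.
rewrite -natrM -natrX !Im_natM normrM (gtr0_norm s0) normr_nat ltr_pM2r // ltr_nat expnS expn1.
by rewrite ltn_pmul2l // prime_gt0.
Qed.

Lemma sdiff_opp h u : sdiff h (- u) -> sdiff (fun v => h (- v)) u.
Proof.
move=> hs; apply: (@sdiff_ext _ (fun v => h (-1 * v + 0))); first by move=> v;
  rewrite mulN1r addr0.
by apply: sdiff_compl; rewrite mulN1r addr0.
Qed.

Lemma twist_gap_sdiff : sdiff twist_gap 0.
Proof.
have hs : sdiff (fun u => twist (combGN t') u - combGN t u) 0.
  apply: sdiffB; last exact: combGN_sdiff.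
  by apply: twist_sdiff; rewrite mul0r; apply: combGN_sdiff; exact: t'_up.
apply: (@sdiff_ext _ (fun u => ((twist (combGN t') u - combGN t u) +
  (twist (combGN t') (- u) - combGN t (- u))) *
   (theta t (u - 1 / p%:R) * theta t (u + 1 / p%:R)))).
  by move=> v; rewrite /twist_gap twist_combHN.
apply: sdiffM; last exact: theta_factor_sdiff.
apply: sdiffD; first exact: hs.
by apply: (@sdiff_opp (fun u => twist (combGN t') u - combGN t u)); rewrite oppr0.
Qed.

Lemma good_moebius u : good p t u -> good p t' (u / autJ).
Proof. by rewrite /good mulrA => g /(inlat_moebius dt t0). Qed.

(** These integers govern the signs in the quasi-periods of the twisted
    function. *)
Lemma parity_odd : oddz (al - p%:Z * cc + 3 * c * al) /\ oddz (d - p%:Z * be +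
  3 * be * d).
Proof.
have : oddz (al * d - be * c) by rewrite dt.
have : oddz c = oddz cc by rewrite cE !oddzE /= /oddz /= (p_odd hp hp3).
rewrite !oddzE /= (_ : oddz p%:Z = true); last exact: p_odd hp hp3.
by case: (oddz al); case: (oddz be); case: (oddz c); case: (oddz d); case: (oddz cc).
Qed.

Lemma combHN_lattice s v l m : 0 < complex.Im s -> good p s v ->
  combHN s (v + l%:~R * (p%:R * s) + m%:~R) =
  qexp ((l + m)%:~R / 2 + 3 * l%:~R ^+ 2 * p%:R ^+ 2 * s / 2 +
    3 * l%:~R * p%:R * v) * combHN s v.
Proof. by move=> s0 g; rewrite /combHN combH_lattice // mulrCA. Qed.

(** Dividing u + 1 by the automorphy factor moves u / J by the period - c t' +
    al, and the quasi-periodicity of the transformed function gives the same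
    factor as for the original one. *)
Lemma twist_combHN1 u : good p t u -> twist (combHN t') (u + 1) = - twist (combHN t') u.
Proof.
move=> g; have J0 := autJ_neq0; have D := detC; have g' := good_moebius g.
have e1 : (u + 1) / autJ = u / autJ + (- (p%:Z * cc))%:~R * (p%:R * t') + al%:~R.
  have h : 1 / autJ = - (c%:~R * t') + al%:~R.
    apply/eqP; rewrite -(inj_eq (mulIf J0)) divfK //; apply/eqP.
    transitivity (al%:~R * d%:~R - be%:~R * c%:~R : C) => //.
    by move: J0; rewrite /t' /autJ => J0; field.
  by rewrite mulrDl -[1 / autJ]/(1 / autJ) h intrN intrM -pmulrn cC; ring.
rewrite /twist e1 combHN_lattice //; last exact: t'_up.
have [odd1 _] := parity_odd.
have key : 3 * c%:~R * (u + 1) ^+ 2 / (2 * autJ) + ((- (p%:Z * cc) + al)%:~R / 2 +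
    3 * (- (p%:Z * cc))%:~R ^+ 2 * p%:R ^+ 2 * t' / 2 +
      3 * (- (p%:Z * cc))%:~R * p%:R * (u / autJ)) =
    3 * c%:~R * u ^+ 2 / (2 * autJ) + (al - p%:Z * cc + 3 * c * al)%:~R / 2 :> C.
  have h : c%:~R / autJ + c%:~R ^+ 2 * t' = c%:~R * al%:~R :> C.
    transitivity (c%:~R * al%:~R * (al%:~R * d%:~R - be%:~R * c%:~R) +
      c%:~R * (1 - (al%:~R * d%:~R - be%:~R * c%:~R)) * al%:~R
       + (c%:~R / autJ) * (1 - (al%:~R * d%:~R - be%:~R * c%:~R)) : C).
      by move: J0; rewrite /t' /autJ => J0; field.
    by rewrite D; ring.
  rewrite !(intrD, intrB, intrN, intrM) -!pmulrn.
  transitivity (3 * c%:~R * u ^+ 2 / (2 * autJ) + (al%:~R - p%:R * cc%:~R) / 2 +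
    3 / 2 * (c%:~R / autJ + c%:~R ^+ 2 * t')).
    by rewrite cC; field.
  by rewrite h; ring.
have : qexp (3 * c%:~R * (u + 1) ^+ 2 / (2 * autJ)) * qexp ((- (p%:Z * cc) + al)%:~R / 2 +
    3 * (- (p%:Z * cc))%:~R ^+ 2 * p%:R ^+ 2 * t' / 2 +
      3 * (- (p%:Z * cc))%:~R * p%:R * (u / autJ)) =
   - qexp (3 * c%:~R * u ^+ 2 / (2 * autJ)) by rewrite -qexpD key qexp_odd.
set A := qexp (3 * c%:~R * (u + 1) ^+ 2 / _); set B := qexp (_ / 2 + _ + _);
  set A' := qexp (3 * c%:~R * u ^+ 2 / _).
move: autJ^-1 A B A' (combHN t' _) => J A B A' X E.
by transitivity (J * (A * B) * X); [ring|rewrite E; ring].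
Qed.

Lemma twist_combHN_tau u : good p t u -> twist (combHN t') (u + p%:R * t) =
  - qexp (3 * p%:R ^+ 2 * t / 2 + 3 * p%:R * u) * twist (combHN t') u.
Proof.
move=> g; have J0 := autJ_neq0; have D := detC; have g' := good_moebius g.
have e1 : (u + p%:R * t) / autJ = u / autJ + d%:~R * (p%:R * t') + (- (p%:Z * be))%:~R.
  have h : t / autJ = d%:~R * t' - be%:~R.
    apply/eqP; rewrite -(inj_eq (mulIf J0)) divfK //; apply/eqP.
    transitivity (t * (al%:~R * d%:~R - be%:~R * c%:~R)); first by rewrite D mulr1.
    by move: J0; rewrite /t' /autJ => J0; field.
  by rewrite mulrDl -mulrA h intrN intrM -pmulrn; ring.
rewrite /twist e1 combHN_lattice //; last exact: t'_up.
have [_ odd2] := parity_odd.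
have key : 3 * c%:~R * (u + p%:R * t) ^+ 2 / (2 * autJ) + ((d + - (p%:Z * be))%:~R / 2 +
    3 * d%:~R ^+ 2 * p%:R ^+ 2 * t' / 2 + 3 * d%:~R * p%:R * (u / autJ)) =
    (3 * p%:R ^+ 2 * t / 2 + 3 * p%:R * u) + 3 * c%:~R * u ^+ 2 / (2 * autJ) +
      ((d - p%:Z * be) + 3 * (p%:Z * p%:Z) * be * d)%:~R / 2 :> C.
  have h : d%:~R ^+ 2 * t' + c%:~R * t ^+ 2 / autJ = t + be%:~R * d%:~R.
    have : d%:~R ^+ 2 * t' + c%:~R * t ^+ 2 / autJ - (t + be%:~R * d%:~R) =
       (al%:~R * d%:~R - be%:~R * c%:~R - 1) * d%:~R * t / autJ.
      by move: J0; rewrite /t' /autJ => J0; field.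
    by rewrite D subrr !mul0r => /subr0_eq.
  rewrite !(intrD, intrB, intrN, intrM) -!pmulrn.
  transitivity ((3 * p%:R * (c%:~R * t + d%:~R) / autJ * u) +
    3 * c%:~R * u ^+ 2 / (2 * autJ) + (d%:~R - p%:R * be%:~R) / 2 +
     3 * p%:R ^+ 2 / 2 * (d%:~R ^+ 2 * t' + c%:~R * t ^+ 2 / autJ)).
    by field.
  by rewrite h -/autJ mulfK //; ring.
have : qexp (3 * c%:~R * (u + p%:R * t) ^+ 2 / (2 * autJ)) * qexp ((d +
  - (p%:Z * be))%:~R / 2 +
    3 * d%:~R ^+ 2 * p%:R ^+ 2 * t' / 2 + 3 * d%:~R * p%:R * (u / autJ)) =
   - (qexp (3 * p%:R ^+ 2 * t / 2 + 3 * p%:R * u) * qexp (3 * c%:~R * u ^+ 2 / (2 *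
     autJ))).
  have ppz : oddz p%:Z = true := p_odd hp hp3.
  by rewrite -qexpD key qexp_odd ?qexpD //; move: odd2; rewrite !oddzE ppz.
set A := qexp (3 * c%:~R * (u + _) ^+ 2 / _); set B := qexp (_ / 2 + _ + _);
  set A' := qexp (3 * c%:~R * u ^+ 2 / _).
set A'' := qexp (3 * p%:R ^+ 2 * t / 2 + _).
move: autJ^-1 A B A' A'' (combHN t' _) => J A B A' A'' X E.
by transitivity (J * (A * B) * X); [ring|rewrite E; ring].
Qed.

Lemma good_discrete P : exists2 L : R, 0 < L & forall z, 0 < cm (z - P) <= L ->
  good p t z.
Proof.
have [L L0 hL] := lattice_discrete (p%:R * P) t0.
have cp : 0 < cm (p%:R : C) by rewrite cm_gt0.
exists (L / cm (p%:R : C)); first by rewrite divr_gt0.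
move=> z; rewrite ler_pdivlMr // mulrC -cmM => /andP[z0 zL]; apply: hL.
by rewrite -mulrBr zL cmM mulr_gt0.
Qed.

Lemma twist_gap1 u : good p t u -> cm (twist_gap (u + 1)) = cm (twist_gap u).
Proof.
move=> g; rewrite /twist_gap twist_combHN1 //.
have -> : combHN t (u + 1) = - combHN t u by rewrite /combHN combH1 // mulrN.
have -> : u + 1 - 1 / p%:R = u - 1 / p%:R + 1 by ring.
have -> : u + 1 + 1 / p%:R = u + 1 / p%:R + 1 by ring.
rewrite !theta1; move: (twist _ _) (combHN t u) (theta _ _) (theta _ _) => A B y2 y1.
have -> : (- A - - B) * (- y1 * - y2) = - ((A - B) * (y1 * y2)) by ring.
by rewrite cmN.
Qed.

(** The factor e(3 p^2 t/2 + 3 p u) of [combH] decays upwards more than the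
    factor e(- p^2 t - 2 p u) of the two theta functions grows. This inequality
    between the indices is what [negative_index_zero] exploits. *)
Lemma twist_gap_tau u : good p t u -> cm (twist_gap (u + p%:R * t)) =
  cm (twist_gap u) * expR (- (2 * (pi * p%:R) * complex.Im u +
    pi * p%:R * complex.Im (p%:R * t))).
Proof.
move=> g; rewrite /twist_gap twist_combHN_tau //.
have -> : combHN t (u + p%:R * t) = - qexp (3 * p%:R ^+ 2 * t / 2 +
  3 * p%:R * u) * combHN t u.
  by rewrite /combHN combH_shift //; ring.
have -> : u + p%:R * t - 1 / p%:R = u - 1 / p%:R + p%:R * t by ring.
have -> : u + p%:R * t + 1 / p%:R = u + 1 / p%:R + p%:R * t by ring.
rewrite !theta_taun //.
have -> : - (2 * (pi * p%:R) * complex.Im u + pi * p%:R * complex.Im (p%:R * t)) =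
   - (2 * pi * complex.Im (p%:R * u + p%:R / 2 * (p%:R * t))) :> R.
  have -> : p%:R / 2 * (p%:R * t) = ((p%:R / 2 : R)%:C)%C * (p%:R * t).
    by rewrite realCM realCV !realC_nat.
  by rewrite ImD (cImM (_%:C)%C) /= mul0r addr0 !Im_natM; field.
rewrite -cm_qexp -[RHS]cmM.
have E : qexp (3 * p%:R ^+ 2 * t / 2 + 3 * p%:R * u) *
  (qexp (- (p%:R * (u - 1 / p%:R)) - p%:R ^+ 2 * t / 2) * qexp (- (p%:R * (u +
    1 / p%:R)) - p%:R ^+ 2 * t / 2)) =
  qexp (p%:R * u + p%:R / 2 * (p%:R * t)).
  by rewrite -!qexpD; congr Defs.qexp; field; exact: p0.
rewrite -E.
have ss : (-1) ^+ p * (-1) ^+ p = 1 :> C by rewrite -expr2 sqrr_sign.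
move: (twist _ _) (combHN t u) (qexp _) (qexp _) (qexp _) ((-1) ^+ p : C) ss (theta _ _) (theta _ _) => A B q1 q2 q3 s ss y1 y2.
rewrite -[RHS]cmN; congr cm.
transitivity (- ((s * s) * ((A - B) * (y1 * y2) * (q1 * (q2 * q3))))); first by ring.
by rewrite ss; ring.
Qed.

(** The gap is pole-free by [twist_gap_pol] and has negative index, hence
    vanishes near u = 0, and there the theta factors are nonzero. *)
Theorem weight_one : combHN t' 0 = autJ * combHN t 0.
Proof.
have J0 := autJ_neq0.
have [L L0 hL] : exists2 L : R, 0 < L & forall z, 0 < cm (z - 0) < L -> twist_gap z = 0.
  apply: (@negative_index_zero R twist_gap (p%:R * t) (pi * p%:R)) => [|| P|P].
  - by rewrite Im_natM mulr_gt0 // ltr0n prime_gt0.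
  - by rewrite mulr_gt0 ?pi_gt0 // ltr0n prime_gt0.
  - have [L1 L10 [M hM]] := twist_gap_pol P; exists L1 => //; exists M => v /hM.
    by rewrite mul0r subr0.
  - have [L2 L20 h2] := good_discrete P; exists L2 => // v /h2 g.
    by split; [exact: twist_gap1|exact: twist_gap_tau].
have Y00 : twist_gap 0 = 0 := eq_punctured L0 twist_gap_sdiff (sdiff_cst 0 0) hL.
have n1 : ~ inlat t (1 / p%:R) by exact: torsion_notlat.
have n2 : ~ inlat t (- (1 / p%:R)) by exact: notlatN.
have : twist_gap 0 = (autJ^-1 * combHN t' 0 - combHN t 0) *
  (theta t (- (1 / p%:R)) * theta t (1 / p%:R)).
  rewrite /twist_gap sub0r add0r /twist mul0r.
  have -> : 3 * c%:~R * (0 : C) ^+ 2 / (2 * autJ) = 0 by rewrite expr0n /= mulr0 mul0r.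
  by rewrite qexp0 mulr1.
rewrite Y00 => /esym/eqP;
  rewrite mulf_eq0 [X in _ || X]mulf_eq0 (negPf (theta_neq0 t0 n1)) (negPf (theta_neq0 t0 n2)) !orbF => /eqP/subr0_eq <-.
by rewrite mulrA divff // mul1r.
Qed.

End FixP.
End Modularity.

(** * A Rogers-Fine identity *)

Section RogersFine.
Variable R : realType.
Local Notation C := (Cplx R).
Variables (q w : C).
Hypothesis q0 : q != 0.
Hypothesis q1 : cm q < 1.
Hypothesis w1 : cm w = 1.

Let r := cm q.
Let r0 : 0 <= r := cm_ge0 q.

Lemma cw0 : w != 0. Proof. by rewrite -cm_gt0 w1. Qed.

Lemma sub_w Q : 1 - Q / w != 0 -> w - Q != 0.
Proof.
have w0 := cw0; move=> h; have -> : w - Q = (1 - Q / w) * w by field.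
by rewrite mulf_neq0.
Qed.

Lemma rp_bound N n : expR (- (2 * (r / (1 - r)))) <= cm (qp (q ^+ N.+1 / w) q n).
Proof.
apply: le_trans (rp_lower n r0 q1) (qp_ge_rp n r0 q1 _) => k.
rewrite cmM cmM cmV w1 invr1 mulr1 -cmM -exprD cmX.
by apply: ler_wiXn2l; rewrite ?r0 ?(ltW q1) // addSn ltnS leq_addl.
Qed.

Lemma rp_bound' n : expR (- (2 * (r / (1 - r)))) <= cm (qp (w * q) q n).
Proof.
apply: le_trans (rp_lower n r0 q1) (qp_ge_rp n r0 q1 _) => k.
by rewrite cmM cmM w1 mul1r -cmM -exprS cmX.
Qed.

Lemma qp1_neq0 N n : qp (q ^+ N.+1 / w) q n != 0.
Proof. by rewrite -cm_gt0; exact: lt_le_trans (expR_gt0 _) (rp_bound N n). Qed.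

Lemma qp2_neq0 n : qp (w * q) q n != 0.
Proof. by rewrite -cm_gt0; exact: lt_le_trans (expR_gt0 _) (rp_bound' n). Qed.

Lemma fac1_neq0 N : 1 - q ^+ N.+1 / w != 0.
Proof. by have := qp1_neq0 N 1; rewrite qpS qp0 mul1r expr0 mulr1. Qed.

Lemma fac2_neq0 N : 1 - w * q ^+ N.+1 != 0.
Proof.
have := qp2_neq0 N.+1; rewrite qpS mulf_eq0 negb_or => /andP[_].
by rewrite exprS mulrA.
Qed.

Definition fine_term N n : C := (w * q ^+ N.+1) ^+ n / qp (q ^+ N.+1 / w) q n.

Lemma fine_term_geo N : geo (fine_term N) (expR (2 * (r / (1 - r)))) r.
Proof.
move=> n; rewrite /fine_term cmM cmV cmX cmM w1 mul1r cmX mulrC; apply: ler_pM.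
- by rewrite invr_ge0 cm_ge0.
- by rewrite !exprn_ge0 ?cm_ge0.
- rewrite -[2 * _]opprK expRN lef_pV2 ?posrE ?expR_gt0 ?cm_gt0 ?qp1_neq0 //.
  exact: rp_bound.
- rewrite -exprM; apply: ler_wiXn2l; rewrite ?r0 ?(ltW q1) //.
  by rewrite mulSn leq_addr.
Qed.

(** Fine's function with one parameter zero. Its value at N = 0 is the sum over
    the largest part that arises from partitions; iterating [fine_sum_step]
    turns it into a sum over Durfee rectangles. *)
Definition fine_sum N : C := lim ((fun n => \sum_(k < n) fine_term N k) @ \oo).
Lemma fine_sum_csum N : csum (fine_term N) (fine_sum N).
Proof. by have [l hl] := geo_cvg (fine_term_geo N) r0 q1;
  rewrite /fine_sum (ccvg_lim hl). Qed.

Lemma fine_sum_le N : cm (fine_sum N) <= expR (2 * (r / (1 - r))) / (1 - r).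
Proof. exact: csum_le (fine_sum_csum N) (fine_term_geo N) r0 q1. Qed.

(** The term of index n + 1 minus w q^(N+1) times the term of index n is a
    multiple of the n-th term of the sum for N + 1. *)
Lemma fine_sum_step N : (1 - w * q ^+ N.+1) * fine_sum N =
  1 + q ^+ (2 * N.+1) / (1 - q ^+ N.+1 / w) * fine_sum N.+1.
Proof.
have w0 := cw0.
have S1 : csum (fun n => fine_term N n.+1 +
  - (w * q ^+ N.+1) * fine_term N n) (fine_sum N - fine_term N 0%N +
    - (w * q ^+ N.+1) * fine_sum N).
  by apply: csumD; [exact: csum_S (fine_sum_csum N)|apply: csumZ; exact: fine_sum_csum].
have S2 : csum (fun n => fine_term N n.+1 +
  - (w * q ^+ N.+1) * fine_term N n) (q ^+ (2 * N.+1) / (1 - q ^+ N.+1 / w) *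
    fine_sum N.+1).
  apply: (csum_ext _ (csumZ _ (fine_sum_csum N.+1))) => n.
  have h1 := fac1_neq0 N; have h2 := qp1_neq0 N.+1 n; have h3 := qp1_neq0 N n.
  have h4 := fac1_neq0 (N + n).
  have E : (1 - q ^+ N.+1 / w) * qp (q ^+ N.+2 / w) q n =
    qp (q ^+ N.+1 / w) q n * (1 - q ^+ N.+1 / w * q ^+ n).
    by rewrite -qpS qpSl (exprSr q N.+1) mulrAC.
  have -> : fine_term N n.+1 = (w * q ^+ N.+1) ^+ n.+1 / ((1 - q ^+ N.+1 / w) *
    qp (q ^+ N.+2 / w) q n).
    by rewrite /fine_term E qpS.
  have -> : fine_term N n = (w * q ^+ N.+1) ^+ n * (1 - q ^+ N.+1 / w *
    q ^+ n) / ((1 - q ^+ N.+1 / w) * qp (q ^+ N.+2 / w) q n).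
    rewrite E /fine_term;
      have h5 : 1 - q ^+ N.+1 / w * q ^+ n != 0 by rewrite mulrAC -exprD addSn.
    move: h3 h5; set A := qp _ _ _; set B := 1 - _; set X := _ ^+ n => h3 h5.
    by field; rewrite h3 h5.
  rewrite /fine_term (exprS _ n) mul2n -addnn exprD.
  have -> : (w * q ^+ N.+2) ^+ n = (w * q ^+ N.+1) ^+ n *
    q ^+ n by rewrite -exprMn exprSr mulrA.
  move: h1 h2; set A := qp _ _ _; set X := (_ * _) ^+ n; set Q := q ^+ N.+1;
    set Y := q ^+ n => h1 h2.
  have h1' := sub_w h1.
  by field; rewrite h2 h1' w0.
have := ccvg_uniq S1 S2; rewrite /fine_term expr0 qp0 invr1 mulr1 => <-.
by ring.
Qed.

Definition dual_term n : C := q ^+ (n ^ 2 + n) / (qp (q / w) q n * qp (w * q) q n.+1).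

Lemma fine_sum_iter N : fine_sum 0 = \sum_(k < N) dual_term k +
  q ^+ (N ^ 2 + N) / (qp (q / w) q N * qp (w * q) q N) * fine_sum N.
Proof.
elim: N => [|N IH]; first by rewrite big_ord0 !qp0 -[(0 ^ 2 +
  0)%N]/0%N expr0 mulr1 invr1 !mul1r add0r.
rewrite big_ord_recr /= {1}IH -addrA; congr (_ + _).
have h1 := fac1_neq0 N; have h2 := fac2_neq0 N; have h3 := qp1_neq0 0 N;
  rewrite expr1 in h3.
have h4 := qp2_neq0 N; have w0 := cw0.
have -> : fine_sum N = (1 + q ^+ (2 * N.+1) / (1 - q ^+ N.+1 / w) *
  fine_sum N.+1) / (1 - w * q ^+ N.+1).
  by rewrite -fine_sum_step; field.
rewrite /dual_term !qpS.
have -> : q / w * q ^+ N = q ^+ N.+1 / w by rewrite mulrAC -exprS.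
have -> : w * q * q ^+ N = w * q ^+ N.+1 by rewrite -mulrA -exprS.
have -> : (N.+1 ^ 2 + N.+1 = N ^ 2 + N + 2 * N.+1)%N by rewrite !expnS !expn0; lia.
rewrite (exprD q (N ^ 2 + N)); move: h1 h2 h3 h4.
set A := qp _ _ _; set B := qp _ _ _; set X := q ^+ (N ^ 2 + N);
  set Y := q ^+ (2 * _); set Q := q ^+ N.+1 => h1 h2 h3 h4.
have h1' := sub_w h1.
by field; rewrite h1' w0 h2 h3 h4.
Qed.

Lemma fine_sum_dual : csum dual_term (fine_sum 0).
Proof.
pose D := (expR (2 * (r / (1 - r)))) ^+ 2 * (expR (2 * (r / (1 - r))) / (1 - r)).
have D0 : 0 <= D by rewrite mulr_ge0 ?exprn_ge0 ?expR_ge0 // divr_ge0 ?expR_ge0 // subr_ge0 ltW.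
pose v N := q ^+ (N ^ 2 + N) / (qp (q / w) q N * qp (w * q) q N) * fine_sum N.
have inv_le x : expR (- (2 * (r / (1 - r)))) <= x -> x^-1 <= expR (2 * (r / (1 - r))).
  move=> h; rewrite -[2 * _]opprK expRN lef_pV2 ?posrE ?expR_gt0 //.
  exact: lt_le_trans (expR_gt0 _) h.
have v0 : ccvg v 0.
  apply: (@geo_ccvg0 _ _ D r) => // N.
  have -> : cm (v N) = (cm (qp (q / w) q N))^-1 * (cm (qp (w * q) q N))^-1 *
    cm (fine_sum N) * cm q ^+ (N ^ 2 + N).
    by rewrite /v (cmM _ (fine_sum N)) cmM cmV cmM cmX invfM; ring.
  apply: ler_pM; rewrite ?mulr_ge0 ?invr_ge0 ?exprn_ge0 ?cm_ge0 //.
    rewrite /D expr2; apply: ler_pM; rewrite ?mulr_ge0 ?invr_ge0 ?cm_ge0 //;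
      last exact: fine_sum_le.
    apply: ler_pM; rewrite ?invr_ge0 ?cm_ge0 //; apply: inv_le; last exact: rp_bound'.
    by have := rp_bound 0 N; rewrite expr1.
  by apply: ler_wiXn2l; rewrite ?r0 ?(ltW q1) // leq_addl.
have := ccvgB (ccvg_cst (fine_sum 0)) v0; rewrite subr0; apply: ccvg_ext => N.
by rewrite (fine_sum_iter N) addrK.
Qed.

Lemma Ku_csum1 : csum (kterm w q) (Ku w q).
Proof. by apply: (@Ku_csum _ _ _ r); rewrite ?cmM ?cmV ?w1 ?mul1r ?invr1 ?mulr1. Qed.

(** Durfee squares on one side, Durfee rectangles on the other: up to a
    telescoping sum, (1 - w) E(w; q) is w^-1 times the dual sum of
    [fine_sum_dual]. *)
Lemma Ku_fine_sum : Ku w q = 1 - w^-1 + w^-1 * fine_sum 0.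
Proof.
have w0 := cw0.
pose c n := kterm w q n * (1 - q ^+ n / w).
have k_geo : geo (kterm w q) (expR (4 * (r / (1 - r)))) r.
  move=> n; have [] := @kterm_bound _ w q r n;
    rewrite ?cmM ?cmV ?w1 ?mul1r ?invr1 ?mulr1 //.
have c0 : ccvg c 0.
  apply: (@geo_ccvg0 _ _ (expR (4 * (r / (1 - r))) * 2) r) => // n.
  rewrite /c (cmM (kterm w q n)) [leRHS]mulrAC.
  apply: (ler_pM (cm_ge0 _) (cm_ge0 _) (k_geo n)).
  apply: (le_trans (cmB _ _)); rewrite cm1 cmM cmX cmV w1 invr1 mulr1 -[2]/(1 + 1) lerD2l.
  by rewrite exprn_ile1 // ltW.
have S1 := csum_tele c0.
have S2 := csumD (csumZ (-1) Ku_csum1) (csumZ w^-1 fine_sum_dual).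
have E : csum (fun n => c n.+1 - c n) (-1 * Ku w q + w^-1 * fine_sum 0).
  apply: csum_ext S2 => n; rewrite /c /kterm /dual_term !qpS.
  have h1 := fac1_neq0 n; have h2 := fac2_neq0 n; have h3 := qp1_neq0 0 n;
    rewrite expr1 in h3.
  have h4 := qp2_neq0 n.
  have -> : q / w * q ^+ n = q * q ^+ n / w by rewrite mulrAC.
  have -> : w * q * q ^+ n = w * (q * q ^+ n) by rewrite -mulrA.
  have -> : (n.+1 ^ 2 = n ^ 2 + n + n + 1)%N by rewrite !expnS !expn0; lia.
  rewrite !exprD expr1 (exprS q n); rewrite exprS in h1 h2; move: h1 h2 h3 h4.
  set A := qp _ _ _; set B := qp _ _ _; set X := q ^+ (n ^ 2);
    set Y := q ^+ n => h1 h2 h3 h4.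
  have h1' := sub_w h1.
  by field; rewrite w0 h1' h3 h2 h4.
have := ccvg_uniq E S1; rewrite /c /kterm !qp0 expr0 mulr1 invr1 !mul1r sub0r => h.
have -> : Ku w q = w^-1 * fine_sum 0 - (-1 * Ku w q + w^-1 * fine_sum 0) by ring.
by rewrite h; ring.
Qed.

End RogersFine.

(** * Partitions counted by rank *)

Section Partitions.

(** The bound m on the number of parts is there for the structural recursion;
    it is inactive as soon as n <= m, by [partitions_in_stable]. *)
Fixpoint partitions_in (m L n : nat) : seq (seq nat) :=
  (if n == 0%N then [:: [::]] else [::]) ++
  (if m is m'.+1 then [seq i :: l | i <- iota 1 (minn L n),
    l <- partitions_in m' i (n - i)] else [::]).

Lemma geq_trans : transitive geq. Proof. by move=> y x z /= h1 h2;
  exact: leq_trans h2 h1. Qed.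

Lemma mem_partitions_in m L n l : (l \in partitions_in m L n) =
  [&& is_partition n l, all (geq L) l & (size l <= m)%N].
Proof.
elim: m L n l => [|m IH] L n l.
  rewrite /= cats0; case: l => [|i l]; last first.
    by rewrite /= !andbF; case: (n == 0%N).
  by rewrite /is_partition /= eq_sym; case: eqP.
rewrite /= mem_cat; case: l => [|i l].
  rewrite /is_partition /= [(_ \in [seq _ | _ <- _, _ <- _])]negbTE ?orbF; last first.
    by apply/negP => /allpairsPdep [x [y [_ _]]].
  by rewrite eq_sym; case: eqP.
rewrite [(_ \in (if _ then _ else _))]negbTE; last by case: ifP.
rewrite /=; apply/allpairsPdep/idP => [[x [y [hx hy [-> ->]]]]|].
  move: hx hy; rewrite mem_iota IH /is_partition => /andP[x1 x2].
  rewrite add1n ltnS leq_min in x2; move: x2 => /andP[xL xn].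
  move=> /and3P[/and3P[s1 s2 s3] s4 s5]; apply/and3P; split => //.
    apply/and3P; split; [|by rewrite /= x1|by rewrite /= (eqP s3) subnKC].
    by rewrite /= (path_sortedE geq_trans) s4.
  rewrite /= xL; apply: sub_all s4 => z /= zx; exact: leq_trans zx xL.
rewrite /is_partition /= (path_sortedE geq_trans) =>
  /and3P[/and3P[/andP[s1 s2] /andP[i1 s3] /eqP s4] /andP[iL s5] s6].
exists i, l; split=> //; first by rewrite mem_iota i1 add1n ltnS leq_min iL -s4 leq_addr.
by rewrite IH /is_partition s2 s3 s1 -s4 addKn eqxx /= -ltnS.
Qed.

Lemma uniq_partitions_in m L n : uniq (partitions_in m L n).
Proof.
elim: m L n => [|m IH] L n /=; first by case: (n == 0%N).
rewrite cat_uniq; apply/and3P; split; first by case: (n == 0%N).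
  by apply/hasPn => l /allpairsPdep [x [y [_ _ ->]]]; case: (n == 0%N).
apply: allpairs_uniq_dep => [|i _|]; [exact: iota_uniq|exact: IH|].
by move=> [i l] [i' l'] _ _ /= [-> ->].
Qed.

Lemma size_sumn l : all (leq 1) l -> (size l <= sumn l)%N.
Proof. by elim: l => //= i l IH /andP[i1 /IH h]; rewrite -add1n leq_add. Qed.

Lemma partitions_in_stable m L n : (n <= m)%N ->
  perm_eq (partitions_in m L n) (partitions_in n L n).
Proof.
move=> nm; apply: uniq_perm; rewrite ?uniq_partitions_in // => l;
  rewrite !mem_partitions_in.
have [/and3P[_ h2 /eqP h3]|//] := boolP (is_partition n l).
by have := size_sumn h2; rewrite h3 => h; rewrite h (leq_trans h nm).
Qed.

Section Weighted.
Variable K : comNzRingType.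
Variable x : K.

(** For x = 1 this counts partitions and bounds all the weighted sums; for x =
    1 / w it is the contribution of the parts other than the largest. *)
Definition part_sum L n : K := \sum_(l <- partitions_in n L n) x ^+ size l.

Lemma part_sum_rec L n : part_sum L n = (n == 0%N)%:R + x * \sum_(1 <=
  i < (minn L n).+1) part_sum i (n - i).
Proof.
case: n => [|n]; first by rewrite /part_sum /= minn0 big_geq // mulr0 addr0 big_seq1.
rewrite /part_sum [partitions_in n.+1 L n.+1]/= add0r big_allpairs_dep mulr_sumr /index_iota subn1 /=.
rewrite !big_seq; apply: eq_bigr => i; rewrite mem_iota => /andP[i1 _].
rewrite (perm_big _ (@partitions_in_stable n i (n.+1 - i) _)) /=;
  last by rewrite leq_subLR -(add1n n) leq_add2r.
by rewrite mulr_sumr; apply: eq_bigr => l _; rewrite exprS.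
Qed.

Lemma part_sum0 n : part_sum 0 n = (n == 0%N)%:R.
Proof. by rewrite part_sum_rec min0n big_geq // mulr0 addr0. Qed.

Lemma part_sum_succ L n : part_sum L.+1 n =
  part_sum L n + (if (L.+1 <= n)%N then x * part_sum L.+1 (n - L.+1) else 0).
Proof.
rewrite [LHS]part_sum_rec [part_sum L n]part_sum_rec; case: ifP => h.
  by rewrite (minn_idPl h) big_nat_recr //= (minn_idPl (ltnW h)) mulrDr addrA.
move: h => /negbT; rewrite -leqNgt => h.
by rewrite (minn_idPr h) (minn_idPr (leqW h)) addr0.
Qed.
End Weighted.

Section RealBound.
Variable R : realType.

Lemma part_sum_ge0 L n : 0 <= part_sum (1 : R) L n.
Proof. by apply: sumr_ge0 => l _; rewrite expr1n. Qed.

Lemma sum_shift (K : pzRingType) (u : nat -> K) (k N : nat) :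
  \sum_(n < N) (if (k <= n)%N then u (n - k)%N else 0) = \sum_(n < N - k) u n.
Proof.
have [h|h] := leqP N k.
  have -> : (N - k = 0)%N by apply/eqP; rewrite subn_eq0.
  rewrite big_ord0 big1 // => i _; rewrite leqNgt (leq_trans (ltn_ord i) h) //.
move: (N - k)%N (subnKC (ltnW h)) => d <-.
rewrite big_split_ord /= big1 => [|i _]; last by rewrite leqNgt ltn_ord.
by rewrite add0r; apply: eq_bigr => i _; rewrite leq_addr addKn.
Qed.

(** Splitting off the parts equal to L + 1 gives the inequality (1 - s^(L+1))
    S_(L+1) <= S_L between partial sums. *)
Lemma part_sum_series_le (s : R) L N : 0 <= s -> s < 1 ->
  \sum_(n < N) part_sum 1 L n * s ^+ n <= (rp s L)^-1.
Proof.
move=> s0 s1; elim: L => [|L IH].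
  rewrite /rp big_ord0 invr1; case: N => [|N]; first by rewrite big_ord0.
  rewrite big_ord_recl part_sum0 eqxx expr0 mulr1 big1 ?addr0 // => i _.
  by rewrite part_sum0 /= mul0r.
have step : \sum_(n < N) part_sum 1 L.+1 n * s ^+ n <=
    (rp s L)^-1 + s ^+ L.+1 * \sum_(n < N) part_sum 1 L.+1 n * s ^+ n.
  under [leLHS]eq_bigr do rewrite part_sum_succ mulrDl.
  rewrite big_split /=; apply: lerD => //.
  rewrite (eq_bigr (fun n : 'I_N => if (L.+1 <=
    n)%N then s ^+ L.+1 * (part_sum 1 L.+1 (n - L.+1) * s ^+ (n - L.+1)) else 0)).
    rewrite (sum_shift (fun n => s ^+ L.+1 * (part_sum 1 L.+1 n * s ^+ n))) -mulr_sumr.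
    rewrite ler_wpM2l ?exprn_ge0 //.
    rewrite -!(big_mkord xpredT (fun n => part_sum 1 L.+1 n * s ^+ n)).
    rewrite [leRHS](@big_cat_nat _ _ _ (N - L.+1)) //= ?leq_subr // lerDl.
    by apply: sumr_ge0 => i _; rewrite mulr_ge0 ?part_sum_ge0 ?exprn_ge0.
  move=> i _; case: ifP => h; last by rewrite mul0r.
  have e : s ^+ i = s ^+ L.+1 * s ^+ (i - L.+1) by rewrite -exprD subnKC.
  by rewrite e; ring.
have e0 : 0 < 1 - s ^+ L.+1 by rewrite subr_gt0 exprn_ilt1.
rewrite /rp big_ord_recr /= -/(rp s L) invfM -ler_pdivrMr ?invr_gt0 // invrK.
by move: step; set A := \sum_(n < N) _; set B := (rp s L)^-1; set y := s ^+ L.+1; lra.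
Qed.

Lemma part_sum_le (s : R) L n : 0 <= s -> s < 1 ->
  part_sum 1 L n * s ^+ n <= expR (2 * (s / (1 - s))).
Proof.
move=> s0 s1; have := part_sum_series_le L n.+1 s0 s1; rewrite big_ord_recr /= => h.
apply: (@le_trans _ _ (rp s L)^-1).
  apply: le_trans h; rewrite lerDr; apply: sumr_ge0 => i _.
  by rewrite mulr_ge0 ?part_sum_ge0 ?exprn_ge0.
rewrite -[2 * _]opprK expRN lef_pV2 ?posrE ?expR_gt0 ?rp_ge0 //; exact: rp_lower.
Qed.
End RealBound.

Section RankSeries.
Variable R : realType.
Local Notation C := (Cplx R).
Variables (q w : C).
Hypothesis q0 : q != 0.
Hypothesis q1 : cm q < 1.
Hypothesis w1 : cm w = 1.

Lemma csum_delta : csum (fun n => (n == 0%N)%:R : C) 1.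
Proof.
apply: (@ccvg_near _ (fun=> 1) _ _ 1); last exact: ccvg_cst.
by case=> // n _; rewrite big_ord_recl eqxx big1 ?addr0.
Qed.

Lemma csum_shift (c : C) (u : nat -> C) l k : csum u l ->
  csum (fun n => if (k <= n)%N then c * u (n - k)%N else 0) (c * l).
Proof.
move=> hu; apply: (@ccvg_unshift _ _ _ k).
apply: (@ccvg_ext _ (fun n => \sum_(j < n) c * u j)); last exact: csumZ.
by move=> n; rewrite (sum_shift (fun j => c * u j)) addnK.
Qed.

(** A radius strictly between |q| and 1, which leaves room for a geometric
    bound. *)
Let s : R := (1 + cm q) / 2.
Lemma s_bounds : [/\ 0 <= s, s < 1, 0 < s, 0 <= cm q / s & cm q / s < 1].
Proof.
have h := q1; have h0 := cm_ge0 q; have sp : 0 < s by rewrite /s; lra.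
split; [exact: ltW|rewrite /s; lra|by []|by rewrite divr_ge0 // ltW|].
by rewrite ltr_pdivrMr // mul1r /s; lra.
Qed.

Definition weight_bound : R := expR (2 * (s / (1 - s))).

Lemma part_sum_cm L n : cm (part_sum w^-1 L n) <= part_sum (1 : R) L n.
Proof.
apply: (le_trans (cm_sum _ _ _)); apply: ler_sum => l _.
by rewrite cmX cmV w1 invr1.
Qed.

Lemma bound_geo (u : nat -> C) : (forall n, cm (u n) <= part_sum (1 : R) n n) ->
  geo (fun n => u n * q ^+ n) weight_bound (cm q / s).
Proof.
move=> hu n; have [s0 s1 sp rs0 rs1] := s_bounds.
rewrite cmM cmX expr_div_n; have := part_sum_le n n s0 s1; rewrite -/weight_bound => hB.
have sn : 0 < s ^+ n by rewrite exprn_gt0.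
rewrite [leLHS]mulrC [leRHS]mulrCA ler_wpM2l ?exprn_ge0 ?cm_ge0 //.
by rewrite ler_pdivlMr // (le_trans _ hB) // ler_wpM2r ?(ltW sn).
Qed.

Lemma part_sum_mono L M n : (L <= M)%N -> part_sum (1 : R) L n <= part_sum (1 : R) M n.
Proof.
elim: M => [|M IH]; first by rewrite leqn0 => /eqP ->.
rewrite leq_eqVlt => /orP[/eqP -> //|/IH h]; apply: (le_trans h).
by rewrite part_sum_succ lerDl; case: ifP => _ //; rewrite mul1r part_sum_ge0.
Qed.

Lemma part_sum_le_diag L n : part_sum (1 : R) L n <= part_sum (1 : R) n n.
Proof.
have [h|/ltnW h] := leqP L n; first exact: part_sum_mono.
have -> // : part_sum (1 : R) L n = part_sum 1 n n.
by rewrite [LHS]part_sum_rec [RHS]part_sum_rec (minn_idPr h) minnn.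
Qed.

Lemma fac_neq0 k : 1 - q ^+ k.+1 / w != 0.
Proof. exact: fac1_neq0. Qed.

(** The same splitting, for the whole series: the generating function for parts
    at most L is the inverse of a product. *)
Lemma part_sum_csum L : csum (fun n => part_sum w^-1 L n * q ^+ n) (qp (q / w) q L)^-1.
Proof.
have [s0 s1 sp rs0 rs1] := s_bounds.
elim: L => [|L IH].
  rewrite qp0 invr1; apply: csum_ext csum_delta => n.
  by rewrite part_sum0; case: n => [|n]; rewrite ?mul1r ?mul0r.
have [l hl] := geo_cvg (bound_geo (fun n =>
  le_trans (part_sum_cm L.+1 n) (part_sum_le_diag L.+1 n))) rs0 rs1.
have E : csum (fun n => part_sum w^-1 L.+1 n * q ^+ n) ((qp (q / w) q L)^-1 +
  (w^-1 * q ^+ L.+1) * l).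
  apply: csum_ext (csumD IH (csum_shift (w^-1 * q ^+ L.+1) L.+1 hl)) => n.
  rewrite [part_sum _ L.+1 n]part_sum_succ mulrDl; congr (_ + _); case: ifP => h;
    last by rewrite mul0r.
  have e : q ^+ n = q ^+ L.+1 * q ^+ (n - L.+1) by rewrite -exprD subnKC.
  by rewrite e; ring.
have := ccvg_uniq hl E => h.
have d := fac_neq0 L.
have a := @qp1_neq0 _ q w q1 w1 0 L; rewrite expr1 in a.
have -> // : (qp (q / w) q L.+1)^-1 = l.
rewrite qpS invfM mulrAC.
apply: (mulIf d).
have -> : 1 - q * q ^+ L / w = 1 - q ^+ L.+1 / w by rewrite -exprS.
rewrite divfK // mulrBr mulr1 {1}h.
by ring.
Qed.

(** A partition with largest part i has rank i - 1 minus the number of the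
    other parts, which are at most i; here i is bounded by L. *)
Definition rank_sum L n : C := (n == 0%N)%:R + \sum_(1 <=
  i < (minn L n).+1) w ^+ i.-1 * part_sum w^-1 i (n - i).

Lemma rank_sum_csum L : csum (fun n => rank_sum L n * q ^+ n)
  (1 + \sum_(1 <= i < L.+1) w ^+ i.-1 * q ^+ i / qp (q / w) q i).
Proof.
elim: L => [|L IH].
  rewrite big_geq // addr0; apply: csum_ext csum_delta => n.
  by rewrite /rank_sum min0n big_geq // addr0; case: n => [|n]; rewrite ?mul1r ?mul0r.
rewrite big_nat_recr //= addrA.
apply: csum_ext (csumD IH (csum_shift (w ^+ L *
  q ^+ L.+1) L.+1 (part_sum_csum L.+1))) => n.
rewrite /rank_sum; case: ifP => h.
  rewrite (minn_idPl h) (minn_idPl (ltnW h)) [in RHS]big_nat_recr //= addrA [RHS]mulrDl; congr (_ + _).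
  have e : q ^+ n = q ^+ L.+1 * q ^+ (n - L.+1) by rewrite -exprD subnKC.
  by rewrite e; ring.
move: h => /negbT; rewrite -leqNgt => h.
by rewrite (minn_idPr h) (minn_idPr (leqW h)) addr0.
Qed.

Lemma rank_sum_cm L n : cm (rank_sum L n) <= part_sum (1 : R) n n.
Proof.
rewrite part_sum_rec minnn mul1r /rank_sum; apply: (le_trans (cmD _ _)); apply: lerD.
  by case: (n == 0%N); rewrite ?cm1 ?cm0.
apply: (le_trans (cm_sum _ _ _)).
rewrite [leRHS](@big_cat_nat _ _ _ (minn L n).+1) //=; last by rewrite ltnS geq_minr.
apply: (@le_trans _ _ (\sum_(1 <= i < (minn L n).+1) part_sum (1 : R) i (n - i))).
  apply: ler_sum => i _; rewrite cmM cmX w1 expr1n mul1r; exact: part_sum_cm.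
by rewrite lerDl; apply: sumr_ge0 => i _; exact: part_sum_ge0.
Qed.

Lemma rank_sumE L n : (n <= L)%N -> rank_sum L n = rank_sum n n.
Proof. by move=> h; rewrite /rank_sum (minn_idPr h) minnn. Qed.

(** For parts bounded by L the series is a partial sum of Fine's sum. As L
    grows it tends to (1 - w) E(w; q) by [Ku_fine_sum], and its coefficients
    are final up to L, with uniformly geometric tails. *)
Theorem rank_sum_diag_csum : csum (fun n => rank_sum n n * q ^+ n) (Ku w q).
Proof.
have [s0 s1 sp rs0 rs1] := s_bounds.
have g := bound_geo (fun n => rank_sum_cm n n).
have [l hl] := geo_cvg g rs0 rs1.
pose G L := 1 + \sum_(1 <= i < L.+1) w ^+ i.-1 * q ^+ i / qp (q / w) q i.
have G1 : ccvg G l.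
  move=> e e0; have D0 : 0 <= 2 * weight_bound / (1 - cm q / s).
    by rewrite divr_ge0 ?mulr_ge0 ?expR_ge0 // subr_ge0 ltW.
  have [N hN] := expr_small rs0 rs1 D0 e0.
  exists N => L /hN; apply: le_lt_trans.
  have S := csumD (rank_sum_csum L) (csumZ (-1) hl).
  have g2 : geo (fun n => rank_sum L n * q ^+ n +
    -1 * (rank_sum n n * q ^+ n)) (2 * weight_bound) (cm q / s).
    move=> n; apply: (le_trans (cmD _ _)).
    rewrite (cmM (-1)) cmN cm1 mul1r; have := g n;
      have := bound_geo (rank_sum_cm L) n; lra.
  have := csum_tail L S g2 rs0 rs1; rewrite [X in _ - X]big1 => [|i _]; last first.
    by rewrite rank_sumE ?mulN1r ?subrr // ltnW.
  by rewrite subr0 mulN1r mulrAC.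
have G2 : ccvg G (Ku w q).
  have w0 := @cw0 _ w w1.
  rewrite (Ku_fine_sum q0 q1 w1); have h := @ccvg_shift _ _ _ 1 (fine_sum_csum q1 w1 0).
  apply: ccvg_ext (ccvgD (ccvg_cst (1 - w^-1)) (ccvgZ w^-1 h)) => L.
  rewrite addn1 big_ord_recl /fine_term expr0 qp0 invr1 mulr1 mulrDr mulr1 addrA subrK /G; congr (_ + _).
  rewrite big_add1 big_mkord mulr_sumr; apply: eq_bigr => i _ /=.
  rewrite /bump /= add1n !expr1 exprMn (exprS w).
  by rewrite -!mulrA mulKf.
by rewrite (ccvg_uniq G2 G1).
Qed.

End RankSeries.

Section RankCount.
Variable R : realType.
Local Notation C := (Cplx R).

Lemma sum_partitions (n : nat) (F : seq nat -> C) :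
  \sum_(l in [set l : n.-bseq 'I_n.+1 | is_partition n (map val l)]%SET) F (map val l) =
  \sum_(l <- partitions_in n n n) F l.
Proof.
rewrite -big_enum /=.
rewrite -(big_map (fun l : n.-bseq 'I_n.+1 => map val l) xpredT F).
apply: perm_big; apply: uniq_perm; last 1 first.
- move=> l; rewrite mem_partitions_in; apply/mapP/and3P => [[l']|[h1 h2 h3]].
    rewrite mem_enum inE => h -> ; split=> //.
      by apply/allP => x /mapP [y _ ->]; rewrite /= -ltnS.
    by rewrite size_map size_bseq.
  have e : map val (map (@inord n) l) = l.
    rewrite -map_comp -[RHS]map_id; apply/eq_in_map => x xl /=.
    by rewrite inordK // ltnS; exact: (allP h2).
  have sz : (size (map (@inord n) l) <= n)%N by rewrite size_map.
  exists (Bseq sz); last by rewrite /= e.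
  by rewrite mem_enum inE /= e.
- rewrite map_inj_uniq ?enum_uniq // => l1 l2 /= h.
  by apply: val_inj; apply: (inj_map val_inj).
- exact: uniq_partitions_in.
Qed.

Lemma rank_weight (w : C) (n : nat) : w != 0 ->
  \sum_(l <- partitions_in n n n) w ^ (rank l) = rank_sum w n n.
Proof.
move=> w0; case: n => [|n].
  by rewrite /rank_sum /= big_seq1 minnn big_geq // addr0.
rewrite [partitions_in n.+1 n.+1 n.+1]/= big_allpairs_dep /rank_sum add0r minnn /index_iota subn1 succnK.
rewrite !big_seq; apply: eq_bigr => i; rewrite mem_iota => /andP[i1 _].
rewrite /part_sum mulr_sumr (perm_big _ (@partitions_in_stable n i (n.+1 - i) _)) /=;
  last by rewrite leq_subLR -(add1n n) leq_add2r.
apply: eq_bigr => l _; rewrite /rank /=.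
have -> : i%:Z - (size l).+1%:Z = i.-1%:Z - (size l)%:Z by lia.
by rewrite expfzDr // exprVn -exprnN.
Qed.

(** Grouping the partitions of n by their rank, shifted by n to be an index
    between 0 and 2n, gives the coefficients of the definition. *)
Theorem rank_gf_Ku (w q : C) : q != 0 -> cm q < 1 -> cm w = 1 -> rank_gf w q = Ku w q.
Proof.
move=> q0 q1 w1; have w0 : w != 0 by rewrite -cm_gt0 w1.
apply: csum_cvg; apply: csum_ext (rank_sum_diag_csum q0 q1 w1) => n; congr (_ * _).
rewrite -rank_weight // -(sum_partitions n (fun l => w ^ rank l)).
have rb (l : n.-bseq 'I_n.+1) : is_partition n (map val l) ->
  (0 <= rank (map val l) + n%:Z < (2 * n).+1%:Z).
  move=> h; have : map val l \in partitions_in n n n.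
    rewrite mem_partitions_in h /=; apply/andP; split; last by rewrite size_map size_bseq.
    by apply/allP => x /mapP [y _ ->]; rewrite /= -ltnS.
  rewrite mem_partitions_in => /and3P[_ h2 h3]; rewrite /rank.
  have : (head 0 (map val l) <= n)%N by case: (map val l) h2 => //= a l' /andP[].
  by move: h3; set a := head _ _; set b := size _; lia.
pose f (l : n.-bseq 'I_n.+1) : 'I_((2 * n).+1) := inord (absz (rank (map val l) + n%:Z)).
have fE (l : n.-bseq 'I_n.+1) : is_partition n (map val l) ->
  (f l : nat)%:Z = rank (map val l) + n%:Z.
  move=> /rb /andP[h1 h2]; rewrite /f inordK; first by rewrite gez0_abs.
  by rewrite -ltz_nat gez0_abs.
rewrite (partition_big f xpredT) //= big_mkord; apply: eq_bigr => j _.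
rewrite /num_rank -sum1_card natr_sum mulr_suml; apply: eq_big => [l|l].
  rewrite !inE; case h : (is_partition n (map val l)) => //=.
  rewrite -val_eqE /= -[(f l == j :> nat)]eqz_nat fE //.
  by rewrite [RHS]eq_sym subr_eq eq_sym.
rewrite !inE => /andP[h /eqP e]; rewrite mul1r.
by rewrite -e fE // addrK.
Qed.
End RankCount.
End Partitions.

(** * The function of the theorem *)

Section Assembly.
Variable R : realType.
Local Notation C := (Cplx R).
Implicit Types (z : C).
Local Notation qexp := (@qexp R).

Lemma zetaE p : zeta R p = qexp (1 / p%:R). Proof. by rewrite /Defs.qexp mul1r. Qed.

Lemma qpowE z (r : rat) : qpow z r = qexp (ratr r * z).
Proof. by rewrite /qpow /Defs.qexp; congr Defs.cexp; ring. Qed.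

Lemma ratr24 : ratr (1 / 24 : rat) = 1 / 24 :> C.
Proof. by rewrite rmorphM fmorphV rmorph1 rmorph_nat. Qed.

Lemma ratr_exponent (p a : nat) :
  ratr (a%:R / 2 * (p%:R - 3 * a%:R) - p%:R ^+ 2 / 24) =
  a%:R / 2 * (p%:R - 3 * a%:R) - p%:R ^+ 2 / 24 :> C.
Proof.
rewrite rmorphB /= [X in X - _]rmorphM [X in _ - X]rmorphM /=.
rewrite [X in X * _ - _]rmorphM rmorphXn rmorphB [X in _ * (_ - X)]rmorphM /=.
have -> : ratr 2^-1 = 2^-1 :> C by rewrite fmorphV /= ratr_nat.
have -> : ratr 24^-1 = 24^-1 :> C by rewrite fmorphV /= ratr_nat.
by rewrite !ratr_nat.
Qed.

Lemma cm_zeta p : cm (zeta R p) = 1.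
Proof.
have -> : zeta R p = qexp (((1 / p%:R : R)%:C)%C).
  by rewrite zetaE realCM realCV realC_nat.
by rewrite cm_qexp /= mulr0 oppr0 expR0.
Qed.

Lemma eta_etaf z : 0 < complex.Im z -> eta z = etaf z.
Proof.
move=> z0; rewrite /eta /etaf qpowE ratr24; congr (_ * _); first by congr Defs.qexp; ring.
apply: ccvg_lim; apply: (@ccvg_unshift _ _ _ 1).
apply: ccvg_ext (qpi_cvg (qexp z) (nome_lt1 z0)) => n.
rewrite addn1 big_add1 big_mkord /qp; apply: eq_bigr => i _.
by rewrite exprS.
Qed.

Variable p : nat.
Hypothesis hp : prime p.
Hypothesis hp3 : (3 < p)%N.
Let p0 : (p%:R : C) != 0 := p_neq0 R hp3.

Lemma PhiE z a : 0 < complex.Im z -> (0 < a < p)%N -> Phi p a (qexp z ^+ p) =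
  Eu (qexp (p%:R * a%:R * z)) (qexp (p%:R ^+ 2 * z)) - (if (6 * a < p)%N then 0 else 1).
Proof.
move=> z0 /andP[a1 a2]; set Q := qexp z ^+ p.
have Qa : Q ^+ a = qexp (p%:R * a%:R * z).
  by rewrite /Q -exprM -qexpMn natrM.
have Qp : Q ^+ p = qexp (p%:R ^+ 2 * z).
  by rewrite /Q -exprM -qexpMn natrM expr2.
have Q1 : cm Q < 1.
  by rewrite /Q cmX exprn_ilt1 ?cm_ge0 ?nome_lt1 // -lt0n prime_gt0.
have Q0 : Q != 0 by rewrite expf_neq0 // qexp_neq0.
have fac n : (0 < n)%N -> 1 - Q ^+ n != 0.
  move=> n0; rewrite -cm_gt0; have := cmB_ge 1 (Q ^+ n); rewrite cm1 cmX.
  have : cm Q ^+ n < 1 by rewrite exprn_ilt1 ?cm_ge0 // -lt0n.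
  by lra.
have pp : (0 < p)%N by exact: prime_gt0.
have W0 : Q ^+ p != 0 by rewrite expf_neq0.
have W1 : cm (Q ^+ p) < 1 by rewrite cmX exprn_ilt1 ?cm_ge0 // -lt0n.
have WQ : Q ^+ (p - a) = Q ^+ p / Q ^+ a.
  by rewrite -{2}(subnK (ltnW a2)) exprD mulfK // expf_neq0.
have f1 k : 1 - Q ^+ a * (Q ^+ p) ^+ k != 0 by rewrite -exprM -exprD fac // ltn_addr.
have f2 k : 1 - Q ^+ p / Q ^+ a * (Q ^+ p) ^+ k != 0.
  by rewrite -WQ -exprM -exprD fac // ltn_addr // subn_gt0.
have rg : regular (Q ^+ a) (Q ^+ p) by split => //; rewrite expf_neq0.
have S : \big[+%R/0]_(0 <= n <oo) (Q ^+ (p * n ^ 2) /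
      (qpoch (Q ^+ a) (Q ^+ p) n.+1 * qpoch (Q ^+ (p - a)) (Q ^+ p) n)) =
        Eu (Q ^+ a) (Q ^+ p).
  apply: csum_cvg; apply: csum_ext (Eu_csum W0 W1 rg) => n.
  by rewrite /eterm WQ !qpochE // exprM.
rewrite /Phi S -Qa -Qp; case: ifP => _; first by rewrite subr0.
by rewrite addrC.
Qed.

Definition mform z : C := eta ((p ^ 2)%:R * z) * calR p z.

(** Here zeta^((p + 1)/2) = - e(1/(2p)) and zeta^((p - 1)/2) = - e(-1/(2p)), so
    that the four terms factor. *)
Lemma zeta_coef a : zeta R p ^+ (3 * a + (p + 1) %/ 2) + zeta R p ^- (3 * a + (p +
  1) %/ 2)
       - zeta R p ^+ (3 * a + (p - 1) %/ 2) - zeta R p ^- (3 * a + (p - 1) %/ 2) =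
   (qexp (- (1 / (2 * p%:R))) - qexp (1 / (2 * p%:R))) * (qexp (3 *
     a%:R / p%:R) - qexp (- (3 * a%:R / p%:R))).
Proof.
have o := p_odd hp hp3; have pE := halfpE hp hp3.
have e1 : ((p + 1) %/ 2 = (halfp p).+1)%N by rewrite {1}pE; lia.
have e2 : ((p - 1) %/ 2 = halfp p)%N by [].
have pC : p%:R = 2 * (halfp p)%:R + 1 :> C by rewrite {1}pE -natr1 natrM.
have Z n : zeta R p ^+ n = qexp (n%:R / p%:R).
  by rewrite zetaE -qexpMn; congr Defs.qexp; ring.
rewrite e1 e2 !Z -!qexpN.
set A := 3 * a%:R / p%:R; set B := 1 / (2 * p%:R).
have E1 : (3 * a + (halfp p).+1)%:R / p%:R = A + B + 1 / 2 :> C.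
  have h : (halfp p)%:R = (p%:R - 1) / 2 :> C by rewrite pC; field.
  by rewrite /A /B natrD natrM -(natr1 (halfp p)) h; field; exact: p0.
have E2 : (3 * a + halfp p)%:R / p%:R = A - B + 1 / 2 :> C.
  have h : (halfp p)%:R = (p%:R - 1) / 2 :> C by rewrite pC; field.
  by rewrite /A /B natrD natrM h; field; exact: p0.
have NH : qexp (- (1 / 2)) = -1 by rewrite qexpN qexp_half invrN invr1.
rewrite E1 E2 !opprD !opprK !qexpD qexp_half NH.
by ring.
Qed.

Lemma sgn_exp a : qexp (a%:R / 2) = (-1) ^+ a.
Proof.
elim: a => [|a IH]; first by rewrite mul0r qexp0.
have -> : a.+1%:R / 2 = a%:R / 2 + 1 / 2 :> C by rewrite -natr1; ring.
by rewrite qexpD IH qexp_half exprSr.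
Qed.

Lemma Eu_zeta z : 0 < complex.Im z ->
  Eu (zeta R p) (qexp z) = Ku (zeta R p) (qexp z) / (1 - zeta R p).
Proof.
move=> z0; have w1 := cm_zeta p.
apply: (@Eu_Ku _ _ _ (cm (qexp z))) => //.
- exact: nome_neq0.
- exact: nome_lt1.
- by rewrite cmM w1 mul1r.
- by rewrite cmM cmV w1 invr1 mulr1.
by rewrite zetaE; apply: notlat_regular; exact: torsion_notlat.
Qed.

Lemma zeta_neq1 z : 0 < complex.Im z -> 1 - zeta R p != 0.
Proof.
move=> z0; have [_ h _] := notlat_regular (torsion_notlat hp3 z0).
by have := h 0%N; rewrite expr0 mulr1 zetaE.
Qed.

Lemma appell0 z a : appell p z a 0 =
  qexp ((a%:R / 2 * (p%:R - 3 * a%:R) - p%:R ^+ 2 / 24) * z) *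
  (Eu (qexp (p%:R * a%:R * z)) (qexp (p%:R ^+ 2 * z)) - (if (6 * a < p)%N then 0 else 1)).
Proof.
rewrite /appell !mulr0 add0r addr0.
have -> : theta_term z (6 * a%:Z - p%:Z) 0 =
  qexp ((a%:R / 2 * (p%:R - 3 * a%:R) - p%:R ^+ 2 / 24) * z).
  by rewrite /theta_term; congr Defs.qexp;
    rewrite mulr0 mul0r subr0 intrB intrM -!pmulrn; field.
have -> : qexp (- (3 * a%:R ^+ 2 * z / 2)) * mock (p%:R ^+ 2 * z) (p%:R * a%:R * z) =
   qexp ((a%:R / 2 * (p%:R - 3 * a%:R) - p%:R ^+ 2 / 24) * z) *
   Eu (qexp (p%:R * a%:R * z)) (qexp (p%:R ^+ 2 * z)).
  by rewrite /mock mulrA -qexpD; congr (Defs.qexp _ * _); field.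
by rewrite [RHS]mulrBr; case: ifP => _; rewrite ?mulr0 ?mulr1.
Qed.

(** The constant is 1 - zeta up to a root of unity, and it is the common factor
    of the four terms of zeta in calR_p and of (1 - zeta) in the rank
    generating function. *)
Theorem mform_combGN z : 0 < complex.Im z ->
  mform z = (qexp (- (1 / (2 * p%:R))) - qexp (1 / (2 * p%:R))) * combGN p z 0.
Proof.
move=> z0; have z1 := T_up hp3 z0; have pp : (0 < p)%N by exact: prime_gt0.
rewrite /mform natrX eta_etaf // /combGN mulrCA; congr (_ * _).
rewrite /calR /combG (rank_gf_Ku (nome_neq0 z) (nome_lt1 z0) (cm_zeta p)) mulrBr.
congr (_ - _).
  rewrite addr0 /mock qpowE rmorphN /= ratr24 mulNr -zetaE Eu_zeta //.
  have -> : 1 / p%:R / 2 - z / 24 = 1 / (2 * p%:R) + - (1 / 24 * z) by field; exact: p0.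
  rewrite qexpD; set A := qexp (- (1 / 24 * z)).
  have e1 : qexp (- (1 / (2 * p%:R))) * qexp (1 / (2 * p%:R)) =
    1 by rewrite -qexpD addNr qexp0.
  have e2 : qexp (1 / (2 * p%:R)) * qexp (1 / (2 * p%:R)) = zeta R p.
    by rewrite -qexpD zetaE; congr Defs.qexp; field; exact: p0.
  have d0 := zeta_neq1 z0.
  move: e1 e2 d0 (Ku _ _); set s := qexp (- (1 / (2 * _))); set s' := qexp (1 / (2 * _)).
  move: s s' A (zeta R p) => s s' A w e1 e2 d0 k.
  transitivity ((s * s' - s' * s') * A * (k / (1 - w))); last by ring.
  by rewrite e1 e2; field.
rewrite mulrCA; congr (_ * _); rewrite mulr_sumr !big_nat;
  apply: eq_bigr => a /andP[a1 a2].
have ap : (a < p)%N by have := halfpE hp hp3; move: a2; clear; lia.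
rewrite zeta_coef PhiE ?a1 // /combc appell0 -[a%:Z%:~R]pmulrn sgn_exp.
rewrite qpowE ratr_exponent.
by rewrite !mulrA [(-1) ^+ a * _]mulrC.
Qed.

(** At u = 0 the function [combHN] is twice [combGN], and the constant of
    [mform_combGN] is the same for both arguments. *)
Theorem mform_modular (al be c d k k2 cc : int) z : al * d - be * c = 1 ->
  al = 1 + p%:Z * k -> d = 1 + p%:Z * k2 -> c = p%:Z ^+ 2 * cc -> 0 < complex.Im z ->
  mform ((al%:~R * z + be%:~R) / (c%:~R * z + d%:~R)) = (c%:~R * z + d%:~R) * mform z.
Proof.
move=> dt alE dE cE z0; have z1 := moebius_up dt z0.
have HG s : combHN p s 0 = 2 * combGN p s 0 :> C by rewrite /combHN /combGN /combH oppr0; ring.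
have h := weight_one hp hp3 dt alE dE cE z0.
rewrite /autJ /t' !HG in h.
rewrite !mform_combGN //.
have two : (2 : C) != 0 by rewrite pnatr_eq0.
apply: (mulfI two); rewrite mulrCA h; ring.
Qed.

End Assembly.

(** * Holomorphy and growth *)

Section Growth.
Variable R : realType.
Local Notation C := (Cplx R).
Implicit Types (z : C) (h g : C -> C) (A B y : R).
Local Notation qexp := (@qexp R).

(** Control towards infinity and towards the real axis at once, so that it can
    be transported by Moebius substitutions; sums and products preserve it. *)
Definition mgrow h := exists2 A, 0 <= A & exists2 B, 0 <=
  B & forall z, 0 < complex.Im z ->
  cm (h z) <= A * expR (B * (complex.Im z + (complex.Im z)^-1)).

Lemma yy_ge0 y : 0 < y -> 0 <= y + y^-1.
Proof. by move=> y0; rewrite addr_ge0 ?invr_ge0 // ltW. Qed.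

Lemma mgrow_ext h g : (forall z, 0 < complex.Im z -> h z = g z) -> mgrow h -> mgrow g.
Proof.
move=> hg [A A0 [B B0 H]]; exists A => //; exists B => // z z0.
by rewrite -hg //; exact: H.
Qed.

Lemma mgrow_cst (c : C) : mgrow (fun=> c).
Proof.
exists (cm c); first exact: cm_ge0.
by exists 0 => // z z0; rewrite mul0r expR0 mulr1.
Qed.

Lemma mgrowM h g : mgrow h -> mgrow g -> mgrow (fun z => h z * g z).
Proof.
move=> [A A0 [B B0 H]] [A' A'0 [B' B'0 H']].
exists (A * A'); first exact: mulr_ge0.
exists (B + B'); first exact: addr_ge0.
move=> z z0; rewrite cmM mulrDl expRD mulrACA.
by apply: ler_pM; rewrite ?cm_ge0 ?H ?H'.
Qed.

Lemma mgrowD h g : mgrow h -> mgrow g -> mgrow (fun z => h z + g z).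
Proof.
move=> [A A0 [B B0 H]] [A' A'0 [B' B'0 H']].
exists (A + A'); first exact: addr_ge0.
exists (B + B'); first exact: addr_ge0.
move=> z z0; apply: (le_trans (cmD _ _)); rewrite mulrDl; apply: lerD.
  apply: (le_trans (H _ z0)); rewrite ler_wpM2l // ler_expR ler_wpM2r ?yy_ge0 // lerDl //.
apply: (le_trans (H' _ z0)); rewrite ler_wpM2l // ler_expR ler_wpM2r ?yy_ge0 // lerDr //.
Qed.

Lemma mgrowB h g : mgrow h -> mgrow g -> mgrow (fun z => h z - g z).
Proof.
move=> H1 H2; have := mgrowD H1 (mgrowM (mgrow_cst (-1)) H2).
by apply: mgrow_ext => z _; rewrite mulN1r.
Qed.

Lemma mgrow_sum (I : eqType) (s : seq I) (F : I -> C -> C) :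
  (forall i, i \in s -> mgrow (F i)) -> mgrow (fun z => \sum_(i <- s) F i z).
Proof.
elim: s => [|i s IH] hF.
  by apply: mgrow_ext (mgrow_cst 0) => z _; rewrite big_nil.
have H2 : mgrow (fun z => \sum_(j <- s) F j z).
  by apply: IH => j hj; apply: hF; rewrite inE hj orbT.
by apply: mgrow_ext (mgrowD (hF i (mem_head _ _)) H2) => z _; rewrite big_cons.
Qed.

Lemma mgrow_qexp (a : R) (b : C) : mgrow (fun z => qexp ((a%:C)%C * z + b)).
Proof.
exists (cm (qexp b)); first exact: cm_ge0.
have p2 : 0 <= 2 * pi * `|a| by rewrite !mulr_ge0 ?pi_ge0.
exists (2 * pi * `|a|) => // z z0.
rewrite qexpD cmM mulrC ler_wpM2l ?cm_ge0 // cm_qexp ler_expR cImM /= mul0r addr0.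
have iv : 0 <= (complex.Im z)^-1 by rewrite invr_ge0 ltW.
apply: (@le_trans _ _ (2 * pi * `|a| * complex.Im z)).
  rewrite -mulrN -mulrA ler_wpM2l ?mulr_ge0 ?pi_ge0 // -mulNr ler_wpM2r ?(ltW z0) //.
  by rewrite -normrN ler_norm.
by rewrite ler_wpM2l // lerDl.
Qed.

(** From exp(2 pi y) >= 1 + y, which gives |q| <= 1 / (1 + y). *)
Lemma nome_gap z : 0 < complex.Im z -> (1 - cm (qexp z))^-1 <= 1 + (complex.Im z)^-1.
Proof.
move=> z0; have p2 := pi_ge2 R; have q1 := nome_lt1 z0.
set y := complex.Im z in z0 *; set r := cm (qexp z) in q1 *.
have rE : r * expR (2 * pi * y) = 1 by rewrite /r cm_qexp -expRD addNr expR0.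
have e1 : 1 + 2 * pi * y <= expR (2 * pi * y) by exact: expR_ge1Dx.
have r0 : 0 <= r by exact: cm_ge0.
have e2 : 1 + y <= expR (2 * pi * y) by apply: le_trans e1; rewrite lerD2l; nra.
have e3 : r * (1 + y) <= 1 by rewrite -[leRHS]rE ler_wpM2l.
have y1 : y^-1 * y = 1 by rewrite mulVf // gt_eqF.
have iv : 0 < y^-1 by rewrite invr_gt0.
rewrite -[leLHS]mul1r ler_pdivrMr; last by rewrite subr_gt0.
have : 0 <= y^-1 * (1 - r * (1 + y)) by rewrite mulr_ge0 ?(ltW iv) // subr_ge0.
have -> : y^-1 * (1 - r * (1 + y)) = (1 + y^-1) * (1 - r) - 1 * (y^-1 * y) +
  (y^-1 * y) * (1 - r) - (1 - r) by ring.
by rewrite y1; lra.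
Qed.

Lemma gap_exp z (c : R) : 0 <= c -> 0 < complex.Im z ->
  expR (c / (1 - cm (qexp z))) <= expR c * expR (c * (complex.Im z + (complex.Im z)^-1)).
Proof.
move=> c0 z0; rewrite -expRD ler_expR;
  apply: (@le_trans _ _ (c * (1 + (complex.Im z)^-1))).
  by rewrite ler_wpM2l // nome_gap.
by rewrite mulrDr mulr1 lerD2l ler_wpM2l // lerDr ltW.
Qed.

Lemma gap_lin z : 0 < complex.Im z ->
  (1 - cm (qexp z))^-1 <= expR 1 * expR (1 * (complex.Im z + (complex.Im z)^-1)).
Proof.
move=> z0; apply: le_trans (gap_exp ler01 z0).
by rewrite div1r; apply: le_trans (expR_ge1Dx _); rewrite lerDr.
Qed.

Lemma mgrow_inv (fx : C -> C) : (forall z, 0 < complex.Im z ->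
  cm (fx z) <= cm (qexp z)) ->
  mgrow (fun z => (1 - fx z)^-1).
Proof.
move=> H; exists (expR 1); first exact: expR_ge0.
exists 1 => // z z0; apply: le_trans (gap_lin z0).
have q1 := nome_lt1 z0; have := H _ z0; have := cmB_ge 1 (fx z); rewrite cm1 => h1 h2.
by rewrite cmV lef_pV2 ?posrE; lra.
Qed.

Lemma mgrow_qpi (fa fq : C -> C) : (forall z, 0 < complex.Im z ->
  cm (fa z) <= 1 /\ cm (fq z) <= cm (qexp z)) ->
  mgrow (fun z => qpi (fa z) (fq z)).
Proof.
move=> H; exists (expR 1); first exact: expR_ge0.
exists 1 => // z z0; apply: le_trans (gap_exp ler01 z0).
have q1 := nome_lt1 z0; have [h1 h2] := H _ z0.
apply: (ccvg_le (qpi_cvg (fa z) (le_lt_trans h2 q1))) => n.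
apply: le_trans (qp_le _ n (le_lt_trans h2 q1)) _; rewrite ler_expR.
by apply: ler_pM; rewrite ?cm_ge0 ?invr_ge0 ?lef_pV2 ?posrE; lra.
Qed.

Lemma mgrow_Ku (fx fq : C -> C) : (forall z, 0 < complex.Im z ->
    [/\ cm (fq z) <= cm (qexp z), cm (fx z * fq z) <=
      cm (qexp z) & cm (fq z / fx z) <= cm (qexp z)]) ->
  mgrow (fun z => Ku (fx z) (fq z)).
Proof.
move=> H; exists (expR 4 * expR 1); first by rewrite mulr_ge0 ?expR_ge0.
exists (4 + 1); first by lra.
move=> z z0; have [h1 h2 h3] := H _ z0; have q1 := nome_lt1 z0.
apply: (le_trans (Ku_le h1 q1 h2 h3)).
set Y := complex.Im z + _.
have -> : (4 + 1) * Y = 4 * Y + 1 * Y by ring.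
rewrite (expRD (4 * Y)) mulrACA; apply: ler_pM; rewrite ?expR_ge0 ?invr_ge0 //;
  first by lra.
  apply: le_trans (gap_exp (ler0n _ 4) z0); rewrite ler_expR ler_wpM2l //.
  by rewrite -[leRHS]mul1r ler_wpM2r ?invr_ge0; lra.
exact: gap_lin.
Qed.

End Growth.

Section FormGrowth.
Variable R : realType.
Local Notation C := (Cplx R).
Implicit Types (z : C).
Local Notation qexp := (@qexp R).
Variable p : nat.
Hypothesis hp : prime p.
Hypothesis hp3 : (3 < p)%N.
Let p0 : (p%:R : C) != 0 := p_neq0 R hp3.
Let pp : (0 < p)%N := prime_gt0 hp.

Definition corr_exp (a : nat) : R := a%:R / 2 * (p%:R - 3 * a%:R) - p%:R ^+ 2 / 24.
Definition corr_x (a : nat) z : C := qexp (((p * a)%N%:R%:C)%C * z + 0).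
Definition corr_q z : C := qexp (((p * p)%N%:R%:C)%C * z + 0).

Lemma cm_corr_x a z : cm (corr_x a z) = cm (qexp z) ^+ (p * a).
Proof. by rewrite /corr_x addr0 realC_nat qexpMn cmX. Qed.
Lemma cm_corr_q z : cm (corr_q z) = cm (qexp z) ^+ (p * p).
Proof. by rewrite /corr_q addr0 realC_nat qexpMn cmX. Qed.

(** The arguments stay in the annulus where [kterm_bound] applies with s = |q|,
    since 0 < a < p. *)
Lemma corr_bounds a z : (0 < a < p)%N -> 0 < complex.Im z ->
  [/\ cm (corr_q z) <= cm (qexp z), cm (corr_x a z * corr_q z) <=
    cm (qexp z), cm (corr_q z / corr_x a z) <= cm (qexp z) &
   cm (corr_x a z) <= cm (qexp z)].
Proof.
move=> /andP[a1 a2] z0; have q1 := nome_lt1 z0; have r0 := cm_ge0 (qexp z).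
have le n : (0 < n)%N -> cm (qexp z) ^+ n <= cm (qexp z).
  by move=> n0; rewrite -[leRHS]expr1; apply: ler_wiXn2l; rewrite ?r0 ?(ltW q1).
have rn : cm (qexp z) != 0 by rewrite cm_eq0 qexp_neq0.
split.
- by rewrite cm_corr_q le // muln_gt0 pp.
- by rewrite cmM cm_corr_q cm_corr_x -exprD le // addn_gt0 !muln_gt0 pp a1.
- rewrite cmM cmV cm_corr_q cm_corr_x.
  have -> : (p * p = p * (p - a) + p * a)%N by rewrite -mulnDr subnK // ltnW.
  by rewrite exprD mulfK ?expf_neq0 // le // muln_gt0 pp subn_gt0.
- by rewrite cm_corr_x le // muln_gt0 pp.
Qed.

(** The same function with every exponent a real multiple of z and every mock
    theta function in the regular form (1 - x) E, so that holomorphy and growth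
    are read off factor by factor. *)
Definition explicit_mform z : C :=
  (qexp (- (1 / (2 * p%:R))) - qexp (1 / (2 * p%:R))) *
  ((qexp (((p%:R ^+ 2 / 24 : R)%:C)%C * z + 0) * qpi (corr_q z) (corr_q z)) *
   (qexp (((- (1 / 24) : R)%:C)%C * z + 1 / (2 * p%:R)) * (Ku (zeta R p) (qexp z) *
     (1 - zeta R p)^-1) -
    (chi12 p)%:~R * \sum_(a <- index_iota 1 (halfp p).+1) combc R p a%:Z *
      (qexp (((corr_exp a)%:C)%C * z + 0) * (Ku (corr_x a z) (corr_q z) *
        (1 - corr_x a z)^-1 - (if (6 * a < p)%N then 0 else 1))))).

Lemma mform_explicit z : 0 < complex.Im z -> mform p z = explicit_mform z.
Proof.
move=> z0; rewrite (mform_combGN hp hp3 z0) /explicit_mform /combGN; congr (_ * _).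
have q1 := nome_lt1 z0.
have WE : corr_q z = qexp (p%:R ^+ 2 * z) by rewrite /corr_q addr0 realC_nat natrM expr2.
have -> : etaf (p%:R ^+ 2 * z) = qexp (((p%:R ^+ 2 / 24 : R)%:C)%C * z +
  0) * qpi (corr_q z) (corr_q z).
  rewrite /etaf WE; congr (Defs.qexp _ * _).
  have -> : ((p%:R ^+ 2 / 24 : R)%:C)%C = p%:R ^+ 2 / 24 :> C by rewrite -natrX realCM realCV !realC_nat natrX.
  by ring.
set A := qexp _ * qpi _ _; apply: (congr1 (fun X => A * X)); rewrite {A} /combG.
congr (_ - _ * _).
  rewrite addr0 /mock -zetaE Eu_zeta //; congr (Defs.qexp _ * _).
  by rewrite realCN realCM realCV realC_nat; field; exact: p0.
rewrite !big_seq; apply: eq_bigr => a; rewrite mem_index_iota => /andP[a1 a2];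
  congr (_ * _).
have ap : (a < p)%N by have := halfpE hp hp3; move: a2; clear; lia.
have [b1 b2 b3 b4] := corr_bounds (introT andP (conj a1 ap)) z0.
have rgx : regular (corr_x a z) (corr_q z).
  apply: (regular_annulus b1 q1 b2 b3); first exact: qexp_neq0.
  by apply/eqP => e; move: b4; rewrite e cm1 leNgt q1.
have W0 : corr_q z != 0 by exact: qexp_neq0.
rewrite -(Eu_Ku W0 b1 q1 b2 b3 rgx) appell0 WE.
have -> : corr_x a z = qexp (p%:R * a%:R * z) by rewrite /corr_x addr0 realC_nat natrM.
have -> : ((corr_exp a)%:C)%C = a%:R / 2 * (p%:R - 3 * a%:R) - p%:R ^+ 2 / 24 :> C.
  by rewrite /corr_exp -natrX !(realCM, realCD, realCN, realCV, realC_nat) natrX.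
by rewrite addr0.
Qed.

Theorem mform_mgrow : mgrow (mform (R := R) p).
Proof.
apply: (@mgrow_ext _ explicit_mform) => [z z0|]; first by rewrite mform_explicit.
have w1 := cm_zeta R p.
have B1 z : 0 < complex.Im z -> cm (corr_q z) <= cm (qexp z).
  by move=> z0; have [|h _ _ _] := @corr_bounds 1 z _ z0; [rewrite prime_gt1|].
apply: mgrowM; first exact: mgrow_cst.
apply: mgrowM.
  apply: mgrowM; first exact: mgrow_qexp.
  apply: mgrow_qpi => z z0; split; last exact: B1.
  by apply: le_trans (B1 _ z0) _; apply: ltW; exact: nome_lt1.
apply: mgrowB.
  apply: mgrowM; first exact: mgrow_qexp.
  apply: mgrowM; last exact: mgrow_cst.
  by apply: mgrow_Ku => z z0; rewrite !cmM cmV w1 invr1 mul1r mulr1.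
apply: mgrowM; first exact: mgrow_cst.
apply: mgrow_sum => a; rewrite mem_index_iota => /andP[a1 a2].
have ap : (a < p)%N by have := halfpE hp hp3; move: a2; lia.
have bd z := @corr_bounds a z (introT andP (conj a1 ap)).
apply: mgrowM; first exact: mgrow_cst.
apply: mgrowM; first exact: mgrow_qexp.
apply: mgrowB; last exact: mgrow_cst.
apply: mgrowM.
  by apply: mgrow_Ku => z z0; have [] := bd z z0.
by apply: mgrow_inv => z z0; have [] := bd z z0.
Qed.

Theorem mform_sdiff z : 0 < complex.Im z -> sdiff (mform (R := R) p) z.
Proof.
move=> z0; pose L := complex.Im z / 2; have L0 : 0 < L by rewrite divr_gt0.
have imL v : cm (v - z) <= L -> L <= complex.Im v.
  move=> h; have := le_trans (Im_le _) h; rewrite ImD ImN ler_norml => /andP[h1 _].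
  by rewrite /L in h1 *; lra.
have imp v : cm (v - z) <= L -> 0 < complex.Im v by move=> /imL; exact: lt_le_trans.
apply: (@sdiff_near _ explicit_mform _ _ L) => // [v vL|].
  by rewrite mform_explicit // imp // ltW.
have w1 := cm_zeta R p.
have w0 : zeta R p != 0 by rewrite -cm_gt0 w1.
pose r : R := expR (- (2 * pi * L)).
have r1 : r < 1.
  by rewrite /r -expR0 ltr_expR oppr_lt0; apply: mulr_gt0 => //; rewrite mulr_gt0 ?pi_gt0.
have qr v : cm (v - z) <= L -> cm (qexp v) <= r.
  move=> /imL h; rewrite cm_qexp ler_expR lerN2; apply: ler_wpM2l => //.
  by rewrite mulr_ge0 ?pi_ge0.
have B1 v : cm (v - z) <= L -> cm (corr_q v) <= r.
  by move=> vL; have [|h _ _ _] := @corr_bounds 1 v _ (imp _ vL);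
    [rewrite prime_gt1|apply: le_trans h _; exact: qr].
have sW v : sdiff corr_q v by exact: sdiff_lin.
apply: sdiffZ; apply: sdiffM.
  apply: sdiffM; first exact: sdiff_lin.
  apply: (@qpi_sdiff _ corr_q corr_q z L 1 r) => //; first exact: expR_ge0.
  by move=> v vL; split; [apply: le_trans (B1 _ vL) (ltW r1)|exact: B1].
apply: sdiffB.
  apply: sdiffM; first exact: sdiff_lin.
  apply: sdiffM; last exact: sdiff_cst.
  apply: (@Ku_sdiff _ (fun=> zeta R p) qexp z L r) => //.
    by move=> v _; split=> //; [exact: sdiff_cst|exact: sdiff_qexp].
  by move=> v vL; rewrite !cmM cmV w1 invr1 mul1r mulr1; split; exact: qr.
apply: sdiffZ.
apply: (@sdiff_ext _ (fun v => \sum_(a <- index_iota 1 (halfp p).+1 | (1 <=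
  a < (halfp p).+1)%N) combc R p a%:Z *
      (qexp (((corr_exp a)%:C)%C * v + 0) * (Ku (corr_x a v) (corr_q v) *
        (1 - corr_x a v)^-1 - (if (6 * a < p)%N then 0 else 1))))).
  move=> v; rewrite [RHS]big_seq [LHS]big_seq_cond; apply: eq_bigl => a.
  by rewrite mem_index_iota andbb.
apply: sdiff_sum => a /andP[a1 a2].
have ap : (a < p)%N by have := halfpE hp hp3; move: a2; lia.
have bd v := @corr_bounds a v (introT andP (conj a1 ap)).
have sx v : sdiff (corr_x a) v by exact: sdiff_lin.
apply: sdiffZ; apply: sdiffM; first exact: sdiff_lin.
apply: sdiffB; last exact: sdiff_cst.
apply: sdiffM.
  apply: (@Ku_sdiff _ (corr_x a) corr_q z L r) => //.
    by move=> v _; split=> //; exact: qexp_neq0.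
  move=> v vL; have [b1 b2 b3 _] := bd v (imp _ vL); have := qr _ vL => h.
  by split; [apply: le_trans b1 h|apply: le_trans b2 h|apply: le_trans b3 h].
apply: (@sdiffV _ (fun v => 1 - corr_x a v)); last by apply: sdiffB;
  [exact: sdiff_cst|exact: sx].
have [_ _ _ b4] := bd z z0; have q1 := nome_lt1 z0.
by rewrite -cm_gt0; have := cmB_ge 1 (corr_x a z); rewrite cm1; lra.
Qed.

End FormGrowth.

(** * Laurent expansion of periodic functions *)

Section Laurent.
Variable R : realType.
Local Notation C := (Cplx R).
Implicit Types (z t w : C).
Local Notation qexp := (@qexp R).

(** A branch of the logarithm near 1, by ln |w| and the arctangent. *)
Lemma qexp_local (e : R) : 0 < e -> exists2 d : R, 0 < d &
  forall w, cm (w - 1) < d -> exists2 z, qexp z = w & cm z < e.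
Proof.
move=> e0; have e20 : 0 < e / 2 by rewrite divr_gt0.
have hA : \forall x \near (0 : R), `|atan 0 - atan x| < e / 2.
  by move: (@continuous_atan R 0) => /cvgrPdist_lt; exact.
have hL : \forall x \near (1 : R), `|ln 1 - ln x| < e / 2.
  by move: (@continuous_ln R 1 ltr01) => /cvgrPdist_lt; exact.
have [d1 /= d10 h1] := hA; have [d2 /= d20 h2] := hL.
exists (Num.min (1 / 2) (Num.min (d1 / 2) d2)); first by rewrite !lt_min d20 !divr_gt0.
move=> w; rewrite !lt_min => /and3P[w12 wd1 wd2].
have rew : `|complex.Re w - 1| <= cm (w - 1) by have := Re_le (w - 1); rewrite ReD ReN.
have imw : `|complex.Im w| <= cm (w - 1) by have := Im_le (w - 1);
  rewrite ImD ImN /= subr0.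
set a := complex.Re w in rew *; set b := complex.Im w in imw *.
have a12 : 1 / 2 < a.
  by have := le_lt_trans rew w12; rewrite ltr_norml => /andP[h _]; move: h; clear; lra.
have a0 : 0 < a by apply: lt_trans a12; rewrite divr_gt0.
have an0 : a != 0 by rewrite gt_eqF.
have rho0 : 0 < cm w.
  by rewrite cm_gt0; apply/eqP => e1; move: a0; rewrite /a e1 /= ltxx.
have rho_n0 : cm w != 0 by rewrite gt_eqF.
have p2 := pi_ge2 R.
exists ((ln (cm w) +i* atan (b / a))%C / two_pi_i R).
  rewrite /Defs.qexp mulrC divfK; last by exact: tpi_neq0.
  have sq : Num.sqrt (1 + (b / a) ^+ 2) = cm w / a.
    have -> : 1 + (b / a) ^+ 2 = (cm w / a) ^+ 2.
      by rewrite expr_div_n expr_div_n cmE -/a -/b; field.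
    by rewrite sqrtr_sqr ger0_norm // divr_ge0 ?ltW.
  have ca : cos (atan (b / a)) = a / cm w by rewrite cos_atan sq invf_div.
  have sa : sin (atan (b / a)) = b / cm w.
    have := atanK (b / a); rewrite /tan ca => h.
    by have -> : sin (atan (b / a)) = (sin (atan (b / a)) / (a / cm w)) * (a / cm w);
      [field; rewrite an0 rho_n0|rewrite h; field; rewrite an0 rho_n0].
  by apply: ceq; rewrite /= lnK ?posrE // ?ca ?sa mulrC divfK.
have l1 : `|ln (cm w)| < e / 2.
  have := h2 (cm w); rewrite ln1 sub0r normrN; apply; rewrite /ball /=.
  apply: le_lt_trans wd2; have := cmB_ge w 1; have := cmB_ge 1 w; rewrite (cmBC 1 w) cm1.
  by rewrite ler_norml; clear; lra.
have l2 : `|atan (b / a)| < e / 2.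
  have := h1 (b / a); rewrite atan0 sub0r normrN; apply; rewrite /ball /= sub0r normrN.
  rewrite normrM normfV (gtr0_norm a0) ltr_pdivrMr //.
  apply: (le_lt_trans imw); apply: (lt_le_trans wd1).
  have : 0 <= d1 * (a - 1 / 2) by rewrite mulr_ge0 ?ltW // subr_gt0.
  by clear; lra.
rewrite cmM cmV -/(tpi R).
have t1 : 1 <= cm (tpi R).
  by rewrite /tpi cm_imag ger0_norm; move: p2; clear; lra.
rewrite ltr_pdivrMr; last exact: lt_le_trans t1.
apply: (@lt_le_trans _ _ e); last by rewrite ler_peMr // ltW.
by apply: (le_lt_trans (cm_le_ReIm _)) => /=; move: l1 l2; clear; lra.
Qed.

(** The chain rule read backwards: if F = G o E and the derivative of E is
    nonzero, then G is differentiable as soon as nearby points have nearby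
    preimages under E. *)
Lemma sderiv_quotient (E F G : C -> C) z0 t0 (a b : C) : sderiv E z0 b -> b != 0 ->
  sderiv F z0 a ->
  (forall e : R, 0 < e -> exists2 d : R, 0 < d & forall x, cm (x - t0) < d ->
     exists v, [/\ cm (v - z0) < e, E v = x & G x = F v]) ->
  sderiv G t0 (a / b).
Proof.
move=> hE b0 hF hL e e0; have cb : 0 < cm b by rewrite cm_gt0.
pose k := 1 + cm (a / b); have k0 : 0 < k by rewrite /k; have := cm_ge0 (a / b); lra.
pose e1 : R := Num.min (cm b / 2) (e * cm b / (2 * k)).
have e10 : 0 < e1 by rewrite lt_min !divr_gt0 // mulr_gt0.
have [d1 d10 h1] := hE _ e10; have [d2 d20 h2] := hF _ e10.
have m0 : 0 < Num.min d1 d2 by rewrite lt_min d10.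
have [d d0 h3] := hL _ m0.
exists d => // x y xd yd.
have [v [vd Ev Gv]] := h3 _ xd; have [u [ud Eu Gu]] := h3 _ yd.
move: vd ud; rewrite !lt_min => /andP[v1 v2] /andP[u1 u2].
have A := h1 _ _ v1 u1; have B := h2 _ _ v2 u2.
rewrite Ev Eu in A; rewrite Gv Gu.
have [e1a e1b] : e1 <= cm b / 2 /\ e1 <= e * cm b / (2 *
  k) by rewrite /e1 !ge_min !lexx orbT.
have vu : cm (u - v) * (cm b / 2) <= cm (y - x).
  have := cmB_ge (b * (u - v)) (- (y - x - b * (u - v))).
  have -> : b * (u - v) - - (y - x - b * (u - v)) = y - x by ring.
  rewrite cmN cmM; have := cm_ge0 (u - v).
  have : e1 * cm (u - v) <= cm b / 2 * cm (u - v) by rewrite ler_wpM2r ?cm_ge0.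
  by lra.
have -> : F u - F v - a / b * (y - x) = (F u - F v - a * (u - v)) - a / b *
  (y - x - b * (u - v)).
  by field.
apply: (le_trans (cmB _ _)); rewrite (cmM (a / b)).
have : cm (a / b) * cm (y - x - b * (u - v)) <=
  cm (a / b) * (e1 * cm (u - v)) by rewrite ler_wpM2l ?cm_ge0.
have : e1 * k * cm (u - v) <= e * (cm (u - v) * (cm b / 2)).
  have -> : e * (cm (u - v) * (cm b / 2)) = e * cm b / (2 * k) * k * cm (u - v).
    by field; rewrite gt_eqF.
  by rewrite ler_wpM2r ?cm_ge0 // ler_wpM2r // ltW.
have : e * (cm (u - v) * (cm b / 2)) <= e * cm (y - x) by rewrite ler_wpM2l // ltW.
by move: B; rewrite /k; clear; lra.
Qed.

Lemma power_series_zero (c : nat -> C) (L M : R) : 0 < L ->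
  (forall k, cm (c k) * L ^+ k <= M) ->
  (forall z, 0 < cm z < L -> csum (fun k => c k * z ^+ k) 0) -> forall k, c k = 0.
Proof.
move=> L0 cM cS k; have [n] := ubnP k; elim: n k => // n IH k; rewrite ltnS => kn.
have M0 : 0 <= M by have := cM 0%N; rewrite expr0 mulr1; apply: le_trans; exact: cm_ge0.
have below j : (j < k)%N -> c j = 0 by move=> jk; apply: IH; exact: leq_trans jk kn.
apply/eqP; rewrite -cm_eq0 eq_le cm_ge0 andbT; apply/ler_addgt0Pl => e e0; rewrite addr0.
have Lk : 0 < L ^+ k.+1 by rewrite exprn_gt0.
pose x : R := Num.min (L / 2) (e * L ^+ k.+1 / (2 * M + 1)).
have x0 : 0 < x by rewrite lt_min !divr_gt0 ?mulr_gt0 //; lra.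
have [xL xe] : x <= L / 2 /\ x <= e * L ^+ k.+1 / (2 * M +
  1) by rewrite /x !ge_min !lexx orbT.
have cx : cm ((x%:C)%C : C) = x by rewrite cm_real gtr0_norm.
have S := cS (x%:C)%C; rewrite cx in S; have {}S := S (introT andP (conj x0 _)).
have g : geo (fun j => c j * (x%:C)%C ^+ j) M (x / L).
  move=> j; rewrite cmM cmX cx expr_div_n mulrA ler_pdivlMr ?exprn_gt0 // mulrAC.
  by rewrite ler_wpM2r // exprn_ge0 // ltW.
have rL0 : 0 <= x / L by rewrite divr_ge0 ?ltW.
have rL1 : x / L <= 1 / 2 by rewrite ler_pdivrMr //; move: xL; clear; lra.
have xlt : x < L by move: xL L0; clear; lra.
have := csum_tail k.+1 (S xlt) g rL0 (le_lt_trans rL1 _).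
have h12 : (1 / 2 : R) < 1 by lra.
move=> /(_ h12); rewrite big_ord_recr /= big1 => [|i _]; last by rewrite below ?mul0r.
rewrite !add0r cmN cmM cmX cx expr_div_n => H.
have xk : 0 < x ^+ k by rewrite exprn_gt0.
have H2 : cm (c k) * x ^+ k <= (2 * M * x / L ^+ k.+1) * x ^+ k.
  apply: (le_trans H).
  have -> : M * (x ^+ k.+1 / L ^+ k.+1) / (1 - x / L) =
    (M * x / L ^+ k.+1 * x ^+ k) * (1 - x / L)^-1.
    by rewrite exprS; ring.
  have -> : 2 * M * x / L ^+ k.+1 * x ^+ k = (M * x / L ^+ k.+1 * x ^+ k) * 2 by ring.
  apply: ler_wpM2l; first by rewrite !mulr_ge0 ?invr_ge0 ?(ltW x0) ?(ltW Lk) ?(ltW xk).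
  by rewrite -[leRHS]invrK lef_pV2 ?posrE ?subr_gt0; move: rL1; clear; lra.
rewrite ler_pM2r // in H2; apply: (le_trans H2).
rewrite ler_pdivrMr //.
have M21 : 0 < 2 * M + 1 by move: M0; clear; lra.
have : x * (2 * M + 1) <= e * L ^+ k.+1 by rewrite -ler_pdivlMr.
by move: x0; clear; lra.
Qed.

(** By periodicity F is a function G of t = q^(1/h), holomorphic in the
    punctured disc by [sderiv_quotient]. For N >= B h the function t^N G is
    bounded on punctured discs of every radius less than 1, hence a power
    series there, and the coefficients are the same for all radii. *)
Theorem periodic_laurent (F : C -> C) (h : nat) (B : R) : (0 < h)%N ->
  (forall z, 0 < complex.Im z -> F (z + h%:R) = F z) ->
  (forall z, 0 < complex.Im z -> sdiff F z) -> 0 <= B ->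
  (forall y0 : R, 0 < y0 -> exists M, forall z, y0 <= complex.Im z ->
    `|complex.Re z| <= h%:R ->
     cm (F z) <= M * expR (B * complex.Im z)) ->
  meromorphic_at_infty F.
Proof.
move=> h0 Fh Fs B0 Fb; have p2 := pi_ge2 R.
have hR0 : 0 < h%:R :> R by rewrite ltr0n.
have hC0 : h%:R != 0 :> C by rewrite pnatr_eq0 -lt0n.
have Imh (n : int) z : complex.Im (z + n%:~R * h%:R) = complex.Im z.
  have -> : n%:~R * h%:R = ((n%:~R * h%:R : R)%:C)%C :> C by rewrite realCM realC_int realC_nat.
  by rewrite ImD /= addr0.
have Fz (n : int) z : 0 < complex.Im z -> F (z + n%:~R * h%:R) = F z.
  have N (k : nat) v : 0 < complex.Im v -> F (v + k%:R * h%:R) = F v.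
    move=> v0; elim: k => [|k IH]; first by rewrite mul0r addr0.
    by rewrite -natr1 mulrDl mul1r addrA Fh ?IH // (Imh k%:Z).
  move=> z0; case: n => k; first exact: N.
  rewrite NegzE mulrNz -pmulrn mulNr -[in RHS](subrK (k.+1%:R * h%:R) z) N //.
  by have := Imh (Negz k) z; rewrite NegzE mulrNz -pmulrn mulNr => ->.
have FE z z' : 0 < complex.Im z -> qexp (z / h%:R) = qexp (z' / h%:R) -> F z' = F z.
  move=> z0 e; have : qexp (z' / h%:R - z / h%:R) =
    1 by rewrite qexpB e divff // qexp_neq0.
  move=> /qexp_eq1 [m em]; rewrite -(Fz m z z0); congr F.
  by rewrite -em; field.
have [G GE] : exists G : C -> C, forall z, 0 < complex.Im z -> G (qexp (z / h%:R)) = F z.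
  exists (fun t => match pselect (exists z, qexp (z / h%:R) = t) with
     left H => F (projT1 (cid H)) | right _ => 0 end) => z z0.
  case: pselect => [H|]; last by case; exists z.
  by apply: FE => //; rewrite (projT2 (cid H)).
have cmq z : cm (qexp (z / h%:R)) = expR (- (2 * pi * complex.Im z / h%:R)).
  rewrite cm_qexp; congr (expR (- _)).
  have -> : z / h%:R = ((h%:R^-1 : R)%:C)%C * z by rewrite realCV realC_nat mulrC.
  by rewrite cImM /= mul0r addr0; ring.
(* The radius of the circle that is the image of the horizontal line at height
   y. *)
pose Rad (y : R) : R := expR (- (2 * pi * y / h%:R)).
have Rad0 y : 0 < Rad y by exact: expR_gt0.
have Rad_le y y' : (Rad y <= Rad y') = (y' <= y).
  rewrite /Rad ler_expR lerN2 ler_pM2r ?invr_gt0 // ler_pM2l //; lra.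
have lift t : t != 0 -> exists z, [/\ qexp (z / h%:R) = t & `|complex.Re z| <= h%:R].
  move=> tn0; have [w ew] := qexp_surj tn0.
  pose n := Num.floor (complex.Re w).
  exists ((w - n%:~R) * h%:R); split; first by rewrite mulfK // -intrN qexpDint.
  have /andP[n1 n2] := floor_itv (complex.Re w).
  rewrite -realC_int -realC_nat cReM ReD ReN /= mulr0 subr0 normrM [`|h%:R|]ger0_norm //.
  rewrite -[leRHS]mul1r ler_wpM2r // ger0_norm ?subr_ge0 //.
  by move: n2; rewrite intrD -/n; lra.
have Gs t : 0 < cm t < 1 -> sdiff G t.
  move=> /andP[t0 t1]; have tn0 : t != 0 by rewrite -cm_gt0.
  have [z [ez _]] := lift t tn0.
  have z0 : 0 < complex.Im z.
    move: t1; rewrite -ez cmq -[X in _ < X]expR0 ltr_expR oppr_lt0 => H.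
    have : 0 < 2 * pi * complex.Im z by have := mulr_gt0 H hR0; rewrite divfK ?gt_eqF.
    by rewrite pmulr_rgt0 //; lra.
  have [a ha] := Fs z z0.
  pose E v := qexp (v / h%:R).
  have [b hb b0] : exists2 b, sderiv E z b & b != 0.
    pose bb := tpi R / h%:R * qexp (z / h%:R); exists bb; last first.
      by rewrite !mulf_neq0 ?invr_eq0 ?tpi_neq0 ?qexp_neq0.
    move=> e e0; have k0 : 0 < cm (tpi R / h%:R) by rewrite cm_gt0 mulf_neq0 ?invr_eq0 ?tpi_neq0.
    have e1 : 0 < e / cm (tpi R / h%:R) by rewrite divr_gt0.
    have [d d0 hd] := sderiv_cexp (tpi R / h%:R * z) e1.
    exists (d / cm (tpi R / h%:R)); first by rewrite divr_gt0.
    have EE v : E v = cexp (tpi R / h%:R * v) by rewrite /E /Defs.qexp -/(tpi R);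
      congr Defs.cexp; ring.
    have sc v : cm (v - z) < d / cm (tpi R / h%:R) ->
      cm (tpi R / h%:R * v - tpi R / h%:R * z) < d.
      by move=> vd; rewrite -(mulrBr (tpi R / h%:R) v z) cmM mulrC -ltr_pdivlMr.
    move=> x y xd yd; have := hd _ _ (sc _ xd) (sc _ yd); rewrite -!EE.
    rewrite -(mulrBr (tpi R / h%:R) y x) (cmM (tpi R / h%:R) (y - x)).
    rewrite [X in _ <= X]mulrA divfK ?gt_eqF // mulrA.
    by rewrite /bb -[qexp (z / h%:R)]/(E z) [tpi R / h%:R * E z]mulrC.
  exists (a / b); apply: (sderiv_quotient hb b0 ha) => e e0.
  have e1 : 0 < Num.min e (complex.Im z) / h%:R by rewrite divr_gt0 // lt_min e0.
  have [d d0 hd] := qexp_local e1.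
  exists (d * cm t); first by rewrite mulr_gt0.
  move=> x xt; have : cm (x / t - 1) < d.
    have -> : x / t - 1 = (x - t) / t by field.
    by rewrite cmM cmV ltr_pdivrMr.
  move=> /hd [u eu]; rewrite ltr_pdivlMr // -(cm_nat R h) -cmM lt_min => /andP[u1 u2].
  have Ev : E (z + u * h%:R) = x.
    have -> : E (z + u * h%:R) = qexp (z / h%:R) * qexp u.
      by rewrite /E -qexpD; congr Defs.qexp; field.
    by rewrite ez eu mulrC divfK.
  have iv : 0 < complex.Im (z + u * h%:R).
    have := Im_le (u * h%:R); rewrite ImD ler_norml => /andP[h1 _].
    by move: h1 u2; clear; lra.
  exists (z + u * h%:R); split=> //; first by rewrite addrAC subrr add0r.
  by rewrite -Ev GE.
pose N := (Num.trunc (B * h%:R)).+1.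
have NB : B * h%:R <= N%:R by apply: ltW; exact: truncnS_gt.
pose K t := t ^+ N * G t.
have Kb (y0 : R) : 0 < y0 -> exists M, forall t, 0 < cm t <= Rad y0 -> cm (K t) <= M.
  move=> y00; have [M hM] := Fb y0 y00; exists M => t /andP[t0 tR].
  have tn0 : t != 0 by rewrite -cm_gt0.
  have [z [ez rz]] := lift t tn0.
  have yz : y0 <= complex.Im z by rewrite -Rad_le /Rad -cmq ez.
  have z0 : 0 < complex.Im z by apply: lt_le_trans yz.
  have := hM z yz rz; rewrite -GE // ez /K cmM cmX => H.
  have M0 : 0 <= M.
    by have := le_trans (cm_ge0 _) H; rewrite pmulr_lge0 // expR_gt0.
  apply: (le_trans (ler_wpM2l (exprn_ge0 _ (cm_ge0 _)) H)).
  rewrite mulrCA ler_piMr // -ez cmq -expRM_natl -expRD -[leRHS]expR0 ler_expR.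
  have -> : N%:R * - (2 * pi * complex.Im z / h%:R) + B * complex.Im z =
     - (complex.Im z / h%:R * (N%:R * (2 * pi) - B * h%:R)) by field; rewrite gt_eqF.
  rewrite oppr_le0 mulr_ge0 ?divr_ge0 ?(ltW z0) // subr_ge0 (le_trans NB) //.
  by rewrite ler_peMr //; move: p2; clear; lra.
have Rad1 y : 0 < y -> Rad y < 1.
  by move=> y0; rewrite /Rad -[X in _ < X]expR0 ltr_expR oppr_lt0 divr_gt0 // mulr_gt0 //; lra.
have Kc (y0 : R) : 0 < y0 -> exists c : nat ->
  C, exists M, (forall k, cm (c k) * Rad y0 ^+ k <= M) /\
    forall t, 0 < cm t < Rad y0 -> csum (fun k => c k * t ^+ k) (K t).
  move=> y00; have [M hM] := Kb y0 y00.
  have [t|t|c [c1 c2]] := @removable_taylor R K 0 (Rad y0) M (Rad0 y0).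
  - rewrite subr0 => /andP[t1 t2]; apply: sdiffM; first exact: sdiffX (sdiff_id _).
    by apply: Gs; rewrite t1 (le_lt_trans t2) // Rad1.
  - by rewrite subr0; exact: hM.
  exists c, M; split=> // t tR; have := c2 t; rewrite subr0 => /(_ tR).
  by apply: csum_ext => k.
have [c [M [cM cS]]] := Kc 1 ltr01.
exists h, (- N%:Z), c; split=> // z zu; have z0 : 0 < complex.Im z := zu.
apply: ccvg_cvg.
set t := qexp (z / h%:R).
have tn0 : t != 0 by exact: qexp_neq0.
have t0 : 0 < cm t by rewrite cm_gt0.
pose y0 : R := Num.min 1 (complex.Im z / 2).
have y00 : 0 < y0 by rewrite lt_min ltr01 divr_gt0.
have [y01 y0z] : y0 <= 1 /\ y0 < complex.Im z.
  rewrite /y0 ge_min lexx /=; split=> //.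
  by rewrite gt_min; apply/orP; right; move: z0; clear; lra.
have [c' [M' [cM' cS']]] := Kc y0 y00.
have cc : forall k, c k = c' k.
  move=> k; apply/eqP; rewrite -subr_eq0; apply/eqP; move: k.
  apply: (@power_series_zero _ (Rad 1) (M + M')) => [|k|v /andP[v0 v1]];
    first exact: Rad0.
    apply: (@le_trans _ _ (cm (c k) * Rad 1 ^+ k + cm (c' k) * Rad y0 ^+ k)).
      apply: (@le_trans _ _ ((cm (c k) + cm (c' k)) * Rad 1 ^+ k)).
        by rewrite ler_wpM2r ?exprn_ge0 ?(ltW (Rad0 _)) // cmB.
      rewrite mulrDl lerD2l ler_wpM2l ?cm_ge0 //.
      by rewrite lerXn2r ?nnegrE ?(ltW (Rad0 _)) // Rad_le.
    by rewrite lerD.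
  have S1 := cS v (introT andP (conj v0 v1)).
  have S2 := cS' v (introT andP (conj v0 (lt_le_trans v1 _))).
  have rr : Rad 1 <= Rad y0 by rewrite Rad_le.
  have := csumD S1 (csumZ (-1) (S2 rr)); rewrite mulN1r subrr.
  by apply: csum_ext => k; ring.
have tz : cm t < Rad y0 by rewrite /t cmq -/(Rad _) ltNge Rad_le -ltNge.
have S := cS' t (introT andP (conj t0 tz)).
have S2 := csumZ (t ^- N) S.
have -> : F z = t ^- N * K t by rewrite /K mulKf ?expf_neq0 // /t GE.
apply: ccvg_ext S2 => n; rewrite big_mkord; apply: eq_bigr => k _.
rewrite -cc mulrCA; congr (_ * _).
rewrite qpowE rmorphM fmorphV /= ratr_int ratr_nat.
rewrite /t -!qexpMn -qexpN -qexpD; congr Defs.qexp.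
by rewrite intrD intrN -!pmulrn; ring.
Qed.

End Laurent.

(** * The cusps *)

Section Cusps.
Variable R : realType.
Local Notation C := (Cplx R).
Implicit Types (z : C).
Variable p : nat.
Hypothesis hp : prime p.
Hypothesis hp3 : (3 < p)%N.

Section FixMatrix.
Variables (a b c d : int).
Hypothesis dt : a * d - b * c = 1.

Let J z : C := c%:~R * z + d%:~R.
Let mob z : C := (a%:~R * z + b%:~R) / J z.
Definition at_cusp z : C := (J z)^-1 * mform p (mob z).

Lemma J_neq0 z : 0 < complex.Im z -> J z != 0.
Proof. exact: aut_neq0 dt _. Qed.

Lemma mob_up z : 0 < complex.Im z -> 0 < complex.Im (mob z).
Proof. exact: moebius_up. Qed.

Lemma at_cusp_sdiff z : 0 < complex.Im z -> sdiff at_cusp z.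
Proof.
move=> z0; have J0 := J_neq0 z0.
have sJ : sdiff J z by exact: sdiff_affine.
apply: sdiffM; first exact: sdiffV.
apply: (@sdiff_comp _ (mform p) mob); last by apply: mform_sdiff => //; exact: mob_up.
by apply: sdiff_div => //; exact: sdiff_affine.
Qed.

(** Conjugating translation by p^2 with the matrix gives an element of the
    group, because p^2 divides all the entries of the difference with 1. *)
Lemma at_cusp_period z : 0 < complex.Im z -> at_cusp (z + (p ^ 2)%N%:R) = at_cusp z.
Proof.
move=> z0; pose h : int := p%:Z * p%:Z.
have hC : (p ^ 2)%N%:R = h%:~R :> C by rewrite /h intrM -!pmulrn natrX expr2.
rewrite hC.
have z1 : 0 < complex.Im (z + h%:~R) by rewrite -realC_int ImD /= addr0.
have J0 := J_neq0 z0; have J1 := J_neq0 z1.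
have D : (a%:~R * d%:~R - b%:~R * c%:~R : C) = 1 by rewrite -!intrM -intrB dt.
have := @mform_modular R p hp hp3 (1 - a * c * h) (a ^+ 2 * h) (- (c ^+ 2 * h)) (1 +
  a * c * h)
  (- (a * c * p%:Z)) (a * c * p%:Z) (- c ^+ 2) (mob z).
have e1 : (1 - a * c * h) * (1 + a * c * h) - a ^+ 2 * h * - (c ^+ 2 * h) = 1 by ring.
have e2 : 1 - a * c * h = 1 + p%:Z * - (a * c * p%:Z) by rewrite /h; ring.
have e3 : 1 + a * c * h = 1 + p%:Z * (a * c * p%:Z) by rewrite /h; ring.
have e4 : - (c ^+ 2 * h) = p%:Z ^+ 2 * - c ^+ 2 by rewrite /h; ring.
clearbody h.
move=> /(_ e1 e2 e3 e4 (mob_up z0)).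
have c2 : (c ^+ 2)%:~R = c%:~R ^+ 2 :> C by rewrite rmorphXn.
have a2 : (a ^+ 2)%:~R = a%:~R ^+ 2 :> C by rewrite rmorphXn.
have E1 : (- (c ^+ 2 * h))%:~R * mob z + (1 + a * c * h)%:~R = J (z + h%:~R) / J z.
  rewrite intrN [(c ^+ 2 * h)%:~R]intrM c2 intrD !intrM /mob.
  have -> : J (z + h%:~R) = J z + c%:~R * h%:~R * (a%:~R * d%:~R - b%:~R *
    c%:~R) by rewrite D /J; ring.
  by move: J0; rewrite /J => J0; field.
have E2 : (1 - a * c * h)%:~R * mob z + (a ^+ 2 * h)%:~R =
  (a%:~R * (z + h%:~R) + b%:~R) / J z.
  rewrite [(a ^+ 2 * h)%:~R]intrM a2 intrB !intrM /mob.
  have -> : a%:~R * (z + h%:~R) + b%:~R = a%:~R * z + b%:~R +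
    a%:~R * h%:~R * (a%:~R * d%:~R - b%:~R * c%:~R) by rewrite D; ring.
  by move: J0; rewrite /J => J0; field.
rewrite E1 E2 /at_cusp => H.
have -> : mob (z + h%:~R) = (a%:~R * (z + h%:~R) + b%:~R) / J z / (J (z + h%:~R) / J z).
  by rewrite /mob; field; rewrite J0 J1.
rewrite H; field; rewrite J0 J1 //.
Qed.

(** As Im(g z) = y / |c z + d|^2, both Im(g z) and its inverse are at most
    linear in y where y >= y0 and Re z is bounded. *)
Lemma at_cusp_growth : exists2 B : R, 0 <= B & forall y0 : R, 0 < y0 -> exists M : R,
  forall z, y0 <= complex.Im z -> `|complex.Re z| <= (p ^ 2)%N%:R ->
  cm (at_cusp z) <= M * expR (B * complex.Im z).
Proof.
have [A A0 [B B0 H]] := @mform_mgrow R p hp hp3.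
pose n : R := (p ^ 2)%N%:R.
have n0 : 0 <= n by exact: ler0n.
pose Q : R := `|c%:~R| * (n + 1) + `|d%:~R|.
have Q0 : 0 <= Q by rewrite addr_ge0 ?mulr_ge0 ?addr_ge0 //.
exists (B * (1 + Q ^+ 2)); first by rewrite mulr_ge0 // addr_ge0 // exprn_ge0.
move=> y0 y00; exists ((1 + y0^-1) * (A * expR (B * (y0^-1 + Q ^+ 2 * (y0^-1 +
  2))))) => z zy rz.
have z0 : 0 < complex.Im z by apply: lt_le_trans zy.
have J0 := J_neq0 z0; have cJ : 0 < cm (J z) by rewrite cm_gt0.
set y := complex.Im z in zy z0 *.
have yi : y^-1 <= y0^-1 by rewrite lef_pV2.
have yi0 : 0 < y^-1 by rewrite invr_gt0.
have y0i0 : 0 < y0^-1 by rewrite invr_gt0.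
have JQ : cm (J z) <= Q * (1 + y).
  apply: (le_trans (cmD _ _)); rewrite cmM -!realC_int !cm_real.
  have zn : cm z <= n + y by apply: le_trans (cm_le_ReIm _) _;
    rewrite lerD // ger0_norm // ltW.
  apply: (@le_trans _ _ (`|c%:~R| * (n + y) + `|d%:~R|));
    first by rewrite lerD2r ler_wpM2l.
  rewrite /Q; have := normr_ge0 (c%:~R : R); have := normr_ge0 (d%:~R : R).
  set cc := `|c%:~R|; set dd := `|d%:~R| => dd0 cc0.
  have : 0 <= cc * (n * y) by rewrite !mulr_ge0 // ltW.
  have : 0 <= dd * y by rewrite mulr_ge0 // ltW.
  by lra.
have [JV yJ] : (cm (J z))^-1 <= 1 + y0^-1 /\ y / cm (J z) ^+ 2 <= y + y0^-1.
  have [c0|cn0] := eqVneq c 0.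
    have dn0 : d != 0 by apply/eqP => d0; move: dt; rewrite c0 d0 !mulr0.
    have JE : cm (J z) = `|d%:~R| by rewrite /J c0 mul0r add0r -realC_int cm_real.
    have d1 : 1 <= cm (J z).
      by rewrite JE -intr_norm -[1]/(1%:~R) ler_int -gtz0_ge1 normr_gt0.
    have j1 : (cm (J z))^-1 <= 1 by rewrite invf_le1.
    split; first by lra.
    rewrite ler_pdivrMr ?exprn_gt0 //.
    have : 1 <= cm (J z) ^+ 2 by rewrite exprn_ege1.
    have : 0 <= y0^-1 * (cm (J z) ^+ 2) by rewrite mulr_ge0 ?exprn_ge0 ?cm_ge0 // ltW.
    have := z0; set j2 := cm (J z) ^+ 2; nra.
  have c1 : 1 <= `|c%:~R| :> R by rewrite -intr_norm -[1]/(1%:~R) ler_int -gtz0_ge1 normr_gt0.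
  have yJ : y <= cm (J z).
    apply: le_trans (Im_le _);
      rewrite /J -!realC_int ImD cImM /= mul0r !addr0 normrM (gtr0_norm z0).
    by rewrite ler_peMl // ltW.
  have JV : (cm (J z))^-1 <= y^-1 by rewrite lef_pV2 ?posrE.
  split; first by apply: le_trans JV _; apply: le_trans yi _; rewrite lerDr.
  rewrite expr2 invfM mulrA.
  have : y / cm (J z) <= 1 by rewrite ler_pdivrMr // mul1r.
  have jv0 : 0 <= (cm (J z))^-1 by rewrite invr_ge0 ltW.
  have : 0 <= y / cm (J z) by rewrite divr_ge0 // ltW.
  nra.
have Jy : cm (J z) ^+ 2 / y <= Q ^+ 2 * (y0^-1 + 2 + y).
  apply: (@le_trans _ _ ((Q * (1 + y)) ^+ 2 / y)).
    rewrite ler_wpM2r ?(ltW yi0) // lerXn2r ?nnegrE ?cm_ge0 //.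
    by rewrite mulr_ge0 // addr_ge0 // ltW.
  have -> : (Q * (1 + y)) ^+ 2 / y = Q ^+ 2 * (y^-1 + 2 + y) by field; rewrite gt_eqF.
  by rewrite ler_wpM2l ?exprn_ge0 // !lerD2r.
rewrite /at_cusp cmM cmV -mulrA; apply: ler_pM; rewrite ?invr_ge0 ?cm_ge0 //.
apply: (le_trans (H _ (mob_up z0))).
have -> : complex.Im (mob z) = y / cm (J z) ^+ 2 by exact: Im_moebius dt _ z0.
rewrite -mulrA ler_wpM2l // -expRD ler_expR invf_div.
have := lerD yJ Jy => h.
apply: (le_trans (ler_wpM2l B0 h)).
by rewrite le_eqVlt; apply/orP; left; apply/eqP; ring.
Qed.

Theorem at_cusp_meromorphic : meromorphic_at_infty at_cusp.
Proof.
have [B B0 H] := at_cusp_growth.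
have n0 : (0 < p ^ 2)%N by rewrite expn_gt0 prime_gt0.
exact: (periodic_laurent n0 at_cusp_period at_cusp_sdiff B0 H).
Qed.
End FixMatrix.

Lemma det2 (g : 'M[int]_2) : \det g = g 0 0 * g 1 1 - g 0 1 * g 1 0.
Proof.
rewrite (expand_det_row _ 0) !big_ord_recl big_ord0 addr0 /cofactor !det_mx11 !mxE /= !expr0 !expr1.
rewrite /bump /= !mul1r mulN1r mulrN; congr (_ * _ - _ * _); congr (g _ _);
  exact: val_inj.
Qed.

End Cusps.

Theorem theorem1p2 (R : realType) (p : nat) (hp : prime p) (hp3 : (3 < p)%N) :
  weakly_holomorphic_modular_form 1
    (Gamma0 (p ^ 2)%N `&` Gamma1 p)
    (fun z : Cplx R => eta ((p ^ 2)%:R * z) * calR p z).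
Proof.
rewrite -[fun z => _]/(mform (R := R) p); split.
- by move=> z z0; apply/sdiff_derivable/mform_sdiff.
- move=> g z [[sl h0] [_ _ h1 h2]] z0.
  rewrite expr1z /moebius /autom_factor.
  have [k hk] : exists k, g 0 0 = 1 + p%:Z * k.
    move: h1 => /eqP; rewrite eqz_mod_dvd => /dvdzP [k hk]; exists k.
    by rewrite mulrC -hk addrCA subrr addr0.
  have [k2 hk2] : exists k, g 1 1 = 1 + p%:Z * k.
    move: h2 => /eqP; rewrite eqz_mod_dvd => /dvdzP [k2 hk2]; exists k2.
    by rewrite mulrC -hk2 addrCA subrr addr0.
  have [cc hcc] : exists k, g 1 0 = p%:Z ^+ 2 * k.
    move: h0 => /eqP; rewrite eqz_mod_dvd subr0 => /dvdzP [cc hcc]; exists cc.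
    by rewrite mulrC hcc -natz natrX natz.
  by apply: (mform_modular hp hp3 _ hk hk2 hcc z0); rewrite -det2.
- move=> g sl; have dt : g 0 0 * g 1 1 - g 0 1 * g 1 0 = 1 by rewrite -det2.
  have -> : slash 1 (mform (R := R) p) g = at_cusp (R := R) p (g 0 0) (g 0 1) (g 1 0) (g 1 1).
    by apply/funext => z; rewrite /slash exprN1.
  exact: at_cusp_meromorphic.
Qed.
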